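(* Fix $n\geq 3$, $j\in\{2,\dots,n-1\}$ and $p\in\big(\frac{2n-j-nj}{n-1},1\big)$. There exists $\delta>0$, depending only on $n$ and $p$, such that for all $\lambda\in(0,1)$ and all origin-symmetric convex bodies $K,L$ in $\mathbb R^n$ with $h_K,h_L\in C^2(\mathbb S^{n-1})$ and $\max\{\|h_K-1\|_{C^2},\|h_L-1\|_{C^2}\}<\delta$, one has $$V_j\big((1-\lambda)\cdot K+_p\lambda\cdot L\big)\geq\Big((1-\lambda)V_j(K)^{p/j}+\lambda V_j(L)^{p/j}\Big)^{j/p}$$ (for $p=0$ the right-hand side is understood as $V_j(K)^{1-\lambda}V_j(L)^\lambda$). Equality holds if and only if $K$ and $L$ are dilates of each other.
   Context: A convex body is a compact convex subset of $\mathbb R^n$ with nonempty interior; it is origin-symmetric if $K=-K$. The support function is $h_K(x)=\max_{y\in K}\langle x,y\rangle$, and $\|h_K-1\|_{C^2}$ denotes the $C^2$ norm on the unit sphere $\mathbb S^{n-1}$ of the restriction of $h_K-1$. For a continuous $f:\mathbb S^{n-1}\to(0,\infty)$, $W(f)$ is the largest convex body whose support function is $\le f$ on $\mathbb S^{n-1}$. For convex bodies $K,L$ containing the origin in their interior, $(1-\lambda)\cdot K+_p\lambda\cdot L:=W\big(((1-\lambda)h_K^p+\lambda h_L^p)^{1/p}\big)$ for $p\neq0$ and $W(h_K^{1-\lambda}h_L^\lambda)$ for $p=0$. The intrinsic volumes are defined by $V_n(K+\rho B_2^n)=\sum_{j=0}^n\rho^{n-j}\kappa_{n-j}V_j(K)$,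 $\rho>0$, where $V_n$ is volume, $B_2^n$ the Euclidean unit ball, $\kappa_d$ the volume of the $d$-dimensional unit ball. *)

(* Defs.v *)
From HB Require Import structures.
From mathcomp Require Import all_boot all_order all_algebra.
From mathcomp Require Import all_classical all_reals all_analysis.
Set Implicit Arguments. Unset Strict Implicit. Unset Printing Implicit Defensive.
Import Order.TTheory GRing.Theory Num.Theory.
Import numFieldNormedType.Exports.
Local Open Scope classical_set_scope.
Local Open Scope ring_scope.

Section ConvexGeometry.
Variables (R : realType) (n : nat).
Notation V := 'rV[R]_n.

Definition dotp (x y : V) : R := \sum_(i < n) x ord0 i * y ord0 i.
Definition enorm (x : V) : R := Num.sqrt (dotp x x).
Definition sphere : set V := [set u | enorm u = 1].
Definition unit_ball : set V := [set x | enorm x <= 1].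

Definition convex_set_n (K : set V) : Prop :=
  forall x y t, K x -> K y -> 0 <= t <= 1 -> K ((1 - t) *: x + t *: y).
Definition convex_body (K : set V) : Prop :=
  compact K /\ convex_set_n K /\ interior K !=set0.
Definition origin_symmetric (K : set V) : Prop := [set - x | x in K] = K.

Definition supp (K : set V) (x : V) : R := sup [set dotp x y | y in K].

Definition wulff (f : V -> R) : set V :=
  [set x | forall u, sphere u -> dotp x u <= f u].

Definition lp_comb (p lam : R) (K L : set V) : set V :=
  wulff (fun u => if p == 0 then supp K u `^ (1 - lam) * supp L u `^ lam
                  else ((1 - lam) * supp K u `^ p + lam * supp L u `^ p) `^ (1 / p)).

Definition box (a b : V) : set V := [set x | forall i, a ord0 i <= x ord0 i <= b ord0 i].
Definition boxvol (a b : V) : R := \prod_(i < n) Num.max 0 (b ord0 i - a ord0 i).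
Definition lebesgue_vol (A : set V) : \bar R :=
  ereal_inf [set s : \bar R | exists (a b : nat -> V),
     A `<=` \bigcup_k box (a k) (b k) /\
     s = (\sum_(0 <= k <oo) (boxvol (a k) (b k))%:E)%E].

Definition msum (A B : set V) : set V := [set x + y | x in A & y in B].
Definition dilate (r : R) (A : set V) : set V := [set r *: x | x in A].

Definition evec (i : 'I_n) : V := delta_mx ord0 i.
Definition pder (i : 'I_n) (g : V -> R) (x : V) : R :=
  derive1 (fun t : R => g (x + t *: evec i)) 0.
Definition has_pder (i : 'I_n) (g : V -> R) (x : V) : Prop :=
  derivable (fun t : R => g (x + t *: evec i)) 0 1.

Definition cont_at (x : V) (g : V -> R) : Prop := g y @[y --> x] --> g x.

Definition hom0 (f : V -> R) (x : V) : R := f ((enorm x)^-1 *: x).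

(* f restricted to S^{n-1} is C^2: its 0-homogeneous extension has
   continuous first and second order partial derivatives on R^n \ {0} *)
Definition C2_sphere (f : V -> R) : Prop :=
  forall x : V, x != 0 ->
    [/\ cont_at x (hom0 f),
      (forall i, has_pder i (hom0 f) x),
      (forall i, cont_at x (pder i (hom0 f))),
      (forall i k, has_pder k (pder i (hom0 f)) x) &
      (forall i k, cont_at x (pder k (pder i (hom0 f))))].

Definition C2_norm (f : V -> R) : R :=
  sup [set `|hom0 f u| + \sum_(i < n) `|pder i (hom0 f) u|
           + \sum_(i < n) \sum_(k < n) `|pder k (pder i (hom0 f)) u|
      | u in sphere].
End ConvexGeometry.

Definition kappa (R : realType) (d : nat) : R := fine (lebesgue_vol (@unit_ball R d)).

(* intrinsic volumes, defined through the Steiner formula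
   V_n(K + rho B) = sum_{j=0}^n rho^(n-j) kappa_(n-j) V_j(K), rho > 0:
   the volume of the parallel body is a polynomial P of degree <= n in rho,
   and V_j(K) = P_(n-j) / kappa_(n-j). *)
Definition steiner_poly (R : realType) (n : nat) (K : set 'rV[R]_n) (P : {poly R}) : Prop :=
  (size P <= n.+1)%N /\ (forall rho : R, 0 < rho ->
    lebesgue_vol (msum K (dilate rho (@unit_ball R n))) = (P.[rho])%:E).
Definition intrinsic_volume (R : realType) (n j : nat) (K : set 'rV[R]_n) : R :=
  (xget 0 [set P | steiner_poly K P])`_(n - j) / kappa R (n - j).

(* Main.v *)
(* Write K and L as Wulff shapes of functions a, b close to 1 and let f be their
   pointwise L_p mean.  Near the unit ball the gradient map of a 1-homogeneous
   support function is a diffeomorphism, so the change of variables formula makes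
   the volume of K + rho B an explicit polynomial in rho, and V_j a smooth functional
   of the support function and its derivatives.  The L_p Brunn-Minkowski inequality
   for V_j then reduces to the Minkowski-type inequality
     int Phi_p(a / f) f sigma >= Phi_p((V_j(a) / V_j(f))^(1/j)) int f sigma,
   applied to (a, f) and (b, f), where Phi_p(t) = (t^p - 1) / p (ln t for p = 0) and
   sigma is the first variation of V_j at f.  It follows from a second-order
   expansion at f: near the ball the second variation of V_j is close to that of the
   ball, which even perturbations control through the spectral gap 2(n + 1) for the
   Laplacian on the sphere of R^(n + 1); the bound on p is exactly what this gap buys. *)
Require Import Defs.
From HB Require Import structures.
From mathcomp Require Import all_boot all_order all_algebra.
From mathcomp Require Import all_classical all_reals all_analysis.
From mathcomp Require Import perm measurable_realfun zify ring lra.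
Import Order.TTheory GRing.Theory Num.Theory.
Import numFieldNormedType.Exports.
Set Implicit Arguments. Unset Strict Implicit. Unset Printing Implicit Defensive.
Local Open Scope classical_set_scope.
Local Open Scope ring_scope.

(** Spherical integrals are replaced by integrals [M] of 0-homogeneous functions over the unit ball,
    and integration by parts by translation invariance of the outer measure. The obstacle is the
    second variation: integrating a Hessian by parts would cost a third derivative of C^2 data.
    Instead, in the coordinates of the gradient map of [a], the radial function of the Wulff shape
    of [b] is determined to second order by [b - a] and the difference of the gradients ([Lam]).
    This pinches the volume with an error of [e] times the squared H^1 distance, and it treats the
    L_p mean through its Wulff shape, like any other function close to 1. Volumes suffice, because
    each V_j is a fixed linear combination of the volumes of the parallel bodies at distances
    [1, ..., n.+2], shrunk to be close to the ball again. The spectral gap comes from mirrors: on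
    functions odd in two coordinates, completing a square in each coordinate is sharp; reflections
    carry this to even functions odd in any mirror; and a mean-zero function nearly minimising the
    L^2 mass must be nearly symmetric in every mirror, hence nearly constant. *)

Lemma max0_split (R : realDomainType) (u v c : R) :
  Num.max 0 (v - u) = Num.max 0 (Num.min v c - u) + Num.max 0 (v - Num.max u c).
Proof.
have [uc|uc] := lerP u c; have [vc|vc] := lerP v c;
  do 3?[case: (lerP 0 _) => ?]; lra.
Qed.

(** * Lebesgue outer measure from countable box covers *)

Section OuterMeasure.
Variables (R : realType) (n : nat).
Notation V := 'rV[R]_n.
Local Open Scope ereal_scope.

Lemma boxvol_ge0 (a b : V) : (0 <= boxvol a b)%R.
Proof. by apply: prodr_ge0 => i _; rewrite le_max lexx. Qed.

Lemma lebesgue_vol_ge0 (A : set V) : 0 <= lebesgue_vol A.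
Proof.
apply: le_ereal_inf_tmp => _ [a [b [_ ->]]].
by apply: nneseries_ge0 => k _ _; rewrite lee_fin boxvol_ge0.
Qed.

Lemma le_lebesgue_vol : {homo @lebesgue_vol R n : A B / A `<=` B >-> A <= B}.
Proof.
move=> A B AB; apply: ereal_inf_le_tmp => x [a [b [Bab ->]]].
by exists a, b; split => //; apply: subset_trans AB Bab.
Qed.

Lemma lebesgue_vol_bigcup_le (A : set V) (a b : nat -> V) :
  A `<=` \bigcup_k box (a k) (b k) ->
  lebesgue_vol A <= \sum_(0 <= k <oo) (boxvol (a k) (b k))%:E.
Proof. by move=> Aab; apply: ereal_inf_lbound; exists a, b. Qed.

(** Covers of the [A k], each within [e / 2 ^ k.+1] of optimal, are merged into one cover indexed by
    pairs. A bijection of [nat] with [nat * nat] makes it a sequence again, and rearrangement of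
    nonnegative sums gives the iterated series. *)
Lemma lebesgue_vol_sigma_subadditive : sigma_subadditive (@lebesgue_vol R n).
Proof.
move=> A; have [[i ioo]|] := pselect (exists i, lebesgue_vol (A i) = +oo).
  rewrite (eseries_pinfty _ _ ioo) ?leey// => k _.
  by rewrite -ltNye (lt_le_trans _ (lebesgue_vol_ge0 _)).
rewrite -forallNE => Aoo.
apply/lee_addgt0Pr => e e0.
rewrite (le_trans _ (epsilon_trick _ _ (ltW e0)))//; last first.
  by move=> k; exact: lebesgue_vol_ge0.
pose P k (ab : (nat -> V) * (nat -> V)) :=
  A k `<=` \bigcup_m box (ab.1 m) (ab.2 m) /\
  \sum_(0 <= m <oo) (boxvol (ab.1 m) (ab.2 m))%:E
    <= lebesgue_vol (A k) + (e / (2 ^ k.+1)%:R)%:E.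
have [G PG] : {G & forall k, P k (G k)}.
  apply: (@choice _ _ P) => k; rewrite /P.
  have ek : (0 < e / (2 ^ k.+1)%:R)%R by rewrite divr_gt0// ltr0n expn_gt0.
  have fk : lebesgue_vol (A k) \is a fin_num.
    by rewrite ge0_fin_numE ?lebesgue_vol_ge0// ltey; apply/eqP/Aoo.
  have [_ [a [b [Aab ->]]] lt] := lb_ereal_inf_adherent ek fk.
  by exists (a, b); split => //; apply: ltW.
pose w (km : nat * nat) := (boxvol ((G km.1).1 km.2) ((G km.1).2 km.2))%:E.
have w0 km : 0 <= w km by rewrite lee_fin boxvol_ge0.
apply: (@le_trans _ _ (\esum_(i in setT) w i)).
  have /card_esym/ppcard_eqP[f] := card_nat2.
  apply: (@le_trans _ _ (\sum_(0 <= k <oo) w (f k))).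
    apply: lebesgue_vol_bigcup_le => t [i _ /((PG i).1)[j _ tj]].
    by exists (f^-1%FUN (i, j)) => //; rewrite invK ?inE.
  rewrite -(esum_pred_image w f xpredT)// ?[fun=> _]set_true//.
  by rewrite image_eq.
rewrite (_ : esum _ _ = \sum_(i <oo) \sum_(j <oo) w (i, j)); last first.
  rewrite nneseries_esumT => [|k]; last exact: nneseries_ge0.
  under [RHS]eq_esum do rewrite nneseries_esumT//.
  by rewrite esum_esum//; congr esum; apply/seteqP; split.
apply: lee_lim.
- by apply: is_cvg_nneseries => k *; apply: nneseries_ge0.
- apply: is_cvg_nneseries => k *; apply: adde_ge0; rewrite ?lebesgue_vol_ge0//.
  by rewrite lee_fin divr_ge0// ltW.
- by near=> k; apply: lee_sum => i _; exact: (PG i).2.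
Unshelve. all: by end_near. Qed.

(** A cover is pulled back box by box, so the hypothesis speaks of boxes only. Translations,
    dilations and coordinate reflections satisfy it because they map boxes to boxes. *)
Lemma lebesgue_vol_le_scale (c : R) (f : V -> V) (A : set V) : (0 < c)%R ->
  (forall a b, exists a' b',
     f @^-1` (box a b) `<=` box a' b' /\ (boxvol a' b' <= c * boxvol a b)%R) ->
  lebesgue_vol (f @^-1` A) <= c%:E * lebesgue_vol A.
Proof.
move=> c0 fbox; rewrite muleC -lee_pdivrMr//.
apply: le_ereal_inf_tmp => _ [a [b [Aab ->]]]; rewrite lee_pdivrMr// muleC.
have /choice[g gP] : forall k, exists ab : V * V,
    f @^-1` (box (a k) (b k)) `<=` box ab.1 ab.2 /\
    (boxvol ab.1 ab.2 <= c * boxvol (a k) (b k))%R.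
  by move=> k; have [a' [b' ?]] := fbox (a k) (b k); exists (a', b').
rewrite -nneseriesZl; last by move=> *; rewrite lee_fin boxvol_ge0.
apply: (@le_trans _ _ (\sum_(0 <= k <oo) (boxvol (g k).1 (g k).2)%:E)).
  by apply: lebesgue_vol_bigcup_le => x /Aab[k _ xk]; exists k => //; apply: (gP k).1.
apply: lee_nneseries => k; first by rewrite lee_fin boxvol_ge0.
by move=> _; rewrite -EFinM lee_fin; exact: (gP k).2.
Qed.

End OuterMeasure.

Section BoxLowerBound.
Variable R : realType.
Local Open Scope ereal_scope.

Let tl n (x : 'rV[R]_n.+1) : 'rV[R]_n := \row_i x ord0 (lift ord0 i).

Let boxvolS n (a b : 'rV[R]_n.+1) : boxvol a b =
  (Num.max 0 (b ord0 ord0 - a ord0 ord0) * boxvol (tl a) (tl b))%R.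
Proof.
rewrite /boxvol big_ord_recl; congr (_ * _)%R.
by apply: eq_bigr => i _; rewrite !mxE.
Qed.

(** Induction on the dimension by slicing: for each value [t] of coordinate 0, the tails of the
    boxes whose first side contains [t] cover the tail of the given box, and integrating in [t] with
    one-dimensional Lebesgue measure multiplies the first sides back in. The predicate [P] serves
    the induction, which at each [t] keeps only part of the cover. *)
Lemma boxvol_le_cover n (a b : 'rV[R]_n) (A B : nat -> 'rV[R]_n) (P : pred nat) :
  (forall i, a ord0 i <= b ord0 i)%R ->
  box a b `<=` \bigcup_(k in P) box (A k) (B k) ->
  (boxvol a b)%:E <= \sum_(0 <= k <oo | P k) (boxvol (A k) (B k))%:E.
Proof.
elim: n a b A B P => [|n IH] a b A B P ab sub.
  (* In dimension 0 every box has volume 1, the empty product, so one box of the cover is enough. *)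
  have [k Pk _] : (\bigcup_(k in P) box (A k) (B k)) a by apply: sub => -[].
  rewrite (nneseriesD1 (n := k))//; last first.
    by move=> *; rewrite lee_fin boxvol_ge0.
  rewrite /boxvol !big_ord0 leeDl// nneseries_ge0// => m _ _.
  by rewrite big_ord0.
pose mu := @lebesgue_measure R.
pose I (k : nat) := `[A k ord0 ord0, B k ord0 ord0]%classic.
pose w k : R := if P k then boxvol (tl (A k)) (tl (B k)) else 0%R.
have w0 k : (0 <= w k)%R by rewrite /w; case: ifP => // _; exact: boxvol_ge0.
have itvE (u v : R) : mu `[u, v]%classic = (Num.max 0 (v - u))%:E.
  rewrite /mu lebesgue_measure_itv/= lte_fin; case: ltP => uv.
    by rewrite max_r// subr_ge0 ltW.
  by rewrite max_l// subr_le0.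
pose D := `[a ord0 ord0, b ord0 ord0]%classic.
pose f k (t : R) := (w k * \1_(I k) t)%:E.
have f0 k t : 0 <= f k t by rewrite lee_fin mulr_ge0.
have mf k : measurable_fun D (f k).
  apply/measurable_EFinP; apply: measurable_funM; first exact: measurable_cst.
  by apply: measurable_indic; exact: measurable_itv.
apply: (@le_trans _ _ (\int[mu]_(t in D) \sum_(0 <= k <oo) f k t)).
  rewrite boxvolS mulrC EFinM -itvE -integral_cst//.
  apply: ge0_le_integral => //.
  - by move=> t _; rewrite lee_fin boxvol_ge0.
  - apply: ge0_emeasurable_sum => [k t _ _|k _]; [exact: f0|exact: mf].
  move=> t; rewrite /D/= in_itv/= => tab.
  have sub' : box (tl a) (tl b) `<=` \bigcup_(k in fun k => P k && (t \in I k)) box (tl (A k)) (tl (B k)).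
    move=> y yab.
    pose x : 'rV[R]_n.+1 := \row_i (if unlift ord0 i is Some j then y ord0 j else t).
    have xab : box a b x.
      move=> i; rewrite mxE; case: unliftP => [j ->|-> //].
      by have := yab j; rewrite !mxE.
    have [k Pk xk] := sub _ xab; exists k.
      apply/andP; split => //; rewrite inE /I/= in_itv/=.
      by have := xk ord0; rewrite mxE unlift_none.
    by move=> j; have := xk (lift ord0 j); rewrite !mxE liftK.
  have ab' i : (tl a ord0 i <= tl b ord0 i)%R by rewrite !mxE ab.
  apply: (le_trans (IH _ _ _ _ _ ab' sub')).
  rewrite eseries_mkcond; apply: lee_nneseries => k.
    by case: ifP => // _ _; rewrite lee_fin boxvol_ge0.
  rewrite /f /w indicE; case: (P k) => /=; last by rewrite mul0r.
  by case: (t \in I k); rewrite ?mulr1 ?mulr0.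
rewrite integral_nneseries//.
rewrite [leRHS]eseries_mkcond; apply: lee_nneseries => k.
  by move=> _ _; apply: integral_ge0.
rewrite /f; under eq_integral do rewrite EFinM.
rewrite ge0_integralZl//; last 2 first.
- by apply/measurable_EFinP; apply: measurable_indic; exact: measurable_itv.
- by rewrite lee_fin.
have mD : measurable D by exact: measurable_itv.
have mI : measurable (I k) by exact: measurable_itv.
rewrite integral_indic//; first (move=> _; apply: (@le_trans _ _ ((w k)%:E * mu (I k)))).
- apply: lee_wpmul2l; first by rewrite lee_fin.
  by apply: le_measure; rewrite ?inE//; exact: measurableI.
- rewrite /I itvE /w; case: (P k) => /=; last by rewrite mul0e.
  by rewrite boxvolS mulrC EFinM.
all: exact: measurable_itv.
Qed.

Lemma lebesgue_vol_box n (a b : 'rV[R]_n) : (forall i, a ord0 i <= b ord0 i)%R ->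
  (boxvol a b)%:E <= lebesgue_vol (box a b).
Proof.
move=> ab; apply: le_ereal_inf_tmp => _ [A [B [sub ->]]].
by apply: boxvol_le_cover => // x /sub[k _ ?]; exists k.
Qed.

End BoxLowerBound.

(** The dimension is positive for a reason: in dimension 0 every box has volume 1, so even the empty
    set would get volume [+oo]. The lock gives the outer-measure instance a constant that does not
    unfold. *)
HB.lock Definition lvol (R : realType) (n : nat) : set 'rV[R]_n.+1 -> \bar R :=
  @lebesgue_vol R n.+1.

(** * Caratheodory measurability and invariance under elementary maps *)

Section Measure.
Variables (R : realType) (n : nat).
Notation V := 'rV[R]_n.+1.
Local Open Scope ereal_scope.
Notation vol := (@lvol R n).

Lemma lvolE : vol = @lebesgue_vol R n.+1. Proof. by rewrite unlock. Qed.

Let lvol0 : vol set0 = 0.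
Proof.
rewrite lvolE; apply/eqP; rewrite eq_le lebesgue_vol_ge0 andbT.
apply: (le_trans (@lebesgue_vol_bigcup_le _ _ _ (fun=> 0%R) (fun=> 0%R) _)) => //.
rewrite eseries0// => k _ _; rewrite /boxvol big_ord_recl !mxE subrr.
by rewrite maxxx mul0r.
Qed.

Let lvol_ge0 A : 0 <= vol A.
Proof. by rewrite lvolE; exact: lebesgue_vol_ge0. Qed.

Let lvol_le : {homo vol : A B / A `<=` B >-> A <= B}.
Proof. by rewrite lvolE; exact: le_lebesgue_vol. Qed.

Let lvol_subadditive : sigma_subadditive vol.
Proof. by rewrite lvolE; exact: lebesgue_vol_sigma_subadditive. Qed.

HB.instance Definition _ :=
  isOuterMeasure.Build R V vol lvol0 lvol_ge0 lvol_le lvol_subadditive.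

Definition volO : {outer_measure set V -> \bar R} := vol.

Definition muV : {measure set (caratheodory_type volO) -> \bar R} :=
  (volO : set (caratheodory_type volO) -> \bar R).

Notation mV := (caratheodory_type volO).

Lemma muVE : (muV : set V -> \bar R) = @lebesgue_vol R n.+1.
Proof. exact: lvolE. Qed.

(** Cutting every box of a cover at height [c] gives covers of the two pieces of [X] with the same
    total volume ([max0_split]), which is Caratheodory's condition. *)
Lemma measurable_lt_coord (i : 'I_n.+1) (c : R) :
  measurable ([set x : V | (x ord0 i < c)%R] : set mV).
Proof.
apply: le_caratheodory_measurable => X; set A := [set x | _].
rewrite /volO/= lvolE; apply: le_ereal_inf_tmp => _ [a [b [sub ->]]].
pose b' k : V := \row_l (if l == i then Num.min (b k ord0 l) c else b k ord0 l).
pose a' k : V := \row_l (if l == i then Num.max (a k ord0 l) c else a k ord0 l).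
have split k : (boxvol (a k) (b k) = boxvol (a k) (b' k) + boxvol (a' k) (b k))%R.
  rewrite /boxvol (bigD1 i)//= [X in (_ = X + _)%R](bigD1 i)//= [X in (_ = _ + X)%R](bigD1 i)//=.
  rewrite !mxE eqxx.
  have e1 : (\prod_(l < n.+1 | l != i) Num.max 0 (b' k ord0 l - a k ord0 l) =
    \prod_(l < n.+1 | l != i) Num.max 0 (b k ord0 l - a k ord0 l))%R.
    by apply: eq_bigr => l /negbTE li; rewrite mxE li.
  have e2 : (\prod_(l < n.+1 | l != i) Num.max 0 (b k ord0 l - a' k ord0 l) =
    \prod_(l < n.+1 | l != i) Num.max 0 (b k ord0 l - a k ord0 l))%R.
    by apply: eq_bigr => l /negbTE li; rewrite mxE li.
  rewrite e1 e2 -mulrDl; congr (_ * _)%R.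
  move: (a k ord0 i) (b k ord0 i) => u v.
  exact: max0_split.
under eq_eseriesr do rewrite split EFinD.
rewrite nneseriesD; last 2 first.
- by move=> *; rewrite lee_fin boxvol_ge0.
- by move=> *; rewrite lee_fin boxvol_ge0.
apply: leeD; apply: lebesgue_vol_bigcup_le => x [/sub[k _ xk] xc]; exists k => // l.
  rewrite mxE; have /andP[-> xb] := xk l; case: eqP => //= li.
  by rewrite le_min xb/= li ltW.
rewrite mxE; have /andP[xa ->] := xk l; case: eqP => [li|]; rewrite ?andbT//.
by rewrite ge_max xa/= li leNgt; apply/negP.
Qed.

Lemma measurable_coord (i : 'I_n.+1) :
  measurable_fun [set: mV] (fun x : mV => (x : V) ord0 i).
Proof.
apply: (measurability _ (RGenInftyO.measurableE R)) => _ [_ [c ->]] <-.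
rewrite setTI; apply: (measurable_lt_coord i c).
Qed.

Lemma measurable_box (a b : V) : measurable (box a b : set mV).
Proof.
rewrite (_ : box a b = \bigcap_(i in [set: 'I_n.+1])
    (fun x : mV => (x : V) ord0 i) @^-1` `[a ord0 i, b ord0 i]%classic).
  apply: fin_bigcap_measurable => // i _; rewrite -[X in measurable X]setTI.
  by apply: measurable_coord => //; exact: measurable_itv.
apply/seteqP; split=> [x xab i _|x xab i]; rewrite /=.
  by rewrite in_itv/=; exact: xab.
by have := xab i Logic.I; rewrite /= in_itv.
Qed.

(** Balls of the sup norm are boxes, so every point of [U] lies in a box inside [U] with rational
    centre and half-side [1 / (m + 1)]; there are countably many of these. *)
Lemma open_measurableV (U : set V) : open U -> measurable (U : set mV).
Proof.
move=> oU.
pose B (p : {ffun 'I_n.+1 -> rat} * nat) : set V :=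
  let S := box (\row_i (ratr (p.1 i) - p.2.+1%:R^-1)%R) (\row_i (ratr (p.1 i) + p.2.+1%:R^-1)%R) in
  if `[< S `<=` U >] then S else set0.
rewrite (_ : U = \bigcup_p B p); last first.
  apply/seteqP; split=> [x Ux|x [p _]]; last first.
    by rewrite /B; case: asboolP => // pU /pU.
  have /nbhs_ballP[e /= e0 eU] := open_nbhs_nbhs (conj oU Ux).
  have [m me] : exists m : nat, (m.+1%:R^-1 < e / 2)%R.
    have [m _ mP] := near_infty_natSinv_lt (PosNum (divr_gt0 e0 (ltr0n _ 2))).
    by exists m; exact: (mP m (leqnn m)).
  have /choice[r rP] : forall i : 'I_n.+1, exists r : rat,
      (x ord0 i - m.+1%:R^-1 < ratr r < x ord0 i + m.+1%:R^-1)%R.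
    move=> i; have [|r] := @rat_in_itvoo R (x ord0 i - m.+1%:R^-1)%R (x ord0 i + m.+1%:R^-1)%R.
      by rewrite ltrD2l gtrN// invr_gt0.
    by rewrite in_itv; exists r.
  exists ([ffun i => r i], m) => //; rewrite /B; case: asboolP => [_ i|].
    rewrite !mxE !ffunE/=; have /andP[] := rP i.
    by move: (m.+1%:R^-1%R) => d ? ?; apply/andP; split; lra.
  case=> y yB; apply: eU; split=> // i0 i; rewrite (ord1 i0).
  rewrite /ball/= ltr_norml; have := yB i; rewrite !mxE !ffunE/= => /andP[].
  by have /andP[] := rP i; move: me; move: (m.+1%:R^-1%R) => d ? ? ? ? ?; apply/andP; split; lra.
apply: countable_bigcupT_measurable => // p.
by rewrite /B; case: ifP => // _; exact: measurable_box.
Qed.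

Lemma measurable_continuousV (U : set V) (f : V -> R) : open U ->
  {in U, continuous f} -> measurable_fun (U : set mV) (f : mV -> R).
Proof.
move=> oU cf; apply: (measurability _ (RGenOpens.measurableE R)) => _ [_ [a [b ->]] <-].
apply: open_measurableV; rewrite openE => x [Ux fx].
have cx : f @ x --> f x by exact: cf (mem_set Ux).
have ci : \forall y \near x, (f @^-1` `]a, b[) y.
  by apply: cx; apply: open_nbhs_nbhs; split => //; exact: interval_open.
near=> y; split; [near: y; exact: open_nbhs_nbhs|near: y; exact: ci].
Unshelve. all: by end_near. Qed.

Lemma lebesgue_vol_transform (c : R) (f g : V -> V) :
  (0 < c)%R -> cancel f g -> cancel g f ->
  (forall a b, exists a' b',
     f @^-1` (box a b) `<=` box a' b' /\ (boxvol a' b' <= c * boxvol a b)%R) ->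
  (forall a b, exists a' b',
     g @^-1` (box a b) `<=` box a' b' /\ (boxvol a' b' <= c^-1 * boxvol a b)%R) ->
  forall A : set V, lebesgue_vol (f @^-1` A) = c%:E * lebesgue_vol A.
Proof.
move=> c0 fg gf fbox gbox A; apply/eqP; rewrite eq_le; apply/andP; split.
  exact: lebesgue_vol_le_scale.
have -> : A = g @^-1` (f @^-1` A).
  by apply/seteqP; split=> x; rewrite /preimage/= gf.
have c1 : (0 < c^-1)%R by rewrite invr_gt0.
apply: (le_trans (lee_wpmul2l _ (lebesgue_vol_le_scale (f @^-1` A) c1 gbox))).
  by rewrite lee_fin ltW.
rewrite muleA -EFinM divff ?gt_eqF// mul1e.
by apply: le_lebesgue_vol => x; rewrite /preimage/= fg.
Qed.

(** Caratheodory's condition compares outer measures of arbitrary sets, and [f] multiplies all of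
    these by the same [c]; so the condition passes directly from [A] to its preimage. *)
Lemma measurable_transform (c : R) (f g : V -> V) : (0 <= c)%R -> cancel f g -> cancel g f ->
  (forall A : set V, lebesgue_vol (f @^-1` A) = c%:E * lebesgue_vol A) ->
  measurable_fun [set: mV] (f : mV -> mV).
Proof.
move=> c0 fg gf fA _ A mA; rewrite setTI.
have {}mA : volO.-caratheodory A := mA.
change (volO.-caratheodory (f @^-1` A)) => X.
have pre (Y : set V) : Y = f @^-1` (g @^-1` Y).
  by apply/seteqP; split=> x; rewrite /preimage/= fg.
have fA' Y : volO (f @^-1` Y) = c%:E * volO Y by rewrite /volO/= lvolE fA.
rewrite [X in volO X](pre X) [X in volO (X `&` _)](pre X) [X in volO (X `&` ~` _)](pre X).
change (volO (f @^-1` (g @^-1` X)) = volO (f @^-1` (g @^-1` X `&` A)) +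
  volO (f @^-1` (g @^-1` X `&` ~` A))).
rewrite !fA' -ge0_muleDr ?outer_measure_ge0//.
by congr (_ * _); exact: mA.
Qed.

Lemma boxvol_shift (v a b : V) : boxvol (a + v) (b + v) = boxvol a b.
Proof. by apply: eq_bigr => i _; rewrite !mxE; congr Num.max; lra. Qed.

Lemma lebesgue_vol_translate (v : V) (A : set V) :
  lebesgue_vol ((fun x => x + v)%R @^-1` A) = lebesgue_vol A.
Proof.
rewrite -[RHS]mul1e; apply: (@lebesgue_vol_transform 1%R _ (fun x => x - v)%R) => //.
- exact: addrK.
- exact: addrNK.
- move=> a b; exists (a - v)%R, (b - v)%R; rewrite boxvol_shift mul1r; split=> // x.
  by move=> xab i; have := xab i; rewrite !mxE; lra.
- move=> a b; exists (a + v)%R, (b + v)%R; rewrite boxvol_shift invr1 mul1r; split=> // x.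
  by move=> xab i; have := xab i; rewrite !mxE; lra.
Qed.

Lemma boxvolZ (s : R) (a b : V) : (0 <= s)%R ->
  boxvol (s *: a) (s *: b) = (s ^+ n.+1 * boxvol a b)%R.
Proof.
move=> s0; rewrite /boxvol -[in X in (X * _)%R](card_ord n.+1) -prodr_const -big_split/=.
by apply: eq_bigr => i _; rewrite !mxE -mulrBr maxr_pMr// mulr0.
Qed.

Lemma lebesgue_vol_scale (s : R) (A : set V) : (0 < s)%R ->
  lebesgue_vol (( *:%R s) @^-1` A) = (s ^- n.+1)%:E * lebesgue_vol A.
Proof.
move=> s0; have sn0 : (s != 0)%R by rewrite gt_eqF.
apply: (@lebesgue_vol_transform _ _ ( *:%R s^-1)) => //.
- by rewrite invr_gt0 exprn_gt0.
- exact: scalerK.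
- exact: scalerKV.
- move=> a b; exists (s^-1 *: a)%R, (s^-1 *: b)%R; rewrite boxvolZ ?invr_ge0 ?(ltW s0)//.
  rewrite exprVn; split=> // x xab i; have := xab i; rewrite !mxE.
  by rewrite !ler_pdivrMl// ler_pdivlMl.
- move=> a b; exists (s *: a)%R, (s *: b)%R; rewrite boxvolZ ?(ltW s0)//.
  rewrite invrK; split=> // x xab i; have := xab i; rewrite !mxE.
  by rewrite ler_pdivlMl// ler_pdivrMl.
Qed.

Definition flip (i : 'I_n.+1) (x : V) : V :=
  \row_l (if l == i then - x ord0 l else x ord0 l)%R.

Lemma flipK i : involutive (flip i).
Proof. by move=> x; apply/rowP => l; rewrite !mxE; case: eqP => //; rewrite opprK. Qed.

Lemma lebesgue_vol_flip i (A : set V) :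
  lebesgue_vol (flip i @^-1` A) = lebesgue_vol A.
Proof.
rewrite -[RHS]mul1e.
have fbox : forall a b : V, exists a' b' : V,
    flip i @^-1` (box a b) `<=` box a' b' /\ (boxvol a' b' <= 1 * boxvol a b)%R.
  move=> a b; pose a' := (\row_l (if l == i then - b ord0 l else a ord0 l)%R : V).
  pose b' := (\row_l (if l == i then - a ord0 l else b ord0 l)%R : V).
  exists a', b'; split.
    move=> x xab l; have := xab l; rewrite !mxE; case: eqP => // _; lra.
  rewrite mul1r /boxvol le_eqVlt; apply/orP; left; apply/eqP.
  by apply: eq_bigr => l _; rewrite !mxE; case: eqP => // _; congr Num.max; lra.
by apply: (@lebesgue_vol_transform 1%R _ (flip i)) => //; rewrite ?invr1//; exact: flipK.
Qed.

End Measure.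

(** * Integration of bounded functions with bounded support *)

Section Integral.
Variables (R : realType) (n : nat).
Notation V := 'rV[R]_n.+1.
Notation mV := (caratheodory_type (volO R n)).
Notation mu := (muV R n).

Definition Int (f : V -> R) : R := Rintegral mu setT (f : mV -> R).

Definition mfun (f : V -> R) := measurable_fun [set: mV] (f : mV -> R).

(** A single constant bounds both the values and the support, so that [C] times the indicator of
    [cube C] is an integrable majorant. A common [C] is therefore all that dominated convergence
    asks for. *)
Definition bbd (C : R) (f : V -> R) :=
  (forall x, `|f x| <= C) /\ (forall x, C < `|x| -> f x = 0).

Definition bbm (f : V -> R) := mfun f /\ exists C, bbd C f.

Lemma coord_le_norm (x : V) i : `|x ord0 i| <= `|x|.
Proof.
have /mapP[j Hj ->] : `|x ord0 i| \in [seq `|x k.1 k.2| | k : 'I_1 * 'I_n.+1].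
  by apply/mapP; exists (ord0, i) => //=; rewrite mem_enum.
by rewrite [leRHS]/Num.norm /= mx_normrE; apply/bigmax_geP; right => /=; exists j.
Qed.

Lemma norm_le_coord (x : V) (c : R) : (forall i, `|x ord0 i| <= c) -> `|x| <= c.
Proof.
move=> xc; rewrite [leLHS]/Num.norm /= mx_normrE; apply/bigmax_leP; split=> /=.
  exact: le_trans (xc ord0).
by case=> i j _ /=; rewrite (ord1 i).
Qed.

Definition cube (C : R) : set V := box (\row_i (- C)) (\row_i C).

Lemma cubeP (C : R) x : cube C x <-> `|x| <= C.
Proof.
split=> [xC|xC i].
  by apply: norm_le_coord => i; have := xC i; rewrite !mxE -ler_norml.
by rewrite !mxE -ler_norml (le_trans (coord_le_norm x i)).
Qed.

Lemma lebesgue_vol_box_le (a b : V) :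
  (lebesgue_vol (box a b) <= (boxvol a b)%:E)%E.
Proof.
pose A k : V := if k is 0%N then a else 0.
pose B k : V := if k is 0%N then b else 0.
apply: (le_trans (@lebesgue_vol_bigcup_le _ _ _ A B _)); first by move=> x xab; exists 0%N.
rewrite nneseries_recl//; last by move=> *; rewrite lee_fin boxvol_ge0.
rewrite eseries_cond/= eseries0 ?adde0// => -[//|k] _ _ /=.
by rewrite /boxvol big_ord_recl subrr maxxx mul0r.
Qed.

Lemma mu_cube (C : R) : (mu (cube C) < +oo)%E.
Proof.
by rewrite muVE; apply: le_lt_trans (lebesgue_vol_box_le _ _) _; rewrite ltry.
Qed.

Lemma cube_measurable C : measurable (cube C : set mV).
Proof. exact: measurable_box. Qed.

Lemma mfun_cst (c : R) : mfun (fun=> c). Proof. exact: measurable_cst. Qed.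
Lemma mfunD f g : mfun f -> mfun g -> mfun (fun x => f x + g x).
Proof. exact: measurable_funD. Qed.
Lemma mfunB f g : mfun f -> mfun g -> mfun (fun x => f x - g x).
Proof. exact: measurable_funB. Qed.
Lemma mfunM f g : mfun f -> mfun g -> mfun (fun x => f x * g x).
Proof. exact: measurable_funM. Qed.
Lemma mfun_sum (I : Type) (r : seq I) (f : I -> V -> R) :
  (forall i, mfun (f i)) -> mfun (fun x => \sum_(i <- r) f i x).
Proof. by move=> mf; apply: measurable_sum. Qed.
Lemma mfun_prod (I : Type) (r : seq I) (f : I -> V -> R) :
  (forall i, mfun (f i)) -> mfun (fun x => \prod_(i <- r) f i x).
Proof.
move=> mf; elim: r => [|i r IH]; first by under eq_fun do rewrite big_nil; exact: mfun_cst.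
by under eq_fun do rewrite big_cons; exact: mfunM.
Qed.

Lemma mfun_cvg (f_ : nat -> V -> R) f : (forall k, mfun (f_ k)) ->
  (forall x, f_ ^~ x @ \oo --> f x) -> mfun f.
Proof.
move=> mf cf; apply: (@measurable_fun_cvg _ mV R setT f_ f) => // x _; exact: cf.
Qed.

Lemma mfun_indic (A : set V) : measurable (A : set mV) -> mfun \1_A.
Proof. by move=> mA; apply: measurable_indic. Qed.

Lemma continuous_mfun (f : V -> R) : continuous f -> mfun f.
Proof.
move=> cf; apply: (@measurable_continuousV _ _ setT) => //; exact: openT.
Qed.

Lemma set0V_measurable : measurable ([set 0] : set mV).
Proof.
rewrite (_ : [set 0] = cube 0); first exact: cube_measurable.
apply/seteqP; split=> x; first by move=> ->; apply/cubeP; rewrite normr0.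
by move/cubeP; rewrite normr_le0 => /eqP.
Qed.

(** Tailored to 0-homogeneous functions, which in general jump at the origin; the origin itself is a
    measurable set. *)
Lemma continuous_off0_mfun (f : V -> R) :
  (forall x, x != 0 -> {for x, continuous f}) -> mfun f.
Proof.
move=> cf; rewrite /mfun -(setvU [set 0]); apply/measurable_funU => //.
- exact/measurableC/set0V_measurable.
- exact: set0V_measurable.
split; last first.
  apply: (@eq_measurable_fun _ _ mV _ _ (cst (f 0))) => //.
  by move=> x; rewrite inE => ->.
apply: (@measurable_continuousV _ _ (~` [set 0])).
  apply/closed_openC/accessible_closed_set1/hausdorff_accessible.
  exact: (@norm_hausdorff _ V).
by move=> x; rewrite inE => /eqP; exact: cf.
Qed.

Lemma bbd_bbm C f : mfun f -> bbd C f -> bbm f.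
Proof. by move=> mf bf; split => //; exists C. Qed.

Lemma bbd_ge0 C f : bbd C f -> 0 <= C.
Proof. by move=> [/(_ 0)+ _]; apply: le_trans. Qed.

Lemma bbd_cube C f : bbd C f -> forall x, `|f x| <= C * \1_(cube C) x.
Proof.
move=> [b s] x; rewrite indicE; case: (boolP (x \in cube C)) => [_|xC].
  by rewrite mulr1.
rewrite mulr0 s ?normr0// ltNge; apply/negP => h; move/negP: xC; apply.
by rewrite inE; apply/cubeP.
Qed.

Lemma cube_integrable C : mu.-integrable setT (EFin \o (fun x : mV => C * \1_(cube C) x)).
Proof.
apply: (@eq_integrable _ _ _ _ setT _ (fun x : mV => C%:E * (\1_(cube C) x)%:E)%E) => //.
apply: integrableZl => //; apply/integrableP; split.
  exact/measurable_EFinP/mfun_indic/cube_measurable.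
under eq_integral do rewrite gee0_abs ?lee_fin//.
rewrite integral_indic//; last exact: cube_measurable.
by rewrite setIT mu_cube.
Qed.

Lemma bbm_integrable f : bbm f -> mu.-integrable setT (EFin \o (f : mV -> R)).
Proof.
move=> [mf [C bf]]; apply: le_integrable (cube_integrable C) => //.
  exact/measurable_EFinP.
move=> x _; rewrite /= lee_fin (le_trans (bbd_cube bf x))// ler_norm//.
Qed.

Lemma bbm0 : bbm (fun=> 0).
Proof. by split; [exact: mfun_cst|exists 0; split=> // x; rewrite normr0]. Qed.

Lemma bbmD f g : bbm f -> bbm g -> bbm (fun x => f x + g x).
Proof.
move=> [mf [C bf]] [mg [D bg]]; split; first exact: mfunD.
have C0 := bbd_ge0 bf; have D0 := bbd_ge0 bg.
exists (C + D); split=> x.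
  by rewrite (le_trans (ler_normD _ _))// lerD ?(proj1 bf) ?(proj1 bg).
by move=> h; rewrite (proj2 bf) ?(proj2 bg) ?addr0//; lra.
Qed.

Lemma bbmMl g f : mfun g -> (forall C, exists D, forall x, `|x| <= C -> `|g x| <= D) ->
  bbm f -> bbm (fun x => g x * f x).
Proof.
move=> mg bg [mf [C bf]]; split; first exact: mfunM.
have C0 := bbd_ge0 bf; have [D gD] := bg C.
exists (C + `|D| * C); split=> x.
  have [xC|xC] := leP `|x| C; last by rewrite (proj2 bf)// mulr0 normr0 addr_ge0// mulr_ge0.
  rewrite normrM (@le_trans _ _ (`|D| * C))//; last by rewrite lerDr.
  by rewrite ler_pM// ?(proj1 bf)// (le_trans (gD _ xC))// ler_norm.
move=> h; rewrite (proj2 bf) ?mulr0//; apply: le_lt_trans h.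
by rewrite lerDl mulr_ge0.
Qed.

Lemma bbmM f g : bbm f -> bbm g -> bbm (fun x => f x * g x).
Proof.
by move=> [mf [C bf]]; apply: bbmMl => // D; exists C => x _; exact: (proj1 bf).
Qed.

Lemma bbmZ k f : bbm f -> bbm (fun x => k * f x).
Proof. by apply: bbmMl; [exact: mfun_cst|move=> C; exists `|k|]. Qed.

Lemma bbmN f : bbm f -> bbm (fun x => - f x).
Proof. by move=> /(bbmZ (-1)); under eq_fun do rewrite mulN1r. Qed.

Lemma bbmB f g : bbm f -> bbm g -> bbm (fun x => f x - g x).
Proof. by move=> bf bg; apply: bbmD => //; exact: bbmN. Qed.

Lemma bbm_sum (I : Type) (r : seq I) (f : I -> V -> R) :
  (forall i, bbm (f i)) -> bbm (fun x => \sum_(i <- r) f i x).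
Proof.
move=> bf; elim: r => [|i r IH]; first by under eq_fun do rewrite big_nil; exact: bbm0.
by under eq_fun do rewrite big_cons; exact: bbmD.
Qed.

Lemma bbm_indic (A : set V) : measurable (A : set mV) ->
  (exists C, A `<=` cube C) -> bbm \1_A.
Proof.
move=> mA [C AC]; split; first exact: mfun_indic.
exists (Num.max 1 C); split=> x; rewrite indicE.
  by case: (x \in A); rewrite ?normr1 ?normr0 le_max ?ler01 ?lexx.
rewrite gt_max => /andP[_ h]; case: (boolP (x \in A)) => //.
by rewrite inE => /AC/cubeP; rewrite leNgt h.
Qed.

Lemma IntD f g : bbm f -> bbm g -> Int (fun x => f x + g x) = Int f + Int g.
Proof. by move=> bf bg; rewrite /Int RintegralD//; exact: bbm_integrable. Qed.

Lemma IntB f g : bbm f -> bbm g -> Int (fun x => f x - g x) = Int f - Int g.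
Proof. by move=> bf bg; rewrite /Int RintegralB//; exact: bbm_integrable. Qed.

Lemma IntZ k f : bbm f -> Int (fun x => k * f x) = k * Int f.
Proof. by move=> bf; rewrite /Int RintegralZl//; exact: bbm_integrable. Qed.

Lemma Int0 : Int (fun=> 0) = 0.
Proof. by rewrite -[RHS](mul0r (Int (fun=> 0))) -IntZ ?mul0r//; exact: bbm0. Qed.

Lemma eq_Int f g : f =1 g -> Int f = Int g. Proof. by move=> /funext ->. Qed.

Lemma Int_sum (I : Type) (r : seq I) (f : I -> V -> R) : (forall i, bbm (f i)) ->
  Int (fun x => \sum_(i <- r) f i x) = \sum_(i <- r) Int (f i).
Proof.
move=> bf; elim: r => [|i r IH].
  by rewrite big_nil; under eq_Int do rewrite big_nil; exact: Int0.
rewrite big_cons -IH -IntD//; last exact: bbm_sum.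
by apply: eq_Int => x; rewrite big_cons.
Qed.

Lemma Int_ge0 f : (forall x, 0 <= f x) -> 0 <= Int f.
Proof. by move=> f0; apply: Rintegral_ge0. Qed.

Lemma le_Int f g : bbm f -> bbm g -> (forall x, f x <= g x) -> Int f <= Int g.
Proof. by move=> bf bg fg; apply: le_Rintegral => //; exact: bbm_integrable. Qed.

Lemma Int_indic (A : set V) : measurable (A : set mV) -> Int \1_A = fine (lebesgue_vol A).
Proof.
by move=> mA; rewrite /Int /Rintegral integral_indic// setIT muVE.
Qed.

Lemma Int_dct C (f_ : nat -> V -> R) f : (forall k, mfun (f_ k)) ->
  (forall k, bbd C (f_ k)) -> (forall x, f_ ^~ x @ \oo --> f x) ->
  bbm f /\ Int (f_ k) @[k --> \oo] --> Int f.
Proof.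
move=> mf bf cf.
have mlim : mfun f by exact: mfun_cvg cf.
have cE (x : mV) : setT x -> (fun k => (f_ k x)%:E) @ \oo --> (f x)%:E.
  by move=> _; apply: cvg_EFin; [exact: nearW|exact: cf].
have bE (x : mV) k : setT x -> (`|(f_ k x)%:E| <= (C * \1_(cube C) x)%:E)%E.
  by move=> _; rewrite lee_fin; exact: bbd_cube.
have [i1 _ i2] := @dominated_convergence _ mV R mu setT measurableT
  (fun k x => (f_ k x)%:E) (fun x => (f x)%:E) (fun x => (C * \1_(cube C) x)%:E)
  (fun k => proj2 (measurable_EFinP _ _) (mf k)) (proj2 (measurable_EFinP _ _) mlim)
  (aeW _ cE) (cube_integrable C) (aeW _ bE).
have bff : bbd C f.
  split=> x.
    have cn : `|f_ k x| @[k --> \oo] --> `|f x| by apply: cvg_norm; exact: cf.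
    rewrite -(cvg_lim _ cn)//; apply: limr_le.
      exact: cvgP cn.
    by apply: nearW => k; exact: (proj1 (bf k)).
  move=> xC; have e : (fun k => f_ k x) = cst 0.
    by apply/funext => k; exact: (proj2 (bf k)).
  by have := cf x; rewrite e => /cvg_lim <-//; rewrite lim_cst.
split; first by split => //; exists C.
have fl : (\int[mu]_x (f x)%:E)%E \is a fin_num.
  by apply: integrable_fin_num.
apply: fine_cvg; rewrite fineK//; exact: i2.
Qed.

Lemma bbm_transform C (f : V -> V) (g : V -> R) :
  measurable_fun [set: mV] (f : mV -> mV) -> (forall x, `|x| <= C * `|f x|) ->
  bbm g -> bbm (g \o f).
Proof.
move=> mf fC [mg [D bg]]; split; first exact: measurableT_comp mg mf.
have D0 := bbd_ge0 bg.
exists (D + `|C| * D); split=> x.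
  by rewrite (le_trans (proj1 bg _))// lerDl mulr_ge0.
move=> h; apply: (proj2 bg); rewrite ltNge; apply/negP => fD; move: h; rewrite ltNge => /negP; apply.
rewrite (le_trans (fC x))// (@le_trans _ _ (`|C| * D))// ?lerDr//.
by rewrite (le_trans (ler_wpM2r _ (ler_norm _)))// ler_wpM2l.
Qed.

Lemma Int_transform (c : R) (f : V -> V) (g : V -> R) : 0 <= c ->
  measurable_fun [set: mV] (f : mV -> mV) ->
  (forall A : set V, lebesgue_vol (f @^-1` A) = (c%:E * lebesgue_vol A)%E) ->
  bbm g -> bbm (g \o f) -> Int (g \o f) = c * Int g.
Proof.
move=> c0 mf fA bg bgf.
(* The pushforward of the measure by [f] is [c] times the measure, which settles nonnegative
   functions; a signed [g] is then written as [(|g| + g) - |g|]. *)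
have pos (h : V -> R) : (forall x, 0 <= h x) -> bbm h -> Int (h \o f) = c * Int h.
  move=> h0 bh; rewrite -IntZ// /Int /Rintegral; congr fine.
  have hm : measurable_fun [set: mV] (fun x : mV => (h x)%:E).
    exact: (proj2 (measurable_EFinP _ _) (proj1 bh)).
  have hp (x : mV) : setT x -> (0 <= (h x)%:E)%E by rewrite lee_fin.
  have hp' : {in [set: mV], forall x, (0 <= (h x)%:E)%E} by move=> x _; exact: hp.
  have <- := @ge0_integral_pushforward _ _ mV mV R f mf mu setT (fun x => (h x)%:E)
    measurableT hm hp'.
  rewrite (@eq_measure_integral _ mV R setT (mscale (NngNum c0) mu))//; last first.
    move=> A mA _; change (mu (f @^-1` A) = (c%:E * mu A)%E).
    by rewrite muVE fA.
  by rewrite (ge0_integral_mscale _ _ _ hm hp)// -(ge0_integralZl _ measurableT hm hp).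
have nb h : bbm h -> bbm (fun x => `|h x|).
  move=> [mh [D bh]]; split; first exact: measurableT_comp.
  by exists D; split=> x; [rewrite normr_id (proj1 bh)|move=> /(proj2 bh) ->; rewrite normr0].
have := pos (fun x => `|g x|) (fun x => normr_ge0 _) (nb _ bg).
have := pos (fun x => `|g x| + g x) _ (bbmD (nb _ bg) bg).
rewrite (IntD (nb _ bg) bg) (IntD (nb _ bgf) bgf) mulrDr => e1 e2.
have {e1} := e1 (fun x => ltac:(by have := ler_norm (- g x); rewrite normrN; lra)).
by rewrite e2 => /addrI.
Qed.

Lemma Int_pos f x : bbm f -> (forall y, 0 <= f y) -> {for x, continuous f} ->
  0 < f x -> 0 < Int f.
Proof.
move=> bf f0 cf fx.
have : \forall y \near x, f x / 2 < f y.
  have cf' : f y @[y --> x] --> f x by exact: cf.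
  by apply: (cvgr_gt (f x) cf'); lra.
move=> /nbhs_ballP[e /= e0 eP].
pose a : V := \row_i (x ord0 i - e / 2); pose b : V := \row_i (x ord0 i + e / 2).
have ab i : a ord0 i <= b ord0 i by rewrite !mxE; lra.
have bC : bbm \1_(box a b).
  apply: bbm_indic; first exact: measurable_box.
  exists (`|x| + e) => y yab; apply/cubeP; apply: norm_le_coord => i.
  have := yab i; rewrite !mxE => /andP[? ?].
  have := coord_le_norm x i; rewrite ler_norml => /andP[? ?].
  by rewrite ler_norml; apply/andP; split; lra.
have bv : 0 < boxvol a b.
  by rewrite /boxvol; apply: prodr_gt0 => i _; rewrite !mxE lt_max; apply/orP; right; lra.
have vf : fine (lebesgue_vol (box a b)) = boxvol a b.
  have -> : lebesgue_vol (box a b) = (boxvol a b)%:E.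
    by apply/eqP; rewrite eq_le lebesgue_vol_box// lebesgue_vol_box_le.
  by [].
apply: (@lt_le_trans _ _ (Int (fun y => f x / 2 * \1_(box a b) y))).
  rewrite IntZ// Int_indic; last exact: measurable_box.
  by rewrite vf mulr_gt0// divr_gt0.
apply: le_Int => //; first exact: bbmZ.
move=> y; rewrite indicE; case: (boolP (y \in box a b)) => [|_]; last by rewrite mulr0.
rewrite inE mulr1 => yab; apply/ltW/eP; split=> // i0 i; rewrite (ord1 i0).
rewrite /ball/= ltr_norml; have := yab i; rewrite !mxE => /andP[? ?].
by apply/andP; split; lra.
Qed.

Lemma Int_translate (v : V) g : bbm g -> Int (fun x => g (x + v)) = Int g.
Proof.
move=> bg.
have mf : measurable_fun [set: mV] ((fun x => x + v) : mV -> mV).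
  apply: (@measurable_transform _ _ 1 _ (fun x => x - v)) => //.
  - exact: addrK.
  - exact: addrNK.
  - by move=> A; rewrite mul1e lebesgue_vol_translate.
have bgv : bbm (fun x => g (x + v)).
  have [mg [D bg']] := bg; split; first exact: (measurableT_comp mg mf).
  exists (D + `|v|); split=> x.
    by rewrite (le_trans (proj1 bg' _))// lerDl.
  move=> h; apply: (proj2 bg'); have := ler_normB (x + v) v; rewrite addrK.
  by move: h; lra.
rewrite -[RHS]mul1r -(Int_transform _ mf _ bg)// => A.
by rewrite mul1e lebesgue_vol_translate.
Qed.

Lemma Int_scale (s : R) g : 0 < s -> bbm g -> Int (fun x => g (s *: x)) = s ^- n.+1 * Int g.
Proof.
move=> s0 bg; have sn0 : s != 0 by rewrite gt_eqF.
have c0 : 0 <= s ^- n.+1 by rewrite invr_ge0 exprn_ge0// ltW.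
have mf : measurable_fun [set: mV] (( *:%R s) : mV -> mV).
  apply: (@measurable_transform _ _ (s ^- n.+1) _ ( *:%R s^-1)) => //.
  - exact: scalerK.
  - exact: scalerKV.
  - by move=> A; rewrite lebesgue_vol_scale.
apply: Int_transform => //; first by move=> A; rewrite lebesgue_vol_scale.
apply: (@bbm_transform s^-1 _ _ mf _ bg) => x; rewrite normrZ (gtr0_norm s0) mulrA.
by rewrite (mulVf sn0) mul1r.
Qed.

Lemma Int_flip i g : bbm g -> Int (g \o flip i) = Int g.
Proof.
move=> bg.
have mf : measurable_fun [set: mV] (flip i : mV -> mV).
  apply: (@measurable_transform _ _ 1 _ (flip i)) => //; [exact: flipK|exact: flipK|].
  by move=> A; rewrite mul1e lebesgue_vol_flip.
rewrite -[RHS]mul1r; apply: Int_transform => //.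
  by move=> A; rewrite mul1e lebesgue_vol_flip.
apply: (@bbm_transform 1 _ _ mf _ bg) => x; rewrite mul1r.
apply: norm_le_coord => l; apply: le_trans (coord_le_norm _ l).
by rewrite mxE; case: eqP => _; rewrite ?normrN.
Qed.

End Integral.

(** * Derivatives along lines, and integrals of derivatives *)

Section LineCalculus.
Variables (R : realType) (n : nat).
Notation V := 'rV[R]_n.+1.

Lemma is_derive_line (f : V -> R) (x v : V) (t : R) d :
  is_derive (x + t *: v) v f d -> is_derive (t : R) (1 : R) (fun s : R => f (x + s *: v)) d.
Proof.
move=> [df <-].
have e : (fun h : R => h^-1 *: (((fun s : R => f (x + s *: v)) \o shift t) (h *: 1) - f (x + t *: v)))
    = (fun h => h^-1 *: ((f \o shift (x + t *: v)) (h *: v) - f (x + t *: v))).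
  apply/funext => h; rewrite /= [h *: 1]mulr1 scalerDl; congr (_ *: (f _ - _)).
  by rewrite addrCA.
split; first by rewrite /derivable e.
by rewrite /derive e.
Qed.

Lemma is_derive_line0 (f : V -> R) (x v : V) d :
  is_derive (0 : R) (1 : R) (fun s : R => f (x + s *: v)) d -> is_derive x v f d.
Proof.
move=> [df <-].
have e : (fun h : R => h^-1 *: (((fun s : R => f (x + s *: v)) \o shift 0) (h *: 1) - f (x + 0 *: v)))
    = (fun h => h^-1 *: ((f \o shift x) (h *: v) - f x)).
  apply/funext => h; rewrite /= [h *: 1]mulr1 addr0 scale0r addr0.
  by rewrite [x + _]addrC.
by split; [move: df; rewrite /derivable e | rewrite /derive e].
Qed.

Lemma line_mvt (f : V -> R) (df : V -> R) (x v : V) (t : R) :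
  (forall s, is_derive (x + s *: v) v f (df (x + s *: v))) ->
  exists2 c, `|c| <= `|t| & f (x + t *: v) - f x = df (x + c *: v) * t.
Proof.
move=> fd; pose g s := f (x + s *: v).
have gd (s : R) : is_derive s (1 : R) g (df (x + s *: v)) by exact: is_derive_line.
have gc : continuous g.
  by move=> s; apply: differentiable_continuous; apply/derivable1_diffP; case: (gd s).
have g0 : g 0 = f x by rewrite /g scale0r addr0.
have [t0|t0] := leP 0 t.
  have [c + e] := @MVT_segment R g (fun s => df (x + s *: v)) 0 t t0
    (fun s _ => gd s) (continuous_subspaceT gc).
  rewrite in_itv/= => /andP[c0 ct]; exists c; first by rewrite !ger0_norm.
  by rewrite -/(g t) -g0 e subr0.
have [c + e] := @MVT_segment R g (fun s => df (x + s *: v)) t 0 (ltW t0)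
  (fun s _ => gd s) (continuous_subspaceT gc).
rewrite in_itv/= => /andP[c0 ct]; exists c; first by rewrite !ler0_norm ?lerN2// ltW.
by rewrite -/(g t) -g0 -[LHS]opprB e sub0r mulrN opprK.
Qed.

Lemma line_lip (f df : V -> R) (x v : V) (t C : R) :
  (forall s, is_derive (x + s *: v) v f (df (x + s *: v))) -> (forall y, `|df y| <= C) ->
  `|f (x + t *: v) - f x| <= C * `|t|.
Proof.
move=> fd dC; have [c _ ->] := line_mvt t fd.
by rewrite normrM ler_wpM2r.
Qed.

Lemma derive_seq_cvg (f : V -> R) (x v : V) d (e : nat -> R) : is_derive x v f d ->
  (forall k, e k != 0) -> e @ \oo --> 0 ->
  (fun k => (e k)^-1 * (f (x + e k *: v) - f x)) @ \oo --> d.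
Proof.
move=> [df <-] e0 ecv.
have h : (h^-1 : R) *: ((f \o shift x) (h *: v) - f x) @[h --> 0^'] --> 'D_v f x by exact: df.
have h' : e @ \oo --> 0^'.
  by move=> A nA; have [N _ NP] := ecv _ nA; exists N => // k Nk; exact: (NP k Nk (e0 k)).
have := cvg_comp _ _ h' h; apply: cvg_trans; apply: near_eq_cvg.
by apply: nearW => k /=; rewrite [x + _]addrC.
Qed.

Lemma mfun_translate (v : V) (f : V -> R) : mfun f -> mfun (fun x => f (x + v)).
Proof.
move=> mf; apply: (measurableT_comp mf); apply: (@measurable_transform _ _ 1 _ (fun x => x - v)) => //.
- exact: addrK.
- exact: addrNK.
- by move=> A; rewrite mul1e lebesgue_vol_translate.
Qed.

Lemma bbm_translate (v : V) (f : V -> R) : bbm f -> bbm (fun x => f (x + v)).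
Proof.
move=> [mf [C bf]]; split; first exact: mfun_translate.
exists (C + `|v|); split=> x.
  by rewrite (le_trans (proj1 bf _))// lerDl.
move=> h; apply: (proj2 bf); have := ler_normB (x + v) v; rewrite addrK.
by move: h; lra.
Qed.

(** Each difference quotient has integral 0 by translation invariance, and the mean value theorem
    bounds the quotients by the bound on [df], so dominated convergence applies. This is the form in
    which integration by parts is used for the spectral gap. *)
Lemma Int_derive0 (v : V) (f df : V -> R) C D :
  (forall x, is_derive x v f (df x)) -> mfun f -> bbd C f -> bbd D df ->
  bbm df /\ Int df = 0.
Proof.
move=> fd mf bf bdf.
have C0 := bbd_ge0 bf; have D0 := bbd_ge0 bdf.
pose e (k : nat) : R := k.+1%:R^-1.
have e0 k : 0 < e k by rewrite invr_gt0.
have e1 k : e k <= 1 by rewrite invf_le1// ler1n.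
have ec : e @ \oo --> 0 by exact: cvg_harmonic.
pose f_ k x := (e k)^-1 * (f (x + e k *: v) - f x).
have bfm : bbm f by split; [|exists C].
have bs k : bbm (fun x => f (x + e k *: v)) by exact: bbm_translate.
have bf_ k : bbd (D + C + `|v|) (f_ k).
  have v0 := normr_ge0 v; split=> x.
    rewrite /f_ normrM gtr0_norm ?invr_gt0// ler_pdivrMl//.
    apply: (le_trans (line_lip _ (fun s => fd _) (proj1 bdf))).
    by rewrite (gtr0_norm (e0 k)) mulrC ler_wpM2l ?(ltW (e0 k))//; lra.
  move=> h; rewrite /f_ (proj2 bf) ?(proj2 bf) ?subrr ?mulr0//; first by lra.
  have := ler_normB (x + e k *: v) (e k *: v); rewrite addrK normrZ (gtr0_norm (e0 k)).
  have : e k * `|v| <= `|v| by rewrite ler_piMl.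
  by move: h; lra.
have [bdfm cv] := Int_dct (fun k => (bbmZ _ (bbmB (bs k) bfm)).1) bf_
  (fun x => derive_seq_cvg (fd x) (fun k => lt0r_neq0 (e0 k)) ec).
split => //; apply: (cvg_unique (@Rhausdorff R) cv).
rewrite (_ : (fun k => Int (f_ k)) = fun=> 0); first exact: cvg_cst.
apply/funext => k; rewrite /f_ IntZ; last exact: bbmB.
by rewrite IntB// Int_translate// subrr mulr0.
Qed.

End LineCalculus.

(** * Discrete exterior calculus *)

Section DiscreteNullLagrangian.
Variables (R : realType) (n : nat).
Notation V := 'rV[R]_n.+1.
Notation I := 'I_n.+1.
Variable h : I -> V.

Definition alternating (c : seq I -> R) :=
  forall a x y b, c (a ++ x :: y :: b) = - c (a ++ y :: x :: b).

(** Discrete counterpart of [du_1 /\ ... /\ du_m] contracted with the coefficients [c]: forward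
    differences along the steps [h k], every later factor being read at the shifted point as in a
    cup product. With differences in place of derivatives the closedness identity is exact for
    arbitrary functions, and C^1 functions are reached in the limit. *)
Fixpoint dwedge (c : seq I -> R) (us : seq (V -> R)) (x : V) : R :=
  if us is u :: us' then
    \sum_k (u (x + h k) - u x) * dwedge (fun s => c (k :: s)) us' (x + h k)
  else c [::].

Lemma alternating_cons c k : alternating c -> alternating (fun s => c (k :: s)).
Proof. by move=> ac a x y b; rewrite -!cat_cons ac. Qed.

Lemma alternatingN c : alternating c -> alternating (fun s => - c s).
Proof. by move=> ac a x y b; rewrite ac. Qed.

Lemma dwedgeN c us x : dwedge (fun s => - c s) us x = - dwedge c us x.
Proof.
elim: us c x => [//|u us IH] c x /=.
by rewrite -sumrN; apply: eq_bigr => k _; rewrite (IH (fun s => c (k :: s))) mulrN.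
Qed.

Lemma sum_antisym (F : I -> I -> R) : (forall k l, F k l = - F l k) ->
  \sum_k \sum_l F k l = 0.
Proof.
move=> FN; have e : \sum_k \sum_l F k l = - \sum_k \sum_l F k l.
  rewrite {1}exchange_big -sumrN; apply: eq_bigr => k _.
  by rewrite -sumrN; apply: eq_bigr => l _.
by move: e; lra.
Qed.

(** Discrete form of [dd = 0]. The mixed second difference of [u] is symmetric in the two step
    indices while [c] changes sign ([A]); the remaining terms [B] are the same statement for the
    shorter list. *)
Lemma dwedge_closed c us x : alternating c ->
  \sum_k (dwedge (fun s => c (k :: s)) us (x + h k) -
          dwedge (fun s => c (k :: s)) us x) = 0.
Proof.
elim: us c x => [|u us IH] c x ac /=; first by rewrite big1// => k _; rewrite subrr.
pose S k l y := dwedge (fun s => c (k :: l :: s)) us y.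
have SN k l y : S k l y = - S l k y.
  by rewrite /S -dwedgeN; congr dwedge; apply/funext => s; exact: (ac [::]).
pose A k l := (u (x + h k + h l) - u (x + h k) - (u (x + h l) - u x)) * S k l (x + h k + h l).
pose B k l := (u (x + h l) - u x) * (S k l (x + h l + h k) - S k l (x + h l)).
have -> : \sum_k (\sum_l (u (x + h k + h l) - u (x + h k)) * S k l (x + h k + h l) -
     \sum_l (u (x + h l) - u x) * S k l (x + h l)) =
   \sum_k \sum_l A k l + \sum_l \sum_k B k l.
  rewrite [X in _ = _ + X]exchange_big -big_split; apply: eq_bigr => k _ /=.
  rewrite -sumrB -big_split; apply: eq_bigr => l _ /=.
  rewrite /A /B (addrAC x (h l) (h k)); ring.
rewrite sum_antisym ?add0r => [|k l]; last first.
  by rewrite /A SN (addrAC x (h k) (h l)); ring.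
rewrite big1// => l _; rewrite /B -mulr_sumr.
have := IH (fun s => - c (l :: s)) (x + h l) (alternatingN (alternating_cons l ac)).
rewrite (_ : \sum_k _ = \sum_k (S k l (x + h l + h k) - S k l (x + h l))) => [->|].
  by rewrite mulr0.
apply: eq_bigr => k _; rewrite -/(S k l _) /S.
by congr (_ - _); congr dwedge; apply/funext => s; rewrite -(ac [::]).
Qed.

(** Leibniz rule [du /\ w = d(u w)] for the closed form [w]. The right-hand side is a sum of
    translation differences, hence integrates to 0. *)
Lemma dwedge_telescope c u us x : alternating c ->
  dwedge c (u :: us) x = \sum_k (u (x + h k) * dwedge (fun s => c (k :: s)) us (x + h k)
                                 - u x * dwedge (fun s => c (k :: s)) us x).
Proof.
move=> ac /=; apply/eqP; rewrite -subr_eq0 -sumrB.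
apply/eqP; transitivity (- u x * \sum_k (dwedge (fun s => c (k :: s)) us (x + h k) -
          dwedge (fun s => c (k :: s)) us x)); last by rewrite dwedge_closed// mulr0.
by rewrite mulr_sumr; apply: eq_bigr => k _; ring.
Qed.

End DiscreteNullLagrangian.

(** * Jacobian determinants are null Lagrangians *)

Section NullLagrangian.
Variables (R : realType) (n : nat).
Notation V := 'rV[R]_n.+1.
Notation I := 'I_n.+1.

Fixpoint wedge (c : seq I -> R) (ds : seq (I -> R)) : R :=
  if ds is d :: ds' then \sum_k d k * wedge (fun s => c (k :: s)) ds' else c [::].

(** The Levi-Civita symbol, extended by 0 to sequences of the wrong length. *)
Definition lc (s : seq I) : R :=
  if size s == n.+1 then \det (\matrix_(i < n.+1, j < n.+1) (nth ord0 s i == j)%:R) else 0.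

Lemma det_row_swap m (A : 'M[R]_m) i j : i != j ->
  \det (row_perm (tperm i j) A) = - \det A.
Proof. by move=> ij; rewrite row_permE det_mulmx det_perm odd_tperm ij expr1 mulN1r. Qed.

Lemma lc_alternating : alternating lc.
Proof.
move=> a x y b; rewrite /lc !size_cat/=; case: eqP => [sz|]; last by rewrite oppr0.
have ia : (size a < n.+1)%N by move: sz; lia.
have ia1 : ((size a).+1 < n.+1)%N by move: sz; lia.
pose i := Ordinal ia; pose j := Ordinal ia1.
have ij : i != j by rewrite -val_eqE/= ltn_eqF.
rewrite -(det_row_swap _ ij); congr (\det _); apply/matrixP => k l; rewrite !mxE.
congr (_ == _)%:R; case: tpermP => [->|->|/eqP ki /eqP kj].
- by rewrite /= !nth_cat ltnn subnn ltnNge leqnSn/= subSn// subnn.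
- by rewrite /= !nth_cat ltnn subnn ltnNge leqnSn/= subSn// subnn.
- rewrite !nth_cat; case: ltnP => // ak.
  have k1 : (k : nat) != size a := ki.
  have k2 : (k : nat) != (size a).+1 := kj.
  have : ((size a).+2 <= k)%N by lia.
  by move=> /subnKC <-; rewrite 2!addSn -2!addnS addKn.
Qed.

(** Contracting one more slot expands the determinant along one more row. The generalised claim
    [gen] starts from the indices [r] already chosen, which have turned the first rows into unit
    vectors. *)
Lemma wedge_det (d : I -> I -> R) :
  wedge lc [seq d i | i <- enum I] = \det (\matrix_(i, j) d i j).
Proof.
suff gen s t : s ++ t = enum I -> forall (r : seq I), size r = size s ->
    wedge (fun q => lc (r ++ q)) [seq d i | i <- t] =
    \det (\matrix_(i, j) (if (i < size s)%N then (nth ord0 r i == j)%:R else d i j)).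
  by rewrite (gen [::] (enum I) erefl [::] erefl); congr (\det _); apply/matrixP => i j; rewrite !mxE.
elim: t s => [|k t IH] s.
  rewrite cats0 => se r rs; have sn : size s = n.+1 by rewrite se size_enum_ord.
  rewrite /= cats0 /lc rs sn eqxx; congr (\det _).
  by apply/matrixP => i j; rewrite !mxE ltn_ord.
move=> st r rs /=.
have ks : k = size s :> nat.
  have := congr1 (fun q => nth ord0 q (size s)) st.
  rewrite nth_cat ltnn subnn/= => ->; rewrite nth_enum_ord//.
  by rewrite -[X in (_ < X)%N](size_enum_ord n.+1) -st size_cat/= -addSnnS leq_addr.
have sk : s ++ k :: t = rcons s k ++ t by rewrite cat_rcons.
rewrite (expand_det_row _ k); apply: eq_bigr => j _.
rewrite mxE ks ltnn; congr (_ * _).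
have := IH (rcons s k) _ (rcons r j); rewrite -sk => /(_ st).
rewrite !size_rcons rs => /(_ erefl).
under eq_fun do rewrite cat_rcons.
move=> ->; rewrite (expand_det_row _ k) (bigD1 j)//= big1 => [|l lj].
  rewrite addr0 mxE ks ltnS leqnn nth_rcons rs ltnn !eqxx mul1r.
  rewrite /cofactor; congr (_ * \det _); apply/matrixP => a b; rewrite !mxE.
  have := neq_lift k a; set i := lift k a; rewrite neq_ltn => /orP[ki|ik].
    have ki' : (k < i)%N := ki.
    by rewrite ltnS -ks leqNgt ki' [in RHS]ltnNge (ltnW ki').
  have ik' : (i < k)%N := ik.
  by rewrite -ks ik' ltnS (ltnW ik') nth_rcons rs -ks ik'.
rewrite mxE ks ltnS leqnn nth_rcons rs ltnn eqxx.
by rewrite eq_sym (negbTE lj) mul0r.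
Qed.

Notation ei k := (delta_mx ord0 k : V).

Definition C1 (u : V -> R) (du : I -> V -> R) :=
  [/\ continuous u, forall k, continuous (du k) &
      forall x k, is_derive x (ei k) u (du k x)].

Lemma norm_ei k (t : R) : `|t *: ei k| <= `|t|.
Proof.
rewrite normrZ -[leRHS]mulr1 ler_wpM2l//; apply: norm_le_coord => i.
by rewrite mxE eqxx/=; case: (i == k); rewrite ?normr1 ?normr0.
Qed.

(** The base point moves with the step size because the later factors of [dwedge] are read at points
    shifted by the earlier steps. *)
Lemma C1_diffq u du k (x : V) (y : nat -> V) (e : nat -> R) : C1 u du ->
  y @ \oo --> x -> (forall m, 0 < e m) -> e @ \oo --> 0 ->
  (fun m => (e m)^-1 * (u (y m + e m *: ei k) - u (y m))) @ \oo --> du k x.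
Proof.
move=> [cu cdu du'] yx e0 ec.
have /choice[c cP] : forall m, exists c : R, `|c| <= e m /\
    (e m)^-1 * (u (y m + e m *: ei k) - u (y m)) = du k (y m + c *: ei k).
  move=> m; have [c ce ->] := line_mvt (e m) (fun s => du' (y m + s *: ei k) k).
  exists c; split; first by rewrite (le_trans ce)// gtr0_norm.
  by rewrite mulrC mulfK// gt_eqF.
under eq_fun do rewrite (proj2 (cP _)).
have cc : (fun m => c m *: ei k) @ \oo --> (0 : V).
  apply/cvgr0Pnorm_lt => d d0; move/cvgr0Pnorm_lt : (ec) => /(_ d d0).
  apply: filterS => m; apply: le_lt_trans; rewrite (le_trans (norm_ei _ _))//.
  by rewrite (le_trans (proj1 (cP m)))// ler_norm.
have : (fun m => y m + c m *: ei k) @ \oo --> x + 0 by apply: cvgD.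
by rewrite addr0 => h; apply: (cvg_comp _ _ h); exact: cdu.
Qed.

Lemma cvg_sumR (T J : Type) (F : set_system T) {FF : Filter F} (r : seq J)
    (f : J -> T -> R) (l : J -> R) : (forall j, f j t @[t --> F] --> l j) ->
  \sum_(j <- r) f j t @[t --> F] --> \sum_(j <- r) l j.
Proof.
move=> fl; elim: r => [|j r IH].
  by rewrite big_nil; under eq_fun do rewrite big_nil; exact: cvg_cst.
by rewrite big_cons; under eq_fun do rewrite big_cons; exact: cvgD.
Qed.

Section Family.
Variables (u : I -> V -> R) (du : I -> I -> V -> R).
Hypothesis uC : forall i, C1 (u i) (du i).

Let step (e : R) (k : I) : V := e *: ei k.

Lemma dwedge_cvg (r : seq I) (c : seq I -> R) (x : V) (y : nat -> V) (e : nat -> R) :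
  y @ \oo --> x -> (forall m, 0 < e m) -> e @ \oo --> 0 ->
  (fun m => (e m) ^- size r * dwedge (step (e m)) c (map u r) (y m)) @ \oo -->
  wedge c [seq (fun k => du i k x) | i <- r].
Proof.
move=> + e0 ec; elim: r c y => [|i r IH] c y yx /=.
  by under eq_fun do rewrite expr0 invr1 mul1r; exact: cvg_cst.
rewrite (_ : (fun m => _) = fun m => \sum_k
    ((e m)^-1 * (u i (y m + step (e m) k) - u i (y m))) *
    ((e m) ^- size r * dwedge (step (e m)) (fun s => c (k :: s)) (map u r) (y m + step (e m) k))); last first.
  apply/funext => m; rewrite mulr_sumr; apply: eq_bigr => k _.
  by rewrite exprS invfM; ring.
apply: cvg_sumR => k; apply: cvgM; first exact: C1_diffq.
apply: IH; rewrite -[X in _ --> X]addr0; apply: cvgD => //.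
rewrite -[X in _ --> X](scale0r (ei k)); apply: cvgZr_tmp => //.
Qed.

Lemma continuous_bounded (f : V -> R) C : continuous f ->
  exists D, forall x, `|x| <= C -> `|f x| <= D.
Proof.
move=> cf; have [C0|C0] := ltP C 0.
  by exists 0 => x /le_lt_trans /(_ C0); rewrite ltNge normr_ge0.
have cK : compact [set x : V | `|x| <= C].
  apply: bounded_closed_compact.
    by exists C; split; [exact: num_real|move=> y Cy x /= xC; exact: le_trans xC (ltW Cy)].
  apply: (@closed_comp _ _ (fun x : V => `|x|) [set t | t <= C]); last exact: closed_le.
  by move=> x _; exact: norm_continuous.
have K0 : [set x : V | `|x| <= C] !=set0 by exists 0; rewrite /= normr0.
have cn : {within [set x : V | `|x| <= C], continuous (fun x => `|f x|)}.
  by apply: continuous_subspaceT => x; apply: (continuous_comp (cf x)); exact: norm_continuous.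
have [x xK xP] := EVT_max_rV K0 cK cn.
by exists `|f x| => y yC; apply: xP; rewrite inE.
Qed.

Lemma dwedge_bounded (r : seq I) (c : seq I -> R) C :
  exists B, forall e x, 0 < e <= 1 -> `|x| <= C ->
    `|e ^- size r * dwedge (step e) c (map u r) x| <= B.
Proof.
elim: r c C => [|i r IH] c C.
  by exists `|c [::]| => e x _ _; rewrite /= expr0 invr1 mul1r.
have /choice[B BP] : forall k, exists B, forall e x, 0 < e <= 1 -> `|x| <= C + 1 ->
    `|e ^- size r * dwedge (step e) (fun s => c (k :: s)) (map u r) x| <= B.
  by move=> k; exact: IH.
have /choice[D DP] : forall k, exists D, forall x, `|x| <= C + 1 -> `|du i k x| <= D.
  by move=> k; apply: continuous_bounded; have [_ + _] := uC i; exact.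
exists (\sum_k `|D k| * `|B k|) => e x e01 xC.
have /andP[e0 e1] := e01.
have -> : e ^- size (i :: r) * dwedge (step e) c [seq u i | i <- i :: r] x = \sum_k
    (e^-1 * (u i (x + step e k) - u i x)) *
    (e ^- size r * dwedge (step e) (fun s => c (k :: s)) (map u r) (x + step e k)).
  rewrite /= mulr_sumr; apply: eq_bigr => k _.
  by rewrite exprS invfM; ring.
rewrite (le_trans (ler_norm_sum _ _ _))//; apply: ler_sum => k _.
have sk : `|step e k| <= e by rewrite (le_trans (norm_ei _ _))// gtr0_norm.
rewrite normrM ler_pM//.
  have [_ _ /(_ _ k) du'] := uC i.
  have [b be ->] := line_mvt e (fun s => du' (x + s *: ei k)).
  rewrite mulrC mulfK ?gt_eqF// (le_trans (DP k _ _)) ?ler_norm//.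
  rewrite (le_trans (ler_normD _ _))// lerD// (le_trans (norm_ei _ _))//.
  by rewrite (le_trans be)// gtr0_norm.
rewrite (le_trans (BP k _ _ e01 _)) ?ler_norm//.
by rewrite (le_trans (ler_normD _ _))// lerD// (le_trans sk).
Qed.

Lemma dwedge_mfun (h : I -> V) (r : seq I) (c : seq I -> R) :
  mfun (dwedge h c (map u r)).
Proof.
have mu i : mfun (u i) by have [+ _ _] := uC i; exact: continuous_mfun.
elim: r c => [|i r IH] c; first exact: mfun_cst.
apply: mfun_sum => k; apply: mfunM; last exact: mfun_translate.
by apply: mfunB => //; exact: mfun_translate.
Qed.

(** At every step size the discrete wedge telescopes and has integral 0; it converges boundedly to
    the continuous one. Every telescoped term carries the factor [u i0], so the bounded support of
    this one function makes all of them integrable. *)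
Lemma Int_wedge0 i0 (r : seq I) (c : seq I -> R) C : alternating c ->
  (forall x, C < `|x| -> u i0 x = 0) ->
  bbm (fun x => wedge c [seq (fun k => du i k x) | i <- i0 :: r]) /\
  Int (fun x => wedge c [seq (fun k => du i k x) | i <- i0 :: r]) = 0.
Proof.
move=> ac su.
pose e (m : nat) : R := m.+1%:R^-1.
have e0 m : 0 < e m by rewrite invr_gt0.
have e1 m : e m <= 1 by rewrite invf_le1// ler1n.
have ec : e @ \oo --> 0 by exact: cvg_harmonic.
pose f_ m x := (e m) ^- (size r).+1 * dwedge (step (e m)) c (map u (i0 :: r)) x.
have sh m k : `|step (e m) k| <= 1 by rewrite (le_trans (norm_ei _ _))// gtr0_norm.
have fs m x : C + 1 < `|x| -> f_ m x = 0.
  move=> xC; rewrite /f_ /= big1 ?mulr0// => k _; rewrite !su ?subrr ?mul0r//; first by lra.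
  have := ler_normB (x + step (e m) k) (step (e m) k); rewrite addrK.
  by have := sh m k; move: xC; lra.
have [B BP] := dwedge_bounded (i0 :: r) c (C + 1).
have fb m : bbd (Num.max `|B| `|C + 1|) (f_ m).
  split=> x; last by rewrite gt_max => /andP[_ h]; apply: fs; rewrite (le_lt_trans (ler_norm _)).
  have [xC|/fs ->] := leP `|x| (C + 1); last by rewrite normr0 le_max normr_ge0.
  by rewrite (le_trans (BP (e m) x _ xC)) ?e0 ?e1// (le_trans (ler_norm _))// le_max lexx.
have mf m : mfun (f_ m) by apply: mfunM; [exact: mfun_cst|exact: dwedge_mfun].
have fl x : f_ ^~ x @ \oo --> wedge c [seq (fun k => du i k x) | i <- i0 :: r].
  by apply: (@dwedge_cvg (i0 :: r) c x (fun=> x)) => //; exact: cvg_cst.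
have [blim cv] := Int_dct mf fb fl.
split => //; apply: (cvg_unique (@Rhausdorff R) cv).
rewrite (_ : (fun m => Int (f_ m)) = fun=> 0); first exact: cvg_cst.
apply/funext => m; rewrite /f_.
have bu : bbm (u i0).
  have [cu _ _] := uC i0; have [D DP] := continuous_bounded C cu.
  split; first exact: continuous_mfun.
  exists (Num.max `|D| `|C|); split=> x.
    have [xC|/su ->] := leP `|x| C; last by rewrite normr0 le_max normr_ge0.
    by rewrite (le_trans (DP _ xC))// (le_trans (ler_norm _))// le_max lexx.
  by rewrite gt_max => /andP[_ h]; apply: su; rewrite (le_lt_trans (ler_norm _)).
pose G k x := u i0 x * dwedge (step (e m)) (fun s => c (k :: s)) (map u r) x.
have bG k : bbm (G k).
  rewrite (_ : G k = fun x => dwedge (step (e m)) (fun s => c (k :: s)) (map u r) x * u i0 x); last first.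
    by apply/funext => x; rewrite mulrC.
  apply: bbmMl bu; first exact: dwedge_mfun.
  move=> D; have [B' BP'] := dwedge_bounded r (fun s => c (k :: s)) D.
  exists (e m ^+ size r * B') => x xD; have := BP' (e m) x _ xD.
  rewrite e0 e1 => /(_ isT); rewrite normrM normfV (gtr0_norm (exprn_gt0 _ _))// ler_pdivrMl//.
  by rewrite exprn_gt0.
have bGs k : bbm (fun x => G k (x + step (e m) k)) by exact: bbm_translate.
rewrite IntZ; last first.
  rewrite (_ : dwedge _ _ _ = fun x => \sum_k (G k (x + step (e m) k) - G k x)).
    by apply: bbm_sum => k; exact: bbmB.
  by apply/funext => x; rewrite [map _ _]/= dwedge_telescope.
rewrite (_ : Int _ = Int (fun x => \sum_k (G k (x + step (e m) k) - G k x))); last first.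
  by apply: eq_Int => x; rewrite [map _ _]/= dwedge_telescope.
rewrite Int_sum => [|k]; last exact: bbmB.
by rewrite big1 ?mulr0// => k _; rewrite IntB// Int_translate// subrr.
Qed.

End Family.

Lemma Int_det0 (u : I -> V -> R) (du : I -> I -> V -> R) (i0 : I) C :
  (forall i, C1 (u i) (du i)) -> (forall x, C < `|x| -> u i0 x = 0) ->
  bbm (fun x => \det (\matrix_(i, j) du i j x)) /\
  Int (fun x => \det (\matrix_(i, j) du i j x)) = 0.
Proof.
(* Exchanging rows 0 and [i0] puts the function of bounded support first, at the cost of a sign. *)
move=> uC su; pose s := tperm ord0 i0.
pose u' i := u (s i); pose du' i := du (s i).
have e0 : enum I = ord0 :: [seq lift ord0 j | j <- enum 'I_n] by rewrite enum_ordSl.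
have := @Int_wedge0 u' du' (fun i => uC (s i)) ord0 [seq lift ord0 j | j <- enum 'I_n] lc C lc_alternating.
rewrite /u' /s tpermL => /(_ su); rewrite -e0.
under eq_fun do rewrite (wedge_det (fun i k => du' i k _)).
have [i00|i0n] := eqVneq ord0 i0.
  have du'E i : du' i = du i by rewrite /du' /s -i00 tperm1 perm1.
  suff -> : (fun x => \det (\matrix_(i, j) du' i j x)) = fun x => \det (\matrix_(i, j) du i j x) by [].
  by apply/funext => x; congr (\det _); apply/matrixP => i j; rewrite !mxE du'E.
have -> : (fun x => \det (\matrix_(i, j) du i j x)) = fun x => -1 * \det (\matrix_(i, j) du' i j x).
  apply/funext => x; rewrite mulN1r -(det_row_swap _ i0n); congr (\det _).
  by apply/matrixP => i j; rewrite !mxE /du' /s tpermK.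
by move=> [b e]; split; [exact: bbmZ|rewrite IntZ// e mulr0].
Qed.

End NullLagrangian.

(** * Calculus of C^1 functions through partial derivatives *)

Section C1Calculus.
Variables (R : realType) (n : nat).
Notation V := 'rV[R]_n.+1.
Notation I := 'I_n.+1.
Notation ei k := (delta_mx ord0 k : V).
Implicit Types (U : set V) (u : V -> R) (du : I -> V -> R).

(** The partial derivatives are part of the data, so that derivatives of compound functions are
    carried along as formulas. Continuity and the chain rule are recovered from [multi_mvt]. *)
Definition C1on U u du := forall x, U x ->
  (forall k, is_derive x (ei k) u (du k x)) /\ (forall k, du k y @[y --> x] --> du k x).

Lemma near_all (T : Type) (F : set_system T) {FF : Filter F} (P : I -> T -> Prop) :
  (forall i, \forall t \near F, P i t) -> \forall t \near F, forall i, P i t.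
Proof. by move=> h; apply: filter_forall. Qed.

Lemma cvg_row (T : Type) (F : set_system T) {FF : Filter F} (f : T -> V) (y : V) :
  (forall i, f t ord0 i @[t --> F] --> y ord0 i) -> f @ F --> y.
Proof.
move=> fy; apply/cvgrPdist_lt => d d0.
have : \forall s \near F, forall i, `|f s ord0 i - y ord0 i| < d.
  apply: (@near_all _ F) => i.
  by move/cvgrPdist_lt : (fy i) => /(_ d d0); apply: filterS => s; rewrite distrC.
apply: filterS => s sd; rewrite distrC.
have [i _ iP] := @arg_maxP _ _ _ ord0 xpredT (fun i => `|f s ord0 i - y ord0 i|) isT.
by apply: le_lt_trans (sd i); apply: norm_le_coord => j; rewrite !mxE; exact: iP.
Qed.

Lemma line_mvt_loc (f df : V -> R) (x v : V) (t : R) :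
  (forall s, `|s| <= `|t| -> is_derive (x + s *: v) v f (df (x + s *: v))) ->
  exists2 c, `|c| <= `|t| & f (x + t *: v) - f x = df (x + c *: v) * t.
Proof.
move=> fd; pose g s := f (x + s *: v).
have gd (s : R) : `|s| <= `|t| -> is_derive s (1 : R) g (df (x + s *: v)).
  by move=> st; apply: is_derive_line; exact: fd.
have g0 : g 0 = f x by rewrite /g scale0r addr0.
have [t0|t0] := leP 0 t.
  have it s : 0 <= s <= t -> `|s| <= `|t|.
    by move=> /andP[s0 st]; rewrite !ger0_norm.
  have cg : {within `[0, t], continuous g}.
    apply: derivable_within_continuous => s; rewrite in_itv/= => /it st.
    by case: (gd s st).
  have gd' (s : R) : s \in `]0, t[ -> is_derive s (1 : R) g (df (x + s *: v)).
    by rewrite in_itv/= => /andP[? ?]; apply/gd/it; rewrite !ltW.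
  have [c + e] := MVT_segment t0 gd' cg.
  rewrite in_itv/= => ct; exists c; first exact: it.
  by rewrite -/(g t) -g0 e subr0.
have it s : t <= s <= 0 -> `|s| <= `|t|.
  by move=> /andP[ts s0]; rewrite !ler0_norm ?lerN2// ltW.
have cg : {within `[t, 0], continuous g}.
  apply: derivable_within_continuous => s; rewrite in_itv/= => /it st.
  by case: (gd s st).
have gd' (s : R) : s \in `]t, 0[ -> is_derive s (1 : R) g (df (x + s *: v)).
  by rewrite in_itv/= => /andP[? ?]; apply/gd/it; rewrite !ltW.
have [c + e] := MVT_segment (ltW t0) gd' cg.
rewrite in_itv/= => ct; exists c; first exact: it.
by rewrite -/(g t) -g0 -[LHS]opprB e sub0r mulrN opprK.
Qed.

Lemma multi_mvt u du (y w : V) :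
  (forall z, `|z - y| <= `|w| -> forall k, is_derive z (ei k) u (du k z)) ->
  exists xi : I -> V, (forall k, `|xi k - y| <= `|w|) /\
    u (y + w) - u y = \sum_k w ord0 k * du k (xi k).
Proof.
move=> ud.
pose p (m : nat) : V := \row_i (y ord0 i + (if (i < m)%N then w ord0 i else 0)).
have pS (k : I) : p k.+1 = p k + w ord0 k *: ei k.
  apply/rowP => i; rewrite !mxE eqxx/= ltnS leq_eqVlt.
  have [->|ik] := eqVneq i k; first by rewrite eqxx ltnn addr0 mulr1.
  by rewrite mulr0 addr0 -[(_ == _ :> nat)]/(i == k) (negbTE ik).
have close (k : I) (s : R) : `|s| <= `|w ord0 k| -> `|p k + s *: ei k - y| <= `|w|.
  move=> sk; apply: norm_le_coord => i; rewrite !mxE eqxx/=.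
  have [->|ik] := eqVneq i k.
    rewrite ltnn addr0 mulr1 addrC addKr (le_trans sk)//; exact: coord_le_norm.
  rewrite mulr0 addr0 addrC addKr; case: ifP => _; first exact: coord_le_norm.
  by rewrite normr0.
have /choice[c cP] : forall k : I, exists c, `|c| <= `|w ord0 k| /\
    u (p k.+1) - u (p k) = w ord0 k * du k (p k + c *: ei k).
  move=> k; rewrite pS; have [|c ck ->] := @line_mvt_loc u (du k) (p k) (ei k) (w ord0 k).
    by move=> s sk; apply: ud; exact: close.
  by exists c; split => //; rewrite mulrC.
exists (fun k : I => p k + c k *: ei k); split; first by move=> k; apply: close; exact: (cP k).1.
have -> : y + w = p n.+1 by apply/rowP => i; rewrite !mxE ltn_ord.
have {1}-> : y = p 0%N by apply/rowP => i; rewrite !mxE ltn0 addr0.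
rewrite -(telescope_sumr (fun m => u (p m)))// big_mkord.
by apply: eq_bigr => k _; exact: (cP k).2.
Qed.

Lemma C1on_mvt U u du (y : V) : open U -> C1on U u du -> U y ->
  exists2 e : R, 0 < e & forall w : V, `|w| < e -> exists xi : I -> V,
    (forall k, `|xi k - y| <= `|w|) /\ u (y + w) - u y = \sum_k w ord0 k * du k (xi k).
Proof.
move=> oU uC Uy; have /nbhs_ballP[e /= e0 eU] := open_nbhs_nbhs (conj oU Uy).
exists e => // w we; apply: multi_mvt => z zy k; have Uz : U z.
  by apply: eU; rewrite -ball_normE /= distrC (le_lt_trans zy).
by have [+ _] := uC z Uz; exact.
Qed.

Lemma cvg_dist0 (T : Type) (F : set_system T) {FF : Filter F} (f : T -> V) (g : T -> R) (y : V) :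
  (\forall t \near F, `|f t - y| <= g t) -> g @ F --> 0 -> f @ F --> y.
Proof.
move=> fg g0; apply/cvgrPdist_lt => d d0.
move/cvgr0Pnorm_lt : g0 => /(_ d d0) gd.
near=> t; rewrite distrC (@le_lt_trans _ _ (g t))//; first by near: t.
by rewrite (le_lt_trans (ler_norm _))//; near: t.
Unshelve. all: by end_near. Qed.

Lemma C1on_chain U u du (g : R -> V) (dg : I -> R) (t : R) :
  open U -> C1on U u du -> U (g t) ->
  (forall i, is_derive t (1 : R) (fun s => g s ord0 i) (dg i)) ->
  is_derive t (1 : R) (u \o g) (\sum_i du i (g t) * dg i).
Proof.
move=> oU uC Ug gd.
have [e e0 eP] := C1on_mvt oU uC Ug.
have cg : g @ t --> g t.
  apply: cvg_row => i.
  by apply: differentiable_continuous; apply/derivable1_diffP; case: (gd i).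
have /choice[xi xiP] : forall h : R, exists xi : I -> V, `|g (h + t) - g t| < e ->
    (forall k, `|xi k - g t| <= `|g (h + t) - g t|) /\
    u (g (h + t)) - u (g t) = \sum_k (g (h + t) - g t) ord0 k * du k (xi k).
  move=> h; have [he|he] := pselect (`|g (h + t) - g t| < e); last by exists (fun=> 0).
  have [xi [x1 x2]] := eP _ he; exists xi => _; split=> //.
  by rewrite -x2 [g t + _]addrC subrK.
have ch : (fun h : R => h + t) @ 0^' --> t.
  rewrite -[X in _ --> X]add0r; apply: cvgD; last exact: cvg_cst.
  exact: cvg_within.
have cgh : (fun h => `|g (h + t) - g t|) @ 0^' --> 0.
  rewrite -[X in _ --> X](normr0 V) -[X in `|X|](subrr (g t)).
  apply: cvg_norm; apply: cvgB; last exact: cvg_cst.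
  exact: (cvg_comp _ _ ch cg).
have ne : \forall h \near 0^', `|g (h + t) - g t| < e.
  move/cvgr0Pnorm_lt : cgh => /(_ e e0); apply: filterS => h; by rewrite normr_id.
have key : (fun h : R => h^-1 *: ((u \o g) (h *: (1 : R) + t) - (u \o g) t)) @ 0^' -->
    \sum_i du i (g t) * dg i.
  apply: (@cvg_trans _ (\sum_k du k (xi h k) * (h^-1 *: (g (h *: (1 : R) + t) ord0 k - g t ord0 k)) @[h --> 0^'])).
    apply: near_eq_cvg; apply: filterS ne => h he.
    have [_ e2] := xiP h he.
    rewrite /= [h *: 1]mulr1 e2 scaler_sumr; apply: eq_bigr => k _.
    by rewrite !mxE /GRing.scale/=; ring.
  apply: cvg_sumR => k; apply: cvgM.
    apply: (@cvg_comp _ _ _ (fun h => xi h k)); last by have [_] := uC _ Ug; exact.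
    apply: cvg_dist0 cgh; apply: filterS ne => h he; exact: (xiP h he).1.
  by have [+ <-] := gd k; exact.
split; first by apply/cvg_ex; eexists; exact: key.
by apply/cvg_lim => //; exact: key.
Qed.

Lemma C1on_cont U u du x : open U -> C1on U u du -> U x -> u y @[y --> x] --> u x.
Proof.
move=> oU uC Ux; have [e e0 eP] := C1on_mvt oU uC Ux.
suff h (d : R) : 0 < d -> \forall y \near x, `|u x - u y| < d.
  by apply/(@cvgrPdist_lt _ _ _ (nbhs x)).
move=> d0.
pose M := \sum_k (`|du k x| + 1).
have M0 : 0 <= M by apply: sumr_ge0 => k _; rewrite addr_ge0.
have : \forall y \near x, forall k, `|du k y| < `|du k x| + 1.
  apply: (@near_all _ (nbhs x)) => k.
  have ck : du k y @[y --> x] --> du k x by have [_ ckk] := uC x Ux; exact: ckk.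
  have cn : `|du k y| @[y --> x] --> `|du k x| by exact: cvg_norm ck.
  by apply: (cvgr_lt _ cn); lra.
move=> /nbhs_ballP[e' /= e'0 e'P].
pose r := Num.min e (Num.min e' (d / (M + 1))).
have M1 : 0 < M + 1 by lra.
have r0 : 0 < r by rewrite !lt_min e0 e'0 divr_gt0.
apply/nbhs_ballP; exists r => //= y; rewrite -ball_normE /= distrC => yr.
have re : r <= e by rewrite ge_min lexx.
have [xi [x1 x2]] := eP (y - x) (lt_le_trans yr re).
rewrite distrC; have -> : u y - u x = u (x + (y - x)) - u x by rewrite [x + _]addrC subrK.
rewrite x2.
have ryx : r <= e' by rewrite !ge_min lexx orbT.
rewrite (le_lt_trans (ler_norm_sum _ _ _))// (@le_lt_trans _ _ (`|y - x| * M))//.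
  rewrite mulr_sumr; apply: ler_sum => k _; rewrite normrM ler_pM ?coord_le_norm//.
  by apply/ltW/e'P; rewrite -ball_normE /= distrC (le_lt_trans (x1 k))// (lt_le_trans yr).
rewrite (@le_lt_trans _ _ (`|y - x| * (M + 1)))// ?ler_wpM2l//; first by lra.
rewrite -ltr_pdivlMr//; apply: lt_le_trans yr _.
by rewrite !ge_min lexx !orbT.
Qed.

Lemma C1onS U U' u du : U' `<=` U -> C1on U u du -> C1on U' u du.
Proof. by move=> UU uC x /UU; exact: uC. Qed.

Lemma C1on_cst U (c : R) : C1on U (fun=> c) (fun _ _ => 0).
Proof. by move=> x _; split=> k; [exact: is_derive_cst|exact: (@cst_continuous _ _ (0 : R) x)]. Qed.

Lemma is_derive_coord (x v : V) i : is_derive x v (fun y : V => y ord0 i) (v ord0 i).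
Proof.
apply: is_derive_line0; have -> : (fun s : R => (x + s *: v) ord0 i) =
    cst (x ord0 i) + (v ord0 i) \*: id by apply/funext => s; rewrite /= !mxE mulrC.
by apply: is_derive_eq; rewrite add0r [_ *: 1]mulr1.
Qed.

Lemma C1on_coord U i : C1on U (fun x => x ord0 i) (fun k _ => (k == i)%:R).
Proof.
move=> x _; split=> k; last exact: (@cst_continuous _ _ ((k == i)%:R : R) x).
by apply: is_derive_eq; [exact: is_derive_coord|rewrite mxE eqxx eq_sym].
Qed.

Lemma C1onD U u w du dw : C1on U u du -> C1on U w dw ->
  C1on U (fun x => u x + w x) (fun k x => du k x + dw k x).
Proof.
move=> uC wC x Ux; have [u1 u2] := uC x Ux; have [w1 w2] := wC x Ux.
by split=> k; [exact: is_deriveD|exact: (cvgD (u2 k) (w2 k))].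
Qed.

Lemma C1onB U u w du dw : C1on U u du -> C1on U w dw ->
  C1on U (fun x => u x - w x) (fun k x => du k x - dw k x).
Proof.
move=> uC wC x Ux; have [u1 u2] := uC x Ux; have [w1 w2] := wC x Ux.
by split=> k; [exact: is_deriveB|exact: (cvgB (u2 k) (w2 k))].
Qed.

Lemma C1onM U u w du dw : open U -> C1on U u du -> C1on U w dw ->
  C1on U (fun x => u x * w x) (fun k x => u x * dw k x + w x * du k x).
Proof.
move=> oU uC wC x Ux; have [u1 u2] := uC x Ux; have [w1 w2] := wC x Ux.
have cu := C1on_cont oU uC Ux; have cw := C1on_cont oU wC Ux.
split=> k; first exact: is_deriveM.
exact: (cvgD (cvgM cu (w2 k)) (cvgM cw (u2 k))).
Qed.

Lemma C1onZ U (c : R) u du : C1on U u du -> C1on U (fun x => c * u x) (fun k x => c * du k x).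
Proof.
move=> uC x Ux; have [u1 u2] := uC x Ux.
by split=> k; [exact: is_deriveZ|exact: (cvgM (@cst_continuous _ _ c x) (u2 k))].
Qed.

Lemma C1on_ext U u w du dw : (forall x, u x = w x) ->
  (forall k x, du k x = dw k x) -> C1on U u du -> C1on U w dw.
Proof. by move=> /funext <- h; have -> : dw = du by do 2 apply/funext => ?. Qed.

Lemma C1on_local U u w du dw : open U -> (forall x, U x -> u x = w x) ->
  (forall k x, U x -> du k x = dw k x) -> C1on U u du -> C1on U w dw.
Proof.
move=> oU uw duw uC x Ux; have [u1 u2] := uC x Ux.
have nU : \forall y \near x, U y by apply: open_nbhs_nbhs.
split=> k.
  rewrite -duw//; apply: near_eq_is_derive (u1 k).
  by apply: filterS nU => y Uy; rewrite uw.
have e : \forall y \near x, du k y = dw k y by apply: filterS nU => y Uy; rewrite duw.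
have := u2 k; rewrite duw//; apply: cvg_trans; exact: near_eq_cvg e.
Qed.

Lemma C1on_sum U (J : Type) (r : seq J) (u : J -> V -> R) (du : J -> I -> V -> R) :
  (forall j, C1on U (u j) (du j)) ->
  C1on U (fun x => \sum_(j <- r) u j x) (fun k x => \sum_(j <- r) du j k x).
Proof.
move=> uC; elim: r => [|j r IH].
  by apply: (C1on_ext _ _ (@C1on_cst U 0)) => [x|k x]; rewrite big_nil.
by apply: (C1on_ext _ _ (C1onD (uC j) IH)) => [x|k x]; rewrite big_cons.
Qed.

Lemma C1on_comp1 U u du (f df : R -> R) : open U -> C1on U u du ->
  (forall x, U x -> is_derive (u x) (1 : R) f (df (u x)) /\ df y @[y --> u x] --> df (u x)) ->
  C1on U (f \o u) (fun k x => df (u x) * du k x).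
Proof.
move=> oU uC fC x Ux; have [u1 u2] := uC x Ux; have [f1 f2] := fC x Ux.
have cu := C1on_cont oU uC Ux.
split=> k; last first.
  exact: (cvgM (cvg_comp _ _ cu f2) (u2 k)).
apply: is_derive_line0.
have d0 : is_derive (0 : R) (1 : R) (fun s : R => u (x + s *: ei k)) (du k x).
  by apply: is_derive_line; rewrite scale0r addr0.
have f1' : is_derive ((fun s : R => u (x + s *: ei k)) 0) (1 : R) f (df (u x)).
  by rewrite scale0r addr0.
exact: (@is_derive1_comp _ f (fun s : R => u (x + s *: ei k)) 0 _ _ f1' d0).
Qed.

Lemma C1on_compV U U' u du (T : I -> V -> R) (dT : I -> I -> V -> R) :
  open U -> open U' -> C1on U u du -> (forall i, C1on U' (T i) (dT i)) ->
  (forall x, U' x -> U (\row_i T i x)) ->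
  C1on U' (fun x => u (\row_i T i x)) (fun k x => \sum_i du i (\row_i T i x) * dT i k x).
Proof.
move=> oU oU' uC TC UT x Ux.
have cT : (fun y => (\row_i T i y : V)) @ x --> (\row_i T i x : V).
  apply: (@cvg_row _ (nbhs x)) => i; rewrite mxE; under eq_fun do rewrite mxE.
  exact: (C1on_cont oU' (TC i) Ux).
split=> k; last first.
  apply: (@cvg_sumR _ _ _ (nbhs x)) => i.
  have [_ /(_ k) h1] := TC i x Ux; have [_ /(_ i) h2] := uC _ (UT x Ux).
  exact: (cvgM (cvg_comp _ _ cT h2) h1).
apply: is_derive_line0.
have := @C1on_chain U u du (fun s : R => \row_i T i (x + s *: ei k)) (fun i => dT i k x) 0 oU uC.
rewrite scale0r addr0; apply; first exact: UT.
move=> i; under eq_fun do rewrite mxE.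
apply: is_derive_line; rewrite scale0r addr0; by have [+ _] := TC i x Ux; exact.
Qed.

Lemma C1onT_C1 u du : C1on setT u du -> C1 u du.
Proof.
move=> uC; split=> [x|k x|x k].
- exact: (C1on_cont openT uC).
- by have [_] := uC x Logic.I; exact.
- by have [+ _] := uC x Logic.I; exact.
Qed.

End C1Calculus.

(** * C^1 cutoffs on the line *)

Section Bump.
Variable R : realType.

(** The squared positive part is a simple C^1 function vanishing on a half-line; the cutoffs below
    are composed from it. *)
Definition pp (t : R) : R := Num.max 0 t ^+ 2.
Definition dpp (t : R) : R := 2 * Num.max 0 t.

Lemma dpp_cont : continuous dpp.
Proof.
move=> t; apply: cvgM; first exact: cvg_cst.
by apply: (@continuous_max _ _ (cst 0) id); [exact: cst_continuous|exact: id].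
Qed.

Lemma pp_derive (t : R) : is_derive t (1 : R) pp (dpp t).
Proof.
have key : (fun h : R => h^-1 *: ((pp \o shift t) (h *: (1 : R)) - pp t)) @ 0^' --> dpp t.
  apply/cvgrPdist_le => e e0; near=> h.
  have h0 : h != 0 by near: h; exact: nbhs_dnbhs_neq.
  have he : `|h| <= e by near: h; apply: cvg_within; apply: (@nbhs0_le _ R).
  rewrite /= [h *: 1]mulr1 /GRing.scale/= -(ler_pM2l (_ : 0 < `|h|)) ?normr_gt0//.
  rewrite -normrM mulrBr mulVKf// /pp /dpp.
  apply: (@le_trans _ _ (`|h| ^+ 2)); last by rewrite expr2 ler_wpM2l.
  rewrite real_normK ?num_real//.
  case: (lerP 0 t) => t0; case: (lerP 0 (h + t)) => ht; rewrite ler_norml; apply/andP; split; nra.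
split; first by apply/cvg_ex; eexists; exact: key.
by apply/cvg_lim => //; exact: key.
Unshelve. all: by end_near. Qed.

Lemma pp_ge0 t : 0 <= pp t. Proof. exact: sqr_ge0. Qed.
Lemma pp0 t : t <= 0 -> pp t = 0.
Proof. by move=> t0; rewrite /pp max_l// expr0n. Qed.
Lemma pp_pos t : 0 <= t -> pp t = t ^+ 2.
Proof. by move=> t0; rewrite /pp max_r. Qed.
Lemma dpp0 t : t <= 0 -> dpp t = 0.
Proof. by move=> t0; rewrite /dpp max_l// mulr0. Qed.
Lemma dpp_pos t : 0 <= t -> dpp t = 2 * t.
Proof. by move=> t0; rewrite /dpp max_r. Qed.
Lemma pp_nd : {homo pp : s t / s <= t}.
Proof.
move=> s t st; have h r : (Num.max 0 r : R) \is Num.nneg by rewrite nnegrE le_max lexx.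
rewrite /pp (ler_sqr (h s) (h t)).
by rewrite ge_max; apply/andP; split; rewrite le_max ?lexx// st orbT.
Qed.
Lemma pp_cont : continuous pp.
Proof.
by move=> t; apply: differentiable_continuous; apply/derivable1_diffP; case: (pp_derive t).
Qed.

(* a C^1 transition from 0 on (-oo, 1] to 1 on [2, +oo) *)
Definition ramp (t : R) : R := 1 - pp (1 - pp (t - 1)).
Definition dramp (t : R) : R := dpp (1 - pp (t - 1)) * dpp (t - 1).

Lemma ramp_derive (t : R) : is_derive t (1 : R) ramp (dramp t).
Proof.
have d1 : is_derive t (1 : R) (fun s => s - 1) (1 : R).
  by apply: is_derive_eq; rewrite subr0.
have d2 := @is_derive1_comp _ pp (fun s => s - 1) t _ _ (pp_derive _) d1.
have d3 : is_derive t (1 : R) (fun s => 1 - pp (s - 1)) (- dpp (t - 1)).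
  have d := is_deriveB (is_derive_cst (1 : R) t (1 : R)) d2.
  by apply: (is_derive_eq d); rewrite /= sub0r mulr1.
have d4 := @is_derive1_comp _ pp (fun s => 1 - pp (s - 1)) t _ _ (pp_derive _) d3.
have d5 := is_deriveB (is_derive_cst (1 : R) t (1 : R)) d4.
apply: (is_derive_eq d5); rewrite /= sub0r /dramp; ring.
Qed.

Lemma dramp_cont : continuous dramp.
Proof.
move=> t; have c1 : (fun s : R => s - 1) @ t --> t - 1.
  by apply: cvgB; [exact: cvg_id|exact: cvg_cst].
have c2 := cvg_comp _ _ c1 (@pp_cont (t - 1)).
have c3 : (fun s : R => 1 - pp (s - 1)) @ t --> 1 - pp (t - 1).
  by apply: cvgB; [exact: cvg_cst|exact: c2].
exact: cvgM (cvg_comp _ _ c3 (@dpp_cont _)) (cvg_comp _ _ c1 (@dpp_cont _)).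
Qed.

Lemma ramp_le1 t : t <= 1 -> ramp t = 0.
Proof. by move=> t1; rewrite /ramp (@pp0 (t - 1)) ?subr0 ?pp_pos ?expr1n ?subrr//; lra. Qed.
Lemma dramp_le1 t : t <= 1 -> dramp t = 0.
Proof. by move=> t1; rewrite /dramp (@dpp0 (t - 1)) ?mulr0//; lra. Qed.
Lemma ramp_ge2 t : 2 <= t -> ramp t = 1.
Proof. by move=> t1; rewrite /ramp pp0 ?subr0// pp_pos; nra. Qed.
Lemma dramp_ge2 t : 2 <= t -> dramp t = 0.
Proof. by move=> t1; rewrite /dramp dpp0 ?mul0r// pp_pos; nra. Qed.
Lemma ramp01 t : 0 <= ramp t <= 1.
Proof.
rewrite /ramp; have h := pp_ge0 (t - 1); set u := pp _ in h *.
have : pp (1 - u) <= pp 1 by apply: pp_nd; lra.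
rewrite (@pp_pos 1)// expr1n; have := pp_ge0 (1 - u); lra.
Qed.
Lemma dramp_bound t : `|dramp t| <= 4.
Proof.
have [t1|t1] := lerP t 1; first by rewrite dramp_le1// normr0.
have [t2|t2] := lerP 2 t; first by rewrite dramp_ge2// normr0.
rewrite /dramp pp_pos ?(dpp_pos (t := t - 1)) ?dpp_pos; try nra.
have h1 : 0 <= 1 - (t - 1) ^+ 2 <= 1 by apply/andP; split; nra.
case/andP: h1 => h1 h2; rewrite !normrM !ger0_norm//; nra.
Qed.

End Bump.

(** * Jacobian integrals depend only on the behaviour far out *)

Section DetInt.
Variables (R : realType) (n : nat).
Notation V := 'rV[R]_n.+1.
Notation I := 'I_n.+1.

Lemma det_row0 (r : I -> R) :
  \det (\matrix_(i, j) (if i == ord0 then r j else (j == i)%:R)) = r ord0.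
Proof.
rewrite -det_tr det_trig; last first.
  apply/is_trig_mxP => i j ij; rewrite !mxE; case: ifP => [/eqP j0|_].
    by move: ij; rewrite j0.
  by rewrite -val_eqE/= (ltn_eqF ij).
rewrite big_ord_recl !mxE/= big1 ?mulr1// => i _.
by rewrite !mxE eqxx.
Qed.

(** The rows of [du] are exchanged for those of [dv] one at a time. By multilinearity two
    consecutive determinants differ by one whose row [m] is the derivative of [u m - v m], a
    function of bounded support. *)
Lemma Int_det_eq (u v : I -> V -> R) (du dv : I -> I -> V -> R) C :
  (forall i, C1on setT (u i) (du i)) -> (forall i, C1on setT (v i) (dv i)) ->
  (forall i x, C < `|x| -> u i x = v i x) ->
  bbm (fun x => \det (\matrix_(i, j) dv i j x)) ->
  bbm (fun x => \det (\matrix_(i, j) du i j x)) /\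
  Int (fun x => \det (\matrix_(i, j) du i j x)) = Int (fun x => \det (\matrix_(i, j) dv i j x)).
Proof.
move=> uC vC uv bv.
pose D (m : nat) x := \det (\matrix_(i < n.+1, j < n.+1) (if (i < m)%N then dv i j x else du i j x)).
have DS (m : I) : bbm (fun x => D m x - D m.+1 x) /\ Int (fun x => D m x - D m.+1 x) = 0.
  pose w (i : I) x := if (i < m)%N then v i x else if i == m then u i x - v i x else u i x.
  pose dw (i j : I) x := if (i < m)%N then dv i j x else if i == m then du i j x - dv i j x else du i j x.
  have wC i : C1 (w i) (dw i).
    by apply: C1onT_C1; rewrite /w /dw; case: (i < m)%N => //; case: (i == m) => //; exact: C1onB.
  have w0 x : C < `|x| -> w m x = 0 by move=> h; rewrite /w ltnn eqxx uv// subrr.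
  suff -> : (fun x => D m x - D m.+1 x) = (fun x => \det (\matrix_(i, j) dw i j x)).
    exact: Int_det0 wC w0.
  apply/funext => x; apply/eqP; rewrite subr_eq; apply/eqP; rewrite /D.
  rewrite (@determinant_multilinear _ _ _ (\matrix_(i, j) dw i j x)
    (\matrix_(i < n.+1, j < n.+1) (if (i < m.+1)%N then dv i j x else du i j x)) m 1 1).
  - by rewrite !mul1r.
  - by apply/rowP => j; rewrite !mxE ltnn ltnSn /dw ltnn eqxx !mul1r subrK.
  - apply/matrixP => i j; rewrite !mxE /dw; case: ifP => //; case: eqP => // e.
    by have := neq_lift m i; rewrite e eqxx.
  - apply/matrixP => i j; rewrite !mxE ltnS leq_eqVlt.
    by have := neq_lift m i; rewrite eq_sym -val_eqE => /negbTE ->.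
have Dv : D n.+1 = (fun x => \det (\matrix_(i, j) dv i j x)).
  by apply/funext => x; congr (\det _); apply/matrixP => i j; rewrite !mxE ltn_ord.
have Du : D 0%N = (fun x => \det (\matrix_(i, j) du i j x)).
  by apply/funext => x; congr (\det _); apply/matrixP => i j; rewrite !mxE ltn0.
rewrite -Du -Dv; rewrite -Dv in bv.
suff h (k : nat) : (k <= n.+1)%N -> bbm (D (n.+1 - k)%N) /\ Int (D (n.+1 - k)%N) = Int (D n.+1).
  by have := h n.+1 (leqnn _); rewrite subnn.
elim: k => [_|k IH kn]; first by rewrite subn0.
have [b1 e1] := IH (ltnW kn).
have mn : (n.+1 - k.+1 < n.+1)%N by rewrite ltn_subrL.
have [] := DS (Ordinal mn); rewrite /= -subSn// subSS => b2 e2.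
have -> : D (n.+1 - k.+1)%N = (fun x => (D (n.+1 - k.+1)%N x - D (n.+1 - k)%N x) + D (n.+1 - k)%N x).
  by apply/funext => x; rewrite subrK.
by split; [exact: bbmD|rewrite IntD// e2 add0r].
Qed.

(** The integrand is the Jacobian of [(G o S, S_1, ..., S_n)], which far out agrees with
    [(G, x_1, ..., x_n)], whose Jacobian is [dG ord0]. The result is a degree-one change of
    variables formula for densities that are a partial derivative in direction 0. *)
Lemma Int_det_comp (G : V -> R) (dG : I -> V -> R) (S : I -> V -> R) (dS : I -> I -> V -> R) C :
  C1on setT G dG -> (forall i, C1on setT (S i) (dS i)) ->
  (forall i x, C < `|x| -> S i x = x ord0 i) -> bbm (dG ord0) ->
  bbm (fun x => dG ord0 (\row_i S i x) * \det (\matrix_(i, j) dS i j x)) /\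
  Int (fun x => dG ord0 (\row_i S i x) * \det (\matrix_(i, j) dS i j x)) = Int (dG ord0).
Proof.
move=> GC SC Sx bG.
pose u (i : I) x := if i == ord0 then G (\row_i S i x) else S i x.
pose du (i k : I) x := if i == ord0 then \sum_l dG l (\row_i S i x) * dS l k x else dS i k x.
pose v (i : I) (x : V) := if i == ord0 then G x else x ord0 i.
pose dv (i k : I) (x : V) := if i == ord0 then dG k x else (k == i)%:R.
have uC i : C1on setT (u i) (du i).
  by rewrite /u /du; case: (i == ord0) => //; exact: (C1on_compV openT openT GC SC).
have vC i : C1on setT (v i) (dv i).
  by rewrite /v /dv; case: (i == ord0) => //; exact: C1on_coord.
have rid (x : V) : C < `|x| -> \row_i S i x = x.
  by move=> h; apply/rowP => i; rewrite mxE Sx.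
have uv i x : C < `|x| -> u i x = v i x.
  by move=> h; rewrite /u /v rid// Sx.
have dve : (fun x => \det (\matrix_(i, j) dv i j x)) = dG ord0.
  by apply/funext => x; exact: det_row0 (fun j => dG j x).
have due : (fun x => \det (\matrix_(i, j) du i j x)) =
    (fun x => dG ord0 (\row_i S i x) * \det (\matrix_(i, j) dS i j x)).
  apply/funext => x; rewrite -[dG ord0 _](det_row0 (fun j => dG j (\row_i S i x))) -det_mulmx.
  congr (\det _); apply/matrixP => i j; rewrite !mxE /du.
  case: ifP => i0; first by apply: eq_bigr => l _; rewrite !mxE i0.
  rewrite (bigD1 i)//= !mxE i0 eqxx mul1r big1 ?addr0// => l li.
  by rewrite !mxE i0 (negbTE li) mul0r.
by rewrite -due -dve; apply: Int_det_eq uC vC uv _; rewrite dve.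
Qed.

Lemma eq_Int_off0 (f g : V -> R) : bbm f -> bbm g -> (forall x, x != 0 -> f x = g x) -> Int f = Int g.
Proof.
move=> bf bg fg; apply/eqP; rewrite -subr_eq0 -IntB//.
have c0 : bbm (\1_(cube 0) : V -> R) by apply: bbm_indic; [exact: cube_measurable|exists 0].
rewrite (@eq_Int _ _ _ (fun x => (f 0 - g 0) * \1_(cube 0) x)).
  rewrite IntZ// Int_indic; last exact: cube_measurable.
  rewrite (_ : lebesgue_vol _ = 0%E) ?mulr0//; apply/eqP; rewrite eq_le lebesgue_vol_ge0 andbT.
  apply: le_trans (lebesgue_vol_box_le _ _) _.
  by rewrite /boxvol big_ord_recl !mxE oppr0 subrr maxxx mul0r.
move=> x; rewrite indicE; have [->|x0] := eqVneq x 0.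
  by rewrite mem_set ?mulr1//; apply/cubeP; rewrite normr0.
rewrite fg// subrr memNset ?mulr0// => /cubeP; rewrite normr_le0; exact/negP.
Qed.

Lemma bbm_off0 (f g : V -> R) : bbm f -> (forall x, x != 0 -> f x = g x) -> bbm g.
Proof.
move=> bf fg; have c0 : bbm (\1_(cube 0) : V -> R).
  by apply: bbm_indic; [exact: cube_measurable|exists 0].
have -> : g = (fun x => f x + (g 0 - f 0) * \1_(cube 0) x); last exact: bbmD (bbmZ _ c0).
apply/funext => x; rewrite indicE; have [->|x0] := eqVneq x 0.
  by rewrite mem_set ?mulr1 ?[f 0 + _]addrC ?subrK//; apply/cubeP; rewrite normr0.
rewrite fg// memNset ?mulr0 ?addr0// => /cubeP; rewrite normr_le0; exact/negP.
Qed.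

Lemma det_bound (M : 'M[R]_n.+1) C : (forall i j, `|M i j| <= C) -> `|\det M| <= (n.+1)`!%:R * C ^+ n.+1.
Proof.
move=> MC; rewrite /determinant (le_trans (ler_norm_sum _ _ _))//.
apply: (@le_trans _ _ (\sum_(s : 'S_n.+1) C ^+ n.+1)).
  apply: ler_sum => s _; rewrite normrM normrX normrN1 expr1n mul1r normr_prod.
  rewrite -[X in C ^+ X]card_ord -prodr_const; apply: ler_prod => i _.
  by rewrite normr_ge0 MC.
by rewrite sumr_const card_Sn mulr_natl.
Qed.

End DetInt.

(** * C^1 approximations of the indicator of a box *)

Section TestFunctions.
Variables (R : realType) (n : nat).
Notation V := 'rV[R]_n.+1.
Notation I := 'I_n.+1.
Implicit Types (l r t k : R).

(** In coordinate 0 a test function must come with a C^1 antiderivative, which is what [tent]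
    provides. The other coordinates use this C^1 plateau, equal to 1 on [[l, r]] and to 0 beyond
    distance [1 / k]. *)
Definition plat k l r t := ramp (k * (t - l) + 2) * ramp (k * (r - t) + 2).
Definition dplat k l r t := k * dramp (k * (t - l) + 2) * ramp (k * (r - t) + 2)
  - k * ramp (k * (t - l) + 2) * dramp (k * (r - t) + 2).

Lemma ramp_cont : continuous (@ramp R).
Proof. by move=> t; apply: differentiable_continuous; apply/derivable1_diffP; case: (ramp_derive t). Qed.

Lemma affine_derive (a b t : R) : is_derive t (1 : R) (fun s => a * s + b) a.
Proof.
have d := is_deriveD (is_deriveZ (a : R) (is_derive_id t (1 : R))) (is_derive_cst (b : R) t (1 : R)).
by apply: (is_derive_eq d); rewrite /= addr0 /GRing.scale/= mulr1.
Qed.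

Lemma plat_derive k l r t : is_derive t (1 : R) (plat k l r) (dplat k l r t).
Proof.
have e1 : (fun s => k * (s - l) + 2) = (fun s => k * s + (2 - k * l)) by apply/funext => s; ring.
have e2 : (fun s => k * (r - s) + 2) = (fun s => (- k) * s + (2 + k * r)) by apply/funext => s; ring.
have d1 : is_derive t (1 : R) (fun s => k * (s - l) + 2) k by rewrite e1; exact: affine_derive.
have d2 : is_derive t (1 : R) (fun s => k * (r - s) + 2) (- k) by rewrite e2; exact: affine_derive.
have c1 := @is_derive1_comp _ (@ramp R) _ t _ _ (ramp_derive _) d1.
have c2 := @is_derive1_comp _ (@ramp R) _ t _ _ (ramp_derive _) d2.
apply: (is_derive_eq (is_deriveM c1 c2)).
by rewrite /dplat /= /GRing.scale/=; ring.
Qed.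

Lemma dplat_cont k l r : continuous (dplat k l r).
Proof.
move=> t.
have e1 : (fun s => k * (s - l) + 2) @ t --> k * (t - l) + 2.
  apply: cvgD; last exact: cvg_cst.
  by apply: cvgMr; apply: cvgB; [exact: cvg_id|exact: cvg_cst].
have e2 : (fun s => k * (r - s) + 2) @ t --> k * (r - t) + 2.
  apply: cvgD; last exact: cvg_cst.
  by apply: cvgMr; apply: cvgB; [exact: cvg_cst|exact: cvg_id].
apply: (@cvgB _ _ _ (nbhs t)); apply: (@cvgM _ _ (nbhs t)).
- by apply: (@cvgMr _ _ (nbhs t)); exact: (cvg_comp _ _ e1 (@dramp_cont _ _)).
- exact: (cvg_comp _ _ e2 (@ramp_cont _)).
- by apply: (@cvgMr _ _ (nbhs t)); exact: (cvg_comp _ _ e1 (@ramp_cont _)).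
- exact: (cvg_comp _ _ e2 (@dramp_cont _ _)).
Qed.

Lemma plat01 k l r t : 0 <= plat k l r t <= 1.
Proof.
rewrite /plat; have /andP[a1 a2] := ramp01 (k * (t - l) + 2).
have /andP[b1 b2] := ramp01 (k * (r - t) + 2).
by rewrite mulr_ge0//= mulr_ile1.
Qed.
Lemma plat1 k l r t : 0 <= k -> l <= t <= r -> plat k l r t = 1.
Proof.
move=> k0 /andP[lt tr]; rewrite /plat !ramp_ge2 ?mulr1// lerDr mulr_ge0// subr_ge0//.
Qed.
Lemma plat0l k l r t : 1 <= k * (l - t) -> plat k l r t = 0.
Proof. by move=> h; rewrite /plat ramp_le1 ?mul0r//; lra. Qed.
Lemma plat0r k l r t : 1 <= k * (t - r) -> plat k l r t = 0.
Proof. by move=> h; rewrite /plat [X in _ * X]ramp_le1 ?mulr0//; lra. Qed.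

(* [tent k l r] is an explicit antiderivative of the continuous bump [dtent k l r] *)
Definition tent k l r t := (pp (k * (t - l) + 1) - pp (k * (t - l)) - pp (k * (t - r))
  + pp (k * (t - r) - 1)) / (2 * k).
Definition dtent k l r t := (dpp (k * (t - l) + 1) - dpp (k * (t - l)) - dpp (k * (t - r))
  + dpp (k * (t - r) - 1)) / 2.

Lemma tent_derive k l r t : k != 0 -> is_derive t (1 : R) (tent k l r) (dtent k l r t).
Proof.
move=> k0.
have aux (a b : R) : is_derive t (1 : R) (fun s => pp (k * (s - a) + b)) (dpp (k * (t - a) + b) * k).
  have e1 : (fun s => k * (s - a) + b) = (fun s => k * s + (b - k * a)) by apply/funext => s; ring.
  have d1 : is_derive t (1 : R) (fun s => k * (s - a) + b) k by rewrite e1; exact: affine_derive.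
  exact: (@is_derive1_comp _ (@pp R) _ t _ _ (pp_derive _) d1).
have h := is_deriveZ ((2 * k)^-1 : R) (is_deriveD (is_deriveB (is_deriveB (aux l 1) (aux l 0)) (aux r 0)) (aux r (-1))).
have -> : tent k l r = (2 * k)^-1 \*: ((fun s => pp (k * (s - l) + 1)) - (fun s => pp (k * (s - l) + 0))
   - (fun s => pp (k * (s - r) + 0)) + (fun s => pp (k * (s - r) - 1))).
  apply/funext => s; rewrite /tent mulrC; transitivity ((2 * k)^-1 * (pp (k * (s - l) + 1)
    - pp (k * (s - l) + 0) - pp (k * (s - r) + 0) + pp (k * (s - r) - 1))); last by [].
  by rewrite !addr0.
apply: (is_derive_eq h); rewrite /dtent !addr0 /GRing.scale/=; field.
exact: k0.
Qed.

Lemma dtent_cont k l r : continuous (dtent k l r).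
Proof.
move=> t.
have aux (a b : R) : (fun s => dpp (k * (s - a) + b)) @ t --> dpp (k * (t - a) + b).
  have e1 : (fun s => k * (s - a) + b) @ t --> k * (t - a) + b.
    apply: cvgD; last exact: cvg_cst.
    by apply: cvgMr; apply: cvgB; [exact: cvg_id|exact: cvg_cst].
  exact: (cvg_comp _ _ e1 (@dpp_cont _ _)).
have := aux l 1; have := aux l 0; have := aux r 0; have := aux r (-1).
rewrite !addr0; under eq_fun do []; move=> h4 h3 h2 h1.
have h2' : (fun s => dpp (k * (s - l))) @ t --> dpp (k * (t - l)) by move: h2; under eq_fun do rewrite addr0.
have h3' : (fun s => dpp (k * (s - r))) @ t --> dpp (k * (t - r)) by move: h3; under eq_fun do rewrite addr0.
apply: (@cvgMl _ _ (nbhs t)).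
exact: (cvgD (cvgB (cvgB h1 h2') h3') h4).
Qed.

Lemma dtentE k l r t : dtent k l r t = Num.max 0 (k * (t - l) + 1) - Num.max 0 (k * (t - l))
  - Num.max 0 (k * (t - r)) + Num.max 0 (k * (t - r) - 1).
Proof. by rewrite /dtent /dpp; set a := Num.max _ _; set b := Num.max _ _; set c := Num.max _ _; set d := Num.max _ _; lra. Qed.

Lemma dtent01 k l r t : 0 <= k -> l <= r -> 0 <= dtent k l r t <= 1.
Proof.
move=> k0 lr; rewrite dtentE; have h : k * (t - r) <= k * (t - l) by rewrite ler_wpM2l//; lra.
set a := k * (t - l) in h *; set b := k * (t - r) in h *.
by case: (lerP 0 (a + 1)); case: (lerP 0 a); case: (lerP 0 b); case: (lerP 0 (b - 1)); move=> *; apply/andP; split; lra.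
Qed.
Lemma dtent1 k l r t : 0 <= k -> l <= t <= r -> dtent k l r t = 1.
Proof.
move=> k0 /andP[lt tr]; rewrite dtentE; have h : k * (t - r) <= 0 by rewrite mulr_ge0_le0//; lra.
have h' : 0 <= k * (t - l) by rewrite mulr_ge0//; lra.
set a := k * (t - l) in h' *; set b := k * (t - r) in h *.
by rewrite (max_r (y := a + 1)) ?(max_r (y := a)) ?max_l//; lra.
Qed.
Lemma dtent0l k l r t : 0 <= k -> l <= r -> 1 <= k * (l - t) -> dtent k l r t = 0.
Proof.
move=> k0 lr h; rewrite dtentE; have h' : k * (t - r) <= k * (t - l) by rewrite ler_wpM2l//; lra.
have {}h : k * (t - l) <= -1 by lra.
set a := k * (t - l) in h h' *; set b := k * (t - r) in h' *.
by rewrite !max_l//; lra.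
Qed.
Lemma dtent0r k l r t : 0 <= k -> l <= r -> 1 <= k * (t - r) -> dtent k l r t = 0.
Proof.
move=> k0 lr h; rewrite dtentE; have h' : k * (t - r) <= k * (t - l) by rewrite ler_wpM2l//; lra.
set a := k * (t - l) in h' *; set b := k * (t - r) in h' h *.
by rewrite !max_r//; lra.
Qed.

End TestFunctions.

Section BoxTest.
Variables (R : realType) (n : nat).
Notation V := 'rV[R]_n.+1.
Notation I := 'I_n.+1.
Variables (a b : V).
Implicit Types (K : R) (x : V).
Hypothesis ab : forall i, a ord0 i <= b ord0 i.

Lemma C1on_prod (J : Type) (s : seq J) (u : J -> V -> R) (du : J -> I -> V -> R) (i0 : I) :
  (forall j, C1on setT (u j) (du j)) -> (forall j x, du j i0 x = 0) ->
  exists2 dP, C1on setT (fun x => \prod_(j <- s) u j x) dP & forall x, dP i0 x = 0.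
Proof.
move=> uC du0; elim: s => [|j s [dP PC P0]].
  exists (fun _ _ => 0) => //.
  by apply: (C1on_ext _ _ (@C1on_cst R n setT 1)) => [x|k x] //; rewrite big_nil.
exists (fun k x => u j x * dP k x + (\prod_(j <- s) u j x) * du j k x).
  by apply: (C1on_ext _ _ (C1onM openT (uC j) PC)) => [x|k x] //; rewrite big_cons.
by move=> x; rewrite P0 du0 !mulr0 addr0.
Qed.

Lemma C1on_coord1 (f df : R -> R) i : (forall t, is_derive t (1 : R) f (df t)) -> continuous df ->
  C1on setT (fun x : V => f (x ord0 i)) (fun k x => df (x ord0 i) * (k == i)%:R).
Proof.
move=> fd fc; apply: (@C1on_comp1 R n setT _ _ f df openT (@C1on_coord R n setT i)) => x _.
by split; [exact: fd|exact: fc].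
Qed.

Definition boxtest (K : R) (x : V) := dtent K (a ord0 ord0) (b ord0 ord0) (x ord0 ord0) *
  \prod_(j < n) plat K (a ord0 (lift ord0 j)) (b ord0 (lift ord0 j)) (x ord0 (lift ord0 j)).

(** [G] is the product of [tent] in coordinate 0 and the plateaus in the others; this puts [boxtest]
    into the form required by [Int_det_comp]. *)
Lemma boxtestP K : 0 < K -> exists G dG, C1on setT G dG /\ dG ord0 = boxtest K.
Proof.
move=> K0.
have [dP PC P0] := @C1on_prod _ (index_enum 'I_n)
  (fun (j : 'I_n) (x : V) => plat K (a ord0 (lift ord0 j)) (b ord0 (lift ord0 j)) (x ord0 (lift ord0 j)))
  _ ord0 (fun j => C1on_coord1 (lift ord0 j) (@plat_derive _ K _ _) (@dplat_cont _ K _ _))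
  (fun j x => mulr0 _).
have TC := C1on_coord1 (ord0 : I) (fun t => @tent_derive _ K (a ord0 ord0) (b ord0 ord0) t (lt0r_neq0 K0)) (@dtent_cont _ _ _ _).
eexists; eexists; split; first exact: (C1onM openT TC PC).
by apply/funext => x; rewrite P0 mulr0 add0r eqxx mulr1 mulrC.
Qed.

Lemma boxtest_cont K : 0 < K -> continuous (boxtest K).
Proof. by move=> /boxtestP[G [dG [GC <-]]] x; have [_] := GC x Logic.I; exact. Qed.

Lemma boxtest01 K x : 0 <= K -> 0 <= boxtest K x <= 1.
Proof.
move=> K0; have /andP[t0 t1] := @dtent01 _ K _ _ (x ord0 ord0) K0 (ab ord0).
have p0 : forall s : seq 'I_n, 0 <= \prod_(j <- s) plat K (a ord0 (lift ord0 j)) (b ord0 (lift ord0 j)) (x ord0 (lift ord0 j)) <= 1.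
  elim=> [|j s /andP[h1 h2]]; first by rewrite big_nil ler01 lexx.
  rewrite big_cons; have /andP[g1 g2] := plat01 K (a ord0 (lift ord0 j)) (b ord0 (lift ord0 j)) (x ord0 (lift ord0 j)).
  by rewrite mulr_ge0//= mulr_ile1.
have /andP[h1 h2] := p0 (index_enum 'I_n).
by rewrite /boxtest mulr_ge0//= mulr_ile1.
Qed.

Lemma boxtest1 K x : 0 <= K -> box a b x -> boxtest K x = 1.
Proof.
move=> K0 xab; rewrite /boxtest (dtent1 K0 (xab ord0)).
by rewrite big1 ?mulr1// => j _; rewrite (plat1 K0 (xab _)).
Qed.

Lemma boxtest0 K x i : 0 <= K -> 1 <= K * (a ord0 i - x ord0 i) \/ 1 <= K * (x ord0 i - b ord0 i) ->
  boxtest K x = 0.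
Proof.
move=> K0 h; rewrite /boxtest; move: h; have [j ->|->] := unliftP ord0 i => h.
  by rewrite (bigD1 j)//=; case: h => h; rewrite ?(plat0l _ h) ?(plat0r _ h) mul0r mulr0.
by case: h => h; [rewrite (dtent0l K0 (ab _) h) mul0r|rewrite (dtent0r K0 (ab _) h) mul0r].
Qed.

Definition boxrad := `|a| + `|b| + 1.

Lemma box_norm x : box a b x -> `|x| <= boxrad.
Proof.
move=> xab; apply: norm_le_coord => i; have /andP[h1 h2] := xab i.
have := coord_le_norm a i; have := coord_le_norm b i; rewrite /boxrad !ler_norml.
by move=> /andP[? ?] /andP[? ?]; apply/andP; split; lra.
Qed.

Lemma boxtest_supp K x : 1 <= K -> boxrad < `|x| -> boxtest K x = 0.
Proof.
move=> K1 xr; have K0 : 0 <= K by lra.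
have [i xi] : exists i, boxrad < `|x ord0 i|.
  apply: contrapT => h; move: xr; rewrite ltNge => /negP; apply.
  by apply: norm_le_coord => i; rewrite leNgt; apply/negP => hi; apply: h; exists i.
apply: (@boxtest0 K x i) => //.
have := coord_le_norm a i; have := coord_le_norm b i; rewrite !ler_norml => /andP[? ?] /andP[? ?].
have a0 := normr_ge0 a; have b0 := normr_ge0 b; move: xi; rewrite /boxrad.
case: (ger0P (x ord0 i)) => x0 xi; [right|left].
  have h : 1 <= x ord0 i - b ord0 i by lra.
  by rewrite (le_trans h)// ler_peMl//; lra.
have h : 1 <= a ord0 i - x ord0 i by lra.
by rewrite (le_trans h)// ler_peMl//; lra.
Qed.

Lemma boxtest_cvg x : boxtest k.+1%:R x @[k --> \oo] --> (\1_(box a b) x : R).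
Proof.
rewrite indicE; case: (boolP (x \in box a b)) => [|/negP]; rewrite inE => xab.
  have -> : (fun k => boxtest k.+1%:R x) = cst 1 by apply/funext => k; rewrite boxtest1.
  exact: cvg_cst.
have [i [d d0 dP]] : exists i, exists2 d, 0 < d & d <= a ord0 i - x ord0 i \/ d <= x ord0 i - b ord0 i.
  apply: contrapT => h; apply: xab => i; apply/andP; split; rewrite leNgt; apply/negP => hi; apply: h; exists i.
    by exists (a ord0 i - x ord0 i); [lra|left].
  by exists (x ord0 i - b ord0 i); [lra|right].
rewrite (_ : false%:R = 0 :> R)//; apply: cvg_near_cst.
near=> k.
have kd : 1 <= k.+1%:R * d.
  rewrite -ler_pdivrMr// div1r.
  have h : d^-1 <= k%:R by near: k; exact: nbhs_infty_ger.
  by apply: le_trans h _; rewrite ler_nat.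
suff h0 : boxtest k.+1%:R x = 0 by rewrite h0.
apply: (@boxtest0 (k.+1%:R) x i); first exact: ler0n.
by case: dP => h; [left|right]; rewrite (le_trans kd)// ler_wpM2l.
Unshelve. all: by end_near. Qed.

End BoxTest.

(** * Change of variables for maps homotopic to the identity *)

Section ChangeOfVariables.
Variables (R : realType) (n : nat).
Notation V := 'rV[R]_n.+1.
Notation I := 'I_n.+1.

Definition q (x : V) : R := dotp x x.

Lemma qE (x : V) : q x = \sum_i x ord0 i ^+ 2.
Proof. by apply: eq_bigr => i _; rewrite expr2. Qed.
Lemma q_ge0 x : 0 <= q x.
Proof. by rewrite qE sumr_ge0// => i _; exact: sqr_ge0. Qed.
Lemma norm_le_q (x : V) : `|x| ^+ 2 <= q x.
Proof.
have [i _ iP] := @arg_maxP _ _ _ (ord0 : I) xpredT (fun i => `|x ord0 i|) isT.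
have -> : `|x| = `|x ord0 i|.
  by apply/eqP; rewrite eq_le coord_le_norm andbT; apply: norm_le_coord => j; exact: iP.
rewrite real_normK ?num_real// qE (bigD1 i)//= lerDl sumr_ge0// => j _; exact: sqr_ge0.
Qed.
Lemma q_le_norm (x : V) : q x <= n.+1%:R * `|x| ^+ 2.
Proof.
rewrite qE (@le_trans _ _ (\sum_(i < n.+1) `|x| ^+ 2))//; last first.
  by rewrite sumr_const card_ord mulr_natl.
by apply: ler_sum => i _; rewrite -real_normK ?num_real// ler_sqr ?nnegrE// coord_le_norm.
Qed.
Lemma q0 : q 0 = 0. Proof. by rewrite qE big1// => i _; rewrite mxE expr0n. Qed.
Lemma q_gt0 x : x != 0 -> 0 < q x.
Proof. by move=> x0; apply: lt_le_trans (norm_le_q x); rewrite exprn_gt0 ?normr_gt0. Qed.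

Lemma C1on_q U : C1on U q (fun k x => 2 * x ord0 k).
Proof.
apply: (@C1on_ext R n U (fun x => \sum_i x ord0 i * x ord0 i) q
  (fun k x => \sum_i (x ord0 i * (k == i)%:R + x ord0 i * (k == i)%:R))) => //.
  move=> k x; rewrite (bigD1 k)//= big1 ?eqxx ?mulr1 ?addr0; first by ring.
  by move=> i ik; rewrite eq_sym (negbTE ik) !mulr0 addr0.
apply: C1on_sum => i; apply: (C1onS (subsetT _)).
exact: (C1onM openT (@C1on_coord R n setT i) (@C1on_coord R n setT i)).
Qed.

Variables (T : I -> V -> R) (dT : I -> I -> V -> R) (C c : R).
Hypothesis TC : forall i, C1on [set x | x != 0] (T i) (dT i).
Hypothesis Tb : forall i x, `|T i x| <= C * `|x|.
Hypothesis dTb : forall i k x, `|dT i k x| <= C.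
Hypothesis c0 : 0 < c.
(** The straight homotopy from the identity to [T] keeps every point away from the origin in
    proportion to its norm. This plays the role of degree theory: far out, [T] can be replaced by
    the identity without new preimages of a bounded box appearing. *)
Hypothesis seg : forall s x, 0 <= s <= 1 -> c * `|x| <= `|(1 - s) *: x + s *: (\row_i T i x : V)|.

Let J x := \det (\matrix_(i, j) dT i j x).
Let Tv x : V := \row_i T i x.

(** A cutoff that vanishes near the origin and far out: [e] sets the inner radius and will tend to
    infinity, [f] sets the outer radius and stays fixed. [S] interpolates accordingly between the
    identity and [T]. *)
Let chi (e f : R) x := ramp (e * q x) * (1 - ramp (f * q x)).
Let dchi (e f : R) (k : I) (x : V) := ramp (e * q x) * (0 - dramp (f * q x) * (f * (2 * x ord0 k)))
  + (1 - ramp (f * q x)) * (dramp (e * q x) * (e * (2 * x ord0 k))).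
Let S e f i (x : V) := x ord0 i + chi e f x * (T i x - x ord0 i).
Let dS e f (i k : I) (x : V) := (k == i)%:R + (chi e f x * (dT i k x - (k == i)%:R)
  + (T i x - x ord0 i) * dchi e f k x).

Lemma cutoff_C1 e f : C1on setT (chi e f) (dchi e f).
Proof.
have r g : C1on setT (fun x => ramp (g * q x)) (fun k x => dramp (g * q x) * (g * (2 * x ord0 k))).
  apply: (@C1on_comp1 R n setT _ _ (@ramp R) (@dramp R) openT (C1onZ g (@C1on_q setT))) => x _.
  by split; [exact: ramp_derive|exact: dramp_cont].
apply: (C1on_ext _ _ (C1onM openT (r e) (C1onB (@C1on_cst R n setT 1) (r f)))) => //.
Qed.

Lemma open_ne0 : open [set x : V | x != 0].
Proof.
have -> : [set x : V | x != 0] = ~` [set 0].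
  by apply/seteqP; split=> x /=; move/eqP.
apply/closed_openC/accessible_closed_set1/hausdorff_accessible.
exact: (@norm_hausdorff _ V).
Qed.

Lemma cut_small e f k x : e * q x <= 1 -> chi e f x = 0 /\ dchi e f k x = 0.
Proof. by move=> h; rewrite /chi /dchi (ramp_le1 h) (dramp_le1 h) !mul0r mulr0 addr0. Qed.

Lemma cut_C1 e f i : C1on setT (S e f i) (dS e f i).
Proof.
move=> x _; have [x0|x0] := eqVneq x 0; last first.
  have := C1onD (@C1on_coord R n [set x | x != 0] i) (C1onM open_ne0 (C1onS (subsetT _) (@cutoff_C1 e f))
    (C1onB (TC i) (@C1on_coord R n [set x | x != 0] i))).
  by move/(_ x x0); apply.
pose U := [set x | e * q x < 1].
have oU : open U.
  have qc : continuous (fun x => e * q x).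
    by move=> y; apply: (@cvgMr _ _ (nbhs y)); exact: (C1on_cont openT (@C1on_q setT)).
  by have := (continuousP _).1 qc _ (@open_lt R 1).
have := C1on_local oU _ _ (@C1on_coord R n U i); move/(_ (S e f i) (dS e f i)).
apply => [y|k y|]; rewrite /U /= ?x0 ?q0 ?mulr0 ?ltr01//.
  by move=> /ltW/cut_small-/(_ f i)[h _]; rewrite /S h mul0r addr0.
by move=> /ltW/cut_small-/(_ f k)[h h']; rewrite /dS h h' mul0r mulr0 !addr0.
Qed.

Lemma dramp_mul (t : R) : 0 <= t -> `|dramp t| * t <= 8.
Proof.
move=> t0; have [t2|t2] := lerP 2 t; first by rewrite dramp_ge2// normr0 mul0r.
by have := dramp_bound t; nra.
Qed.

Lemma T_bound_ge0 : 0 <= C.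
Proof. by apply: le_trans (dTb ord0 ord0 0). Qed.

(** The bound is uniform in [e] and [f], as dominated convergence requires when the inner radius
    shrinks: [|x|] times the gradient of [chi] is at most 32 at every scale, 16 for each [ramp] by
    [dramp_mul], while [T - x] is at most [(C + 1) |x|]. *)
Lemma cut_bound (e f : R) i k x : 0 <= e -> 0 <= f -> `|dS e f i k x| <= 34 + 33 * C.
Proof.
move=> e0 f0; have C0 := T_bound_ge0.
have d1 : `|(k == i)%:R : R| <= 1 by case: (k == i); rewrite ?normr1 ?normr0.
have /andP[re0 re1] := ramp01 (e * q x); have /andP[rf0 rf1] := ramp01 (f * q x).
have chi1 : `|chi e f x| <= 1 by rewrite /chi ger0_norm; [rewrite mulr_ile1//; lra|rewrite mulr_ge0//; lra].
have t1 : `|T i x - x ord0 i| <= (C + 1) * `|x|.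
  rewrite (le_trans (ler_normB _ _))// mulrDl mul1r lerD//; exact: coord_le_norm.
have xk : `|x| * `|x ord0 k| <= q x.
  by apply: le_trans (norm_le_q x); rewrite expr2 ler_wpM2l// coord_le_norm.
have aux (g : R) : 0 <= g -> `|x| * `|dramp (g * q x) * (g * (2 * x ord0 k))| <= 16.
  move=> g0; have h := @dramp_mul (g * q x) (mulr_ge0 g0 (q_ge0 x)).
  rewrite (normrM (dramp _)) (normrM g) (normrM 2) (ger0_norm g0) (ger0_norm (_ : 0 <= 2 :> R))//.
  have -> : `|x| * (`|dramp (g * q x)| * (g * (2 * `|x ord0 k|))) =
      2 * (`|dramp (g * q x)| * (g * (`|x| * `|x ord0 k|))) by ring.
  have : `|dramp (g * q x)| * (g * (`|x| * `|x ord0 k|)) <= `|dramp (g * q x)| * (g * q x).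
    by rewrite ler_wpM2l// ler_wpM2l.
  lra.
have d2 : `|x| * `|dchi e f k x| <= 32.
  have h1 := aux e e0; have h2 := aux f f0; rewrite /dchi sub0r.
  set A := dramp (e * q x) * _ in h1 *; set B := dramp (f * q x) * _ in h2 *.
  apply: (@le_trans _ _ (`|x| * (`|B| + `|A|))); last by lra.
  rewrite ler_wpM2l// (le_trans (ler_normD _ _))// lerD// normrM ?normrN ger0_norm//; last lra.
    by rewrite ler_piMl.
  by rewrite ler_piMl//; lra.
rewrite /dS (le_trans (ler_normD _ _))//.
have : `|chi e f x * (dT i k x - (k == i)%:R)| <= C + 1.
  rewrite normrM -[leRHS]mul1r ler_pM// (le_trans (ler_normB _ _))// lerD//; exact: dTb.
have : `|(T i x - x ord0 i) * dchi e f k x| <= (C + 1) * 32.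
  rewrite normrM (@le_trans _ _ ((C + 1) * `|x| * `|dchi e f k x|))// ?ler_wpM2r//.
  by rewrite -mulrA ler_wpM2l//; lra.
have := ler_normD (chi e f x * (dT i k x - (k == i)%:R)) ((T i x - x ord0 i) * dchi e f k x).
lra.
Qed.

Lemma cut_seg e f x : c * `|x| <= `|(\row_i S e f i x : V)|.
Proof.
have /andP[re0 re1] := ramp01 (e * q x); have /andP[rf0 rf1] := ramp01 (f * q x).
have : 0 <= chi e f x <= 1 by rewrite /chi mulr_ge0 ?mulr_ile1//; lra.
move/(seg x); congr (_ <= `|_|); apply/rowP => i; rewrite !mxE /S; ring.
Qed.

Lemma T0 i : T i 0 = 0.
Proof. by apply/eqP; rewrite -normr_le0 (le_trans (Tb i 0))// normr0 mulr0. Qed.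

Lemma Int_box_comp (a b : V) : (forall i, a ord0 i <= b ord0 i) ->
  bbm (fun x => \1_(box a b) (Tv x) * J x) /\
  Int (fun x => \1_(box a b) (Tv x) * J x) = Int (\1_(box a b) : V -> R).
Proof.
move=> ab; set rho := boxrad a b.
have rho1 : 1 <= rho by rewrite /rho /boxrad; have := normr_ge0 a; have := normr_ge0 b; lra.
(* Where [f * q x >= 1], comparing [q] with the sup norm gives [c * |x| > rho]. All points of the
   homotopy are then outside the support of the test function, so the outer cutoff is invisible. *)
pose f := c ^+ 2 / (n.+1%:R * (rho + 1) ^+ 2).
have den0 : 0 < n.+1%:R * (rho + 1) ^+ 2 by rewrite mulr_gt0 ?ltr0n// exprn_gt0//; lra.
have f0 : 0 < f by rewrite divr_gt0// exprn_gt0.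
have far x : 1 <= f * q x -> rho < c * `|x|.
  move=> h; have {h} : n.+1%:R * (rho + 1) ^+ 2 <= c ^+ 2 * q x.
    by move: h; rewrite /f mulrAC ler_pdivlMr ?mul1r.
  move=> h; have {h} : n.+1%:R * (rho + 1) ^+ 2 <= n.+1%:R * (c * `|x|) ^+ 2.
    apply: le_trans h _; rewrite exprMn mulrCA ler_wpM2l ?q_le_norm//; exact: sqr_ge0.
  rewrite ler_pM2l ?ltr0n// ler_sqr ?nnegrE ?mulr_ge0//; [lra|lra|exact: ltW].
pose e (k : nat) : R := k.+1%:R.
pose g (k : nat) x := boxtest a b k.+1%:R x.
pose F k x := g k (\row_i S (e k) f i x) * \det (\matrix_(i, j) dS (e k) f i j x).
have Fs k x : rho < c * `|x| -> F k x = 0.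
  move=> h; rewrite /F /g boxtest_supp ?mul0r//; first by rewrite ler1n.
  exact: (lt_le_trans h (cut_seg _ _ _)).
have g0 k : (0 : R) < k.+1%:R by rewrite ltr0n.
have gb k : bbm (g k).
  apply: (@bbd_bbm _ _ rho); first exact: continuous_mfun (boxtest_cont (g0 k)).
  split=> x; last by move=> h; rewrite /g boxtest_supp// ler1n.
  by have /andP[h1 h2] := boxtest01 ab x (ltW (g0 k)); rewrite ger0_norm//; exact: le_trans h2 rho1.
have FI k : bbm (F k) /\ Int (F k) = Int (g k).
  have [G [dG [GC dGE]]] := boxtestP a b (g0 k).
  rewrite /F /g -dGE; apply: (Int_det_comp (C := 2 / f + 2) GC (cut_C1 (e k) f)); last by rewrite dGE; exact: gb.
  move=> i x h; rewrite /S /chi (_ : ramp (f * q x) = 1) ?subrr ?mulr0 ?mul0r ?addr0//.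
  have f2 : 0 < 2 / f by rewrite divr_gt0.
  apply: ramp_ge2; rewrite mulrC -ler_pdivrMr//; apply: le_trans (norm_le_q x).
  have x1 : 2 / f <= `|x| by lra.
  have : 1 <= `|x| by lra.
  by move: x1; set t := 2 / f; nra.
pose M := Num.max (rho / c) (1 * ((n.+1)`!%:R * (34 + 33 * C) ^+ n.+1)).
have Fb k : bbd M (F k).
  split=> x; last first.
    by rewrite gt_max => /andP[h _]; apply: Fs; move: h; rewrite ltr_pdivrMr// mulrC.
  rewrite le_max; apply/orP; right; rewrite normrM ler_pM//.
    by have /andP[h1 h2] := boxtest01 ab (\row_i S (e k) f i x) (ltW (g0 k)); rewrite ger0_norm.
  by apply: det_bound => i j; rewrite mxE; apply: cut_bound; [exact: ltW (g0 k)|exact: ltW].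
have gc := Int_dct (fun k => proj1 (gb k)) (C := rho) _ (boxtest_cvg ab).
have {gc} [_ gc] : bbm (\1_(box a b) : V -> R) /\ Int (g k) @[k --> \oo] --> Int (\1_(box a b) : V -> R).
  apply: gc => k; split=> x; last by move=> h; rewrite /g boxtest_supp// ler1n.
  by have /andP[h1 h2] := boxtest01 ab x (ltW (g0 k)); rewrite ger0_norm//; exact: le_trans h2 rho1.
(* At 0 the cut-off map is the identity for every [k], so the pointwise limit there is the plain
   indicator; a single point does not change the integral. *)
pose L x := if x == 0 then \1_(box a b) (0 : V) else \1_(box a b) (Tv x) * J x : R.
have [bL IL] : bbm L /\ Int (F k) @[k --> \oo] --> Int L.
  apply: (Int_dct (fun k => proj1 (proj1 (FI k))) Fb) => x; rewrite /L; case: eqVneq => [->|x0].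
    have -> : (fun k => F k 0) = (fun k => g k 0).
      apply/funext => k; rewrite /F.
      have -> : \row_i S (e k) f i 0 = 0 by apply/rowP => i; rewrite !mxE /S !mxE T0 subrr mulr0 addr0.
      have -> : \matrix_(i, j) dS (e k) f i j 0 = 1%:M.
        apply/matrixP => i j; rewrite !mxE /dS.
        have [|h h'] := @cut_small (e k) f j 0; first by rewrite q0 mulr0.
        by rewrite h h' mul0r mulr0 !addr0 eq_sym.
      by rewrite det1 mulr1.
    exact: boxtest_cvg.
  have [fq|fq] := lerP 1 (f * q x).
    have -> : (fun k => F k x) = cst 0 by apply/funext => k; rewrite Fs//; exact: far.
    suff -> : \1_(box a b) (Tv x) = 0 :> R by rewrite mul0r; exact: cvg_cst.
    rewrite indicE memNset// => /box_norm; rewrite leNgt; apply/negP.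
    rewrite negbK; apply: lt_le_trans (far _ fq) _.
    by have := @seg 1 x; rewrite subrr scale0r add0r scale1r; apply; rewrite ler01 lexx.
  have ne : \forall k \near \oo, g k (Tv x) * J x = F k x.
    near=> k.
    have ek : 2 <= e k * q x.
      rewrite -ler_pdivrMr ?q_gt0//.
      have h : 2 / q x <= k%:R by near: k; exact: nbhs_infty_ger.
      by apply: le_trans h _; rewrite ler_nat.
    have c1 : chi (e k) f x = 1 by rewrite /chi (ramp_ge2 ek) ramp_le1 ?subr0 ?mulr1// ltW.
    have c2 i : dchi (e k) f i x = 0.
      by rewrite /dchi (dramp_ge2 ek) (@dramp_le1 _ (f * q x)) ?ltW// !mul0r subrr !mulr0 addr0.
    rewrite /F; have -> : \row_i S (e k) f i x = Tv x.
      by apply/rowP => i; rewrite !mxE /S c1 mul1r addrC subrK.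
    have -> // : \matrix_(i, j) dS (e k) f i j x = \matrix_(i, j) dT i j x.
    by apply/matrixP => i j; rewrite !mxE /dS c1 c2 mul1r mulr0 addr0 addrC subrK.
  apply: cvg_trans (near_eq_cvg ne) _.
  by apply: cvgMl; exact: boxtest_cvg.
have LE x : x != 0 -> L x = \1_(box a b) (Tv x) * J x by rewrite /L => /negbTE ->.
have bF := bbm_off0 bL LE; split=> //.
rewrite -(eq_Int_off0 bL bF LE).
have e1 : (fun k => Int (F k)) = (fun k => Int (g k)) by apply/funext => k; exact: (FI k).2.
rewrite e1 in IL.
exact: (cvg_unique _ IL gc).
Unshelve. all: by end_near. Qed.

Lemma mfun_comp1 (u : V -> R) (f : R -> R) : mfun u -> measurable_fun setT f -> mfun (f \o u).
Proof. by move=> mu_ mf; exact: (measurableT_comp mf mu_). Qed.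

Lemma mfun_T i : mfun (T i).
Proof. by apply: continuous_off0_mfun => x x0; exact: (C1on_cont open_ne0 (TC i)). Qed.

Lemma mfun_box_comp (a b : V) : mfun (fun x => \1_(box a b) (Tv x)).
Proof.
have -> : (fun x => \1_(box a b) (Tv x) : R) =
    (fun x => \prod_(i <- enum I) (\1_(`[a ord0 i, b ord0 i]%classic) (T i x))).
  apply/funext => x; rewrite indicE; case: (boolP (Tv x \in box a b)) => [|/negP]; rewrite inE => h.
    rewrite big1// => i _; rewrite indicE mem_set//= in_itv/=.
    by have := h i; rewrite mxE.
  have [i hi] : exists i, ~~ (a ord0 i <= T i x <= b ord0 i).
    apply: contrapT => h'; apply: h => i; rewrite mxE; apply/negPn/negP => hi.
    by apply: h'; exists i.
  rewrite (big_rem i) ?mem_enum//= indicE memNset ?mul0r//= in_itv/=; exact/negP.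
apply: mfun_prod => i; apply: (mfun_comp1 (mfun_T i)); exact: measurable_indic.
Qed.

Lemma mfun_J : mfun J.
Proof.
have mdT i k : mfun (dT i k).
  by apply: continuous_off0_mfun => x x0; have [_] := TC i x0; exact.
rewrite (_ : J = (fun x => \sum_(s : 'S_n.+1) (-1) ^+ s * \prod_i dT i (s i) x)).
  by apply: mfun_sum => s; apply: mfunM; [exact: mfun_cst|exact: mfun_prod].
apply/funext => x; apply: eq_bigr => s _; congr (_ * _).
by apply: eq_bigr => i _; rewrite mxE.
Qed.

Lemma J_bound x : `|J x| <= (n.+1)`!%:R * C ^+ n.+1.
Proof. by apply: det_bound => i j; rewrite mxE. Qed.

Lemma bbm_J w : bbm w -> bbm (fun x => J x * w x).
Proof.
by apply: bbmMl; [exact: mfun_J|move=> D; exists ((n.+1)`!%:R * C ^+ n.+1) => x _; exact: J_bound].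
Qed.

Lemma bbm_box_comp (a b : V) : bbm (fun x => \1_(box a b) (Tv x)).
Proof.
split; first exact: mfun_box_comp.
exists (Num.max 1 (boxrad a b / c)); split=> x; rewrite indicE.
  by rewrite le_max; apply/orP; left; case: (_ \in _); rewrite ?normr1 ?normr0.
rewrite gt_max => /andP[_ h]; rewrite memNset// => /box_norm; rewrite leNgt => /negP; apply.
move: h; rewrite ltr_pdivrMr// mulrC => h; apply: lt_le_trans h _.
by have := @seg 1 x; rewrite subrr scale0r add0r scale1r; apply; rewrite ler01 lexx.
Qed.

Lemma Int_box_comp_le (a b : V) : Int (fun x => J x * \1_(box a b) (Tv x)) <= boxvol a b.
Proof.
have [ab|ab] := pselect (forall i, a ord0 i <= b ord0 i).
  have [_] := Int_box_comp ab; under eq_Int do rewrite mulrC; move=> ->.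
  rewrite Int_indic; last exact: measurable_box.
  have -> : boxvol a b = fine (boxvol a b)%:E by [].
  apply: fine_le; rewrite ?lebesgue_vol_box_le// fin_numE -?ltey -?ltNye.
  by rewrite (le_lt_trans (lebesgue_vol_box_le _ _)) ?ltry// andbT (lt_le_trans _ (lebesgue_vol_ge0 _)).
rewrite (@eq_Int _ _ _ (fun=> 0)) ?Int0 ?boxvol_ge0// => x.
rewrite indicE memNset ?mulr0// => h; apply: ab => i; have /andP[] := h i; exact: le_trans.
Qed.

Hypothesis J0 : forall x, 0 <= J x.

(** Boxes cover [A], so [w] is at most the pulled-back indicator of their union, and by
    [Int_box_comp] and the sign of [J] each box contributes at most its volume. [h m] is the
    indicator for the first [m] boxes; [m] tends to infinity by dominated convergence. *)
Lemma Int_le_vol (w : V -> R) (A : set V) : bbm w -> (forall x, 0 <= w x <= 1) ->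
  (forall x, w x != 0 -> A (Tv x)) -> ((Int (fun x => J x * w x))%:E <= lebesgue_vol A)%E.
Proof.
move=> bw w01 wA; apply: le_ereal_inf_tmp => _ [a [b [Aab ->]]].
pose h m x := 1 - \prod_(k <- iota 0 m) (1 - \1_(box (a k) (b k)) (Tv x)) : R.
have i01 k x : 0 <= (\1_(box (a k) (b k)) (Tv x) : R) <= 1.
  by rewrite indicE; case: (_ \in _); rewrite ?ler01 ?lexx.
have p01 x (s : seq nat) : (0 : R) <= \prod_(k <- s) (1 - \1_(box (a k) (b k)) (Tv x)) <= (1 : R).
  elim: s => [|k s /andP[h1 h2]]; first by rewrite big_nil ler01 lexx.
  have /andP[g1 g2] := i01 k x; rewrite big_cons; move: g1 g2 h1 h2.
  set v := \1_(_) _; set u := \prod_(_ <- _) _ => *; apply/andP; split; first by rewrite mulr_ge0//; lra.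
  by rewrite mulr_ile1//; lra.
have h01 m x : 0 <= h m x <= 1.
  by have /andP[g1 g2] := p01 x (iota 0 m); rewrite /h; apply/andP; split; lra.
have hm m : mfun (h m).
  apply: mfunB; first exact: mfun_cst.
  apply: mfun_prod => k; apply: mfunB; [exact: mfun_cst|exact: mfun_box_comp].
have [mJw [D bJw]] := bbm_J bw.
have hc x : (fun m => h m x * (J x * w x)) @ \oo --> J x * w x.
  have [w0|w0] := eqVneq (w x) 0; first by rewrite w0 !mulr0; under eq_fun do rewrite mulr0; exact: cvg_cst.
  have [k _ xk] := Aab _ (wA x w0).
  rewrite -[X in _ --> X]mul1r; apply: cvgMl; apply: cvg_near_cst; near=> m.
  have km : (k < m)%N by near: m; exact: nbhs_infty_gt.
  rewrite /h (big_rem k) ?mem_iota//= indicE mem_set//.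
  by rewrite subrr mul0r subr0.
have hb m : bbd D (fun x => h m x * (J x * w x)).
  split=> x; last by move=> xD; rewrite (proj2 bJw)// mulr0.
  have /andP[g1 g2] := h01 m x; rewrite normrM (ger0_norm g1); apply: le_trans (proj1 bJw x).
  by rewrite ler_piMl.
have [_ cI] := Int_dct (fun m => mfunM (hm m) mJw) hb hc.
have le1 m : ((Int (fun x => h m x * (J x * w x)))%:E <= \sum_(0 <= k < m) (boxvol (a k) (b k))%:E)%E.
  rewrite sumEFin lee_fin.
  apply: (@le_trans _ _ (Int (fun x => \sum_(k <- iota 0 m) (J x * \1_(box (a k) (b k)) (Tv x))))).
    apply: le_Int.
    - by apply: bbd_bbm (hb m); apply: mfunM.
    - by apply: bbm_sum => k; apply: bbm_J; exact: bbm_box_comp.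
    move=> x; rewrite -mulr_sumr mulrCA; apply: ler_wpM2l => //.
    have /andP[w0 w1] := w01 x; have /andP[g1 g2] := h01 m x.
    apply: (@le_trans _ _ (h m x)); first by rewrite ler_piMr.
    rewrite /h; elim: (iota 0 m) => [|k s IH]; first by rewrite !big_nil subrr.
    rewrite !big_cons; have /andP[k0 k1] := i01 k x; have /andP[s0 s1] := p01 x s.
    by move: IH s0 s1 k0 k1; set u := \prod_(_ <- _) _; set v := \1_(_) _; set t := \sum_(_ <- _) _; nra.
  rewrite Int_sum => [|k]; last by apply: bbm_J; exact: bbm_box_comp.
  rewrite /index_iota subn0; apply: ler_sum => k _; exact: Int_box_comp_le.
have ps m : (\sum_(0 <= k < m) (boxvol (a k) (b k))%:E <= \sum_(0 <= k <oo) (boxvol (a k) (b k))%:E)%E.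
  by apply: nneseries_lim_ge => k _; rewrite lee_fin boxvol_ge0.
move: ps; case: (\sum_(0 <= k <oo) _)%E => [r| |] ps.
- have /cvg_lim <- := cI => //; rewrite lee_fin; apply: limr_le; first exact: cvgP cI.
  by apply: nearW => m; rewrite -lee_fin (le_trans (le1 m)).
- by rewrite leey.
- by have := le_trans (le1 0%N) (ps 0%N); rewrite leeNy_eq.
Unshelve. all: by end_near. Qed.

(** The complementary bound: the part of the preimage of a cube that lies outside [B] maps into the
    cube minus [A], the whole preimage accounts for the volume of the cube, and measurability of [A]
    allows the subtraction. *)
Lemma vol_le_Int (A B : set V) (r : R) : measurable (A : set (caratheodory_type (volO R n))) ->
  A `<=` cube r -> bbm (\1_B : V -> R) -> (forall x, A (Tv x) -> B x) ->
  (lebesgue_vol A <= (Int (fun x => J x * \1_B x))%:E)%E.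
Proof.
move=> mA Ar bB AB.
pose w x : R := (1 - \1_B x) * \1_(cube r) (Tv x).
have bQ : bbm (fun x => \1_(cube r) (Tv x)) := bbm_box_comp _ _.
have bw : bbm w.
  apply: bbmMl bQ; first by apply: mfunB; [exact: mfun_cst|exact: bB.1].
  move=> D; exists 1 => x _; rewrite indicE.
  by case: (_ \in _); rewrite ?subrr ?subr0 ?normr1 ?normr0.
have w01 x : 0 <= w x <= 1.
  rewrite /w !indicE; case: (_ \in _); case: (_ \in _);
    by rewrite ?subrr ?subr0 ?mulr0 ?mul0r ?mulr1 ?ler01 ?lexx.
have h : ((Int (fun x => J x * w x))%:E <= lebesgue_vol (cube r `&` ~` A))%E.
  apply: Int_le_vol => // x; rewrite /w !indicE.
  case: (boolP (x \in B)) => [_|/negP]; first by rewrite subrr mul0r eqxx.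
  rewrite inE => xB; case: (boolP (Tv x \in _)) => [|_]; last by rewrite mulr0 eqxx.
  by rewrite inE => xQ _; split=> // /AB.
have mA' : (volO R n).-caratheodory A := mA.
have e : lebesgue_vol (cube r : set V) = (lebesgue_vol A + lebesgue_vol (cube r `&` ~` A))%E.
  have e0 : (muV R n (cube r) = muV R n (cube r `&` A) + muV R n (cube r `&` ~` A))%E := mA' (cube r).
  rewrite muVE in e0; rewrite [LHS]e0.
  have -> // : cube r `&` A = A.
  by apply/seteqP; split=> [x []//|x Ax]; split => //; exact: Ar.
have bv : (lebesgue_vol (cube r : set V) < +oo)%E by have := @mu_cube R n r; rewrite muVE.
have fA : lebesgue_vol A \is a fin_num.
  by rewrite ge0_fin_numE ?lebesgue_vol_ge0// (le_lt_trans _ bv)//; exact: le_lebesgue_vol.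
have fD : lebesgue_vol (cube r `&` ~` A) \is a fin_num.
  by rewrite ge0_fin_numE ?lebesgue_vol_ge0// (le_lt_trans _ bv)//; apply: le_lebesgue_vol => x [].
rewrite -(fineK fA) lee_fin.
have {}e : fine (lebesgue_vol (cube r : set V)) = fine (lebesgue_vol A) + fine (lebesgue_vol (cube r `&` ~` A)).
  by rewrite e fineD.
move: h; rewrite -{1}(fineK fD) lee_fin => h.
have iQ : Int (fun x => J x * \1_(cube r) (Tv x)) = fine (lebesgue_vol (cube r : set V)).
  have [r0|r0] := lerP 0 r.
    have /Int_box_comp[_] : forall i, (\row_(_ < n.+1) - r : V) ord0 i <= (\row_(_ < n.+1) r : V) ord0 i.
      by move=> i; rewrite !mxE; lra.
    under eq_Int do rewrite mulrC; rewrite -/(cube r) => ->.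
    by rewrite Int_indic//; exact: cube_measurable.
  have c0' : (cube r : set V) = set0.
    by apply/seteqP; split=> x // /cubeP h'; have := normr_ge0 x; lra.
  rewrite c0' (_ : lebesgue_vol set0 = 0%E); last by rewrite -muVE measure0.
  rewrite /= -[RHS](@Int0 R n); apply: eq_Int => x; by rewrite indicE in_set0 mulr0.
have : Int (fun x => J x * \1_(cube r) (Tv x)) <= Int (fun x => J x * w x + J x * \1_B x).
  apply: le_Int.
  - exact: bbm_J.
  - by apply: bbmD; exact: bbm_J.
  move=> x; rewrite -mulrDr ler_wpM2l// /w !indicE.
  by case: (_ \in _); case: (_ \in _); rewrite ?subrr ?subr0 ?mulr0 ?mul0r ?mulr1 ?add0r ?addr0 ?ler01 ?lexx.
rewrite IntD; [lra|exact: bbm_J|exact: bbm_J].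
Qed.

End ChangeOfVariables.

Section Dotp.
Variables (R : realType) (n : nat).
Notation V := 'rV[R]_n.
Implicit Types (x y z : V) (c : R).

Lemma dotpC x y : dotp x y = dotp y x.
Proof. by apply: eq_bigr => i _; rewrite mulrC. Qed.
Lemma dotpDl x y z : dotp (x + y) z = dotp x z + dotp y z.
Proof. by rewrite /dotp -big_split; apply: eq_bigr => i _; rewrite mxE mulrDl. Qed.
Lemma dotpZl c x y : dotp (c *: x) y = c * dotp x y.
Proof. by rewrite /dotp mulr_sumr; apply: eq_bigr => i _; rewrite mxE mulrA. Qed.
Lemma dotpDr x y z : dotp z (x + y) = dotp z x + dotp z y.
Proof. by rewrite !(dotpC z) dotpDl. Qed.
Lemma dotpZr c x y : dotp y (c *: x) = c * dotp y x.
Proof. by rewrite !(dotpC y) dotpZl. Qed.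
Lemma dotpNl x y : dotp (- x) y = - dotp x y.
Proof. by rewrite -scaleN1r dotpZl mulN1r. Qed.
Lemma dotpNr x y : dotp y (- x) = - dotp y x.
Proof. by rewrite !(dotpC y) dotpNl. Qed.
Lemma dotpBl x y z : dotp (x - y) z = dotp x z - dotp y z.
Proof. by rewrite dotpDl dotpNl. Qed.
Lemma dotpBr x y z : dotp z (x - y) = dotp z x - dotp z y.
Proof. by rewrite dotpDr dotpNr. Qed.
Lemma dotp0l x : dotp 0 x = 0.
Proof. by rewrite -(scale0r 0) dotpZl mul0r. Qed.
Lemma dotp0r x : dotp x 0 = 0.
Proof. by rewrite dotpC dotp0l. Qed.
Definition dotpE := (dotpDl, dotpDr, dotpBl, dotpBr, dotpZl, dotpZr, dotpNl, dotpNr, dotp0l, dotp0r).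
Lemma dotp_ge0 x : 0 <= dotp x x.
Proof. by apply: sumr_ge0 => i _; rewrite -expr2 sqr_ge0. Qed.
Lemma dotp_eq0 x : (dotp x x == 0) = (x == 0).
Proof.
apply/eqP/eqP => [|->]; last exact: dotp0l.
move/eqP; rewrite psumr_eq0 => [/allP h|i _]; last by rewrite -expr2 sqr_ge0.
apply/rowP => i; rewrite mxE; have := h i (mem_index_enum i).
by rewrite /= mulf_eq0 orbb => /eqP.
Qed.

Lemma dotp_CS x y : dotp x y ^+ 2 <= dotp x x * dotp y y.
Proof.
have [y0|y0] := eqVneq (dotp y y) 0.
  by move/eqP: (y0); rewrite dotp_eq0 => /eqP ->; rewrite !dotp0r expr0n mulr0.
have yp : 0 < dotp y y by rewrite lt_def y0 dotp_ge0.
have := dotp_ge0 (dotp y y *: x - dotp x y *: y).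
rewrite !dotpE (dotpC y x) => h.
by rewrite -(ler_pM2l yp); nra.
Qed.

Lemma dotp_mulmx x (M : 'M[R]_n) y : dotp (x *m M) y = dotp x (y *m M^T).
Proof.
have E u v : dotp u v = (u *m v^T) ord0 ord0.
  by rewrite mxE; apply: eq_bigr => i _; rewrite !mxE.
by rewrite !E trmx_mul trmxK mulmxA.
Qed.

End Dotp.

(** * Invariance of the integral under reflections *)

Section Isometry.
Variables (R : realType) (n : nat).
Notation V := 'rV[R]_n.+1.
Notation I := 'I_n.+1.
Notation ei k := (delta_mx ord0 k : V).
Notation mV := (caratheodory_type (volO R n)).

Section Rotation.
Variable M : 'M[R]_n.+1.
Hypothesis MT : M *m M^T = 1%:M.
(** If [x] and its image always make an angle of at most 90 degrees, the straight homotopy from the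
    identity to [M] stays away from 0, and the change of variables formula applies. *)
Hypothesis acute : forall x : V, 0 <= dotp x (x *m M).

Let T (i : I) (x : V) : R := (x *m M) ord0 i.
Let dT (i k : I) (_ : V) : R := M k i.
Let C : R := \sum_k \sum_i `|M k i|.

Let MCle k i : `|M k i| <= C.
Proof.
rewrite /C (bigD1 k)//= (bigD1 i)//= -addrA lerDl addr_ge0//; apply: sumr_ge0 => // l _.
exact: sumr_ge0.
Qed.

Let TC i : C1on [set x | x != 0] (T i) (dT i).
Proof.
apply: (C1on_ext _ _ (C1on_sum (index_enum I) (fun k =>
  C1onZ (M k i) (@C1on_coord R n [set x | x != 0] k)))) => [x|k x].
  by rewrite /T mxE; apply: eq_bigr => k _; rewrite mulrC.
by rewrite (bigD1 k)//= eqxx mulr1 big1 ?addr0// => l lk; rewrite eq_sym (negbTE lk) mulr0.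
Qed.

Let Tb i x : `|T i x| <= C * `|x|.
Proof.
rewrite /T mxE (le_trans (ler_norm_sum _ _ _))//.
rewrite /C mulr_suml; apply: ler_sum => k _; rewrite normrM mulrC ler_pM ?coord_le_norm//.
rewrite (bigD1 i)//= lerDl; exact: sumr_ge0.
Qed.

Let rowT x : (\row_i T i x : V) = x *m M. Proof. by apply/rowP => i; rewrite mxE. Qed.

Lemma q_isometry x : q (x *m M) = q x.
Proof. by rewrite /q dotp_mulmx -mulmxA MT mulmx1. Qed.

Lemma norm_q_le (x y : V) (k : R) : 0 <= k -> q x <= k * q y -> `|x| <= n.+1%:R * (k + 1) * `|y|.
Proof.
move=> k0 h; have N1 : 1 <= n.+1%:R :> R by rewrite ler1n.
rewrite -ler_sqr ?nnegrE ?mulr_ge0//; last lra.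
rewrite (le_trans (norm_le_q x))// (le_trans h)// exprMn.
rewrite (@le_trans _ _ (k * (n.+1%:R * `|y| ^+ 2)))//; first by rewrite ler_wpM2l// q_le_norm.
rewrite mulrA ler_wpM2r ?sqr_ge0//.
move: N1; set N := n.+1%:R; nra.
Qed.

Let c : R := (n.+1%:R * (2 + 1))^-1.
Let c0 : 0 < c. Proof. by rewrite invr_gt0 mulr_gt0. Qed.

Let seg (s : R) x : 0 <= s <= 1 -> c * `|x| <= `|(1 - s) *: x + s *: (\row_i T i x : V)|.
Proof.
move=> /andP[s0 s1]; rewrite rowT /c ler_pdivrMl ?mulr_gt0//; apply: norm_q_le => //.
have h := acute x; have e := q_isometry x; rewrite /q !dotpE (dotpC (x *m M) x).
rewrite -[dotp (x *m M) (x *m M)]/(q _) e -/(q x).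
have x0 := q_ge0 x; have : 0 <= q x * (1 - 2 * s) ^+ 2 by rewrite mulr_ge0 ?sqr_ge0.
have : 0 <= s * (1 - s) * dotp x (x *m M) by rewrite !mulr_ge0//; lra.
nra.
Qed.

Let dTb i k x : `|dT i k x| <= C. Proof. exact: MCle. Qed.

Let box_comp := Int_box_comp TC Tb dTb c0 seg.

(** Orthogonality leaves the values 1 and -1; the formula for the unit box says that the determinant
    times a nonnegative integral is 1. *)
Let detM : \det M = 1.
Proof.
have e2 : \det M ^+ 2 = 1 by rewrite expr2 -{2}det_tr -det_mulmx MT det1.
have h0 : forall i, (0 : V) ord0 i <= (\row__ (1 : R) : V) ord0 i by move=> i; rewrite !mxE.
have [_] := box_comp h0.
have -> : (fun x => \1_(box 0 (\row__ 1)) (\row_i T i x) * \det (\matrix_(i, j) dT i j x)) =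
    (fun x => \det M * \1_(box 0 (\row__ 1)) (\row_i T i x)).
  apply/funext => x; rewrite mulrC; congr (_ * _); rewrite -det_tr; congr (\det _).
  by apply/matrixP => i j; rewrite !mxE.
rewrite IntZ; last exact: (bbm_box_comp TC c0 seg).
rewrite Int_indic; last exact: measurable_box.
have -> : fine (lebesgue_vol (box 0 (\row__ 1 : V))) = 1.
  have -> : lebesgue_vol (box 0 (\row__ (1 : R) : V)) = (boxvol 0 (\row__ (1 : R) : V))%:E.
    by apply/eqP; rewrite eq_le lebesgue_vol_box// lebesgue_vol_box_le.
  by rewrite /= /boxvol big1// => i _; rewrite !mxE subr0 max_r.
set J := Int _; have J0 : 0 <= J by apply: Int_ge0 => x; rewrite indicE.
move=> e1; have : (\det M - 1) * (\det M + 1) = 0 by rewrite -subr_sqr e2 expr1n subrr.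
move/eqP; rewrite mulf_eq0 => /orP[/eqP|/eqP] h; first by lra.
have hM : \det M = -1 by lra.
by move: e1; rewrite hM; lra.
Qed.

Let vol_box (a b : V) : (lebesgue_vol ((mulmx^~ M) @^-1` (box a b)) <= (boxvol a b)%:E)%E.
Proof.
have bC : bbm (fun x => \1_(box a b) (\row_i T i x)) := bbm_box_comp TC c0 seg a b.
have := @Int_box_comp_le R n T dT C c TC Tb dTb c0 seg a b.
have -> : (fun x => \det (\matrix_(i, j) dT i j x) * \1_(box a b) (\row_i T i x)) =
    (fun x => \1_((mulmx^~ M) @^-1` (box a b)) x).
  apply/funext => x; rewrite [\det _](_ : _ = 1) ?mul1r; last first.
    by rewrite -det_tr -detM; congr (\det _); apply/matrixP => i j; rewrite !mxE.
  by rewrite rowT !indicE.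
have mP : measurable ((mulmx^~ M) @^-1` (box a b) : set mV).
  have [mC _] := bC; have := mC measurableT _ (@measurable_set1 R 1); rewrite setTI.
  congr (measurable _); apply/seteqP; split=> x /=; rewrite rowT indicE.
    by case: (boolP (_ \in _)) => [|_ /eqP]; rewrite ?inE// eq_sym oner_eq0.
  by move=> h; rewrite mem_set.
rewrite Int_indic// => h.
have fin : lebesgue_vol ((mulmx^~ M) @^-1` (box a b)) \is a fin_num.
  rewrite ge0_fin_numE ?lebesgue_vol_ge0//.
  have [_ [D [_ D0]]] := bC.
  apply: (@le_lt_trans _ _ (lebesgue_vol (cube D : set V))); last first.
    by have := @mu_cube R n D; rewrite muVE.
  apply: le_lebesgue_vol => x xab; apply/cubeP; rewrite leNgt; apply/negP => /D0.
  by rewrite rowT indicE mem_set// => /eqP; rewrite oner_eq0.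
by rewrite -(fineK fin) lee_fin.
Qed.

Lemma lebesgue_vol_rot_le (A : set V) :
  (lebesgue_vol ((mulmx^~ M) @^-1` A) <= lebesgue_vol A)%E.
Proof.
apply: le_ereal_inf_tmp => _ [a [b [Aab ->]]].
apply: (@le_trans _ _ (lebesgue_vol (\bigcup_k ((mulmx^~ M) @^-1` (box (a k) (b k)))))).
  by apply: le_lebesgue_vol => x /Aab[k _ xk]; exists k.
apply: (le_trans (@lebesgue_vol_sigma_subadditive R n.+1 _)).
by apply: lee_nneseries => *; [exact: lebesgue_vol_ge0|exact: vol_box].
Qed.

End Rotation.

Lemma Int_rot (M : 'M[R]_n.+1) g : M *m M^T = 1%:M -> (forall x : V, 0 <= dotp x (x *m M)) ->
  bbm g -> bbm (fun x => g (x *m M)) /\ Int (fun x => g (x *m M)) = Int g.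
Proof.
move=> MT ac bg; have MT' : M^T *m M = 1%:M by apply: mulmx1C.
have ac' : forall x : V, 0 <= dotp x (x *m M^T) by move=> x; rewrite -dotp_mulmx dotpC.
have volE (A : set V) : lebesgue_vol ((mulmx^~ M) @^-1` A) = (1%:E * lebesgue_vol A)%E.
  rewrite mul1e; apply/eqP; rewrite eq_le lebesgue_vol_rot_le//=.
  rewrite -{1}(_ : (mulmx^~ M^T) @^-1` ((mulmx^~ M) @^-1` A) = A).
    by apply: lebesgue_vol_rot_le => //; rewrite trmxK.
  by apply/seteqP; split=> x /=; rewrite -mulmxA MT' mulmx1.
have mf : measurable_fun [set: mV] ((mulmx^~ M) : mV -> mV).
  apply: (@measurable_transform _ _ 1 _ (mulmx^~ M^T)) => // x; by rewrite -mulmxA ?MT ?MT' mulmx1.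
have bgM : bbm (g \o mulmx^~ M).
  apply: (@bbm_transform _ _ (n.+1%:R * (1 + 1)) _ _ mf _ bg) => x.
  by apply: norm_q_le => //; rewrite mul1r q_isometry.
by split => //; rewrite -[RHS]mul1r -(Int_transform ler01 mf volE bg bgM).
Qed.

Definition refl (m x : V) : V := x - (2 * dotp x m) *: m.

Definition reflM (m : V) : 'M[R]_n.+1 := 1%:M - 2 *: (m^T *m m).

Lemma reflME m x : x *m reflM m = refl m x.
Proof.
rewrite /reflM /refl mulmxBr mulmx1 -scalemxAr mulmxA; congr (_ - _).
have -> : x *m m^T = (dotp x m)%:M.
  by apply/matrixP => i j; rewrite !mxE !ord1 eqxx mulr1n; apply: eq_bigr => k _; rewrite !mxE.
by rewrite mul_scalar_mx scalerA.
Qed.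

Lemma reflMT m : (reflM m)^T = reflM m.
Proof. by rewrite /reflM linearB /= trmx1 linearZ /= trmx_mul trmxK. Qed.

Lemma dotp_refl m x y : dotp m m = 1 -> dotp (refl m x) (refl m y) = dotp x y.
Proof. by move=> m1; rewrite /refl !dotpE m1 (dotpC m y); ring. Qed.

Lemma reflK m x : dotp m m = 1 -> refl m (refl m x) = x.
Proof.
move=> m1; rewrite /refl !dotpE m1 mulr1 -addrA -opprD -scalerDl.
have -> : 2 * dotp x m + 2 * (dotp x m - 2 * dotp x m) = 0 by ring.
by rewrite scale0r subr0.
Qed.

Lemma reflMK m : dotp m m = 1 -> reflM m *m reflM m = 1%:M.
Proof.
move=> m1; apply/row_matrixP => i; rewrite !rowE mulmxA !reflME reflK// mulmx1//.
Qed.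

(** Two reflections compose to the rotation by twice the angle between [m] and [b]. The hypothesis
    [1 <= 2 * dotp m b ^+ 2] says that the two lines are at most 45 degrees apart, which makes this
    rotation acute. *)
Lemma Int_refl2 m b g : dotp m m = 1 -> dotp b b = 1 -> 1 <= 2 * dotp m b ^+ 2 -> bbm g ->
  bbm (fun x => g (refl m (refl b x))) /\ Int (fun x => g (refl m (refl b x))) = Int g.
Proof.
move=> m1 b1 mb bg.
have e x : refl m (refl b x) = x *m (reflM b *m reflM m) by rewrite mulmxA !reflME.
rewrite (_ : (fun x => g (refl m (refl b x))) = (fun x => g (x *m (reflM b *m reflM m)))); last first.
  by apply/funext => x; rewrite e.
apply: Int_rot bg.
  by rewrite trmx_mul !reflMT mulmxA -(mulmxA (reflM b)) reflMK// mulmx1 reflMK.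
move=> x; rewrite -e.
pose a := dotp x m; pose d := dotp x b; pose g0 := dotp m b.
have -> : dotp x (refl m (refl b x)) = dotp x x - 2 * (a ^+ 2 + d ^+ 2 - 2 * a * d * g0).
  by rewrite /refl !dotpE (dotpC b m) -/a -/d -/g0; ring.
have gg : g0 ^+ 2 <= 1 by have := dotp_CS m b; rewrite m1 b1 mulr1.
have E0 : 0 <= a ^+ 2 + d ^+ 2 - 2 * a * d * g0.
  have := sqr_ge0 (a - d * g0); have : 0 <= d ^+ 2 * (1 - g0 ^+ 2) by rewrite mulr_ge0 ?sqr_ge0//; lra.
  lra.
have := dotp_ge0 (x - 2 *: ((a - d * g0) *: m + (d - a * g0) *: b)).
rewrite !dotpE m1 b1 (dotpC m x) (dotpC b x) (dotpC b m) -/a -/d -/g0.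
set E := a ^+ 2 + d ^+ 2 - 2 * a * d * g0 in E0 *.
have h1 : 1 - g0 ^+ 2 <= 1 / 2 by move: mb; rewrite -/g0; lra.
have h2 : (1 - g0 ^+ 2) * E <= 1 / 2 * E by rewrite ler_wpM2r.
move=> h.
have : 0 <= dotp x x - 4 * E + 4 * ((1 - g0 ^+ 2) * E).
  apply: le_trans h _; rewrite le_eqVlt; apply/orP; left; apply/eqP; rewrite /E; ring.
lra.
Qed.

Lemma dotp_eir i x : dotp x (ei i) = x ord0 i.
Proof.
rewrite /dotp (bigD1 i)//= !mxE !eqxx mulr1 big1 ?addr0// => k ki.
by rewrite !mxE (negbTE ki) andbF mulr0.
Qed.

Lemma flip_refl i x : flip i x = refl (ei i) x.
Proof.
apply/rowP => j; rewrite /flip /refl dotp_eir !mxE eqxx/=.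
by case: eqP => [->|_]; rewrite ?mulr1 ?mulr0; ring.
Qed.

Lemma dotp_ei i : dotp (ei i) (ei i) = 1.
Proof. by rewrite dotp_eir !mxE !eqxx. Qed.

Lemma bbm_flip i (g : V -> R) : bbm g -> bbm (g \o flip i).
Proof.
move=> bg; have mf : measurable_fun [set: mV] (flip i : mV -> mV).
  apply: (@measurable_transform _ _ 1 _ (flip i)) => //; [exact: flipK|exact: flipK|].
  by move=> A; rewrite mul1e lebesgue_vol_flip.
apply: (@bbm_transform _ _ (n.+1%:R * (1 + 1)) _ _ mf _ bg) => x.
apply: norm_q_le => //; rewrite mul1r flip_refl /q dotp_refl//; exact: dotp_ei.
Qed.

Lemma reflN m : refl (- m) = refl m.
Proof. by apply/funext => x; rewrite /refl dotpNr mulrN scaleNr scalerN opprK. Qed.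

(** With [b] the bisector of [m] and the axis [e0], the reflection is the product of the rotations
    [refl m o refl b] and [refl b o refl e0] and of a coordinate flip. After a possible sign change
    of [m], both angles are at most 45 degrees. *)
Lemma Int_refl m g : dotp m m = 1 -> bbm g ->
  bbm (fun x => g (refl m x)) /\ Int (fun x => g (refl m x)) = Int g.
Proof.
pose e0 := ei ord0; have e1 : dotp e0 e0 = 1 := dotp_ei ord0.
have near_e0 b h : dotp b b = 1 -> 1 <= 2 * dotp b e0 ^+ 2 -> bbm h ->
    bbm (fun x => h (refl b x)) /\ Int (fun x => h (refl b x)) = Int h.
  move=> b1 be bh; have [b2 i2] := Int_refl2 b1 e1 be bh.
  have e : (fun x => h (refl b x)) = (fun x => h (refl b (refl e0 x))) \o flip ord0.
    by apply/funext => x; rewrite /= flip_refl reflK.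
  by rewrite e; split; [exact: bbm_flip|rewrite Int_flip].
wlog m0 : m / 0 <= dotp m e0.
  move=> H m1 bg; have [m0|m0] := lerP 0 (dotp m e0); first exact: H.
  rewrite -(reflN m); apply: H => //; rewrite dotpNl ?dotpNr ?opprK//.
  by rewrite oppr_ge0 ltW.
move=> m1 bg; pose t := Num.sqrt (2 + 2 * dotp m e0).
have t2 : t ^+ 2 = 2 + 2 * dotp m e0 by rewrite sqr_sqrtr//; lra.
have t0 : t != 0 by apply/eqP => t0; move: t2; rewrite t0 expr0n /=; lra.
pose b := t^-1 *: (m + e0).
have b1 : dotp b b = 1.
  rewrite /b !dotpE m1 e1 (dotpC e0 m).
  rewrite (_ : _ * _ = (2 + 2 * dotp m e0) / t ^+ 2); last by field.
  by rewrite t2 divff//; apply/eqP => h; lra.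
have bme : (dotp m b = t / 2) * (dotp b e0 = t / 2).
  rewrite /b !dotpE m1 e1; have -> : dotp m e0 = t ^+ 2 / 2 - 1 by rewrite t2; field.
  by split; field.
have [b2 i2] := @Int_refl2 m b g m1 b1 (ltac:(rewrite bme expr_div_n t2; lra)) bg.
have e : (fun x => g (refl m x)) = (fun x => (fun y => g (refl m (refl b y))) (refl b x)).
  by apply/funext => x; rewrite /= reflK.
rewrite e; have [b3 i3] := near_e0 b _ b1 (ltac:(rewrite bme expr_div_n t2; lra)) b2.
exact: (conj b3 (etrans i3 i2)).
Qed.

End Isometry.

Section DetNearIdentity.
Variable R : realType.

Lemma prod_near (J : Type) (s : seq J) (x y : J -> R) (e : R) : 0 <= e -> e <= 1 ->
  (forall j, `|x j - y j| <= e) -> (forall j, `|y j| <= 1) ->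
  `|\prod_(j <- s) x j - \prod_(j <- s) y j| <= 3 ^+ size s * e.
Proof.
move=> e0 e1 xy y1; elim: s => [|j s IH]; first by rewrite !big_nil subrr normr0 mul1r.
rewrite !big_cons /= exprS.
have p2 : 1 <= 3 ^+ size s :> R by rewrite exprn_ege1//; lra.
have yb : `|\prod_(j <- s) y j| <= 1.
  elim: (s) => [|k t IHt]; first by rewrite big_nil normr1.
  by rewrite big_cons normrM mulr_ile1.
set X := \prod_(j <- s) x j in IH *; set Y := \prod_(j <- s) y j in IH yb *.
have -> : x j * X - y j * Y = (x j - y j) * Y + x j * (X - Y) by ring.
have xj : `|x j| <= 2.
  rewrite -[x j](subrK (y j)) (le_trans (ler_normD _ _))//.
  by have := xy j; have := y1 j; lra.
rewrite (le_trans (ler_normD _ _))// !normrM.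
have h1 : `|x j - y j| * `|Y| <= e by rewrite -[leRHS]mulr1 ler_pM.
have h2 : `|x j| * `|X - Y| <= 2 * (3 ^+ size s * e) by rewrite ler_pM.
have h3 : e <= 3 ^+ size s * e by rewrite ler_peMl.
lra.
Qed.

Lemma det_near1 (m : nat) : exists2 K : R, 0 < K & forall (M : 'M[R]_m) e, 0 <= e -> e <= 1 ->
  (forall i j, `|M i j - (i == j)%:R| <= e) -> `|\det M - 1| <= K * e.
Proof.
exists (\sum_(s : 'S_m) 3 ^+ m).
  by rewrite sumr_const card_Sn pmulrn_lgt0 ?fact_gt0// exprn_gt0.
move=> M e e0 e1 ME.
rewrite -[X in _ - X](det1 R m) /determinant -sumrB (le_trans (ler_norm_sum _ _ _))// mulr_suml.
apply: ler_sum => s _; rewrite -mulrBr normrM normrX normrN1 expr1n mul1r.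
have := @prod_near _ (index_enum 'I_m) (fun i => M i (s i)) (fun i => (1%:M : 'M[R]_m) i (s i)) e e0 e1.
rewrite -sum1_size sum1_card card_ord; apply => j.
  by rewrite !mxE; exact: ME.
by rewrite mxE; case: (_ == _); rewrite ?normr1 ?normr0.
Qed.

End DetNearIdentity.

(** * Nearly constant 0-homogeneous functions and their gradient maps *)

Section HomogeneousFunctions.
Variables (R : realType) (n : nat).
Notation V := 'rV[R]_n.+1.
Notation I := 'I_n.+1.
Notation off0 := [set x : V | x != 0].
Implicit Types (x y : V) (t c s e : R) (a : V -> R) (da : I -> V -> R) (dda : I -> I -> V -> R).

Definition hom2 a da dda := [/\ forall (t : R) x, 0 < t -> a (t *: x) = a x,
  C1on off0 a da & forall i, C1on off0 (da i) (dda i)].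

Lemma C1on_uniq U (u : V -> R) du dw x k : C1on U u du -> C1on U u dw -> U x -> du k x = dw k x.
Proof.
move=> h1 h2 Ux; have [/(_ k) [_ <-] _] := h1 x Ux; have [/(_ k) [_ <-] _] := h2 x Ux.
by [].
Qed.

Lemma hom_diff (f : V -> R) df (t c : R) x k : 0 < t -> C1on off0 f df ->
  (forall y, y != 0 -> f (t *: y) = c * f y) -> x != 0 -> df k (t *: x) = t^-1 * c * df k x.
Proof.
move=> t0 fC ft x0.
have rE y : (\row_i (t * y ord0 i) : V) = t *: y by apply/rowP => i; rewrite !mxE.
have off y : y != 0 -> (\row_i (t * y ord0 i) : V) != 0.
  by rewrite rE scaler_eq0 negb_or (gt_eqF t0).
have h1 := C1on_compV (@open_ne0 R n) (@open_ne0 R n) fC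
  (fun i => C1onZ t (@C1on_coord R n off0 i)) off.
have h2 : C1on off0 (fun y => f (\row_i (t * y ord0 i))) (fun k y => c * df k y).
  apply: (C1on_local (@open_ne0 R n) _ _ (C1onZ c fC)) => // y y0; by rewrite rE ft.
have := @C1on_uniq off0 _ _ _ x k h1 h2 x0.
rewrite (bigD1 k)//= big1 ?addr0 => [|i ik]; last by rewrite eq_sym (negbTE ik) !mulr0.
rewrite eqxx mulr1 rE => e; rewrite -mulrA -e mulrCA mulVf ?mulr1//.
by rewrite gt_eqF.
Qed.

Lemma hom0_euler (a : V -> R) da x : (forall t y, 0 < t -> a (t *: y) = a y) -> C1on off0 a da ->
  x != 0 -> \sum_i x ord0 i * da i x = 0.
Proof.
move=> h1 h2 x0.
have g1 (i : I) : is_derive (1 : R) (1 : R) (fun s : R => (s *: x) ord0 i) (x ord0 i).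
  have -> : (fun s : R => (s *: x) ord0 i) = (fun s => x ord0 i * s + 0).
    by apply/funext => s; rewrite mxE addr0 mulrC.
  exact: affine_derive.
have := @C1on_chain R n off0 a da (fun s => s *: x) (fun i => x ord0 i) 1 (@open_ne0 R n) h2.
rewrite /= scale1r => /(_ x0 g1) d1.
have d2 : is_derive (1 : R) (1 : R) (a \o (fun s : R => s *: x)) (0 : R).
  have c1 : is_derive (1 : R) (1 : R) (cst (a x) : R -> R) (0 : R) by exact: is_derive_cst.
  apply: near_eq_is_derive c1; near=> s; rewrite /= h1//; near: s.
  by apply: (cvgr_gt (1 : R) (@cvg_id _ (nbhs (1 : R)))); exact: ltr01.
transitivity (\sum_i da i x * x ord0 i); first by apply: eq_bigr => i _; rewrite mulrC.
by case: d1 => _ <-; case: d2 => _ <-.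
Unshelve. all: by end_near. Qed.

Section Hom2.
Variables (a : V -> R) (da : I -> V -> R) (dda : I -> I -> V -> R).
Hypothesis aH : hom2 a da dda.

Lemma hom2_da t x k : 0 < t -> x != 0 -> da k (t *: x) = t^-1 * da k x.
Proof.
case: aH => h1 h2 _ t0 x0; rewrite (@hom_diff a da t 1)// ?mulr1// => y _.
by rewrite mul1r h1.
Qed.

Lemma hom2_dda t x i k : 0 < t -> x != 0 -> dda i k (t *: x) = t ^- 2 * dda i k x.
Proof.
case: aH => h1 h2 h3 t0 x0; rewrite (@hom_diff (da i) (dda i) t t^-1)// -?invfM// => y y0.
exact: hom2_da.
Qed.

Lemma hom2_euler x : x != 0 -> \sum_i x ord0 i * da i x = 0.
Proof. by case: aH => h1 h2 _; exact: (hom0_euler h1 h2). Qed.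

End Hom2.

(* [Tmap a] is the 1-homogeneous extension of the gradient of the support function [enorm x * a x] *)
Definition Tmap a da (i : I) (x : V) : R := a x * x ord0 i + q x * da i x.
(** The value at 0, where a 0-homogeneous function has no derivatives in general, is set to the
    identity; closeness to the identity then holds at every point. *)
Definition dTmap a da dda (i k : I) (x : V) : R := if x == 0 then (k == i)%:R else
  a x * (k == i)%:R + x ord0 i * da k x + (q x * dda i k x + da i x * (2 * x ord0 k)).
Definition Jac a da dda (x : V) := \det (\matrix_(i, j) dTmap a da dda i j x).

Lemma Tmap_C1 a da dda i : hom2 a da dda -> C1on off0 (Tmap a da i) (dTmap a da dda i).
Proof.
move=> [_ h2 h3].
have := C1onD (C1onM (@open_ne0 R n) h2 (@C1on_coord R n off0 i))
  (C1onM (@open_ne0 R n) (@C1on_q R n off0) (h3 i)).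
apply: C1on_local => // [|k x]; first exact: open_ne0.
by rewrite /dTmap /= => /negbTE ->.
Qed.

(** C^2 closeness to 1, asked on the unit sphere only; homogeneity spreads it to bounds on [a - 1],
    [|x| da] and [|x|^2 dda] everywhere off 0. *)
Definition nice e a da dda := hom2 a da dda /\ forall x, q x = 1 ->
  [/\ `|a x - 1| <= e, forall i, `|da i x| <= e & forall i k, `|dda i k x| <= e].

Lemma normalize_q (x : V) : x != 0 -> q ((enorm x)^-1 *: x) = 1.
Proof.
move=> x0; rewrite /q !dotpE mulrA -invfM -expr2 sqr_sqrtr ?dotp_ge0//.
by rewrite mulVf// dotp_eq0.
Qed.

Lemma enorm_gt0 (x : V) : x != 0 -> 0 < enorm x.
Proof. by move=> x0; rewrite sqrtr_gt0 -/(q x) q_gt0. Qed.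
Lemma enorm_sqr (x : V) : enorm x ^+ 2 = q x.
Proof. by rewrite sqr_sqrtr ?dotp_ge0. Qed.
Lemma enorm_ge0 (x : V) : 0 <= enorm x. Proof. exact: sqrtr_ge0. Qed.
Lemma coord_le_enorm (x : V) i : `|x ord0 i| <= enorm x.
Proof.
rewrite -ler_sqr ?nnegrE ?enorm_ge0// enorm_sqr (le_trans _ (norm_le_q x))//.
by rewrite ler_sqr ?nnegrE// coord_le_norm.
Qed.
Lemma enorm_le_norm (x : V) : enorm x <= n.+1%:R * `|x|.
Proof.
rewrite -ler_sqr ?nnegrE ?enorm_ge0 ?mulr_ge0// enorm_sqr (le_trans (q_le_norm x))//.
have N1 : 1 <= n.+1%:R :> R by rewrite ler1n.
by rewrite exprMn ler_wpM2r ?sqr_ge0// expr2 ler_peMl//; lra.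
Qed.

Section Nice.
Variables (e : R) (a : V -> R) (da : I -> V -> R) (dda : I -> I -> V -> R).
Hypothesis aN : nice e a da dda.

Lemma nice_ge0 : 0 <= e.
Proof.
have [_ h] := aN; have [+ _ _] := h (delta_mx ord0 ord0) (dotp_ei _ ord0).
exact: le_trans.
Qed.

Lemma nice_val x : x != 0 -> `|a x - 1| <= e.
Proof.
move=> x0; case: aN => [[h1 _ _] h]; have [+ _ _] := h _ (normalize_q x0).
by rewrite h1// invr_gt0 enorm_gt0.
Qed.

Lemma nice_da x i : x != 0 -> `|da i x| * enorm x <= e.
Proof.
move=> x0; have [ah h] := aN; have [_ + _] := h _ (normalize_q x0).
move/(_ i); rewrite (hom2_da ah)// ?invr_gt0 ?enorm_gt0// invrK normrM.
by rewrite ger0_norm ?enorm_ge0// mulrC.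
Qed.

Lemma nice_dda x i k : x != 0 -> `|dda i k x| * q x <= e.
Proof.
move=> x0; have [ah h] := aN; have [_ _ +] := h _ (normalize_q x0).
move/(_ i k); rewrite (hom2_dda ah)// ?invr_gt0 ?enorm_gt0// exprVn invrK normrM.
by rewrite enorm_sqr (ger0_norm (q_ge0 x)) mulrC.
Qed.

Lemma Tmap_near i x : `|Tmap a da i x - x ord0 i| <= 2 * e * enorm x.
Proof.
have [->|x0] := eqVneq x 0.
  rewrite /Tmap q0 mul0r !mxE mulr0 addr0 subrr normr0.
  by rewrite mulr_ge0 ?enorm_ge0// mulr_ge0// nice_ge0.
have -> : Tmap a da i x - x ord0 i = (a x - 1) * x ord0 i + q x * da i x by rewrite /Tmap; ring.
rewrite (le_trans (ler_normD _ _))// !normrM.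
have h1 : `|a x - 1| * `|x ord0 i| <= e * enorm x.
  by rewrite ler_pM ?nice_val ?coord_le_enorm.
have h2 : `|q x| * `|da i x| <= enorm x * e.
  rewrite ger0_norm ?q_ge0// -enorm_sqr expr2 -mulrA ler_wpM2l ?enorm_ge0// mulrC.
  exact: nice_da.
lra.
Qed.

Lemma dTmap_near i k x : `|dTmap a da dda i k x - (i == k)%:R| <= 5 * e.
Proof.
have e0 := nice_ge0; rewrite /dTmap; case: eqVneq => [_|x0].
  by rewrite eq_sym subrr normr0 mulr_ge0.
have -> : a x * (k == i)%:R + x ord0 i * da k x + (q x * dda i k x + da i x * (2 * x ord0 k)) - (i == k)%:R =
  (a x - 1) * (i == k)%:R + x ord0 i * da k x + (dda i k x * q x + 2 * (da i x * x ord0 k)).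
  by rewrite eq_sym; ring.
have h1 : `|(a x - 1) * (i == k)%:R| <= e.
  rewrite normrM; case: (i == k); rewrite ?normr1 ?normr0 ?mulr0// mulr1; exact: nice_val.
have h2 j l : `|da j x * x ord0 l| <= e.
  by rewrite normrM (le_trans _ (nice_da j x0))// ler_wpM2l// coord_le_enorm.
have h3 : `|dda i k x * q x| <= e by rewrite normrM (ger0_norm (q_ge0 x)) nice_dda.
have h4 := h2 i k; have h5 : `|x ord0 i * da k x| <= e by rewrite mulrC.
move: h1 h3 h4 h5; rewrite !ler_norml; set A := _ * (i == k)%:R; set B := dda i k x * _.
set D := da i x * _; set E := _ * da k x.
move=> /andP[? ?] /andP[? ?] /andP[? ?] /andP[? ?]; apply/andP; split; lra.
Qed.

Lemma Jac_near K : (forall (M : 'M[R]_n.+1) d, 0 <= d -> d <= 1 ->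
  (forall i j, `|M i j - (i == j)%:R| <= d) -> `|\det M - 1| <= K * d) -> e <= 1 / 5 ->
  forall x, `|Jac a da dda x - 1| <= K * (5 * e).
Proof.
move=> HK e5 x; apply: HK; [by rewrite mulr_ge0// nice_ge0|lra|].
by move=> i j; rewrite mxE; exact: dTmap_near.
Qed.

Lemma Tmap_seg (s : R) x : 8 * n.+1%:R * e <= 1 -> 0 <= s <= 1 ->
  1 / 2 * `|x| <= `|(1 - s) *: x + s *: (\row_i Tmap a da i x : V)|.
Proof.
move=> eN /andP[s0 s1].
have -> : (1 - s) *: x + s *: (\row_i Tmap a da i x : V) = x + s *: \row_i (Tmap a da i x - x ord0 i).
  by apply/rowP => i; rewrite !mxE; ring.
have h : `|(\row_i (Tmap a da i x - x ord0 i) : V)| <= 1 / 2 * `|x|.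
  apply: norm_le_coord => i; rewrite mxE (le_trans (Tmap_near i x))//.
  have := enorm_le_norm x; have := nice_ge0; have := normr_ge0 x; set N := n.+1%:R in eN *.
  move=> x0 e0 xn; apply: (@le_trans _ _ (2 * e * (N * `|x|))).
    by rewrite ler_wpM2l// mulr_ge0.
  have -> : 2 * e * (N * `|x|) = (8 * N * e) * (1 / 4 * `|x|) by field.
  apply: (@le_trans _ _ (1 * (1 / 4 * `|x|))); last lra.
  by rewrite ler_wpM2r// mulr_ge0.
have hs : `|s *: (\row_i (Tmap a da i x - x ord0 i) : V)| <= 1 / 2 * `|x|.
  by rewrite normrZ ger0_norm// (le_trans _ h)// ler_piMl.
have := ler_normB (x + s *: (\row_i (Tmap a da i x - x ord0 i) : V)) (s *: (\row_i (Tmap a da i x - x ord0 i) : V)).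
rewrite addrK; lra.
Qed.

Lemma Tmap_bounds : e <= 1 -> exists C,
  (forall i x, `|Tmap a da i x| <= C * `|x|) /\ (forall i k x, `|dTmap a da dda i k x| <= C).
Proof.
move=> e1; have e0 := nice_ge0; have N1 : 1 <= n.+1%:R :> R by rewrite ler1n.
exists (1 + 5 * n.+1%:R); split=> [i x|i k x].
  have := Tmap_near i x; have := enorm_le_norm x; have := coord_le_norm x i.
  have x0 := normr_ge0 x; have r0 := enorm_ge0 x.
  have h := ler_normD (Tmap a da i x - x ord0 i) (x ord0 i); rewrite subrK in h.
  move=> h1 h2 h3.
  have h4 : 2 * e * enorm x <= 2 * (n.+1%:R * `|x|).
    by rewrite -mulrA ler_wpM2l// (le_trans _ h2)// ler_piMl.
  have h5 : 0 <= n.+1%:R * `|x| by rewrite mulr_ge0.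
  lra.
have h := ler_normD (dTmap a da dda i k x - (i == k)%:R) ((i == k)%:R); rewrite subrK in h.
have h1 := dTmap_near i k x.
have h2 : `|(i == k)%:R : R| <= 1 by case: (i == k); rewrite ?normr1 ?normr0.
lra.
Qed.

End Nice.
End HomogeneousFunctions.

(** * Second-order radial comparison of Wulff shapes *)

Section Pointwise.
Variables (R : realType) (n : nat).
Notation V := 'rV[R]_n.+1.
Notation I := 'I_n.+1.
Notation off0 := [set x : V | x != 0].
Notation N := (n.+1%:R : R).
Implicit Types (x y u v w : V) (t s e d : R).

Lemma C1on_dir U (f : V -> R) df x v : open U -> C1on U f df -> U x ->
  is_derive x v f (\sum_i df i x * v ord0 i).
Proof.
move=> oU fC Ux; apply: is_derive_line0.
have := @C1on_chain R n U f df (fun s => x + s *: v) (fun i => v ord0 i) 0 oU fC.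
rewrite scale0r addr0 => /(_ Ux); apply => i.
have -> : (fun s : R => (x + s *: v) ord0 i) = (fun s => v ord0 i * s + x ord0 i).
  by apply/funext => s; rewrite !mxE addrC mulrC.
exact: affine_derive.
Qed.

Definition grad (da : I -> V -> R) x : V := \row_i da i x.

Lemma dotp_grad da x v : dotp (grad da x) v = \sum_i da i x * v ord0 i.
Proof. by apply: eq_bigr => i _; rewrite mxE. Qed.

Lemma grad_ort a da dda x : hom2 a da dda -> x != 0 -> dotp (grad da x) x = 0.
Proof.
move=> aH x0; rewrite dotp_grad -[RHS](hom2_euler aH x0).
by apply: eq_bigr => i _; rewrite mulrC.
Qed.

Lemma q1_neq0 x : q x = 1 -> x != 0.
Proof. by move=> h; apply/eqP => x0; move: h; rewrite x0 q0 => /eqP; rewrite eq_sym oner_eq0. Qed.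

Lemma coord2_le_q x i k : `|x ord0 i| * `|x ord0 k| <= q x.
Proof. by rewrite -enorm_sqr expr2 ler_pM ?coord_le_enorm. Qed.

Lemma q_line u v s : q (u + s *: v) = q u + s * (2 * dotp u v) + s ^+ 2 * q v.
Proof. by rewrite /q !dotpE (dotpC v u); ring. Qed.

Lemma dotp_sqZD t x y : dotp (t *: x + y) (t *: x + y) =
  t ^+ 2 * dotp x x + 2 * t * dotp x y + dotp y y.
Proof. by rewrite !dotpE (dotpC y x); ring. Qed.

(** Taylor expansion along the chord from [u] to [v], with a gradient orthogonal to [u]. If the
    squared chord length is at most 1, the points used stay where [q >= 3 / 4], so the Hessian bound
    worsens by less than a factor 2; longer chords are covered by the crude bounds on [b] and
    [db]. *)
Lemma nice_taylor e b db ddb u v : nice e b db ddb -> q u = 1 -> q v = 1 ->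
  `|b v - b u - dotp (grad db u) v| <= 4 * N ^+ 2 * e * q (v - u).
Proof.
move=> bN u1 v1; have e0 := nice_ge0 bN; have u0 := q1_neq0 u1; have v0 := q1_neq0 v1.
have N1 : 1 <= N by rewrite ler1n.
have [bH _] := bN; have [_ bC dbC] := bH.
pose d := v - u; rewrite -/d.
have ud : 2 * dotp u d = - q d.
  have : q v = q u + 2 * dotp u d + q d.
    by have := q_line u d 1; rewrite scale1r [u + d]addrC subrK mul1r expr1n mul1r.
  rewrite u1 v1; lra.
have qz s : q (u + s *: d) = 1 - s * (1 - s) * q d.
  by rewrite q_line u1 ud; ring.
have gd : dotp (grad db u) d = dotp (grad db u) v by rewrite dotpBr (grad_ort bH u0) subr0.
have [d1|d1] := lerP (q d) 1; last first.
  have h1 := nice_val bN u0; have h2 := nice_val bN v0.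
  have h3 : `|dotp (grad db u) v| <= N * e.
    rewrite dotp_grad (le_trans (ler_norm_sum _ _ _))// (@le_trans _ _ (\sum_(i < n.+1) e))//; last first.
      by rewrite sumr_const card_ord mulr_natl.
    apply: ler_sum => i _; rewrite normrM -[leRHS]mulr1 ler_pM//.
      by have := nice_da bN i u0; rewrite /enorm -/(q u) u1 sqrtr1 mulr1.
    by have := coord_le_enorm v i; rewrite /enorm -/(q v) v1 sqrtr1.
  have h4 : 4 * N ^+ 2 * e <= 4 * N ^+ 2 * e * q d.
    by rewrite ler_peMr ?mulr_ge0 ?sqr_ge0// ltW.
  have h5 : (2 + N) * e <= 4 * N ^+ 2 * e by rewrite ler_wpM2r//; nra.
  move: h1 h2 h3; rewrite !ler_norml => /andP[? ?] /andP[? ?] /andP[? ?].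
  by apply/andP; split; lra.
have zq s : `|s| <= 1 -> 3 / 4 <= q (u + s *: d).
  rewrite ler_norml => /andP[s1 s2]; rewrite qz; have d0 := q_ge0 d.
  have : 0 <= (1 / 4 - s * (1 - s)) * q d.
    by rewrite mulr_ge0//; have := sqr_ge0 (1 - 2 * s); lra.
  lra.
have z0 s : `|s| <= 1 -> u + s *: d != 0.
  move=> s1; apply/eqP => z0; have := zq s s1; rewrite z0 q0; lra.
pose D z := \sum_i db i z * d ord0 i.
pose D2 z := \sum_i (\sum_k ddb i k z * d ord0 k) * d ord0 i.
have h1 : exists2 c, `|c| <= `|1 : R| & b (u + 1 *: d) - b u = D (u + c *: d) * 1.
  apply: line_mvt_loc => s; rewrite normr1 => s1.
  exact: (C1on_dir _ (@open_ne0 R n) bC (z0 s s1)).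
have [c c1 e1] := h1; rewrite normr1 in c1.
have h2 : exists2 c', `|c'| <= `|c| & D (u + c *: d) - D u = D2 (u + c' *: d) * c.
  apply: line_mvt_loc => s sc; have s1 : `|s| <= 1 := le_trans sc c1.
  have DC : C1on off0 D (fun k z => \sum_i d ord0 i * ddb i k z).
    apply: (C1on_ext _ _ (C1on_sum (index_enum I) (fun i => C1onZ (d ord0 i) (dbC i)))) => //.
    by move=> z; apply: eq_bigr => i _; rewrite mulrC.
  have := C1on_dir d (@open_ne0 R n) DC (z0 s s1).
  congr is_derive; rewrite /D2; under eq_bigr do rewrite mulr_suml.
  rewrite exchange_big; apply: eq_bigr => i _; rewrite mulr_suml; apply: eq_bigr => k _; ring.
have [c' c1' e2] := h2.
rewrite scale1r mulr1 [u + d]addrC subrK in e1.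
have -> : b v - b u - dotp (grad db u) v = D2 (u + c' *: d) * c.
  by rewrite e1 -gd dotp_grad -e2.
have z2 : `|D2 (u + c' *: d)| <= N ^+ 2 * (2 * e * q d).
  have c'1 := le_trans c1' c1; have zz := zq _ c'1.
  rewrite /D2 (le_trans (ler_norm_sum _ _ _))//.
  have h i k : `|ddb i k (u + c' *: d) * d ord0 k * d ord0 i| <= 2 * e * q d.
    rewrite !normrM -mulrA ler_pM//; last exact: coord2_le_q.
    have := nice_dda bN i k (z0 _ c'1); have := normr_ge0 (ddb i k (u + c' *: d)).
    by move: zz e0; move: (q _) `|ddb i k _| => Q X; nra.
  apply: (@le_trans _ _ (\sum_(i < n.+1) \sum_(k < n.+1) (2 * e * q d))).
    apply: ler_sum => i _; rewrite mulr_suml (le_trans (ler_norm_sum _ _ _))//.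
    by apply: ler_sum => k _; exact: h.
  by rewrite !sumr_const !card_ord -mulrnA -[leLHS]mulr_natl natrM expr2.
rewrite normrM (@le_trans _ _ (N ^+ 2 * (2 * e * q d)))//.
  by rewrite -[leRHS]mulr1 ler_pM.
have : 0 <= N ^+ 2 * (2 * e * q d) by rewrite !mulr_ge0// ?sqr_ge0// q_ge0.
lra.
Qed.

Section Inequalities.
Variables (u A B : V) (a b d f g : R).
Hypotheses (d0 : 0 <= d) (d1 : d <= 1 / 100) (u1 : dotp u u = 1).
Hypotheses (ad : `|a - 1| <= d) (bd : `|b - 1| <= d).
Hypotheses (Au : dotp A u = 0) (Bu : dotp B u = 0).
Hypotheses (Ad : dotp A A <= d ^+ 2) (Bd : dotp B B <= d ^+ 2).

Local Notation P := (B - A).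
Hypotheses (fE : f = b - a) (gE : g = dotp P P).
Local Ltac pull0 := move: (d0) (d1) (fE) => ? ? ?.
Let a0 : 99 / 100 <= a. Proof. pull0; by move: ad; rewrite ler_norml => /andP[? ?]; lra. Qed.
Let a2 : a <= 1 + d. Proof. by move: ad; rewrite ler_norml => /andP[? ?]; lra. Qed.
Let a3 : 1 - d <= a. Proof. by move: ad; rewrite ler_norml => /andP[? ?]; lra. Qed.
Let b2 : b <= 1 + d. Proof. by move: bd; rewrite ler_norml => /andP[? ?]; lra. Qed.
Let b3 : 1 - d <= b. Proof. by move: bd; rewrite ler_norml => /andP[? ?]; lra. Qed.
Let g0 : 0 <= g. Proof. by rewrite gE dotp_ge0. Qed.
Let gle : g <= 4 * d ^+ 2.
Proof.
have := dotp_ge0 (B + A); rewrite gE !dotpE (dotpC B A); move: Ad Bd; lra.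
Qed.
Local Ltac pull1 := pull0; move: (a0) (a2) (a3) (b2) (b3) (g0) (gle) => ? ? ? ? ? ? ?.
Let f2 : f ^+ 2 <= 4 * d ^+ 2.
Proof.
pull1.
have h1 : - (2 * d) <= f <= 2 * d by apply/andP; split; lra.
by case/andP: h1 => h1 h2; nra.
Qed.
Let f20 : 0 <= f ^+ 2. Proof. exact: sqr_ge0. Qed.
Local Ltac pull := pull1; move: (f2) (f20) => ? ?.
Let fa2 : (f / a) ^+ 2 <= 11 / 10 * f ^+ 2.
Proof.
pull.
rewrite expr_div_n ler_pdivrMr; last by rewrite exprn_gt0//; lra.
have : 98 / 100 <= a ^+ 2 by nra.
by move=> h; nra.
Qed.

Let small_kappa k : - (7 / 10 * (f ^+ 2 + g)) <= k <= 7 / 10 * (f ^+ 2 + g) ->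
  (f / a - k) ^+ 2 <= 3 * (f ^+ 2 + g).
Proof.
pull; move=> /andP[k1 k2]; have h : f ^+ 2 + g <= 8 * d ^+ 2 by lra.
have h2 : f ^+ 2 + g <= 1 / 1000 by nra.
have kk : k ^+ 2 <= 1 / 100 * (f ^+ 2 + g).
  set S := f ^+ 2 + g in k1 k2 h h2 *; have S0 : 0 <= S by rewrite /S; lra.
  have : k ^+ 2 <= (7 / 10 * S) ^+ 2 by nra.
  nra.
have := sqr_ge0 (f / a + k); move: fa2; set F := f / a; lra.
Qed.

Let cross l z D : z ^+ 2 <= d ^+ 2 * D -> 0 <= D -> `|2 * (l * z)| <= d * (l ^+ 2 + D).
Proof.
move=> zD D0; rewrite -ler_sqr ?nnegrE//; last by rewrite mulr_ge0// addr_ge0// sqr_ge0.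
rewrite real_normK ?num_real//.
have : 0 <= d ^+ 2 * (l ^+ 2 - D) ^+ 2 by rewrite mulr_ge0 ?sqr_ge0.
have : l ^+ 2 * z ^+ 2 <= l ^+ 2 * (d ^+ 2 * D) by rewrite ler_wpM2l ?sqr_ge0.
lra.
Qed.

(** In direction [a u + A] the radial function of the Wulff shape of [b] is the minimum over [v] of
    [b v / <a u + A, v>]. With [w = v - u] and the factor [1 + f / a - k], the slack is to second
    order [k + <P, w> + |w|^2 / 2]. Its minimum is at [w = - P] and vanishes for [k = g / 2]. *)
Lemma pointwise_lower v bv : dotp v v = 1 -> b + dotp B v - d * dotp (v - u) (v - u) <= bv ->
  (1 + f / a - g / 2 - 10 * d * (f ^+ 2 + g)) * dotp (a *: u + A) v <= bv.
Proof.
pull; move=> v1 hb; set w := v - u in hb; set D := dotp w w in hb.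
have D0 : 0 <= D by exact: dotp_ge0.
have uv : dotp u v = 1 - D / 2.
  by rewrite /D /w !dotpE u1 v1 (dotpC v u); lra.
pose z := dotp A w.
have Av : dotp A v = z by rewrite /z /w dotpBr Au subr0.
have Bv : dotp B v = dotp P w + z.
  by rewrite /z /w !dotpE Au Bu; lra.
pose k := g / 2 + 10 * d * (f ^+ 2 + g).
pose L := 1 + f / a - k.
have -> : 1 + f / a - g / 2 - 10 * d * (f ^+ 2 + g) = L by rewrite /L /k; ring.
have S0 : 0 <= f ^+ 2 + g by lra.
have dS : 10 * d * (f ^+ 2 + g) <= 1 / 10 * (f ^+ 2 + g) by rewrite ler_wpM2r//; lra.
have dS0 : 0 <= d * (f ^+ 2 + g) by rewrite mulr_ge0.
have kb : 0 <= k <= 7 / 10 * (f ^+ 2 + g) by rewrite /k; apply/andP; split; lra.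
have kd : k <= 6 * d ^+ 2 by case/andP: kb => _; lra.
have [k0 k7] := andP kb.
have L2 : (L - 1) ^+ 2 <= 3 * (f ^+ 2 + g).
  have -> : L - 1 = f / a - k by rewrite /L; ring.
  apply: small_kappa; apply/andP; split; lra.
have zD : z ^+ 2 <= d ^+ 2 * D.
  by rewrite (le_trans (dotp_CS _ _))// ler_wpM2r.
have := cross (L - 1) zD D0; rewrite ler_norml => /andP[_ hz].
have aL : a * L = b - a * k by rewrite /L fE; field; lra.
rewrite !dotpE uv Av.
(* Completing the square in [t P + w] has to leave a coefficient of [D] slightly below [1 / 2]. The
   slack [6 * d] works because [(1 + 6 d) (1 - 5.6 d) >= 1] for [0 <= d <= 1 / 100]. *)
pose t := 1 + 6 * d.
have hP : 0 <= t ^+ 2 * g + 2 * t * dotp P w + D.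
  by have := dotp_ge0 (t *: P + w); rewrite dotp_sqZD -gE.
have t0 : 0 < t by rewrite /t; lra.
have hP2 : - (dotp P w) <= t * g / 2 + D * (1 / 2 - 28 / 10 * d).
  rewrite -(ler_pM2l (_ : 0 < 2 * t)); last by rewrite mulr_gt0.
  have : D <= 2 * t * (D * (1 / 2 - 28 / 10 * d)).
    have -> : 2 * t * (D * (1 / 2 - 28 / 10 * d)) = D * ((1 + 6 * d) * (1 - 56 / 10 * d)) by rewrite /t; field.
    by rewrite ler_peMr//; nra.
  move: hP; lra.
have -> : L * (a * (1 - D / 2) + z) = (a * L) * (1 - D / 2) + (L - 1) * z + z by ring.
rewrite aL; apply: le_trans hb; rewrite Bv.
have h3 : (1 / 2 - 6 / 10 * d) * D <= (b - a * k) * (D / 2).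
  have h : a * k <= 2 * (6 * d ^+ 2) by rewrite ler_pM//; lra.
  have h' : 12 * d ^+ 2 <= 12 / 100 * d by nra.
  have : 0 <= (b - a * k - (1 - 12 / 10 * d)) * D by rewrite mulr_ge0//; lra.
  lra.
have h4 : (1 - d) * k <= a * k by rewrite ler_wpM2r.
have h5 : (1 - d) * k = k - d * k by ring.
have h6 : d * k <= d * (7 / 10 * (f ^+ 2 + g)) by rewrite ler_wpM2l.
have h7 : d * (L - 1) ^+ 2 <= d * (3 * (f ^+ 2 + g)) by rewrite ler_wpM2l.
have h8 : 0 <= d * f ^+ 2 by rewrite mulr_ge0.
have h9 : 0 <= d * g by rewrite mulr_ge0.
have h10 : 0 <= d * D by rewrite mulr_ge0.
move: hz hP2 h3 h4 h5 h6 h7; rewrite /k /t; lra.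
Qed.

(** The witness is the unit vector along [u - P], the second-order minimiser of the slack in the
    lower bound; the single constraint at this [v] already caps the radial function. *)
Lemma pointwise_upper : exists2 v, dotp v v = 1 &
  forall bv, bv <= b + dotp B v + d * dotp (v - u) (v - u) ->
  0 < dotp (a *: u + A) v /\
  bv <= (1 + f / a - g / 2 + 10 * d * (f ^+ 2 + g)) * dotp (a *: u + A) v.
Proof.
pull; pose s := Num.sqrt (1 + g).
have s2 : s ^+ 2 = 1 + g by rewrite sqr_sqrtr//; lra.
have s1 : 1 <= s by rewrite -sqrtr1 ler_wsqrtr//; lra.
have s0 : s != 0 by apply/eqP => h; move: s1; rewrite h; lra.
have Pu : dotp P u = 0 by rewrite !dotpE Au Bu subrr.
have v1 : dotp (s^-1 *: (u - P)) (s^-1 *: (u - P)) = 1.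
  have uP : dotp (u - P) (u - P) = 1 + g.
    have := dotp_sqZD (-1) P u; rewrite scaleN1r [- P + u]addrC -gE u1 Pu => ->; ring.
  rewrite dotpZl dotpZr uP (_ : _ * _ = (1 + g) / s ^+ 2); last by field.
  by rewrite s2 divff//; apply/eqP; lra.
set v := s^-1 *: (u - P) in v1.
exists v => // bv hb.
have uv : dotp u v = s^-1 by rewrite /v dotpZr dotpBr u1 (dotpC u) Pu subr0 mulr1.
pose z := dotp A P.
have sAv : s * dotp A v = - z by rewrite /v dotpZr dotpBr Au sub0r mulrA divff// mul1r.
have sBv : s * dotp B v = - z - g.
  by rewrite /v dotpZr dotpBr Bu sub0r mulrA divff// mul1r /z gE !dotpE (dotpC A B); lra.
have sy : s * dotp (a *: u + A) v = a - z.
  by rewrite dotpDl dotpZl uv mulrDr sAv mulrCA divff// mulr1.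
have zz : z ^+ 2 <= d ^+ 2 * g by rewrite (le_trans (dotp_CS _ _))// -gE ler_wpM2r.
have zs : z <= 1 / 2.
  have dd : d ^+ 2 <= 1 / 10 by nra.
  have g4 : g <= 1 by lra.
  have : d ^+ 2 * g <= 1 / 10 * 1 by rewrite ler_pM ?sqr_ge0.
  have {}zz := zz; move=> hh; have : z ^+ 2 <= 1 / 4 by lra.
  by move=> h; rewrite leNgt; apply/negP => hz; nra.
have sp : 0 < s by lra.
split; first by rewrite -(pmulr_rgt0 _ sp) sy; lra.
rewrite -(ler_pM2l sp) mulrCA sy.
have sle : s <= 1 + g / 2.
  rewrite -ler_sqr ?nnegrE ?s2; [have := sqr_ge0 g; lra|lra|lra].
have hs : s * dotp (v - u) (v - u) <= g.
  have -> : dotp (v - u) (v - u) = 2 - 2 * s^-1.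
    by rewrite dotpBl !dotpBr v1 u1 (dotpC v u) uv; lra.
  by rewrite mulrBr mulrCA divff// mulr1; lra.
have hb2 : s * bv <= b - g / 2 + 3 / 2 * (d * g) - z.
  have : s * bv <= s * (b + dotp B v + d * dotp (v - u) (v - u)) by rewrite ler_wpM2l// ltW.
  have : d * (s * dotp (v - u) (v - u)) <= d * g by rewrite ler_wpM2l.
  have : s * b <= (1 + g / 2) * b by rewrite ler_wpM2r//; lra.
  have : g * b <= g * (1 + d) by rewrite ler_wpM2l.
  move=> h1 h2 h3 h4; apply: le_trans h4 _.
  rewrite !mulrDr sBv; move: h1 h2 h3; lra.
apply: le_trans hb2 _.
pose k := g / 2 - 10 * d * (f ^+ 2 + g).
pose L := 1 + f / a - k.
have -> : 1 + f / a - g / 2 + 10 * d * (f ^+ 2 + g) = L by rewrite /L /k; ring.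
have S0 : 0 <= f ^+ 2 + g by lra.
have dS : 10 * d * (f ^+ 2 + g) <= 1 / 10 * (f ^+ 2 + g) by rewrite ler_wpM2r//; lra.
have dS0 : 0 <= d * (f ^+ 2 + g) by rewrite mulr_ge0.
have L2 : (L - 1) ^+ 2 <= 3 * (f ^+ 2 + g).
  have -> : L - 1 = f / a - k by rewrite /L; ring.
  apply: small_kappa; rewrite /k; apply/andP; split; lra.
have aL : a * L = b - a * k by rewrite /L fE; field; lra.
have -> : L * (a - z) = a * L - (L - 1) * z - z by ring.
rewrite aL; have := cross (L - 1) zz g0; rewrite ler_norml => /andP[_ hz].
have h4 : a * (g / 2) <= (1 + d) * (g / 2) by rewrite ler_wpM2r//; lra.
have h5 : (1 - d) * (10 * d * (f ^+ 2 + g)) <= a * (10 * d * (f ^+ 2 + g)).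
  by rewrite ler_wpM2r//; lra.
have h7 : d * (L - 1) ^+ 2 <= d * (3 * (f ^+ 2 + g)) by rewrite ler_wpM2l.
have h8 : 0 <= d * f ^+ 2 by rewrite mulr_ge0.
have h9 : 0 <= d * g by rewrite mulr_ge0.
have h11 : d * (d * (f ^+ 2 + g)) <= 1 / 100 * (d * (f ^+ 2 + g)) by rewrite ler_wpM2r.
move: hz h4 h5 h7 h11; rewrite /k; lra.
Qed.

End Inequalities.

Section Wulff.
Variables (e d : R) (a b : V -> R) (da db : I -> V -> R) (dda ddb : I -> I -> V -> R).
Hypotheses (aN : nice e a da dda) (bN : nice e b db ddb).
Hypotheses (ed : 4 * N ^+ 2 * e <= d) (d1 : d <= 1 / 100).

(** The squared length of the spherical gradient: [da] is homogeneous of degree -1 and orthogonal to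
    [x], and the factor [q x] restores degree 0. *)
Definition gsq (da : I -> V -> R) x := q x * \sum_i da i x ^+ 2.

Let e0 : 0 <= e. Proof. exact: nice_ge0 aN. Qed.
Let N1 : 1 <= N. Proof. by rewrite ler1n. Qed.
Let eNd : N * e <= d /\ e <= d /\ 0 <= d.
Proof.
move: (e0) (N1) (ed) (d1) => ? ? ? ?.
have h : N <= 4 * N ^+ 2 by nra.
have h1 : N * e <= 4 * N ^+ 2 * e by rewrite ler_wpM2r.
have h2 : e <= N * e by rewrite ler_peMl.
by split; [|split]; lra.
Qed.

Lemma grad_small e' a' da' dda' u : N * e' <= d -> nice e' a' da' dda' -> q u = 1 ->
  dotp (grad da' u) (grad da' u) <= d ^+ 2.
Proof.
move: (e0) (N1) (ed) (d1) => ? ? ? ?.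
move=> h aN' u1; have u0 := q1_neq0 u1; have e0' := nice_ge0 aN'.
apply: (@le_trans _ _ ((N * e') ^+ 2)); last by rewrite ler_sqr ?nnegrE ?mulr_ge0//; case: eNd => _ [].
rewrite dotp_grad (@le_trans _ _ (\sum_(i < n.+1) e' ^+ 2))//; last first.
  rewrite sumr_const card_ord -[leLHS]mulr_natl exprMn ler_wpM2r ?sqr_ge0//; nra.
apply: ler_sum => i _; rewrite mxE -expr2 -real_normK ?num_real// ler_sqr ?nnegrE//.
by have := nice_da aN' i u0; rewrite /enorm -/(q u) u1 sqrtr1 mulr1.
Qed.

(** The radial function of [wulff b] in the coordinates [Tmap a], to second order; [s = 1] gives the
    upper and [s = -1] the lower bound. *)
Definition Lam (s : R) x := 1 + (b x - a x) / a x - gsq (fun i x => db i x - da i x) x / 2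
  + s * (10 * d * ((b x - a x) ^+ 2 + gsq (fun i x => db i x - da i x) x)).

Let gsqE u : q u = 1 -> dotp (grad db u - grad da u) (grad db u - grad da u) =
  gsq (fun i x => db i x - da i x) u.
Proof. by move=> u1; rewrite /gsq u1 mul1r /dotp; apply: eq_bigr => i _; rewrite !mxE -expr2. Qed.

Let rowT u : q u = 1 -> (\row_i Tmap a da i u : V) = a u *: u + grad da u.
Proof. by move=> u1; apply/rowP => i; rewrite !mxE /Tmap u1 mul1r. Qed.

Lemma sphereE v : sphere v <-> q v = 1.
Proof.
rewrite /sphere /=; split=> [h|h]; first by rewrite -enorm_sqr h expr1n.
by rewrite /enorm -/(q v) h sqrtr1.
Qed.

Lemma wulff_lower u : q u = 1 -> wulff b (Lam (-1) u *: (\row_i Tmap a da i u)).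
Proof.
move=> u1 v /sphereE v1; rewrite rowT// dotpZl.
have [h1 [h2 h3]] := eNd; have u0 := q1_neq0 u1; have v0 := q1_neq0 v1.
have := @pointwise_lower u (grad da u) (grad db u) (a u) (b u) d _ _ h3 d1 u1
  (le_trans (nice_val aN u0) h2) (le_trans (nice_val bN u0) h2) (grad_ort (proj1 aN) u0)
  (grad_ort (proj1 bN) u0) (grad_small h1 aN u1) (grad_small h1 bN u1) erefl (esym (gsqE u1)) v (b v) v1.
rewrite /Lam mulN1r; apply.
have := nice_taylor bN u1 v1; rewrite ler_norml => /andP[h _].
have : 4 * N ^+ 2 * e * q (v - u) <= d * q (v - u) by rewrite ler_wpM2r// q_ge0.
rewrite -/(q (v - u)); lra.
Qed.

Lemma wulff_upper u t : q u = 1 -> wulff b (t *: (\row_i Tmap a da i u)) -> t <= Lam 1 u.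
Proof.
move=> u1 ht; rewrite rowT// in ht.
have [h1 [h2 h3]] := eNd; have u0 := q1_neq0 u1.
have [v v1] := @pointwise_upper u (grad da u) (grad db u) (a u) (b u) d _ _ h3 d1 u1
  (le_trans (nice_val aN u0) h2) (le_trans (nice_val bN u0) h2) (grad_ort (proj1 aN) u0)
  (grad_ort (proj1 bN) u0) (grad_small h1 aN u1) (grad_small h1 bN u1) erefl (esym (gsqE u1)).
move=> /(_ (b v)) []; last first.
  move=> p0 hb; rewrite /Lam mul1r.
  have := ht v ((sphereE v).2 v1); rewrite dotpZl => h.
  by rewrite -(ler_pM2r p0) (le_trans h).
have := nice_taylor bN u1 v1; rewrite ler_norml => /andP[_ h].
have : 4 * N ^+ 2 * e * q (v - u) <= d * q (v - u) by rewrite ler_wpM2r// q_ge0.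
rewrite -/(q (v - u)); lra.
Qed.

End Wulff.
End Pointwise.

(** * Integrals over the ball and volumes of star bodies *)

Section BallMean.
Variables (R : realType) (n : nat).
Notation V := 'rV[R]_n.+1.
Notation mV := (caratheodory_type (volO R n)).
Notation off0 := [set x : V | x != 0].
Implicit Types (x y : V) (F G : V -> R).

Definition qball : set V := [set x | q x <= 1].

Definition adm F := mfun F /\ exists C, forall x, `|F x| <= C.

Lemma adm_cst c : adm (fun=> c).
Proof. by split; [exact: mfun_cst|exists `|c|]. Qed.
Lemma admD F G : adm F -> adm G -> adm (fun x => F x + G x).
Proof.
move=> [mF [C FC]] [mG [D GD]]; split; first exact: mfunD.
by exists (C + D) => x; rewrite (le_trans (ler_normD _ _))// lerD.
Qed.
Lemma admM F G : adm F -> adm G -> adm (fun x => F x * G x).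
Proof.
move=> [mF [C FC]] [mG [D GD]]; split; first exact: mfunM.
by exists (C * D) => x; rewrite normrM ler_pM.
Qed.
Lemma admZ c F : adm F -> adm (fun x => c * F x).
Proof. by apply: admM; exact: adm_cst. Qed.
Lemma admB F G : adm F -> adm G -> adm (fun x => F x - G x).
Proof.
move=> aF aG; have := admD aF (admZ (-1) aG).
by under eq_fun do rewrite mulN1r.
Qed.
Lemma admX F k : adm F -> adm (fun x => F x ^+ k).
Proof.
move=> aF; elim: k => [|k IH]; first by under eq_fun do rewrite expr0; exact: adm_cst.
by under eq_fun do rewrite exprS; exact: admM.
Qed.
Lemma adm_sum (J : Type) (s : seq J) (F : J -> V -> R) : (forall j, adm (F j)) ->
  adm (fun x => \sum_(j <- s) F j x).
Proof.
move=> aF; elim: s => [|j s IH]; first by under eq_fun do rewrite big_nil; exact: adm_cst.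
by under eq_fun do rewrite big_cons; exact: admD.
Qed.

Lemma mfun_off0 F G : mfun F -> (forall x, x != 0 -> F x = G x) -> mfun G.
Proof.
move=> mF FG; have -> : G = (fun x => F x + (G 0 - F 0) * \1_(cube 0) x).
  apply/funext => x; rewrite indicE; have [->|x0] := eqVneq x 0.
    by rewrite mem_set ?mulr1 ?[F 0 + _]addrC ?subrK//; apply/cubeP; rewrite normr0.
  rewrite FG// memNset ?mulr0 ?addr0// => /cubeP; rewrite normr_le0; exact/negP.
apply: mfunD => //; apply: mfunM; first exact: mfun_cst.
exact/mfun_indic/cube_measurable.
Qed.

Lemma adm_off0 F G : adm F -> (forall x, x != 0 -> F x = G x) -> adm G.
Proof.
move=> [mF [C FC]] FG; split; first exact: mfun_off0 FG.
exists (Num.max C `|G 0|) => x; rewrite le_max; have [->|x0] := eqVneq x 0.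
  by rewrite lexx orbT.
by rewrite -FG// FC.
Qed.

Lemma adm_cont F C : (forall x, x != 0 -> {for x, continuous F}) ->
  (forall x, x != 0 -> `|F x| <= C) -> adm F.
Proof.
move=> cF FC; split; first exact: continuous_off0_mfun.
exists (Num.max C `|F 0|) => x; rewrite le_max; have [->|x0] := eqVneq x 0.
  by rewrite lexx orbT.
by rewrite FC.
Qed.

Lemma C1on_forcont F dF x : C1on off0 F dF -> x != 0 -> {for x, continuous F}.
Proof. by move=> FC x0; exact: (C1on_cont (@open_ne0 R n) FC x0). Qed.

Lemma adm_C1on F dF C : C1on off0 F dF -> (forall x, x != 0 -> `|F x| <= C) -> adm F.
Proof. by move=> FC; apply: adm_cont => x x0; exact: C1on_forcont FC x0. Qed.

Lemma mfun_q : mfun (@q R n).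
Proof. by apply: continuous_off0_mfun => x x0; apply: C1on_forcont (@C1on_q R n _) x0. Qed.

Lemma mfun_le F G : mfun F -> mfun G -> measurable ([set x | F x <= G x] : set mV).
Proof.
move=> mF mG; have := mfunB mF mG measurableT (@measurable_itv R `]-oo, 0]).
rewrite setTI; congr (measurable _); apply/seteqP; split=> x /=; by rewrite in_itv/= subr_le0.
Qed.

Lemma bbm_qle (L : V -> R) C : mfun L -> (forall x, `|L x| <= C) -> bbm (\1_[set x | q x <= L x ^+ 2] : V -> R).
Proof.
move=> mL LC; apply: bbm_indic.
  by apply: mfun_le; [exact: mfun_q|apply: mfunM].
exists C => x /= qx; apply/cubeP; have C0 : 0 <= C := le_trans (normr_ge0 _) (LC 0).
rewrite -ler_sqr ?nnegrE//; apply: (le_trans (norm_le_q x)); apply: le_trans qx _.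
by rewrite -[L x ^+ 2]real_normK ?num_real// ler_sqr ?nnegrE.
Qed.

Lemma bbm_qball : bbm (\1_qball : V -> R).
Proof.
have := @bbm_qle (fun=> 1) 1 (mfun_cst _) (fun=> _).
rewrite expr1n; apply => _; by rewrite normr1.
Qed.

Lemma bbm_adm F g : adm F -> bbm g -> bbm (fun x => g x * F x).
Proof.
move=> [mF [C FC]] bg; have := bbmMl mF _ bg; under eq_fun do rewrite mulrC.
by apply => D; exists C => x _.
Qed.

(** For a 0-homogeneous [F] this is a fixed multiple of the integral of [F] over the sphere, and it
    stands for that integral from here on. *)
Definition M F := Int (fun x => \1_qball x * F x).

Lemma bbm_M F : adm F -> bbm (fun x => \1_qball x * F x).
Proof. by move=> aF; apply: bbm_adm => //; exact: bbm_qball. Qed.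

Lemma MD F G : adm F -> adm G -> M (fun x => F x + G x) = M F + M G.
Proof.
move=> aF aG; rewrite /M -IntD; [|exact: bbm_M|exact: bbm_M].
by apply: eq_Int => x; rewrite mulrDr.
Qed.
Lemma MZ c F : adm F -> M (fun x => c * F x) = c * M F.
Proof.
move=> aF; rewrite /M -IntZ; last exact: bbm_M.
by apply: eq_Int => x; rewrite mulrCA.
Qed.
Lemma MB F G : adm F -> adm G -> M (fun x => F x - G x) = M F - M G.
Proof.
move=> aF aG; rewrite /M -IntB; [|exact: bbm_M|exact: bbm_M].
by apply: eq_Int => x; rewrite mulrBr.
Qed.
Lemma M_sum (J : Type) (s : seq J) (F : J -> V -> R) : (forall j, adm (F j)) ->
  M (fun x => \sum_(j <- s) F j x) = \sum_(j <- s) M (F j).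
Proof.
move=> aF; rewrite /M -Int_sum => [|j]; last exact: bbm_M.
by apply: eq_Int => x; rewrite mulr_sumr.
Qed.
Lemma eq_M F G : F =1 G -> M F = M G. Proof. by move=> /funext ->. Qed.
Lemma eq_M_off0 F G : adm F -> (forall x, x != 0 -> F x = G x) -> M F = M G.
Proof.
move=> aF FG; apply: eq_Int_off0; [exact: bbm_M|apply: bbm_M; exact: adm_off0 FG|].
by move=> x x0; rewrite FG.
Qed.
Lemma le_M F G : adm F -> adm G -> (forall x, x != 0 -> F x <= G x) -> M F <= M G.
Proof.
move=> aF aG FG; pose H x := if x == 0 then G 0 else F x.
have FH x : x != 0 -> F x = H x by rewrite /H => /negbTE ->.
rewrite (eq_M_off0 aF FH); apply: le_Int; [|exact: bbm_M|].
  by apply: bbm_M; exact: adm_off0 FH.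
move=> x; apply: ler_wpM2l; first by rewrite indicE.
by rewrite /H; case: eqVneq => [->|]//; exact: FG.
Qed.
Lemma M_ge0 F : adm F -> (forall x, x != 0 -> 0 <= F x) -> 0 <= M F.
Proof.
move=> aF F0; rewrite -[X in X <= _](_ : M (fun=> 0) = 0); last first.
  by rewrite -[RHS](@Int0 R n); apply: eq_Int => x; rewrite mulr0.
by apply: le_M => //; exact: adm_cst.
Qed.
Lemma M_cst c : M (fun=> c) = c * M (fun=> 1).
Proof.
rewrite -MZ; last exact: adm_cst.
by apply: eq_M => x; rewrite mulr1.
Qed.
Lemma le_M_norm F G : adm F -> adm G -> (forall x, x != 0 -> `|F x| <= G x) -> `|M F| <= M G.
Proof.
move=> aF aG FG; rewrite ler_norml; apply/andP; split; last first.
  by apply: le_M => // x x0; apply: le_trans (FG x x0); exact: ler_norm.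
rewrite lerNl -mulN1r -MZ//; apply: le_M => //; first exact: admZ.
by move=> x x0; rewrite mulN1r; apply: le_trans (FG x x0); rewrite -normrN ler_norm.
Qed.

Lemma M1_gt0 : 0 < M (fun=> 1).
Proof.
have w0 x : (1 - q x <= 0) \/ 0 <= 1 - q x by case: (lerP (1 - q x) 0) => h; [left|right; exact: ltW].
pose W x := Num.max 0 (1 - q x).
have cW : continuous W.
  move=> x; apply: (@continuous_max _ _ (cst 0) (fun x => 1 - q x)); first exact: cst_continuous.
  exact: (cvgB (@cst_continuous _ _ (1 : R) x) (C1on_cont openT (@C1on_q R n setT) Logic.I)).
have W1 x : 0 <= W x <= 1.
  by rewrite /W le_max lexx/= ge_max ler01/= gerBl q_ge0.
have bW : bbm W.
  apply: (@bbd_bbm _ _ 1); first exact: continuous_mfun.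
  split=> x; first by have /andP[h1 h2] := W1 x; rewrite ger0_norm.
  move=> x1; rewrite /W max_l// subr_le0; apply: le_trans (norm_le_q x).
  by rewrite exprn_ege1// ltW.
have : 0 < Int W.
  apply: (@Int_pos _ _ _ 0 bW) => [y||]; [by have /andP[] := W1 y|exact: cW|].
  by rewrite /W q0 subr0 max_r.
move/lt_le_trans; apply; apply: le_Int => //; first by apply: bbm_M; exact: adm_cst.
move=> x; rewrite mulr1 indicE; have /andP[h1 h2] := W1 x.
case: (boolP (x \in qball)) => // /negP; rewrite inE /qball /= => /negP; rewrite -ltNge => q1.
by rewrite /W max_l// subr_le0 ltW.
Qed.

Lemma sum_cells (m : nat) (y : R) (G : nat -> R) : 0 <= y -> y < m%:R ->
  \sum_(k < m) \1_(`[k%:R, k.+1%:R[%classic) y * G k = G (Num.truncn y).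
Proof.
move=> y0 ym; have /andP[t1 t2] := truncn_itv y0.
have tm : (Num.truncn y < m)%N by rewrite -(@ltr_nat R); exact: le_lt_trans ym.
rewrite (bigD1 (Ordinal tm))//= indicE mem_set ?mul1r; last by rewrite /= in_itv/= t1.
rewrite big1 ?addr0// => k kt; rewrite indicE memNset ?mul0r//= in_itv/= => /andP[k1 k2].
move/negP: kt; apply; rewrite -val_eqE/= eq_sym; apply/eqP/truncn_def; rewrite k1//.
Qed.

Lemma exprn_lip (x y : R) (m : nat) : 0 <= y -> y <= x -> x <= 3 ->
  x ^+ m - y ^+ m <= m%:R * 3 ^+ m * (x - y).
Proof.
move=> y0 yx x3; elim: m => [|m IH]; first by rewrite !expr0 subrr mul0r mul0r.
rewrite !exprS; have x0 : 0 <= x by lra.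
have ym : y ^+ m <= 3 ^+ m by rewrite lerXn2r ?nnegrE//; lra.
have h1 : x * (x ^+ m - y ^+ m) <= 3 * (m%:R * 3 ^+ m * (x - y)).
  rewrite (@le_trans _ _ (x * (m%:R * 3 ^+ m * (x - y))))// ?ler_wpM2l//.
  by rewrite ler_wpM2r// !mulr_ge0 ?exprn_ge0//; lra.
have h2 : (x - y) * y ^+ m <= (x - y) * 3 ^+ m by rewrite ler_wpM2l//; lra.
have h3 : 0 <= (x - y) * 3 ^+ m by rewrite mulr_ge0 ?exprn_ge0//; lra.
rewrite -natr1; move: h1 h2 h3.
by set A := x ^+ m; set B := y ^+ m; set D := 3 ^+ m; set K := m%:R; nra.
Qed.

Section Star.
Variables (F L : V -> R).
Hypotheses (aF : adm F) (F0 : forall x, 0 <= F x).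
Hypotheses (Fh : forall (t : R) x, 0 < t -> F (t *: x) = F x).
Hypotheses (mL : mfun L) (Lh : forall (t : R) x, 0 < t -> L (t *: x) = L x).
Hypotheses (L12 : forall x, 1 / 2 <= L x <= 2).

Let cell (m k : nat) x : R := \1_(`[k%:R, k.+1%:R[%classic) (m%:R * L x).

Let cell_adm m k : adm (cell m k).
Proof.
split; last by exists 1 => x; rewrite /cell indicE; case: (_ \in _); rewrite ?normr1 ?normr0.
have mm : mfun (fun x => m%:R * L x) by apply: mfunM => //; exact: mfun_cst.
by apply: (mfun_comp1 mm); exact: measurable_indic.
Qed.

Let cell_scale m k (lam : R) : 0 < lam ->
  Int (fun x => \1_[set x | q x <= lam ^+ 2] x * (cell m k x * F x)) = lam ^+ n.+1 * M (fun x => cell m k x * F x).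
Proof.
move=> l0; have := @Int_scale R n lam^-1 (fun x => \1_qball x * (cell m k x * F x)).
rewrite invr_gt0 => /(_ l0); rewrite exprVn invrK => <-; last first.
  by apply: bbm_M; apply: admM.
apply: eq_Int => x; rewrite Fh ?invr_gt0// /cell Lh ?invr_gt0//; congr (_ * _).
rewrite !indicE; congr ((_ : bool)%:R); apply/idP/idP; rewrite !inE /qball /= /q !dotpE mulrA -invfM -expr2.
  by rewrite ler_pdivrMl ?exprn_gt0// mulr1.
by rewrite ler_pdivrMl ?exprn_gt0// mulr1.
Qed.

Let Lge0 x : 0 <= L x. Proof. by have /andP[h _] := L12 x; apply: le_trans h; rewrite divr_ge0. Qed.

Let bound_m (m : nat) x : (0 < m)%N -> m%:R * L x < (2 * m).+1%:R.
Proof.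
move=> m0; have /andP[_ h] := L12 x; rewrite -natr1 natrM mulrC ltr_pwDr// ler_wpM2r//.
Qed.

Let bL : bbm (\1_[set x | q x <= L x ^+ 2] : V -> R).
Proof. by apply: (@bbm_qle _ 2) => // x; rewrite ger0_norm//; have /andP[] := L12 x. Qed.

Let aL : adm L.
Proof. by split => //; exists 2 => x; rewrite ger0_norm//; have /andP[] := L12 x. Qed.

Let bl (lam : R) : bbm (\1_[set x : V | q x <= lam ^+ 2] : V -> R).
Proof. by apply: (@bbm_qle (fun=> lam) `|lam|) => //; exact: mfun_cst. Qed.

Let cells (m : nat) x (G : nat -> R) : (0 < m)%N ->
  \sum_(k < (2 * m).+1) G k * (cell m k x * F x) = G (Num.truncn (m%:R * L x)) * F x.
Proof.
move=> m0; rewrite -(@sum_cells (2 * m).+1 (m%:R * L x) (fun k => G k)) ?mulr_ge0 ?bound_m//.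
by rewrite mulr_suml; apply: eq_bigr => k _; rewrite /cell; ring.
Qed.

Let MC := n.+1%:R * 3 ^+ n.+1 : R.

Let err m : 0 < m -> M (fun x => (L x ^+ n.+1 + MC * m) * F x) =
  M (fun x => L x ^+ n.+1 * F x) + m * (MC * M F).
Proof.
move=> m0; rewrite -!MZ//; last exact: admZ.
rewrite -MD; [by apply: eq_M => x; ring|by apply: admM => //; exact: admX|by do 2 apply: admZ].
Qed.

Lemma star_le (m : nat) : (0 < m)%N ->
  Int (fun x => \1_[set x | q x <= L x ^+ 2] x * F x) <=
  M (fun x => L x ^+ n.+1 * F x) + m%:R^-1 * (MC * M F).
Proof.
move=> m0; have mp : 0 < m%:R :> R by rewrite ltr0n.
have mi : 0 < m%:R^-1 :> R by rewrite invr_gt0.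
have mi1 : m%:R^-1 <= 1 :> R by rewrite invf_le1// ler1n.
pose lam (k : nat) : R := k.+1%:R / m%:R.
have l0 k : 0 < lam k by rewrite divr_gt0.
apply: (@le_trans _ _ (Int (fun x => \sum_(k <- index_enum 'I_(2 * m).+1)
    \1_[set x | q x <= lam k ^+ 2] x * (cell m k x * F x)))).
  apply: le_Int.
  - exact: bbm_adm.
  - by apply: bbm_sum => k; apply: bbm_adm => //; exact: admM.
  move=> x; rewrite (@cells m x (fun k => \1_[set x | q x <= lam k ^+ 2] x))//.
  apply: ler_wpM2r => //; rewrite !indicE; case: (boolP (_ \in _)) => //; rewrite inE /= => h.
  rewrite mem_set//= (le_trans h)// ler_sqr ?nnegrE ?(ltW (l0 _))//.
  have y0 : 0 <= m%:R * L x by rewrite mulr_ge0.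
  by have /andP[t1 t2] := truncn_itv y0; rewrite /lam ler_pdivlMr// mulrC ltW.
rewrite Int_sum => [|k]; last by apply: bbm_adm => //; exact: admM.
under eq_bigr => k _ do rewrite cell_scale//.
have sM (k : nat) : lam k ^+ n.+1 * M (fun x => cell m k x * F x) =
    M (fun x => lam k ^+ n.+1 * (cell m k x * F x)) by rewrite MZ//; exact: admM.
under eq_bigr => k _ do rewrite sM.
rewrite -M_sum; last by move=> k; apply: admZ; apply: admM.
rewrite -err//; apply: le_M.
- by apply: adm_sum => k; apply: admZ; apply: admM.
- by apply: admM => //; apply: admD; [exact: admX|exact: adm_cst].
move=> x _; rewrite (@cells m x (fun k => lam k ^+ n.+1))//; apply: ler_wpM2r => //.
have y0 : 0 <= m%:R * L x by rewrite mulr_ge0.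
have /andP[t1 t2] := truncn_itv y0.
set k := Num.truncn _ in t1 t2 *.
have h1 : L x <= lam k by rewrite /lam ler_pdivlMr// mulrC ltW.
have h2 : lam k - L x <= m%:R^-1.
  by rewrite /lam -natr1 mulrDl mul1r addrAC gerDr subr_le0 ler_pdivrMr// [L x * _]mulrC.
have /andP[_ Lx2] := L12 x.
have := @exprn_lip (lam k) (L x) n.+1 (Lge0 x) h1 (ltac:(lra)).
rewrite -/MC => h; rewrite -lerBlDl (le_trans h)// ler_wpM2l// /MC mulr_ge0 ?exprn_ge0//.
Qed.

Lemma star_ge (m : nat) : (2 < m)%N ->
  M (fun x => L x ^+ n.+1 * F x) - m%:R^-1 * (MC * M F) <=
  Int (fun x => \1_[set x | q x <= L x ^+ 2] x * F x).
Proof.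
move=> m2; have m0 : (0 < m)%N by apply: leq_trans m2.
have mp : 0 < m%:R :> R by rewrite ltr0n.
have mi : 0 < m%:R^-1 :> R by rewrite invr_gt0.
pose lam (k : nat) : R := k%:R / m%:R.
have l0 k : 0 <= lam k by rewrite divr_ge0.
rewrite lerBlDr; apply: (@le_trans _ _ (Int (fun x => \sum_(k <- index_enum 'I_(2 * m).+1)
    \1_[set x | q x <= lam k ^+ 2] x * (cell m k x * F x)) + m%:R^-1 * (MC * M F))); last first.
  rewrite lerD2r; apply: le_Int.
  - by apply: bbm_sum => k; apply: bbm_adm => //; exact: admM.
  - exact: bbm_adm.
  move=> x; rewrite (@cells m x (fun k => \1_[set x | q x <= lam k ^+ 2] x))//.
  apply: ler_wpM2r => //; rewrite !indicE; case: (boolP (_ \in _)) => //; rewrite inE /= => h.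
  rewrite mem_set//= (le_trans h)// ler_sqr ?nnegrE//.
  have y0 : 0 <= m%:R * L x by rewrite mulr_ge0.
  by have /andP[t1 t2] := truncn_itv y0; rewrite /lam ler_pdivrMr// [L x * _]mulrC.
rewrite Int_sum => [|k]; last by apply: bbm_adm => //; exact: admM.
have sc (k : nat) : Int (fun x => \1_[set x | q x <= lam k ^+ 2] x * (cell m k x * F x)) =
    lam k ^+ n.+1 * M (fun x => cell m k x * F x).
  case: k => [|k]; last by apply: cell_scale; rewrite divr_gt0.
  (* Cell 0 is not reached by a dilation, but it is empty: [L >= 1 / 2] and [m >= 3] keep [m * L]
     above 1. *)
  have -> : lam 0%N = 0 by rewrite /lam mulr0n mul0r.
  rewrite [0 ^+ n.+1]expr0n mul0r -[RHS](@Int0 R n); apply: eq_Int => x.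
  rewrite /cell indicE [X in _ * (X * _)]indicE (memNset (A := `[0%:R, 1%:R[%classic)) ?mul0r ?mulr0//=.
  rewrite in_itv/= => /andP[_]; have /andP[h _] := L12 x.
  have m3 : 3 <= m%:R :> R by rewrite ler_nat.
  by rewrite ltNge => /negP; apply; nra.
under eq_bigr => k _ do rewrite sc.
have sM (k : nat) : lam k ^+ n.+1 * M (fun x => cell m k x * F x) =
    M (fun x => lam k ^+ n.+1 * (cell m k x * F x)) by rewrite MZ//; exact: admM.
under eq_bigr => k _ do rewrite sM.
rewrite -M_sum; last by move=> k; apply: admZ; apply: admM.
apply: (@le_trans _ _ (M (fun x => (\sum_(k <- index_enum 'I_(2 * m).+1)
  lam k ^+ n.+1 * (cell m k x * F x)) + MC * m%:R^-1 * F x))); last first.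
  rewrite MD; [|by apply: adm_sum => k; apply: admZ; apply: admM|exact: admZ].
  by rewrite MZ// lerD2l mulrA [m%:R^-1 * _]mulrC.
apply: le_M.
- by apply: admM => //; exact: admX.
- by apply: admD; [apply: adm_sum => k; apply: admZ; apply: admM|exact: admZ].
move=> x _; rewrite (@cells m x (fun k => lam k ^+ n.+1))// -mulrDl; apply: ler_wpM2r => //.
have y0 : 0 <= m%:R * L x by rewrite mulr_ge0.
have /andP[t1 t2] := truncn_itv y0.
set k := Num.truncn _ in t1 t2 *.
have h1 : lam k <= L x by rewrite /lam ler_pdivrMr// mulrC.
have h2 : L x - lam k <= m%:R^-1.
  rewrite lerBlDr /lam -[X in X + _]mul1r -mulrDl ler_pdivlMr// mulrC addrC natr1; exact: ltW.
have /andP[_ Lx2] := L12 x.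
have := @exprn_lip (L x) (lam k) n.+1 (l0 k) h1 (ltac:(lra)).
rewrite -/MC => h; rewrite -lerBlDl (le_trans h)// ler_wpM2l// /MC mulr_ge0 ?exprn_ge0//.
Qed.

(** Polar coordinates in disguise. Space is cut into the cones on which [m * L] has a given integer
    part; on each of them [L] is constant up to [1 / m], the star body is nearly a dilated ball, and
    the dilation produces the power [n.+1]. [star_le] and [star_ge] control the error by a multiple
    of [1 / m]. *)
Lemma star_formula : Int (fun x => \1_[set x | q x <= L x ^+ 2] x * F x) = M (fun x => L x ^+ n.+1 * F x).
Proof.
have MF0 : 0 <= MC * M F.
  by rewrite mulr_ge0 ?M_ge0// /MC mulr_ge0 ?exprn_ge0.
have small (e : R) : 0 < e -> exists2 m, (2 < m)%N & m%:R^-1 * (MC * M F) <= e.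
  move=> e0; have [m hm] : exists m : nat, MC * M F / e <= m%:R.
    exists (Num.truncn (MC * M F / e)).+1; apply/ltW.
    have y0 : 0 <= MC * M F / e by rewrite divr_ge0// ltW.
    by have /andP[] := truncn_itv y0.
  exists m.+3 => //; rewrite ler_pdivrMl ?ltr0n// -ler_pdivrMr//.
  by apply: le_trans hm _; rewrite ler_nat -addn3 leq_addr.
apply/eqP; rewrite eq_le; apply/andP; split; apply/ler_addgt0Pr => e e0; have [m m2 me] := small e e0.
  by apply: le_trans (star_le (ltnW (ltnW m2))) _; rewrite lerD2l.
by rewrite -lerBlDr (le_trans _ (star_ge m2))// lerB.
Qed.

End Star.
End BallMean.

(** * Expansion of a power of the radial function *)

Section RealExpansion.
Variable R : realType.
Implicit Types (y d J a f g s : R).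

Lemma bernoulli2 (m : nat) : exists2 C : R, 0 <= C & forall y, `|y| <= 1 ->
  `|(1 + y) ^+ m - (1 + m%:R * y + m%:R * (m%:R - 1) / 2 * y ^+ 2)| <= C * `|y| ^+ 3.
Proof.
elim: m => [|m [C C0 IH]].
  by exists 0 => // y _; rewrite expr0 !mul0r !addr0 subrr normr0.
exists (2 * C + m%:R * (m%:R + 1)) => [|y y1]; first by rewrite addr_ge0 ?mulr_ge0.
have {}IH := IH y y1; rewrite exprS -natr1.
set E := (1 + y) ^+ m - _ in IH.
have -> : (1 + y) * (1 + y) ^+ m - (1 + (m%:R + 1) * y + (m%:R + 1) * (m%:R + 1 - 1) / 2 * y ^+ 2) =
  (1 + y) * E + m%:R * (m%:R - 1) / 2 * y ^+ 3 by rewrite /E; field.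
have y3 : 0 <= `|y| ^+ 3 by rewrite exprn_ge0.
have m0 : 0 <= m%:R :> R by [].
rewrite (le_trans (ler_normD _ _))// [leRHS]mulrDl lerD//.
  rewrite normrM -mulrA ler_pM//; have := ler_normD 1 y; rewrite normr1; lra.
rewrite normrM normrX ler_wpM2r// ler_norml; apply/andP; split; nra.
Qed.

(** Second-order expansion of the integrand for the star body of radius [Lam]. In the quadratic
    terms [J] and [a] may be replaced by 1 at the price of a factor [d]; the linear term keeps
    [J / a] exactly, because an error of size [d * |f|] would not be of second order. *)
Lemma expand_real (m : nat) (C0 : R) : 0 <= C0 -> exists2 K : R, 0 <= K & forall d J a f g s,
  0 <= d -> d <= 1 / 100 -> `|J - 1| <= C0 * d -> `|a - 1| <= d -> `|f| <= 2 * d ->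
  0 <= g -> g <= 4 * d ^+ 2 -> `|s| <= 1 ->
  `|(1 + f / a - g / 2 + s * (10 * d * (f ^+ 2 + g))) ^+ m * J -
    (J + m%:R * (f * (J / a)) + m%:R / 2 * ((m%:R - 1) * f ^+ 2 - g))| <= K * (d * (f ^+ 2 + g)).
Proof.
move=> C00; have [C Cp HC] := bernoulli2 m.
have [c cE] : {c : R | c = m%:R * (m%:R - 1) / 2} by eexists.
have m0 : 0 <= m%:R :> R by [].
have [c' c'E] : {c' : R | c' = m%:R * (m%:R + 1)} by eexists.
have c'0 : 0 <= c' by rewrite c'E mulr_ge0// addr_ge0.
have cc' : `|c| <= c' by rewrite ler_norml cE c'E; apply/andP; split; nra.
exists ((1 + C0) * (8 * C + 10 * m%:R + 10 * c') + C0 * (m%:R + c')).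
  by rewrite addr_ge0 ?mulr_ge0 ?addr_ge0 ?mulr_ge0.
move=> d J a f g s d0 d1 J1 a1 f1 g0 g1 s1.
have [S SE] : {S : R | S = f ^+ 2 + g} by eexists.
have f20 : 0 <= f ^+ 2 by exact: sqr_ge0.
have f2 : f ^+ 2 <= 4 * d ^+ 2.
  by rewrite -[f ^+ 2]real_normK ?num_real//; have := normr_ge0 f; nra.
have dd : d ^+ 2 <= 1 / 100 * d by nra.
have S0 : 0 <= S by rewrite SE; lra.
have S8 : S <= 8 / 100 * d by rewrite SE; lra.
have [a2 a3] : 99 / 100 <= a /\ a <= 101 / 100.
  by move: a1; rewrite ler_norml => /andP[h h']; clear -h h' d1; split; lra.
have aa0 : a != 0 by apply/eqP => h; move: a2; rewrite h; lra.
have [F FE] : {F : R | F = f / a} by eexists.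
have fF : f = a * F by rewrite FE mulrCA divff// mulr1.
have FF : `|F| <= 3 * d.
  move: f1; rewrite fF normrM (ger0_norm (_ : 0 <= a)); last lra.
  by have h := normr_ge0 F; clear -h a2 d0; nra.
have F2 : `|F ^+ 2 - f ^+ 2| <= 3 * (d * f ^+ 2).
  have ff : f ^+ 2 = a ^+ 2 * F ^+ 2 by rewrite {1}fF exprMn.
  have -> : F ^+ 2 - f ^+ 2 = (1 - a ^+ 2) * F ^+ 2 by rewrite ff; ring.
  have FF0 := sqr_ge0 F; rewrite ff normrM (ger0_norm FF0).
  have h1 : 98 / 100 <= a ^+ 2 by clear -a2; nra.
  have h2 : `|1 - a ^+ 2| <= 202 / 100 * d.
    move: a1; rewrite !ler_norml => /andP[h h']; clear -h h' a2 a3 d0 d1; apply/andP; split; nra.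
  rewrite mulrA (@le_trans _ _ (202 / 100 * d * F ^+ 2))// ?ler_wpM2r//.
  have : 202 / 100 * d <= 3 * d * a ^+ 2 by clear -h1 d0; nra.
  by move=> h3; rewrite [leRHS]mulrA ler_wpM2r.
have [z zE] : {z : R | z = - (g / 2) + s * (10 * d * S)} by eexists.
have dS : 0 <= d * S by rewrite mulr_ge0.
have sdS : `|s * (10 * d * S)| <= 10 * (d * S).
  rewrite normrM -mulrA (ger0_norm (_ : 0 <= 10 * (d * S))); last by rewrite mulr_ge0.
  by rewrite ler_piMl// mulr_ge0.
have dS1 : 10 * (d * S) <= 1 / 10 * S.
  have h : d * S <= 1 / 100 * S by rewrite ler_wpM2r.
  by clear -h; lra.
have z1 : `|z| <= S.
  rewrite zE; have := ler_normD (- (g / 2)) (s * (10 * d * S)).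
  rewrite normrN (ger0_norm (_ : 0 <= g / 2)); last by rewrite divr_ge0.
  by clear -sdS dS1 SE f20 g0 S0; lra.
have [y yE] : {y : R | y = F + z} by eexists.
have y1 : `|y| <= 4 * d by have := ler_normD F z; rewrite -yE; clear -FF z1 S8 d0; lra.
have zz : z ^+ 2 <= d * S.
  rewrite -[z ^+ 2]real_normK ?num_real//; have h := normr_ge0 z; clear -h z1 S8 S0 d0; nra.
have Fz : `|F * z| <= 3 * (d * S) by rewrite normrM mulrA ler_pM.
have yf : `|y ^+ 2 - f ^+ 2| <= 10 * (d * S).
  have -> : y ^+ 2 - f ^+ 2 = (F ^+ 2 - f ^+ 2) + 2 * (F * z) + z ^+ 2 by rewrite yE; ring.
  have : d * f ^+ 2 <= d * S by rewrite ler_wpM2l//; clear -SE g0; lra.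
  move: F2 Fz; rewrite !ler_norml => /andP[h1 h2] /andP[h3 h4] h5; have h6 := sqr_ge0 z.
  by clear -h1 h2 h3 h4 h5 h6 zz dS; apply/andP; split; lra.
have y2 : y ^+ 2 <= 2 * S.
  by move: yf; rewrite ler_norml => /andP[_]; clear -SE g0 dS1 S0; lra.
have y11 : `|y| <= 1 by clear -y1 d1; lra.
have [E EE] : {E : R | E = (1 + y) ^+ m - (1 + m%:R * y + c * y ^+ 2)} by eexists.
have E1 : `|E| <= 8 * C * (d * S).
  rewrite EE cE (le_trans (HC y y11))// [8 * C]mulrC -mulrA ler_wpM2l//.
  rewrite exprS real_normK ?num_real// (@le_trans _ _ (4 * d * (2 * S)))//; last by clear -d; lra.
  by rewrite ler_pM// sqr_ge0.
have yE1 : 1 + f / a - g / 2 + s * (10 * d * (f ^+ 2 + g)) = 1 + y.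
  by rewrite yE zE -SE -FE; ring.
have -> : (1 + f / a - g / 2 + s * (10 * d * (f ^+ 2 + g))) ^+ m * J -
    (J + m%:R * (f * (J / a)) + m%:R / 2 * ((m%:R - 1) * f ^+ 2 - g)) =
    J * (E + m%:R * (s * (10 * d * S)) + c * (y ^+ 2 - f ^+ 2)) +
    (J - 1) * (c * f ^+ 2 - m%:R / 2 * g).
  rewrite yE1 (_ : f * (J / a) = F * J); last by rewrite FE mulrCA mulrC.
  have -> : (1 + y) ^+ m = E + (1 + m%:R * y + c * y ^+ 2) by rewrite EE subrK.
  by rewrite {1}yE zE cE; field.
rewrite -SE (le_trans (ler_normD _ _))// [leRHS]mulrDl lerD//.
  rewrite normrM -[leRHS]mulrA ler_pM//.
    have C0d : C0 * d <= C0 by rewrite ler_piMr//; clear -d1; lra.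
    by have := ler_normD (J - 1) 1; rewrite subrK normr1 => hh; clear -hh J1 C0d; lra.
  rewrite (le_trans (ler_normD _ _))// [leRHS]mulrDl lerD//; last first.
    by rewrite normrM [10 * c']mulrC -[leRHS]mulrA ler_pM.
  rewrite (le_trans (ler_normD _ _))// [leRHS]mulrDl lerD//.
  by rewrite normrM (ger0_norm m0) [10 * m%:R]mulrC -[leRHS]mulrA ler_wpM2l.
have -> : C0 * (m%:R + c') * (d * S) = (C0 * d) * ((c' + m%:R) * S) by ring.
rewrite normrM ler_pM//.
rewrite (le_trans (ler_normB _ _))// mulrDl lerD//.
  by rewrite normrM (ger0_norm f20) ler_pM//; clear -SE g0; lra.
rewrite normrM (ger0_norm g0) ler_pM//; last by clear -SE f20; lra.
by rewrite ger0_norm ?divr_ge0//; clear -m0; lra.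
Qed.

End RealExpansion.

(** * Volume of nearly spherical bodies and its second-order expansion *)

Section BodyVolume.
Variables (R : realType) (n : nat).
Notation V := 'rV[R]_n.+1.
Notation I := 'I_n.+1.
Notation mV := (caratheodory_type (volO R n)).
Notation off0 := [set x : V | x != 0].
Implicit Types (x y u v : V) (t s e : R) (a b : V -> R) (da db : I -> V -> R) (dda ddb : I -> I -> V -> R).

Definition gdist (da db : I -> V -> R) x := gsq (fun i x => db i x - da i x) x.

Section Hom.
Variables (a : V -> R) (da : I -> V -> R) (dda : I -> I -> V -> R).
Hypothesis aH : hom2 a da dda.

Lemma Tmap_hom t x i : 0 < t -> Tmap a da i (t *: x) = t * Tmap a da i x.
Proof.
move=> t0; rewrite /Tmap; have [->|x0] := eqVneq x 0.
  by rewrite scaler0 !mxE mulr0 q0 !mul0r addr0 mulr0.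
have [h1 _ _] := aH; rewrite h1// mxE (hom2_da aH)// /q !dotpE; field.
by rewrite gt_eqF.
Qed.

Lemma Jac_hom t x : 0 < t -> Jac a da dda (t *: x) = Jac a da dda x.
Proof.
move=> t0; congr (\det _); apply/matrixP => i k; rewrite !mxE /dTmap scaler_eq0 gt_eqF//=.
case: eqVneq => // x0; have [h1 _ _] := aH.
rewrite h1// !(hom2_da aH)// (hom2_dda aH)// !mxE /q !dotpE; field.
by rewrite gt_eqF.
Qed.

Lemma mfun_Jac : mfun (Jac a da dda).
Proof. exact: (mfun_J (fun i => Tmap_C1 i aH)). Qed.

End Hom.

Lemma gdist_hom a da dda b db ddb t x : hom2 a da dda -> hom2 b db ddb -> 0 < t ->
  gdist da db (t *: x) = gdist da db x.
Proof.
move=> aH bH t0; have [->|x0] := eqVneq x 0; first by rewrite scaler0.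
rewrite /gdist /gsq /q !dotpE.
under eq_bigr do rewrite (hom2_da aH)// (hom2_da bH)// -mulrBr exprMn.
rewrite -mulr_sumr; set Y := \sum_(_ < _) _; field.
by rewrite gt_eqF.
Qed.

Lemma unit_decomp x : x != 0 -> exists u, [/\ q u = 1, 0 < enorm x & x = enorm x *: u].
Proof.
move=> x0; exists ((enorm x)^-1 *: x); split; [exact: normalize_q|exact: enorm_gt0|].
by rewrite scalerA divff ?scale1r// gt_eqF// enorm_gt0.
Qed.

Lemma wulff_measurable (f : V -> R) : measurable (wulff f : set mV).
Proof.
rewrite -[X in measurable X]setCK; apply/measurableC/open_measurableV/closed_openC.
rewrite (_ : wulff f = \bigcap_(u in @sphere R n.+1) [set x | dotp x u <= f u])//.
apply: closed_bigI => u _.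
have dc : continuous (fun x => dotp x u).
  have dC := C1on_sum (index_enum I) (fun i => C1onZ (u ord0 i) (@C1on_coord R n setT i)).
  rewrite (_ : (fun x => dotp x u) = (fun x => \sum_j u ord0 j * x ord0 j)).
    by move=> x; exact: (C1on_cont openT dC).
  by apply/funext => x; apply: eq_bigr => i _; rewrite mulrC.
by have := (continuous_closedP _).1 dc _ (@closed_le R (f u)).
Qed.

Lemma nice_half e a da dda x : nice e a da dda -> e <= 1 / 2 -> x != 0 -> 1 / 2 <= a x <= 3 / 2.
Proof.
move=> aN e2 x0; have := nice_val aN x0; rewrite ler_norml => /andP[? ?].
by apply/andP; split; lra.
Qed.

Lemma wulff_cube e a da dda : nice e a da dda -> e <= 1 / 2 -> wulff a `<=` (cube 2 : set V).
Proof.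
move=> aN e2 x xa; apply/cubeP; have [->|x0] := eqVneq x 0; first by rewrite normr0.
have [u [u1 r0 xe]] := unit_decomp x0.
have := xa u ((sphereE u).2 u1); rewrite {1}xe dotpZl -/(q u) u1 mulr1 => h.
have /andP[_ h2] := nice_half aN e2 (q1_neq0 u1).
apply: norm_le_coord => i; have := coord_le_enorm x i; lra.
Qed.

Lemma adm_nice e a da dda : nice e a da dda -> adm a.
Proof.
move=> aN; have [[_ h _] _] := aN; apply: (adm_C1on (C := 1 + e) h) => x x0.
have := nice_val aN x0; have := ler_normD (a x - 1) 1; rewrite subrK normr1; lra.
Qed.

Lemma adm_inv e a da dda : nice e a da dda -> e <= 1 / 2 -> adm (fun x => (a x)^-1).
Proof.
move=> aN e2; have [[_ h _] _] := aN; apply: (adm_cont (C := 2)) => x x0.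
  have /andP[h1 _] := nice_half aN e2 x0.
  have a0 : a x != 0 by rewrite gt_eqF//; lra.
  exact: (cvgV a0 (C1on_forcont h x0)).
have /andP[h1 _] := nice_half aN e2 x0.
by rewrite normrV ?unitfE ?gt_eqF//; [rewrite ger0_norm; [rewrite invf_ple ?posrE|];lra|lra].
Qed.

Lemma adm_Jac e a da dda : nice e a da dda -> e <= 1 -> adm (Jac a da dda).
Proof.
move=> aN e1; split; first exact: mfun_Jac aN.1.
have [C [_ dTb]] := Tmap_bounds aN e1.
exists ((n.+1)`!%:R * C ^+ n.+1) => x; exact: (J_bound dTb).
Qed.

Lemma adm_qda e a da dda e' b db ddb i k : nice e a da dda -> nice e' b db ddb ->
  adm (fun x => q x * (da i x * db k x)).
Proof.
move=> aN bN; have [[_ hA _] _] := aN; have [[_ hB _] _] := bN.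
have [[_ _ hdA] _] := aN; have [[_ _ hdB] _] := bN.
have C1 := C1onM (@open_ne0 R n) (@C1on_q R n off0) (C1onM (@open_ne0 R n) (hdA i) (hdB k)).
apply: (adm_C1on (C := e * e') C1) => x x0.
rewrite -enorm_sqr (normrM (_ ^+ 2)) (normrM (da i x)) normrX (ger0_norm (enorm_ge0 x)) expr2 mulrACA.
by rewrite [enorm x * `|da i x|]mulrC [enorm x * `|db k x|]mulrC ler_pM ?mulr_ge0 ?enorm_ge0//;
  [exact: (nice_da aN)|exact: (nice_da bN)].
Qed.

Lemma adm_gdist e a da dda e' b db ddb : nice e a da dda -> nice e' b db ddb -> adm (gdist da db).
Proof.
move=> aN bN.
have -> : gdist da db = (fun x => \sum_i (q x * (db i x * db i x) - 2 * (q x * (da i x * db i x)) + q x * (da i x * da i x))).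
  apply/funext => x; rewrite /gdist /gsq mulr_sumr; apply: eq_bigr => i _; ring.
apply: adm_sum => i; apply: admD; first (apply: admB; last apply: admZ).
- exact: (adm_qda _ _ bN bN).
- exact: (adm_qda _ _ aN bN).
- exact: (adm_qda _ _ aN aN).
Qed.

Section Volumes.
Variables (K e : R).
Hypothesis HK : forall (M : 'M[R]_n.+1) d, 0 <= d -> d <= 1 ->
  (forall i j, `|M i j - (i == j)%:R| <= d) -> `|\det M - 1| <= K * d.
Hypotheses (K0 : 0 < K) (es1 : 4 * n.+1%:R ^+ 2 * e <= 1 / 100) (es2 : K * (5 * e) <= 1 / 2).

Definition dpt := 4 * n.+1%:R ^+ 2 * e.

Section Single.
Variables (a : V -> R) (da : I -> V -> R) (dda : I -> I -> V -> R).
Hypothesis aN : nice e a da dda.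

Lemma e_small : [/\ 0 <= e, e <= 1 / 100, 8 * n.+1%:R * e <= 1, e <= dpt & n.+1%:R * e <= dpt].
Proof.
have e0 := nice_ge0 aN; move: (es1) => e1.
have N1 : 1 <= n.+1%:R :> R by rewrite ler1n.
have h1 : n.+1%:R * e <= n.+1%:R ^+ 2 * e by rewrite ler_wpM2r// expr2 ler_peMl//; lra.
have h2 : e <= n.+1%:R * e by rewrite ler_peMl.
have h3 : dpt = 4 * (n.+1%:R ^+ 2 * e) by rewrite /dpt; ring.
move: e1; rewrite -/dpt h3; move: (n.+1%:R ^+ 2 * e) h1 => X h1 X1.
by split=> //; lra.
Qed.

Lemma Jac_half x : 1 / 2 <= Jac a da dda x <= 3 / 2.
Proof.
have [e0 e1 _ _ _] := e_small; have h := Jac_near aN HK (ltac:(lra)) x.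
move: (es2) => e2; move: h; rewrite ler_norml => /andP[? ?]; apply/andP; split; lra.
Qed.

Lemma Jac_ge0 x : 0 <= Jac a da dda x.
Proof. by have /andP[h _] := Jac_half x; apply: le_trans h; rewrite divr_ge0. Qed.

Let Tv x : V := \row_i Tmap a da i x.

Lemma Int_le_vol_T (w : V -> R) (A : set V) : bbm w -> (forall x, 0 <= w x <= 1) ->
  (forall x, w x != 0 -> A (\row_i Tmap a da i x)) ->
  ((Int (fun x => w x * Jac a da dda x))%:E <= lebesgue_vol A)%E.
Proof.
have [e0 e1 e8 _ _] := e_small; have [C [Tb dTb]] := Tmap_bounds aN (ltac:(lra)).
move=> bw w01 wA.
have := @Int_le_vol R n _ _ C (1 / 2) (fun i => Tmap_C1 i aN.1) Tb dTb (ltac:(lra))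
  (fun s x h => Tmap_seg aN x e8 h) Jac_ge0 w A bw w01 wA.
by under eq_fun do rewrite mulrC.
Qed.

Lemma vol_le_Int_T (A B : set V) (r : R) : measurable (A : set mV) ->
  A `<=` cube r -> bbm (\1_B : V -> R) -> (forall x, A (\row_i Tmap a da i x) -> B x) ->
  (lebesgue_vol A <= (Int (fun x => \1_B x * Jac a da dda x))%:E)%E.
Proof.
have [e0 e1 e8 _ _] := e_small; have [C [Tb dTb]] := Tmap_bounds aN (ltac:(lra)).
move=> mA Ar bB AB.
have := @vol_le_Int R n _ _ C (1 / 2) (fun i => Tmap_C1 i aN.1) Tb dTb (ltac:(lra))
  (fun s x h => Tmap_seg aN x e8 h) Jac_ge0 A B r mA Ar bB AB.
by under eq_fun do rewrite mulrC.
Qed.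

End Single.

Section Pair.
Variables (a b : V -> R) (da db : I -> V -> R) (dda ddb : I -> I -> V -> R).
Hypotheses (aN : nice e a da dda) (bN : nice e b db ddb).

Local Notation L s := (Lam dpt a b da db s).

Lemma Lam_hom s t x : 0 < t -> L s (t *: x) = L s x.
Proof.
move=> t0; have [[ha _ _] _] := aN; have [[hb _ _] _] := bN.
have := gdist_hom x aN.1 bN.1 t0; rewrite /gdist => hg.
by rewrite /Lam ha// hb// hg.
Qed.

Lemma gdist_small x : x != 0 -> 0 <= gdist da db x <= 4 * dpt ^+ 2.
Proof.
move=> x0; have [u [u1 r0 ->]] := unit_decomp x0.
have [e0 _ _ ed Ne] := e_small aN.
rewrite (gdist_hom _ aN.1 bN.1)//.
have -> : gdist da db u = dotp (grad db u - grad da u) (grad db u - grad da u).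
  by rewrite /gdist /gsq u1 mul1r /dotp; apply: eq_bigr => i _; rewrite !mxE -expr2.
rewrite dotp_ge0/=; have d1 := es1.
have h1 := grad_small aN (lexx _) d1 Ne aN u1.
have h2 := grad_small aN (lexx _) d1 Ne bN u1.
have := dotp_ge0 (grad db u + grad da u); rewrite !dotpE (dotpC (grad db u) (grad da u)).
by rewrite -/dpt in h1 h2; lra.
Qed.

Lemma Lam_bounds s x : `|s| <= 1 -> x != 0 -> 1 / 2 <= L s x <= 2.
Proof.
move=> s1 x0; have [e0 e1 _ ed Ne] := e_small aN.
have /andP[g0 g1] := gdist_small x0; rewrite /gdist in g0 g1.
have ha := nice_val aN x0; have hb := nice_val bN x0.
have d1 : dpt <= 1 / 100 := es1.
rewrite /Lam; set g := gsq _ _ in g0 g1 *; move: ha hb; set A := a x; set B := b x.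
rewrite !ler_norml => /andP[a1 a2] /andP[b1 b2].
have A0 : 0 < A by lra.
have h1 : - (3 / 100) <= (B - A) / A <= 3 / 100.
  by rewrite ler_pdivlMr// ler_pdivrMr//; apply/andP; split; lra.
have d0 : 0 <= dpt by lra.
have f2 : (B - A) ^+ 2 <= 4 / 100 by nra.
have g4 : g <= 4 / 100 by nra.
have h2 : `|s * (10 * dpt * ((B - A) ^+ 2 + g))| <= 1 / 100.
  have S0 : 0 <= (B - A) ^+ 2 + g by rewrite addr_ge0 ?sqr_ge0.
  rewrite normrM (ger0_norm (_ : 0 <= 10 * dpt * _)); last by rewrite !mulr_ge0.
  rewrite -[leRHS]mul1r ler_pM//; last by nra.
  by rewrite !mulr_ge0.
move: h1 h2; rewrite ler_norml => /andP[h1 h2] /andP[h3 h4].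
by apply/andP; split; lra.
Qed.

(** [Lam] is controlled off 0 only; [Lc] patches its value at 0 so that [star_formula] applies. *)
Let Lc s x := if x == 0 then 1 else L s x.
Let LcE s x : x != 0 -> L s x = Lc s x. Proof. by rewrite /Lc => /negbTE ->. Qed.

Lemma adm_Lam s : adm (L s).
Proof.
have [e0 e1 _ ed Ne] := e_small aN; have aa := adm_nice aN; have ab := adm_nice bN.
have ai : adm (fun x => (a x)^-1) by apply: adm_inv aN _; lra.
have ag := adm_gdist aN bN; have af := admB ab aa.
apply: admD; first apply: admB; first apply: admD.
- exact: adm_cst.
- exact: admM.
- by under eq_fun do rewrite mulrC; exact: (admZ _ ag).
- by do 2 apply: admZ; apply: admD => //; exact: admX.
Qed.

Let mLc s : mfun (Lc s). Proof. exact: mfun_off0 (proj1 (adm_Lam s)) (@LcE s). Qed.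
Let Lc_hom s t x : 0 < t -> Lc s (t *: x) = Lc s x.
Proof. by move=> t0; rewrite /Lc scaler_eq0 gt_eqF//= Lam_hom. Qed.
Let Lc_bounds s x : `|s| <= 1 -> 1 / 2 <= Lc s x <= 2.
Proof.
move=> s1; rewrite /Lc; case: eqVneq => [_|x0]; last exact: Lam_bounds.
by apply/andP; split; lra.
Qed.

(** Pulled back by [Tmap a], the Wulff shape of [b] lies in the star body of radius [Lam 1], whose
    volume weighted by the Jacobian is given by [star_formula]. *)
Lemma wulff_le_star : (lebesgue_vol (wulff b) <= (M (fun x => L 1 x ^+ n.+1 * Jac a da dda x))%:E)%E.
Proof.
have [e0 e1 _ ed Ne] := e_small aN; have n1 : `|1 : R| <= 1 by rewrite normr1.
have bL : bbm (\1_[set x : V | q x <= Lc 1 x ^+ 2] : V -> R).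
  apply: (@bbm_qle _ _ _ 2) => // x; have /andP[h1 h2] := Lc_bounds x n1.
  by rewrite ger0_norm//; lra.
apply: (le_trans (@vol_le_Int_T a da dda aN _ _ 2 (wulff_measurable b)
  (wulff_cube bN (ltac:(lra))) bL _)).
  move=> x; have [->|x0] := eqVneq x 0; first by move=> _; rewrite /= q0 sqr_ge0.
  have [u [u1 r0 xe]] := unit_decomp x0.
  rewrite {1}xe (_ : \row_i _ = enorm x *: \row_i Tmap a da i u); last first.
    by apply/rowP => i; rewrite !mxE (Tmap_hom aN.1).
  move/(wulff_upper aN bN (lexx _) es1 u1) => h.
  rewrite /= {2}xe Lc_hom// -LcE ?(q1_neq0 u1)// -enorm_sqr ler_sqr ?nnegrE ?enorm_ge0//.
  by apply: le_trans (enorm_ge0 x) h.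
rewrite lee_fin (star_formula (adm_Jac aN (ltac:(lra))) (Jac_ge0 aN) _ (mLc 1) (@Lc_hom 1) (fun x => Lc_bounds x n1)).
  rewrite le_eqVlt; apply/orP; left; apply/eqP; apply: eq_M_off0 => [|x x0]; last by rewrite -LcE.
  apply: admM; last by apply: adm_Jac aN _; lra.
  by apply: admX; exact: adm_off0 (adm_Lam 1) (@LcE 1).
by move=> t x; exact: (Jac_hom aN.1).
Qed.

Lemma star_le_wulff : ((M (fun x => L (-1) x ^+ n.+1 * Jac a da dda x))%:E <= lebesgue_vol (wulff b))%E.
Proof.
have [e0 e1 _ ed Ne] := e_small aN; have n1 : `|-1 : R| <= 1 by rewrite normrN normr1.
have bL : bbm (\1_[set x : V | q x <= Lc (-1) x ^+ 2] : V -> R).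
  apply: (@bbm_qle _ _ _ 2) => // x; have /andP[h1 h2] := Lc_bounds x n1.
  by rewrite ger0_norm//; lra.
have := @Int_le_vol_T a da dda aN _ (wulff b) bL _ _.
rewrite (star_formula (adm_Jac aN (ltac:(lra))) (Jac_ge0 aN) _ (mLc (-1)) (@Lc_hom (-1)) (fun x => Lc_bounds x n1)); last first.
  by move=> t x; exact: (Jac_hom aN.1).
rewrite (@eq_M_off0 _ _ _ (fun x => L (-1) x ^+ n.+1 * Jac a da dda x)); last 2 first.
- apply: admM; last by apply: adm_Jac aN _; lra.
  by apply: admX; exact: adm_off0 (adm_Lam (-1)) (@LcE (-1)).
- by move=> x x0; rewrite -LcE.
apply => [x|x]; first by rewrite indicE; case: (_ \in _); rewrite ?ler01 ?lexx.
rewrite indicE; case: (boolP (_ \in _)) => [|_]; last by rewrite eqxx.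
rewrite inE /= => h _; have [->|x0] := eqVneq x 0.
  move=> v /sphereE v1; rewrite (_ : \row_i _ = 0); last first.
    by apply/rowP => i; rewrite !mxE /Tmap mxE q0 mulr0 mul0r addr0.
  by rewrite dotp0l; have /andP[] := nice_half bN (ltac:(lra)) (q1_neq0 v1); lra.
have [u [u1 r0 xe]] := unit_decomp x0; move=> v sv.
rewrite xe (_ : \row_i _ = enorm x *: \row_i Tmap a da i u); last first.
  by apply/rowP => i; rewrite !mxE (Tmap_hom aN.1).
have /andP[l0 l2] := Lam_bounds n1 (q1_neq0 u1).
have hu := wulff_lower aN bN (lexx _) es1 u1 sv; rewrite -/dpt in hu.
have rl : enorm x <= L (-1) u.
  move: h; rewrite -enorm_sqr {2}xe Lc_hom// -LcE ?(q1_neq0 u1)// ler_sqr ?nnegrE ?enorm_ge0//; lra.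
have b0 : 0 <= b v.
  by have /andP[] := nice_half bN (ltac:(lra)) (q1_neq0 ((sphereE v).1 sv)); lra.
have [t0|t0] := lerP (dotp (\row_i Tmap a da i u) v) 0.
  by apply: le_trans b0; rewrite dotpZl mulr_ge0_le0// enorm_ge0.
apply: le_trans hu; rewrite !dotpZl ler_wpM2r// ltW//.
Qed.

End Pair.

Lemma Lam_diag d a da s x : Lam d a a da da s x = 1.
Proof.
rewrite /Lam /gsq big1 => [|i _]; last by rewrite subrr expr0n.
by rewrite subrr mul0r mulr0 expr0n/= mul0r !addr0 mulr0 subr0 mulr0 addr0.
Qed.

Section BodyVol.
Variables (a : V -> R) (da : I -> V -> R) (dda : I -> I -> V -> R).
Hypothesis aN : nice e a da dda.

Lemma Tmap_in_wulff x : q x <= 1 -> wulff a (\row_i Tmap a da i x).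
Proof.
have [e0 e1 _ ed Ne] := e_small aN.
move=> qx; have [x0|x0] := eqVneq x 0.
  move=> v /sphereE v1; rewrite (_ : \row_i _ = 0); last first.
    by apply/rowP => i; rewrite !mxE /Tmap x0 mxE q0 mulr0 mul0r addr0.
  by rewrite dotp0l; have /andP[] := nice_half aN (ltac:(lra)) (q1_neq0 v1); lra.
have [u [u1 r0 xe]] := unit_decomp x0; move=> v sv.
rewrite xe (_ : \row_i _ = enorm x *: \row_i Tmap a da i u); last first.
  by apply/rowP => i; rewrite !mxE (Tmap_hom aN.1).
have hu := wulff_lower aN aN (lexx _) es1 u1 sv; rewrite Lam_diag scale1r in hu.
have r1 : enorm x <= 1.
  by rewrite -(@ler_sqr R) ?nnegrE ?enorm_ge0// enorm_sqr expr1n.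
have b0 : 0 <= a v.
  by have /andP[] := nice_half aN (ltac:(lra)) (q1_neq0 ((sphereE v).1 sv)); lra.
rewrite dotpZl; have [t0|t0] := lerP (dotp (\row_i Tmap a da i u) v) 0.
  by apply: le_trans b0; rewrite mulr_ge0_le0// enorm_ge0.
by apply: le_trans hu; rewrite ler_piMl// ltW.
Qed.

(** For [b = a] the comparison is exact, as [Lam] is then 1: the Wulff shape has at most, and the
    image of the ball at least, the volume [M (Jac a da dda)]. This serves convex bodies and the
    Wulff shape of an L_p mean alike. *)
Lemma body_vol (D : set V) : D `<=` wulff a -> (forall x, q x <= 1 -> D (\row_i Tmap a da i x)) ->
  lebesgue_vol D = (M (Jac a da dda))%:E.
Proof.
move=> Dw TD; apply/eqP; rewrite eq_le; apply/andP; split.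
  apply: (le_trans (le_lebesgue_vol Dw)); apply: (le_trans (wulff_le_star aN aN)).
  by under eq_fun do rewrite Lam_diag expr1n mul1r.
have := @Int_le_vol_T a da dda aN (\1_(@qball R n)) D (@bbm_qball R n); apply => [x|x].
  by rewrite indicE; case: (_ \in _); rewrite ?ler01 ?lexx.
rewrite indicE; case: (boolP (_ \in _)) => [|_]; last by rewrite eqxx.
by rewrite inE => h _; exact: TD.
Qed.

Lemma wulff_vol : lebesgue_vol (wulff a) = (M (Jac a da dda))%:E.
Proof. by apply: body_vol => //; exact: Tmap_in_wulff. Qed.

End BodyVol.

End Volumes.

(** The star bodies of radius [Lam (-1)] and [Lam 1] pinch the volume, and [expand_real] expands
    both. The second-order term contains first derivatives only, and the error is [e] times the
    squared H^1 distance, which is small against the spectral gap. *)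
Lemma vol_expand (K : R) : 0 < K -> (forall (M : 'M[R]_n.+1) d, 0 <= d -> d <= 1 ->
    (forall i j, `|M i j - (i == j)%:R| <= d) -> `|\det M - 1| <= K * d) ->
  exists2 K' : R, 0 <= K' & forall e, 4 * n.+1%:R ^+ 2 * e <= 1 / 100 -> K * (5 * e) <= 1 / 2 ->
  forall a da dda b db ddb, nice e a da dda -> nice e b db ddb ->
  `|M (Jac b db ddb) - (M (Jac a da dda) + n.+1%:R * M (fun x => (b x - a x) * (Jac a da dda x / a x))
     + n.+1%:R / 2 * M (fun x => (n.+1%:R - 1) * (b x - a x) ^+ 2 - gdist da db x))|
  <= K' * (e * M (fun x => (b x - a x) ^+ 2 + gdist da db x)).
Proof.
move=> K0 HK; have K50 : 0 <= 5 * K by rewrite mulr_ge0// ltW.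
have [Kr Kr0 HKr] := @expand_real R n.+1 (5 * K) K50.
exists (Kr * (4 * n.+1%:R ^+ 2)) => [|e es1 es2 a da dda b db ddb aN bN].
  by rewrite mulr_ge0// mulr_ge0// sqr_ge0.
have [e0 e1 _ ed Ne] := e_small es1 aN; have e2 : e <= 1 / 2 by lra. have e3 : e <= 1 by lra. have e5 : e <= 1 / 5 by lra.
set d := dpt e in ed Ne.
have d0 : 0 <= d by lra.
have d1 : d <= 1 / 100 by exact: es1.
have aa := adm_nice aN; have ab := adm_nice bN; have af := admB ab aa.
have aJ := adm_Jac aN e3; have ag := adm_gdist aN bN; have ai := adm_inv aN e2.
have aS : adm (fun x => (b x - a x) ^+ 2 + gdist da db x) by apply: admD => //; exact: admX.
have aJa : adm (fun x => (b x - a x) * (Jac a da dda x / a x)) by apply: admM => //; exact: admM.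
have aQ : adm (fun x => (n.+1%:R - 1) * (b x - a x) ^+ 2 - gdist da db x).
  by apply: admB => //; apply: admZ; exact: admX.
pose mn x := Jac a da dda x + n.+1%:R * ((b x - a x) * (Jac a da dda x / a x))
   + n.+1%:R / 2 * ((n.+1%:R - 1) * (b x - a x) ^+ 2 - gdist da db x).
have amn : adm mn by apply: admD; [apply: admD => //|]; exact: admZ.
have Mmn : M mn = M (Jac a da dda) + n.+1%:R * M (fun x => (b x - a x) * (Jac a da dda x / a x))
     + n.+1%:R / 2 * M (fun x => (n.+1%:R - 1) * (b x - a x) ^+ 2 - gdist da db x).
  have a1 := admZ n.+1%:R aJa; have a2 := admZ (n.+1%:R / 2) aQ; have a3 := admD aJ a1.
  by rewrite (MD a3 a2) (MD aJ a1) !MZ.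
rewrite -Mmn.
have pt s x : `|s| <= 1 -> x != 0 ->
    `|Lam d a b da db s x ^+ n.+1 * Jac a da dda x - mn x| <= Kr * (d * ((b x - a x) ^+ 2 + gdist da db x)).
  move=> s1 x0; have /andP[g0 g1] := gdist_small es1 aN bN x0.
  apply: HKr => //.
  - apply: le_trans (Jac_near aN HK e5 x) _.
    by rewrite mulrCA -mulrA ler_wpM2l// ler_wpM2l// ltW.
  - exact: le_trans (nice_val aN x0) ed.
  - have ha := nice_val aN x0; have hb := nice_val bN x0.
    have -> : b x - a x = (b x - 1) - (a x - 1) by ring.
    by rewrite (le_trans (ler_normB _ _))//; lra.
have aLJ s : adm (fun x => Lam d a b da db s x ^+ n.+1 * Jac a da dda x).
  by apply: admM => //; apply: admX; exact: (adm_Lam es1 aN bN s).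
have MLb s : `|s| <= 1 -> `|M (fun x => Lam d a b da db s x ^+ n.+1 * Jac a da dda x) - M mn| <=
    Kr * (4 * n.+1%:R ^+ 2) * (e * M (fun x => (b x - a x) ^+ 2 + gdist da db x)).
  move=> s1; rewrite -MB// (_ : Kr * _ * _ = M (fun x => Kr * (d * ((b x - a x) ^+ 2 + gdist da db x)))).
    by apply: le_M_norm => [||x x0]; [exact: admB|do 2 apply: admZ|exact: pt].
  by rewrite !MZ ?/d ?/dpt; [ring| |exact: admZ].
have vb := wulff_vol HK es1 es2 bN.
have up := wulff_le_star HK es1 es2 aN bN; have lo := star_le_wulff HK es1 es2 aN bN.
rewrite vb lee_fin -/d in up; rewrite vb lee_fin -/d in lo.
have := MLb 1 (ltac:(by rewrite normr1)); have := MLb (-1) (ltac:(by rewrite normrN normr1)).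
move: up lo; rewrite !ler_norml.
set A := M (fun x => _ * _); set B := M (fun x => _ * _); set D := M mn; set E := M (Jac b _ _); set G := Kr * _ * _.
by move=> up lo /andP[h1 h2] /andP[h3 h4]; clear -up lo h1 h2 h3 h4; apply/andP; split; lra.
Qed.
End BodyVolume.

Section Interpolation.
Variable R : realType.

(* Lagrange: the coefficients are linear functions of the values at 1, ..., m *)
Lemma coef_interpolation (m : nat) : exists c : nat -> nat -> R, forall p : {poly R},
  (size p <= m)%N -> forall k, (k < m)%N -> p`_k = \sum_(i < m) c k i * p.[i.+1%:R].
Proof.
pose W : 'M[R]_m := Vandermonde m (\row_(i < m) i.+1%:R).
have uW : W \in unitmx.
  rewrite unitmxE unitfE det_Vandermonde; apply/prodf_neq0 => i _; apply/prodf_neq0 => j ij.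
  rewrite !mxE subr_eq0 eqr_nat eqSS; apply/eqP => e; by rewrite e ltnn in ij.
pose c (k i : nat) := (if insub i is Some i' then if insub k is Some k' then invmx W i' k' else 0 else 0) : R.
exists c => p sp k km.
pose v : 'rV[R]_m := \row_j p`_j.
have ev : v *m W = \row_i p.[i.+1%:R].
  apply/rowP => i; rewrite !mxE (horner_coef_wide _ sp); apply: eq_bigr => j _.
  by rewrite !mxE.
have -> : p`_k = v ord0 (Ordinal km) by rewrite mxE.
rewrite -[v](mulmxK uW) ev mxE; apply: eq_bigr => i _; by rewrite mxE mulrC /c valK (insubT (fun j => j < m)%N km).
Qed.

Lemma poly_eq_on_nat (m : nat) (p r : {poly R}) : (size p <= m)%N -> (size r <= m)%N ->
  (forall i : nat, p.[i.+1%:R] = r.[i.+1%:R]) -> p = r.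
Proof.
move=> sp sr pr; have [c cP] := coef_interpolation m.
apply/polyP => k; have [km|km] := ltnP k m.
  by rewrite (cP p sp k km) (cP r sr k km); apply: eq_bigr => i _; rewrite pr.
by rewrite !nth_default// (leq_trans _ km).
Qed.

End Interpolation.

(** * Steiner polynomial and intrinsic volumes *)

Section Steiner.
Variables (R : realType) (n : nat).
Notation V := 'rV[R]_n.+1.
Notation I := 'I_n.+1.
Notation off0 := [set x : V | x != 0].
Implicit Types (x y u v : V) (t s e rho : R) (a b : V -> R) (da db : I -> V -> R) (dda ddb : I -> I -> V -> R).

Definition dmx a da dda x : 'M[R]_n.+1 := \matrix_(i, j) dTmap a da dda i j x.
(** The polynomial [det (X + dT)], encoded as the characteristic polynomial of [- dT]; at [rho] it
    is the Jacobian of the gradient map of the parallel body at distance [rho]. *)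
Definition spoly a da dda x : {poly R} := char_poly (- dmx a da dda x).

Lemma spoly_horner a da dda x r : (spoly a da dda x).[r] = \det (r%:M + dmx a da dda x).
Proof.
rewrite /spoly /char_poly -horner_evalE -det_map_mx; congr (\det _).
apply/matrixP => i j; rewrite !mxE /= /horner_eval hornerD hornerN hornerMn hornerX hornerC.
by rewrite opprK.
Qed.

Lemma size_spoly a da dda x : size (spoly a da dda x) = n.+2.
Proof. exact: size_char_poly. Qed.

(** The function [a + rho] of a parallel body, divided by [1 + rho] so that it is again close to 1.
    Parallel bodies at all distances then obey the same smallness constants. *)
Definition sh rho a x := (1 + rho)^-1 * (a x + rho).
Definition dsh rho da (i : I) x := (1 + rho)^-1 * da i x : R.
Definition ddsh rho dda (i k : I) x := (1 + rho)^-1 * dda i k x : R.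

Lemma hom2_sh rho a da dda : hom2 a da dda -> hom2 (sh rho a) (dsh rho da) (ddsh rho dda).
Proof.
move=> [h1 h2 h3]; split=> [t x t0||i]; first by rewrite /sh h1.
  apply: (C1on_ext _ _ (C1onZ (1 + rho)^-1 (C1onD h2 (@C1on_cst R n off0 rho)))) => // k x.
  by rewrite addr0.
exact: C1onZ.
Qed.

Lemma nice_sh rho e a da dda : 0 <= rho -> nice e a da dda -> nice e (sh rho a) (dsh rho da) (ddsh rho dda).
Proof.
move=> r0 aN; have e0 := nice_ge0 aN; have [aH h] := aN.
split=> [|x x1]; first exact: hom2_sh.
have [h1 h2 h3] := h x x1; have rp : 0 < 1 + rho by lra.
have ri1 : (1 + rho)^-1 <= 1 by rewrite invf_le1//; lra.
have ri0 : 0 <= (1 + rho)^-1 by rewrite invr_ge0 ltW.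
have sc z : `|z| <= e -> `|(1 + rho)^-1 * z| <= e.
  by move=> ze; rewrite normrM (ger0_norm ri0) (le_trans _ ze)// ler_piMl.
split=> [|i|i k]; [|exact: sc|exact: sc].
have -> : sh rho a x - 1 = (1 + rho)^-1 * (a x - 1); last exact: sc.
by rewrite /sh; field; lra.
Qed.

Lemma Jac_sh rho a da dda x : 0 <= rho ->
  (1 + rho) ^+ n.+1 * Jac (sh rho a) (dsh rho da) (ddsh rho dda) x = (spoly a da dda x).[rho].
Proof.
move=> r0; have rp : 1 + rho != 0 by apply/eqP; lra.
rewrite spoly_horner /Jac -detZ; congr (\det _); apply/matrixP => i k; rewrite !mxE /dTmap.
case: eqVneq => [x0|x0].
  rewrite [i == k]eq_sym; case: (k == i); rewrite ?mulr1 ?mulr0 ?mulr1n ?mulr0n ?add0r//.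
  by rewrite addrC.
rewrite /sh /dsh /ddsh -[rho *+ _]mulr_natr [i == k]eq_sym; set D := (k == i)%:R.
field; exact: rp.
Qed.

Lemma Tmap_sh rho a da i x : 0 <= rho ->
  (1 + rho) * Tmap (sh rho a) (dsh rho da) i x = Tmap a da i x + rho * x ord0 i.
Proof.
move=> r0; have rp : 1 + rho != 0 by apply/eqP; lra.
by rewrite /Tmap /sh /dsh; field.
Qed.

(* [C] is squeezed between the image of the ball under the extended gradient map and the Wulff shape *)
Definition Body (C : set V) a da := C `<=` wulff a /\ forall x, q x <= 1 -> C (\row_i Tmap a da i x).

Lemma unit_ballE x : (@unit_ball R n.+1) x <-> q x <= 1.
Proof.
rewrite /unit_ball /= -enorm_sqr -(@ler_sqr R) ?nnegrE ?enorm_ge0// expr1n//.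
Qed.

Section Bodies.
Variable K : R.
Hypotheses (K0 : 0 < K) (HK : forall (M : 'M[R]_n.+1) d, 0 <= d -> d <= 1 ->
  (forall i j, `|M i j - (i == j)%:R| <= d) -> `|\det M - 1| <= K * d).
Variable e : R.
Hypotheses (es1 : 4 * n.+1%:R ^+ 2 * e <= 1 / 100) (es2 : K * (5 * e) <= 1 / 2).

Lemma spoly_adm a da dda rho : nice e a da dda -> 0 <= rho -> adm (fun x => (spoly a da dda x).[rho]).
Proof.
move=> aN r0; have [e0 e1 _ _ _] := e_small es1 aN.
have := admZ ((1 + rho) ^+ n.+1) (adm_Jac (nice_sh r0 aN) (ltac:(lra))).
by congr adm; apply/funext => x; rewrite Jac_sh.
Qed.

(** Shrunk by [1 + rho], the Minkowski sum lies between the image of the ball and the Wulff shape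
    belonging to [sh rho a], so [body_vol] gives its volume. *)
Lemma parallel_vol C a da dda rho : nice e a da dda -> Body C a da -> 0 < rho ->
  lebesgue_vol (Defs.msum C (dilate rho (@unit_ball R n.+1))) = (M (fun x => (spoly a da dda x).[rho]))%:E.
Proof.
move=> aN [Ca TC] r0; have r00 := ltW r0; have rp : 0 < 1 + rho by lra.
have bN := nice_sh r00 aN.
set A := Defs.msum _ _.
have := @lebesgue_vol_scale R n (1 + rho) A rp.
have hv : lebesgue_vol (( *:%R (1 + rho)) @^-1` A) = (M (Jac (sh rho a) (dsh rho da) (ddsh rho dda)))%:E.
  apply: (body_vol HK es1 es2 bN).
    move=> y /= [c Cc [_ [b bB <-] e1]] v sv.
    have v1 := (sphereE v).1 sv; have b1 := (unit_ballE b).1 bB.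
    rewrite /sh ler_pdivlMl// -dotpZl -e1 !dotpE lerD//; first exact: Ca.
    have : dotp b v ^+ 2 <= 1.
      by rewrite (le_trans (dotp_CS _ _))// -/(q v) v1 mulr1.
    by move=> h; rewrite ler_piMr//; nra.
  move=> x qx /=; exists (\row_i Tmap a da i x); first exact: TC.
  exists (rho *: x); first by exists x => //; apply/unit_ballE.
  by apply/rowP => i; rewrite !mxE Tmap_sh.
rewrite hv => h.
have -> : lebesgue_vol A = (((1 + rho) ^+ n.+1)%:E * (((1 + rho) ^- n.+1)%:E * lebesgue_vol A))%E.
  by rewrite muleA -EFinM divff ?mul1e// expf_neq0// gt_eqF.
rewrite -h -EFinM; congr (_%:E).
rewrite -MZ; last by apply: (adm_Jac bN); have [e0 e1 _ _ _] := e_small es1 aN; lra.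
by apply: eq_M => x; rewrite Jac_sh.
Qed.

Definition Ucoef (k : nat) a da dda := M (fun x => (spoly a da dda x)`_k).

Lemma coef_spoly_adm a da dda k : nice e a da dda -> adm (fun x => (spoly a da dda x)`_k).
Proof.
move=> aN; have [c cP] := coef_interpolation R n.+2; have [km|km] := ltnP k n.+2.
  rewrite (_ : (fun x => _) = (fun x => \sum_(i < n.+2) c k i * (spoly a da dda x).[i.+1%:R])).
    by apply: adm_sum => i; apply: admZ; exact: spoly_adm.
  by apply/funext => x; rewrite (cP _ _ _ km)// size_spoly.
rewrite (_ : (fun x => _) = (fun=> 0)); first exact: adm_cst.
by apply/funext => x; rewrite nth_default// size_spoly.
Qed.

Lemma steinerP C a da dda : nice e a da dda -> Body C a da ->
  steiner_poly C (\poly_(k < n.+2) Ucoef k a da dda).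
Proof.
move=> aN bC; split=> [|rho r0]; first exact: size_poly.
rewrite (parallel_vol aN bC r0) horner_poly; congr (_%:E).
have -> : (fun x => (spoly a da dda x).[rho]) = (fun x => \sum_(k < n.+2) rho ^+ k * (spoly a da dda x)`_k).
  apply/funext => x; rewrite horner_coef size_spoly; by apply: eq_bigr => k _; rewrite mulrC.
rewrite M_sum => [|k]; last by apply: admZ; exact: coef_spoly_adm.
by apply: eq_bigr => k _; rewrite (MZ _ (coef_spoly_adm k aN)) mulrC.
Qed.

(** A polynomial of size at most [n.+2] is determined by its values at the integers [1, ..., n.+2],
    so the one that [xget] selects is the one constructed in [steinerP]. *)
Lemma intrinsic_volumeE C a da dda j : nice e a da dda -> Body C a da ->
  intrinsic_volume j C = Ucoef (n.+1 - j) a da dda / kappa R (n.+1 - j).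
Proof.
move=> aN bC; rewrite /intrinsic_volume.
have h := steinerP aN bC.
have [s1 s2] : steiner_poly C (xget 0 [set P | steiner_poly C P]).
  by have := @xgetPex _ 0 [set P | steiner_poly C P] (ex_intro _ _ h).
set P := xget _ _ in s1 s2 *.
have -> : P = \poly_(k < n.+2) Ucoef k a da dda.
  apply: (@poly_eq_on_nat R n.+2); [exact: s1|exact: size_poly|move=> i].
  have [_ h2] := h; have i0 : (0 : R) < i.+1%:R by [].
  by have := s2 _ i0; rewrite h2// => -[].
by rewrite coef_poly ltnS leq_subr.
Qed.

(* [Ucoef] as a combination of volumes of bodies that are again nearly spherical *)
Lemma Ucoef_interp (c : nat -> nat -> R) : (forall p : {poly R}, (size p <= n.+2)%N ->
    forall k, (k < n.+2)%N -> p`_k = \sum_(i < n.+2) c k i * p.[i.+1%:R]) ->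
  forall k a da dda, (k < n.+2)%N -> nice e a da dda ->
  Ucoef k a da dda = \sum_(i < n.+2) c k i * ((1 + i.+1%:R) ^+ n.+1 *
    M (Jac (sh i.+1%:R a) (dsh i.+1%:R da) (ddsh i.+1%:R dda))).
Proof.
move=> cP k a da dda kn aN; rewrite /Ucoef.
rewrite (_ : (fun x => _) = (fun x => \sum_(i < n.+2) c k i * (spoly a da dda x).[i.+1%:R])); last first.
  by apply/funext => x; rewrite (cP _ _ _ kn)// size_spoly.
rewrite M_sum => [|i]; last by apply: admZ; exact: spoly_adm.
apply: eq_bigr => i _; rewrite MZ; last exact: spoly_adm.
congr (_ * _); rewrite -MZ; last first.
  have i0 : 0 <= i.+1%:R :> R by []; apply: (adm_Jac (nice_sh i0 aN)).
  by have [e0 e1 _ _ _] := e_small es1 aN; lra.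
by apply: eq_M => x; rewrite Jac_sh.
Qed.

(** The polynomial of [t a] at [rho] is [t ^ n.+1] times that of [a] at [rho / t]; coefficients are
    compared. The comparison is made off 0, where [dTmap] is a true derivative and scales. *)
Lemma Ucoef_hom k t a da dda : 0 < t -> nice e a da dda -> (k <= n.+1)%N ->
  Ucoef k (fun x => t * a x) (fun i x => t * da i x) (fun i l x => t * dda i l x) =
  t ^+ (n.+1 - k) * Ucoef k a da dda.
Proof.
move=> t0 aN kn; have tn0 : t != 0 by rewrite gt_eqF.
rewrite /Ucoef -MZ; last exact: coef_spoly_adm.
have e1 x : x != 0 -> t ^+ (n.+1 - k) * (spoly a da dda x)`_k =
    (spoly (fun x => t * a x) (fun i x => t * da i x) (fun i l x => t * dda i l x) x)`_k.
  move=> x0; set p := spoly a _ _ _; set r := spoly _ _ _ _.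
  have -> : r = \poly_(l < n.+2) (t ^+ (n.+1 - l) * p`_l).
    apply: (@poly_eq_on_nat R n.+2) => [||i]; [by rewrite size_spoly|exact: size_poly|].
    rewrite horner_poly spoly_horner; set rho := i.+1%:R.
    transitivity (t ^+ n.+1 * p.[rho / t]).
      rewrite spoly_horner -detZ; congr (\det _); apply/matrixP => l m; rewrite !mxE /dTmap (negbTE x0).
      rewrite -[rho *+ _]mulr_natr -[(rho / t) *+ _]mulr_natr; set D := (_ == _)%:R; set D' := (_ == _)%:R.
      by field.
    rewrite horner_coef size_spoly mulr_sumr; apply: eq_bigr => l _.
    have ln : (l <= n.+1)%N by rewrite -ltnS.
    have -> : t ^+ n.+1 = t ^+ (n.+1 - l) * t ^+ l by rewrite -exprD subnK.
    rewrite expr_div_n; field; exact: expf_neq0.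
  by rewrite coef_poly ltnS kn.
apply/esym/eq_M_off0 => //; apply: admZ; exact: coef_spoly_adm.
Qed.

End Bodies.

End Steiner.

Lemma kappa_gt0 (R : realType) (d : nat) : 0 < kappa R d.+1.
Proof.
rewrite /kappa (_ : @unit_ball R d.+1 = @qball R d); last first.
  by apply/seteqP; split=> x; [move/unit_ballE|move=> h; apply/unit_ballE].
have mq : measurable (@qball R d : set (caratheodory_type (volO R d))).
  have := @mfun_le R d _ (fun=> 1) (@mfun_q R d) (mfun_cst 1); exact.
rewrite -Int_indic//; have := @M1_gt0 R d; rewrite /M.
by under eq_Int do rewrite mulr1.
Qed.

(** * Radial moments of homogeneous functions *)

Section Moments.
Variables (R : realType) (n : nat).
Notation V := 'rV[R]_n.+1.
Notation I := 'I_n.+1.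
Notation off0 := [set x : V | x != 0].
Notation ei k := (delta_mx ord0 k : V).
Implicit Types (x y u v : V) (t s e : R) (F : V -> R).

Lemma le_small_eps (A B D : R) : 0 <= D -> (forall s, 0 < s -> s < 1 -> A <= B + D * s) -> A <= B.
Proof.
move=> D0 h; apply/ler_addgt0Pr => e e0.
pose s := Num.min (1 / 2) (e / (D + 1)).
have D1 : 0 < D + 1 by lra.
have s0 : 0 < s by rewrite lt_min divr_gt0//= divr_gt0.
have s1 : s <= 1 / 2 by rewrite ge_min lexx.
apply: (le_trans (h s s0 (ltac:(lra)))); rewrite lerD2l.
have : s <= e / (D + 1) by rewrite ge_min lexx orbT.
rewrite ler_pdivlMr// => h2; apply: le_trans h2; rewrite mulrDr mulr1 mulrC; lra.
Qed.

Lemma geom_bounds (m : nat) s : 0 < s -> s < 1 ->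
  m%:R * s - m%:R ^+ 2 * s ^+ 2 <= 1 - (1 - s) ^+ m <= m%:R * s.
Proof.
move=> s0 s1; elim: m => [|m /andP[h1 h2]]; first by rewrite expr0 subrr mul0r expr0n/= mul0r subrr lexx.
rewrite -natr1; have m0 : 0 <= m%:R :> R by [].
have p0 : 0 <= (1 - s) ^+ m by rewrite exprn_ge0//; lra.
have p1 : (1 - s) ^+ m <= 1 by rewrite exprn_ile1//; lra.
have e : 1 - (1 - s) * (1 - s) ^+ m = 1 - (1 - s) ^+ m + s * (1 - s) ^+ m by ring.
rewrite [(1 - s) ^+ m.+1]exprS e; move: h1 h2 p0 p1 m0; set X := (1 - s) ^+ m; set k := m%:R => h1 h2 p0 p1 m0.
have h3 : s * (1 - k * s) <= s * X by rewrite ler_wpM2l//; lra.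
have h4 : s * X <= s by rewrite ler_piMr//; lra.
have h5 : 0 <= s ^+ 2 by exact: sqr_ge0.
have h6 : 0 <= k * s ^+ 2 by rewrite mulr_ge0.
by apply/andP; split; lra.
Qed.

Lemma bbm_qk F k : adm F -> bbm (fun x => \1_(@qball R n) x * (q x ^+ k * F x)).
Proof.
move=> aF; have mq : mfun (fun x : V => q x ^+ k).
  elim: k => [|k IH]; first by under eq_fun do rewrite expr0; exact: mfun_cst.
  by under eq_fun do rewrite exprS; apply: mfunM => //; exact: mfun_q.
have := bbmMl mq _ (bbm_M aF); under eq_fun do rewrite mulrCA; apply => C.
exists ((n.+1%:R * C ^+ 2) ^+ k) => x xC; have C0 : 0 <= C := le_trans (normr_ge0 _) xC.
rewrite normrX lerXn2r ?nnegrE ?mulr_ge0 ?sqr_ge0//.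
by rewrite ger0_norm ?q_ge0// (le_trans (q_le_norm x))// ler_wpM2l// ler_sqr ?nnegrE.
Qed.

Definition mom k F := Int (fun x => \1_(@qball R n) x * (q x ^+ k * F x)).

(** Polar integration would give both sides at once. Here the two integrands are compared on the
    thin shell [(1 - s)^2 <= q <= 1], where [q ^ k] is 1 up to order [s]; by homogeneity the shell
    carries the fractions [1 - (1 - s)^(n.+1 + 2k)] and [1 - (1 - s)^n.+1] of the two totals. Then
    [s] tends to 0. *)
Lemma moment F k : adm F -> (forall x, 0 <= F x) -> (forall t x, 0 < t -> F (t *: x) = F x) ->
  (n.+1 + 2 * k)%:R * mom k F = n.+1%:R * M F.
Proof.
move=> aF F0 Fh; set N2 := (n.+1 + 2 * k)%N.
have sc (l : nat) s : 0 < s -> Int (fun x => \1_[set x : V | q x <= s ^+ 2] x * (q x ^+ l * F x)) =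
    s ^+ (n.+1 + 2 * l) * mom l F.
  move=> s0; have sn0 : s != 0 by rewrite gt_eqF.
  have := @Int_scale R n s^-1 _ (ltac:(by rewrite invr_gt0)) (bbmZ (s ^+ (2 * l)) (bbm_qk l aF)).
  rewrite exprVn invrK [X in _ = _ * X](IntZ _ (bbm_qk l aF)) mulrA -exprD => <-; apply: eq_Int => x; rewrite Fh ?invr_gt0//.
  have qs : q (s^-1 *: x) = s ^- 2 * q x by rewrite /q !dotpE mulrA -invfM -expr2.
  have -> : \1_(@qball R n) (s^-1 *: x) = \1_[set x : V | q x <= s ^+ 2] x :> R.
    rewrite !indicE; congr ((_ : bool)%:R); apply/idP/idP; rewrite !inE /qball /= qs;
      by rewrite ler_pdivrMl ?exprn_gt0// mulr1.
  rewrite qs exprMn exprVn -exprM; have : s ^+ (2 * l) != 0 by rewrite expf_neq0.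
  by move: (s ^+ (2 * l)) (q x ^+ l) (F x) (\1__ x : R) => s2 ql Fx i1 s20; field.
pose m1 := mom k F; pose m0 := M F.
have m00 : M F = mom 0 F by apply: eq_Int => x; rewrite expr0 mul1r.
have [m0p m1p] : 0 <= m0 /\ 0 <= m1.
  split; apply: Int_ge0 => x; rewrite mulr_ge0 ?indicE//.
  by rewrite mulr_ge0// exprn_ge0// q_ge0.
have key s : 0 < s -> s < 1 -> (1 - (1 - s) ^+ N2) * m1 <= (1 - (1 - s) ^+ n.+1) * m0 /\
    (1 - s) ^+ (2 * k) * ((1 - (1 - s) ^+ n.+1) * m0) <= (1 - (1 - s) ^+ N2) * m1.
  move=> s0 s1; pose t := 1 - s; have t0 : 0 < t by rewrite /t; lra. have t1 : t < 1 by rewrite /t; lra.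
  have bq l : bbm (fun x => \1_[set x : V | q x <= t ^+ 2] x * (q x ^+ l * F x)).
    have bt : bbm (\1_[set x : V | q x <= t ^+ 2] : V -> R).
      by apply: (@bbm_qle _ _ (fun=> t) `|t|) => //; exact: mfun_cst.
    have := bbmM bt (bbm_qk l aF); congr bbm; apply/funext => x; rewrite mulrA; congr (_ * _).
    rewrite !indicE; case: (boolP (x \in [set x0 | _])) => h1; last by rewrite mul0r.
    rewrite mem_set ?mulr1//; move: h1; rewrite inE /qball /= => h1; apply: le_trans h1 _.
    by rewrite exprn_ile1// ltW.
  have D l : (1 - t ^+ (n.+1 + 2 * l)) * mom l F = Int (fun x => \1_(@qball R n) x * (q x ^+ l * F x) -
      \1_[set x : V | q x <= t ^+ 2] x * (q x ^+ l * F x)).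
    by rewrite IntB ?sc// ?mulrBl ?mul1r//; exact: bbm_qk.
  rewrite -/t; have := D k; rewrite -/N2 -/m1 => ->.
  have := D 0%N; rewrite muln0 addn0 -m00 -/m0 => ->.
  have pt x : \1_[set x : V | q x <= t ^+ 2] x <= \1_(@qball R n) x :> R /\
     (\1_(@qball R n) x != \1_[set x : V | q x <= t ^+ 2] x :> R -> t ^+ 2 <= q x <= 1).
    have e1 : \1_[set x : V | q x <= t ^+ 2] x = ((q x <= t ^+ 2)%R : bool)%:R :> R.
      by rewrite indicE; congr ((_ : bool)%:R); apply/idP/idP; rewrite inE.
    have e2 : \1_(@qball R n) x = ((q x <= 1)%R : bool)%:R :> R.
      by rewrite indicE; congr ((_ : bool)%:R); apply/idP/idP; rewrite inE.
    have t21 : t ^+ 2 <= 1 by rewrite exprn_ile1// ltW.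
    rewrite e1 e2; case: (lerP (q x) (t ^+ 2)) => h1.
      by rewrite (le_trans h1 t21) eqxx.
    by rewrite ler0n; split=> //; case: (lerP (q x) 1) => h2; rewrite ?eqxx// (ltW h1).
  have aF1 := bbm_qk k aF; have aF0 := bbm_qk 0 aF.
  split.
    apply: le_Int; [exact: bbmB|exact: bbmB|move=> x].
    rewrite -!mulrBl expr0 mul1r; have [h1 h2] := pt x.
    have [->|/h2/andP[h3 h4]] := eqVneq (\1_(@qball R n) x : R) (\1_[set x : V | q x <= t ^+ 2] x).
      by rewrite subrr !mul0r.
    by rewrite ler_wpM2l ?subr_ge0// ler_piMl// exprn_ile1// q_ge0.
  rewrite -IntZ; last exact: bbmB.
  apply: le_Int; [by apply: bbmZ; exact: bbmB|exact: bbmB|move=> x].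
  rewrite -!mulrBl expr0 mul1r mulrCA; have [h1 h2] := pt x.
  have [->|/h2/andP[h3 h4]] := eqVneq (\1_(@qball R n) x : R) (\1_[set x : V | q x <= t ^+ 2] x).
    by rewrite subrr !mul0r.
  by rewrite ler_wpM2l ?subr_ge0// ler_wpM2r// exprM lerXn2r ?nnegrE ?sqr_ge0 ?q_ge0.
rewrite -/m1 -/m0; apply/eqP; rewrite eq_le; apply/andP; split.
  apply: (@le_small_eps _ _ (N2%:R ^+ 2 * m1)) => [|s s0 s1]; first by rewrite mulr_ge0 ?sqr_ge0.
  have [h1 _] := key s s0 s1.
  have /andP[g1 _] := geom_bounds N2 s0 s1; have /andP[_ g2] := geom_bounds n.+1 s0 s1.
  have h3 : (N2%:R * s - N2%:R ^+ 2 * s ^+ 2) * m1 <= n.+1%:R * s * m0.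
    by rewrite (le_trans (ler_wpM2r m1p g1))// (le_trans h1)// ler_wpM2r.
  rewrite -(ler_pM2l s0); lra.
apply: (@le_small_eps _ _ ((n.+1%:R ^+ 2 + (2 * k)%:R * n.+1%:R) * m0)) => [|s s0 s1].
  by rewrite mulr_ge0// addr_ge0 ?sqr_ge0 ?mulr_ge0.
have [_ h1] := key s s0 s1.
have /andP[_ g1] := geom_bounds N2 s0 s1; have /andP[g2 g3] := geom_bounds n.+1 s0 s1.
have /andP[_ g4] := geom_bounds (2 * k) s0 s1.
have h2 : (1 - (1 - s) ^+ N2) * m1 <= N2%:R * s * m1 by rewrite ler_wpM2r.
move: h1 g2 g3 g4 h2; set X := 1 - (1 - s) ^+ n.+1; set Y := (1 - s) ^+ (2 * k); set Z := 1 - (1 - s) ^+ N2.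
set N := n.+1%:R; set k2 := (2 * k)%:R; set M2 := N2%:R => h1 g2 g3 g4 h2.
have X0 : 0 <= X by rewrite subr_ge0 exprn_ile1//; lra.
have k20 : 0 <= k2 by [].
have h3 : (1 - k2 * s) * X <= Y * X by rewrite ler_wpM2r//; lra.
have h4 : k2 * s * X <= k2 * s * (N * s) by rewrite ler_wpM2l// mulr_ge0// ltW.
have h5 : (N * s - N ^+ 2 * s ^+ 2 - k2 * s * (N * s)) * m0 <= Y * X * m0 by rewrite ler_wpM2r//; lra.
have h6 : (N * s - N ^+ 2 * s ^+ 2 - k2 * s * (N * s)) * m0 <= M2 * s * m1.
  by apply: le_trans h5 _; rewrite -mulrA; apply: le_trans h1 _.
rewrite -(ler_pM2l s0); lra.
Qed.

End Moments.

(** * A sharp weighted inequality for functions odd in one coordinate *)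

Section OddInequality.
Variables (R : realType) (n : nat).
Notation V := 'rV[R]_n.+1.
Notation I := 'I_n.+1.
Notation off0 := [set x : V | x != 0].
Notation ei k := (delta_mx ord0 k : V).
Implicit Types (x y u v : V) (t s e : R).

Lemma is_derive_quadratic (f : V -> R) v C : 0 <= C -> (forall s, `|s| <= 1 -> `|f (s *: v)| <= C * s ^+ 2) ->
  is_derive (0 : V) v f (0 : R).
Proof.
move=> C0 fC; apply: is_derive_line0.
have f0 : f 0 = 0.
  by apply/eqP; rewrite -normr_le0 -(scale0r v) (le_trans (fC 0 _)) ?normr0// expr0n mulr0.
have key : (fun h : R => h^-1 *: (((fun s : R => f (0 + s *: v)) \o shift 0) (h *: (1 : R)) - f (0 + 0 *: v))) @ 0^' --> (0 : R).
  apply/cvgrPdist_le => e e0; near=> h.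
  have h0 : h != 0 by near: h; exact: nbhs_dnbhs_neq.
  have h1 : `|h| <= 1 by near: h; apply: cvg_within; apply: (@nbhs0_le _ R).
  have he : `|h| <= e / (C + 1).
    by near: h; apply: cvg_within; apply: (@nbhs0_le _ R); rewrite divr_gt0//; lra.
  have -> : h^-1 *: (((fun s : R => f (0 + s *: v)) \o shift 0) (h *: (1 : R)) - f (0 + 0 *: v)) =
      h^-1 * f (h *: v).
    by rewrite /= !add0r scale0r f0 subr0 addr0 [h *: 1]mulr1.
  rewrite sub0r normrN normrM normfV.
  rewrite ler_pdivrMl ?normr_gt0// (le_trans (fC h h1))//.
  rewrite -real_normK ?num_real// expr2 mulrCA ler_wpM2l//.
  have C1 : 0 < C + 1 by lra.
  move: he; rewrite ler_pdivlMr//; have := normr_ge0 h; nra.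
split; first by apply/cvg_ex; eexists; exact: key.
by apply/cvg_lim => //; exact: key.
Unshelve. all: by end_near. Qed.

Variables (f0 : V -> R) (df0 : I -> V -> R) (C : R) (i : I).
Hypotheses (fC : C1on off0 f0 df0) (fb : forall x, x != 0 -> `|f0 x| <= C).
Hypotheses (dfb : forall x k, x != 0 -> `|df0 k x| * enorm x <= C).
Hypothesis fodd : forall x, f0 (flip i x) = - f0 x.

(** The 2-homogeneous extension: it is C^1 across the origin, and for the extremal function
    [x_i x_j / |x|^2] it is linear in [x_i], the equality case of the inequality to come. *)
Let f x := q x * f0 x.
Let df (k : I) x := q x * df0 k x + f0 x * (2 * x ord0 k).

Let C0 : 0 <= C.
Proof. by apply: le_trans (fb (q1_neq0 (dotp_ei R ord0))). Qed.

Let f00 : f0 0 = 0.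
Proof.
have := fodd 0; have -> : flip i 0 = 0 :> V.
  by apply/rowP => l; rewrite /flip !mxE oppr0; case: (l == i).
move/eqP; rewrite -addr_eq0 -mulr2n mulrn_eq0/= => /eqP; exact.
Qed.

Let fb' x : `|f0 x| <= C.
Proof. by have [->|x0] := eqVneq x 0; [rewrite f00 normr0|exact: fb]. Qed.

Let f_C1 : C1on off0 f df.
Proof. exact: (C1onM (@open_ne0 R n) (@C1on_q R n off0) fC). Qed.

Let df00 k : df k 0 = 0. Proof. by rewrite /df q0 f00 mul0r mul0r addr0. Qed.

Let fq x : `|f x| <= C * q x.
Proof. by rewrite /f normrM ger0_norm ?q_ge0// mulrC ler_wpM2r ?q_ge0. Qed.

Let df_bound k x : `|df k x| <= 3 * C * enorm x.
Proof.
have [->|x0] := eqVneq x 0; first by rewrite df00 normr0 mulr_ge0 ?enorm_ge0// mulr_ge0.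
have n1 : `|q x * df0 k x| = enorm x ^+ 2 * `|df0 k x| by rewrite normrM ger0_norm ?q_ge0// enorm_sqr.
have n2 : `|f0 x * (2 * x ord0 k)| = `|f0 x| * (2 * `|x ord0 k|) by rewrite !normrM [`|2|]ger0_norm.
rewrite /df (le_trans (ler_normD _ _))// n1 n2.
have h1 : enorm x ^+ 2 * `|df0 k x| <= C * enorm x.
  have -> : enorm x ^+ 2 * `|df0 k x| = (`|df0 k x| * enorm x) * enorm x by ring.
  by rewrite ler_wpM2r ?enorm_ge0 ?dfb.
have h2 : `|f0 x| * (2 * `|x ord0 k|) <= C * (2 * enorm x).
  by rewrite ler_pM ?fb' ?mulr_ge0// ler_wpM2l// coord_le_enorm.
lra.
Qed.

Let f_derive k x : is_derive x (ei k) f (df k x).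
Proof.
have [->|x0] := eqVneq x 0; last by have [+ _] := f_C1 x0; exact.
rewrite df00; apply: (@is_derive_quadratic _ _ C) => // s s1.
by rewrite (le_trans (fq _))// /q !dotpE dotp_ei mulr1 -expr2.
Qed.

(** Oddness makes [f] vanish on the mirror [x_i = 0], and the mean value theorem in direction [i]
    bounds it by the distance to the mirror. *)
Let f_lip x : q x <= 1 -> `|f x| <= 3 * C * `|x ord0 i|.
Proof.
move=> qx; pose x' := x - x ord0 i *: ei i.
have x'i : x' ord0 i = 0 by rewrite !mxE !eqxx mulr1 subrr.
have fx' : f x' = 0.
  have : f0 (flip i x') = f0 x'.
    congr f0; apply/rowP => l; rewrite /flip mxE; case: eqP => // ->; by rewrite x'i oppr0.
  rewrite fodd => /eqP; rewrite eq_sym -addr_eq0 -mulr2n mulrn_eq0/= => /eqP h.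
  by rewrite /f h mulr0.
have xE : x = x' + x ord0 i *: ei i by rewrite subrK.
have [c ci e] := @line_mvt_loc R n f (df i) x' (ei i) (x ord0 i) (fun s _ => f_derive i _).
rewrite {1}xE; have -> : f (x' + x ord0 i *: ei i) = df i (x' + c *: ei i) * x ord0 i.
  by rewrite -e fx' subr0.
rewrite normrM ler_wpM2r// (le_trans (df_bound _ _))// ler_piMr ?mulr_ge0//.
rewrite -(@ler_sqr R) ?nnegrE ?enorm_ge0// expr1n enorm_sqr (le_trans _ qx)//.
rewrite !qE [leRHS](bigD1 i)//= (bigD1 i)//= lerD//.
  rewrite !mxE !eqxx mulr1 subrr add0r mulr1 -[leLHS]real_normK ?num_real// -[leRHS]real_normK ?num_real//.
  by rewrite ler_sqr ?nnegrE.
by apply: ler_sum => l li; rewrite !mxE (negbTE li) andbF !mulr0 subr0 addr0.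
Qed.

(** The weight [W = P ^ 2] vanishes to second order at the unit sphere, so extending it by 0 keeps
    it C^1; its derivative in direction [i] is [- 4 P x_i]. *)
Let P x : R := Num.max 0 (1 - q x).
Let W x : R := pp (1 - q x).
Let WE x : W x = P x ^+ 2. Proof. by []. Qed.
Let P0 x : 0 <= P x. Proof. by rewrite /P le_max lexx. Qed.
Let P1 x : P x <= 1. Proof. by rewrite /P ge_max ler01/= gerBl q_ge0. Qed.
Let Pout x : 1 <= q x -> P x = 0. Proof. by move=> h; rewrite /P max_l// subr_le0. Qed.
Let W_C1 : C1on setT W (fun k x => dpp (1 - q x) * (0 - 2 * x ord0 k)).
Proof.
apply: (@C1on_comp1 R n setT _ _ (@pp R) (@dpp R) openT (C1onB (@C1on_cst R n setT 1) (@C1on_q R n setT))) => x _.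
by split; [exact: pp_derive|exact: dpp_cont].
Qed.
Let norm_q1 x : 1 < `|x| -> 1 <= q x.
Proof. by move=> h; apply: le_trans (norm_le_q x); rewrite exprn_ege1// ltW. Qed.

Let q1P x : q x < 1 \/ P x = 0.
Proof. by case: (ltrP (q x) 1) => h; [left|right; exact: Pout]. Qed.

Let coord1 x k : q x < 1 -> `|x ord0 k| <= 1.
Proof.
move=> qx; rewrite (le_trans (coord_le_enorm x k))//.
by rewrite -(@ler_sqr R) ?nnegrE ?enorm_ge0// expr1n enorm_sqr ltW.
Qed.

Let f_bound x : q x < 1 -> `|f x| <= C.
Proof. by move=> qx; rewrite (le_trans (fq x))// ler_piMr// ltW. Qed.

Let dfi_bound x : q x < 1 -> `|df i x| <= 3 * C.
Proof.
move=> qx; rewrite (le_trans (df_bound i x))// ler_piMr ?mulr_ge0//.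
by rewrite -(@ler_sqr R) ?nnegrE ?enorm_ge0// expr1n enorm_sqr ltW.
Qed.

Let Wb x : `|W x| <= 1.
Proof. by rewrite WE normrX ger0_norm// exprn_ile1. Qed.

Let mf : mfun f.
Proof. by apply: continuous_off0_mfun => x x0; exact: C1on_forcont f_C1 x0. Qed.
Let mdf k : mfun (df k).
Proof. by apply: continuous_off0_mfun => x x0; have [_ /(_ k)] := f_C1 x0; exact. Qed.
Let mP : mfun P.
Proof.
apply: (@mfun_comp1 _ _ (fun x => 1 - q x) (Num.max 0)).
  by apply: mfunB; [exact: mfun_cst|exact: mfun_q].
by apply: continuous_measurable_fun => t; apply: (@continuous_max _ _ (cst 0) id); [exact: cst_continuous|exact: id].
Qed.
Let mW : mfun W. Proof. by apply: mfunM. Qed.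
Let mcoord k : mfun (fun x : V => x ord0 k). Proof. exact: measurable_coord. Qed.

Let bbdq (g : V -> R) D : 0 <= D -> (forall x, q x < 1 -> `|g x| <= D) ->
  (forall x, P x = 0 -> g x = 0) -> bbd (1 + D) g.
Proof.
move=> D0 h1 h2; split=> x; last by move=> hx; apply/h2/Pout/norm_q1; lra.
have [/h1|/h2 ->] := q1P x; first by lra.
by rewrite normr0; lra.
Qed.
Let WP x : P x = 0 -> W x = 0. Proof. by move=> h; rewrite WE h expr0n. Qed.
Let sqb (u b : R) : `|u| <= b -> `|u ^+ 2| <= b ^+ 2.
Proof. by move=> h; rewrite normrX lerXn2r ?nnegrE// (le_trans _ h). Qed.

Let nM (u w a b : R) : `|u| <= a -> `|w| <= b -> `|u * w| <= a * b.
Proof. by move=> h1 h2; rewrite normrM ler_pM. Qed.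
Let n4 : `|4 : R| <= 4. Proof. by rewrite ger0_norm. Qed.
Let n2 : `|2 : R| <= 2. Proof. by rewrite ger0_norm. Qed.
Let Pn x : `|P x| <= 1. Proof. by rewrite ger0_norm. Qed.

Let bT1 : bbm (fun x => 4 * (P x * f x ^+ 2)).
Proof.
apply: (bbd_bbm (C := 1 + 4 * (1 * C ^+ 2))); first by apply: mfunM; [exact: mfun_cst|apply: mfunM => //; apply: mfunM].
apply: bbdq => [|x qx|x ->]; [by rewrite !mulr_ge0 ?sqr_ge0| |by rewrite mul0r mulr0].
exact: (nM n4 (nM (Pn x) (sqb (f_bound qx)))).
Qed.
Let bT2 : bbm (fun x => W x * df i x ^+ 2).
Proof.
apply: (bbd_bbm (C := 1 + (3 * C) ^+ 2)); first by apply: mfunM => //; apply: mfunM.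
apply: bbdq => [|x qx|x /WP ->]; [by rewrite sqr_ge0| |by rewrite mul0r].
by rewrite -[leRHS]mul1r; exact: (nM (Wb x) (sqb (dfi_bound qx))).
Qed.

Section Eps.
Variable e : R.
Hypothesis e0 : 0 < e.
(** [y = t / den t] regularises [1 / t], which is singular on the mirror. *)
Let den t := t ^+ 2 + e ^+ 2.
Let den0 t : 0 < den t. Proof. by rewrite ltr_wpDl ?sqr_ge0// exprn_gt0. Qed.
Let y t := t / den t.
Let dy t := (e ^+ 2 - t ^+ 2) / den t ^+ 2.

Let den_derive t : is_derive t (1 : R) den (2 * t).
Proof.
have h := is_deriveD (is_deriveX 2 (is_derive_id t (1 : R))) (is_derive_cst (e ^+ 2) t (1 : R)).
apply: (is_derive_eq h); rewrite /= addr0 /GRing.scale/= mulr1 expr1 mulr_natl//.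
Qed.
Let y_derive t : is_derive t (1 : R) y (dy t).
Proof.
have dn : den t != 0 by rewrite gt_eqF.
have h := is_deriveM (is_derive_id t (1 : R)) (is_deriveV dn (den_derive t)).
apply: (is_derive_eq h); rewrite /dy /GRing.scale/=.
have -> : e ^+ 2 = den t - t ^+ 2 by rewrite /den addrC addKr.
by field.
Qed.

Let yb t : `|y t| <= e^-1.
Proof.
rewrite /y normrM normfV (gtr0_norm (den0 t)) ler_pdivrMr ?den0// ler_pdivlMl//.
by rewrite /den -[t ^+ 2]real_normK ?num_real//; have := normr_ge0 t; move: (e0); nra.
Qed.
Let dyb t : `|dy t| <= e ^- 2.
Proof.
have e20 : 0 < e ^+ 2 by rewrite exprn_gt0.
have t20 : 0 <= t ^+ 2 by exact: sqr_ge0.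
rewrite /dy normrM normfV (ger0_norm (sqr_ge0 (den t))) ler_pdivrMr ?exprn_gt0// ler_pdivlMl//.
have h : `|e ^+ 2 - t ^+ 2| <= den t by rewrite /den ler_norml; apply/andP; split; lra.
by rewrite expr2 ler_pM ?(ltW e20)//; rewrite /den; lra.
Qed.

Let psi x := W x * (f x ^+ 2 * y (x ord0 i)).
Let dpsi x := W x * (2 * f x * df i x * y (x ord0 i) + f x ^+ 2 * dy (x ord0 i)) -
  4 * P x * (f x ^+ 2 * (x ord0 i * y (x ord0 i))).

Let psi_derive x : is_derive x (ei i) psi (dpsi x).
Proof.
have dW : is_derive x (ei i) W (dpp (1 - q x) * (0 - 2 * x ord0 i)) by have [/(_ i) h _] := @W_C1 x Logic.I; exact: h.
have dY : is_derive x (ei i) (fun z => y (z ord0 i)) (dy (x ord0 i)).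
  apply: is_derive_line0.
  have -> : (fun s : R => y ((x + s *: ei i) ord0 i)) = (fun s => y (x ord0 i + s)).
    by apply/funext => s; rewrite !mxE !eqxx mulr1.
  have h1 : is_derive (0 : R) (1 : R) (fun s : R => x ord0 i + s) (1 : R).
    apply: (is_derive_eq (is_deriveD (is_derive_cst (x ord0 i) (0 : R) (1 : R)) (is_derive_id (0 : R) (1 : R)))).
    by rewrite add0r.
  have h2 : is_derive (x ord0 i + 0) (1 : R) y (dy (x ord0 i)) by rewrite addr0; exact: y_derive.
  by apply: (is_derive_eq (@is_derive1_comp _ y (fun s => x ord0 i + s) 0 _ _ h2 h1)); rewrite mulr1.
have dM (g h : V -> R) dg dh : is_derive x (ei i) g dg -> is_derive x (ei i) h dh ->
    is_derive x (ei i) (fun z => g z * h z) (g x * dh + h x * dg).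
  by move=> h1 h2; exact: (is_derive_eq (is_deriveM h1 h2)).
have d1 := dM _ _ _ _ dW (dM _ _ _ _ (dM _ _ _ _ (f_derive i x) (f_derive i x)) dY).
have -> : psi = (fun x => W x * ((f x * f x) * y (x ord0 i))) by apply/funext => z; rewrite /psi expr2.
apply: (is_derive_eq d1); rewrite /dpsi /dpp -/(P x).
by move: (W x) (P x) (f x) (df i x) (y (x ord0 i)) (dy (x ord0 i)) (x ord0 i) => *; ring.
Qed.

(** What the regularisation leaves over: [y] satisfies [dy + y^2 = e^2 / den^2] and
    [t * y = 1 - e^2 / den] in place of the values 0 and 1 that [1 / t] would give. *)
Definition orem x := 4 * P x * (f x ^+ 2 * (e ^+ 2 / den (x ord0 i))) +
  W x * (f x ^+ 2 * (e ^+ 2 / den (x ord0 i) ^+ 2)).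

Let mcomp (g : R -> R) : continuous g -> mfun (fun x : V => g (x ord0 i)).
Proof. by move=> cg; apply: (@mfun_comp1 _ _ (fun x : V => x ord0 i) g) => //; exact: continuous_measurable_fun. Qed.

Let y_cont : continuous y.
Proof. by move=> t; apply: differentiable_continuous; apply/derivable1_diffP; case: (y_derive t). Qed.
Let denV_cont : continuous (fun t => (den t)^-1).
Proof.
move=> t; apply: cvgV; first by rewrite gt_eqF.
by apply: differentiable_continuous; apply/derivable1_diffP; case: (den_derive t).
Qed.

Let dy_cont : continuous dy.
Proof.
have -> : dy = (fun t => (e ^+ 2 - t * t) * ((den t)^-1 * (den t)^-1)).
  by apply/funext => t; rewrite /dy -[t * t]expr2 -invfM -[den t * den t]expr2.
move=> t; apply: cvgM; last by apply: cvgM; exact: denV_cont.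
by apply: cvgB; [exact: cvg_cst|apply: cvgM; exact: cvg_id].
Qed.

Let e2den t : 0 <= e ^+ 2 / den t <= 1.
Proof.
have e20 : 0 <= e ^+ 2 := sqr_ge0 e; have t20 : 0 <= t ^+ 2 := sqr_ge0 t.
by rewrite divr_ge0 ?(ltW (den0 t))//= ler_pdivrMr ?den0// mul1r /den; lra.
Qed.

(** In the second term the bound [f^2 <= 9 C^2 t^2] from [f_lip] compensates one factor [den]; the
    first term is at most [4 C^2], whence 13. The bound is uniform in [e]. *)
Lemma orem_bbd : mfun orem /\ bbd (1 + 13 * C ^+ 2) orem.
Proof.
split.
  have mc := @mfun_cst R n.
  have c1 : mfun (fun x => e ^+ 2 / den (x ord0 i)) by apply: mfunM => //; exact: (mcomp denV_cont).
  have c2 : mfun (fun x => e ^+ 2 / den (x ord0 i) ^+ 2).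
    apply: mfunM => //; apply: (mcomp (g := fun t => (den t ^+ 2)^-1)) => t.
    by under eq_fun do rewrite expr2 invfM; apply: cvgM; exact: denV_cont.
  have ff : mfun (fun x => f x ^+ 2) by apply: mfunM.
  by apply: mfunD; apply: mfunM => //; apply: mfunM.
apply: bbdq => [|x qx|x h]; first by rewrite mulr_ge0 ?sqr_ge0.
  set t := x ord0 i; have /andP[d0 d1] := e2den t.
  have h1 : `|4 * P x * (f x ^+ 2 * (e ^+ 2 / den t))| <= 4 * C ^+ 2.
    have := nM (nM n4 (Pn x)) (nM (sqb (f_bound qx)) (_ : `|e ^+ 2 / den t| <= 1)).
    by rewrite !mulr1; apply; rewrite ger0_norm.
  have h2 : `|W x * (f x ^+ 2 * (e ^+ 2 / den t ^+ 2))| <= 9 * C ^+ 2.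
    have ed0 : 0 <= e ^+ 2 / den t ^+ 2 by rewrite divr_ge0 ?sqr_ge0.
    have fe0 : 0 <= f x ^+ 2 * (e ^+ 2 / den t ^+ 2) by apply: mulr_ge0 => //; exact: sqr_ge0.
    rewrite -[leRHS]mul1r; apply: (nM (Wb x)); rewrite (ger0_norm fe0).
    have f2 : f x ^+ 2 <= 9 * C ^+ 2 * t ^+ 2.
      have -> : 9 * C ^+ 2 * t ^+ 2 = (3 * C * `|t|) ^+ 2.
        by rewrite !exprMn real_normK ?num_real//; ring.
      by rewrite -(ger0_norm (sqr_ge0 (f x))) sqb// f_lip// ltW.
    apply: (le_trans (ler_wpM2r ed0 f2)); rewrite -[leRHS]mulr1 -[leLHS]mulrA; have [e20 t20] := (sqr_ge0 e, sqr_ge0 t).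
    apply: ler_pM; [by apply: mulr_ge0 => //; exact: sqr_ge0|exact: mulr_ge0|by []|].
    rewrite mulrA ler_pdivrMr ?exprn_gt0// mul1r [leRHS]expr2.
    by apply: ler_pM => //; rewrite /den; lra.
  rewrite /orem -/t; apply: (le_trans (ler_normD _ _)).
  by apply: le_trans (lerD h1 h2) _; lra.
by rewrite /orem (WP h) h mulr0 !mul0r addr0.
Qed.

Lemma orem_le x : x ord0 i != 0 ->
  `|orem x| <= (4 * P x * (f x ^+ 2 / x ord0 i ^+ 2) + W x * (f x ^+ 2 / x ord0 i ^+ 4)) * e ^+ 2.
Proof.
set t := x ord0 i => t0; have t2 : 0 < t ^+ 2 by rewrite exprn_even_gt0.
have [e20 d0] := (sqr_ge0 e, den0 t).
have W0 : 0 <= W x by rewrite WE sqr_ge0.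
have dt : t ^+ 2 <= den t by rewrite /den; lra.
have ia : 0 <= e ^+ 2 / den t by apply: divr_ge0 => //; exact: ltW.
have ib : 0 <= e ^+ 2 / den t ^+ 2 by apply: divr_ge0 => //; exact: sqr_ge0.
have f20 := sqr_ge0 (f x).
rewrite ger0_norm; last first.
  by apply: addr_ge0; [apply: mulr_ge0; [exact: mulr_ge0|exact: mulr_ge0]|apply: mulr_ge0 => //; exact: mulr_ge0].
rewrite mulrDl -[leRHS]/(_ * _ * _ + _ * _ * _) /orem -/t; apply: lerD; rewrite -[leRHS]mulrA.
  rewrite ler_wpM2l ?mulr_ge0//; rewrite -[leRHS]mulrA ler_wpM2l ?sqr_ge0// mulrC ler_wpM2r//.
  by rewrite lef_pV2.
rewrite ler_wpM2l//; rewrite -[leRHS]mulrA ler_wpM2l ?sqr_ge0// mulrC ler_wpM2r//.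
have a1 : 0 < (t ^+ 2) ^+ 2 by exact: exprn_gt0.
have a2 : 0 < den t ^+ 2 by exact: exprn_gt0.
by rewrite (exprM t 2 2) lef_pV2 ?posrE//; apply: lerXn2r; rewrite ?nnegrE// ltW.
Qed.

(** Expand [0 <= W (d_i f - f y)^2]. The cross term is completed to the derivative of
    [psi = W f^2 y], which integrates to 0, and differentiating the weight produces [4 P f^2]
    because [y] is nearly [1 / x_i]. *)
Lemma odd_step : Int (fun x => 4 * (P x * f x ^+ 2)) <= Int (fun x => W x * df i x ^+ 2) + Int orem.
Proof.
have [mr br] := orem_bbd; have brm := bbd_bbm mr br.
have f2m : mfun (fun x => f x ^+ 2) by apply: mfunM.
have mpsi : mfun psi by apply: mfunM => //; apply: mfunM => //; exact: mcomp.
have iy0 : 0 <= e^-1 by rewrite invr_ge0 ltW.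
have bpsi : bbd (1 + C ^+ 2 * e^-1) psi.
  apply: bbdq => [|x qx|x /WP h]; [by rewrite mulr_ge0 ?sqr_ge0| |by rewrite /psi h mul0r].
  by rewrite -[leRHS]mul1r; exact: (nM (Wb x) (nM (sqb (f_bound qx)) (yb _))).
have bdpsi : bbd (1 + ((2 * C * (3 * C) * e^-1 + C ^+ 2 * e ^- 2) + 4 * 1 * (C ^+ 2 * (1 * e^-1)))) dpsi.
  apply: bbdq => [|x qx|x h]; last by rewrite /dpsi (WP h) h mulr0 !mul0r subrr.
    have ie0 : 0 <= e ^- 2 by rewrite invr_ge0 exprn_ge0// ltW.
    by rewrite !addr_ge0 ?mulr_ge0 ?sqr_ge0.
  rewrite /dpsi (le_trans (ler_normB _ _))//; apply: lerD.
    rewrite -[leRHS]mul1r; apply: (nM (Wb x)); apply: (le_trans (ler_normD _ _)); apply: lerD.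
      exact: (nM (nM (nM n2 (f_bound qx)) (dfi_bound qx)) (yb _)).
    exact: (nM (sqb (f_bound qx)) (dyb _)).
  exact: (nM (nM n4 (Pn x)) (nM (sqb (f_bound qx)) (nM (coord1 i qx) (yb _)))).
have [bd id0] := Int_derive0 psi_derive mpsi bpsi bdpsi.
suff : Int dpsi <= Int (fun x => W x * df i x ^+ 2 + orem x - 4 * (P x * f x ^+ 2)).
  by rewrite id0 IntB; [rewrite IntD// subr_ge0|exact: bbmD|exact: bT1].
apply: le_Int => //; first by apply: bbmB => //; exact: bbmD.
move=> x; rewrite -subr_ge0; set t := x ord0 i.
have -> : W x * df i x ^+ 2 + orem x - 4 * (P x * f x ^+ 2) - dpsi x = W x * (df i x - f x * y t) ^+ 2.
  have D0 : den t != 0 by rewrite gt_eqF.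
  rewrite /orem /dpsi -/t /y /dy.
  have -> : e ^+ 2 = den t - t ^+ 2 by rewrite /den addrC addKr.
  by move: D0; move: (den t) => d D0; move: (W x) (P x) (f x) (df i x) => w p ff dd; field.
by rewrite mulr_ge0 ?sqr_ge0.
Qed.
End Eps.

(** The regularisation is removed: off the mirror [orem] is of order [e^2], and on the mirror [f]
    vanishes. *)
Lemma odd_coord_ineq : [/\ bbm (fun x => P x * f x ^+ 2), bbm (fun x => W x * df i x ^+ 2) &
  4 * Int (fun x => P x * f x ^+ 2) <= Int (fun x => W x * df i x ^+ 2)].
Proof.
have bP : bbm (fun x => P x * f x ^+ 2).
  by have := bbmZ 4^-1 bT1; congr bbm; apply/funext => x; rewrite mulrA mulVf// mul1r.
split=> //; rewrite -IntZ//; pose ek (k : nat) : R := k.+1%:R^-1.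
have ek0 k : 0 < ek k by rewrite invr_gt0.
have ekc : ek @ \oo --> 0 by exact: cvg_harmonic.
have c0 x : orem (ek k) x @[k --> \oo] --> 0.
  have [x0|x0] := eqVneq (x ord0 i) 0.
    have -> : (fun k => orem (ek k) x) = fun=> 0; last exact: cvg_cst.
    apply/funext => k; rewrite /orem; have [qx|h] := q1P x; last by rewrite (WP h) h mulr0 !mul0r addr0.
    have -> : f x = 0 by apply/eqP; rewrite -normr_le0 (le_trans (f_lip (ltW qx)))// x0 normr0 mulr0.
    by rewrite expr0n/= !mul0r !mulr0 addr0.
  pose K := 4 * P x * (f x ^+ 2 / x ord0 i ^+ 2) + W x * (f x ^+ 2 / x ord0 i ^+ 4).
  apply/norm_cvg0P; apply: (@squeeze_cvgr _ _ _ _ (fun=> 0) (fun k => K * ek k ^+ 2)).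
  - by apply: nearW => k; rewrite normr_ge0 orem_le.
  - exact: cvg_cst.
  - have -> : (0 : R) = K * (0 * 0) by rewrite mul0r mulr0.
    by apply: cvgM; [exact: cvg_cst|under eq_fun do rewrite expr2; apply: cvgM].
have [_ cI] := Int_dct (fun k => (orem_bbd (ek0 k)).1) (fun k => (orem_bbd (ek0 k)).2) c0.
rewrite Int0 in cI.
apply/ler_addgt0Pr => d d0.
have [k _ /(_ k (leqnn k)) hk] := (cvgrPdist_le _ _).1 cI d d0.
apply: (le_trans (odd_step (ek0 k))); rewrite lerD2l.
by apply: le_trans hk; rewrite sub0r normrN ler_norm.
Qed.
End OddInequality.

(** * The spectral gap for even functions on the sphere *)

Section SpectralGap.
Variables (R : realType) (n : nat).
Notation V := 'rV[R]_n.+1.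
Notation I := 'I_n.+1.
Notation off0 := [set x : V | x != 0].
Notation ei k := (delta_mx ord0 k : V).
Notation N := (n.+1%:R : R).
Implicit Types (x y u v m : V) (t s h C : R) (f : V -> R) (df : I -> V -> R).

Notation M1 := (M (fun _ : V => 1 : R)).
Definition cls C f df := [/\ forall t x, 0 < t -> f (t *: x) = f x, C1on off0 f df,
  forall x, x != 0 -> `|f x| <= C & forall x, x != 0 -> gsq df x <= C ^+ 2].

Definition Bq f df := M (gsq df) - 2 * N * M (fun x => f x ^+ 2).

Lemma gsqE df x : gsq df x = q x * q (grad df x).
Proof. by rewrite /gsq [q (grad _ _)]qE; congr (_ * _); apply: eq_bigr => i _; rewrite mxE. Qed.

Lemma gsq_ge0 df x : 0 <= gsq df x.
Proof. by rewrite gsqE mulr_ge0// q_ge0. Qed.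

Lemma ei_neq0 i : ei i != 0.
Proof. exact: q1_neq0 (dotp_ei R i). Qed.

Section OneFunction.
Variables (C : R) (f : V -> R) (df : I -> V -> R).
Hypothesis fc : cls C f df.

Lemma cls_ge0 : 0 <= C.
Proof. by case: fc => _ _ h _; apply: le_trans (h _ (ei_neq0 ord0)). Qed.

Lemma cls_adm : adm f.
Proof. by case: fc => _ fC fb _; exact: adm_C1on fC fb. Qed.

Lemma cls_cont x k : x != 0 -> {for x, continuous (df k)}.
Proof. by case: fc => _ fC _ _ x0; have [_ /(_ k)] := fC _ x0. Qed.

Lemma adm_gsq : adm (gsq df).
Proof.
apply: (@adm_cont _ _ _ (C ^+ 2)) => x x0; last first.
  by rewrite ger0_norm ?gsq_ge0//; case: fc => _ _ _; apply.
have cq := @C1on_cont R n off0 _ _ x (@open_ne0 R n) (@C1on_q R n off0) x0.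
apply: (cvgM cq); apply: (@cvg_sumR _ _ _ (nbhs x)) => i.
have h : df i y @[y --> x] --> df i x by exact: cls_cont.
by rewrite expr2; under eq_fun do rewrite expr2; exact: (cvgM h h).
Qed.

Lemma cls_dbound x k : x != 0 -> `|df k x| * enorm x <= C.
Proof.
move=> x0; rewrite -(@ler_sqr R) ?nnegrE ?mulr_ge0 ?enorm_ge0 ?cls_ge0//.
rewrite exprMn enorm_sqr real_normK ?num_real//; case: fc => _ _ _ /(_ x x0); apply: le_trans.
rewrite /gsq mulrC ler_wpM2l ?q_ge0// (bigD1 k)//= lerDl sumr_ge0// => i _; exact: sqr_ge0.
Qed.

Lemma cls_dhom t x k : 0 < t -> x != 0 -> df k (t *: x) = t^-1 * df k x.
Proof.
case: fc => h1 h2 _ _ t0 x0; rewrite (@hom_diff R n f df t 1)// ?mulr1// => y _.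
by rewrite mul1r h1.
Qed.

Lemma cls_gsq_hom t x : 0 < t -> gsq df (t *: x) = gsq df x.
Proof.
move=> t0; have [->|x0] := eqVneq x 0; first by rewrite scaler0.
have tn0 : t != 0 by rewrite gt_eqF.
rewrite /gsq {1}/q dotpZl dotpZr mulrA -/(q x).
under eq_bigr do rewrite cls_dhom// exprMn.
by rewrite -mulr_sumr; field.
Qed.

Lemma cls_euler x : x != 0 -> \sum_i x ord0 i * df i x = 0.
Proof. by case: fc => h1 h2 _ _; exact: (hom0_euler h1 h2). Qed.

End OneFunction.

(** Add the inequalities for [i] and [j], and bound the two squared partial derivatives of [q f] by
    its full squared gradient, which is [q (4 f^2 + gsq)] by Euler's identity. The radial moments
    turn this into the claim; for [x_i x_j / |x|^2] every step is an equality. *)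
Lemma odd_pair C f df i j : cls C f df -> i != j -> (forall x, f (flip i x) = - f x) ->
  (forall x, f (flip j x) = - f x) -> 0 <= Bq f df.
Proof.
move=> fc ij oi oj; have af := cls_adm fc; have ag := adm_gsq fc.
have [fh fC fb gb] := fc.
have [bP bWi hi] := odd_coord_ineq fC fb (fun x k (hx : x != 0) => cls_dbound fc k hx) oi.
have [_ bWj hj] := odd_coord_ineq fC fb (fun x k (hx : x != 0) => cls_dbound fc k hx) oj.
pose f2 x := f x ^+ 2; pose H x := 4 * f2 x + gsq df x.
have af2 : adm f2 by exact: admX.
have aH : adm H by apply: admD => //; exact: admZ.
have f20 x : 0 <= f2 x by exact: sqr_ge0.
have H0 x : 0 <= H x by rewrite addr_ge0 ?gsq_ge0// mulr_ge0.
have f2h t x : 0 < t -> f2 (t *: x) = f2 x by move=> t0; rewrite /f2 fh.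
have Hh t x : 0 < t -> H (t *: x) = H x by move=> t0; rewrite /H f2h// (cls_gsq_hom fc).
have iE x : \1_(@qball R n) x = ((q x <= 1)%R : bool)%:R :> R.
  by rewrite indicE; congr ((_ : bool)%:R); apply/idP/idP; rewrite inE.
have maxE x : Num.max 0 (1 - q x) = \1_(@qball R n) x * (1 - q x).
  rewrite iE; case: lerP => h; first by rewrite mul1r max_r// subr_ge0.
  by rewrite mul0r max_l// subr_le0 ltW.
have i2 x : \1_(@qball R n) x ^+ 2 = \1_(@qball R n) x :> R.
  by rewrite iE; case: (_ <= _); rewrite ?expr1n ?expr0n.
have PE : Int (fun x => Num.max 0 (1 - q x) * (q x * f x) ^+ 2) = mom 2 f2 - mom 3 f2.
  rewrite /mom -IntB; [|exact: bbm_qk|exact: bbm_qk].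
  by apply: eq_Int => x; rewrite maxE /f2; move: (\1__ x : R) => a; ring.
have WE : Int (fun x => pp (1 - q x) * (q x * df i x + f x * (2 * x ord0 i)) ^+ 2) +
    Int (fun x => pp (1 - q x) * (q x * df j x + f x * (2 * x ord0 j)) ^+ 2) <=
    mom 1 H - 2 * mom 2 H + mom 3 H.
  have [[b1 b2] b3] := (bbm_qk 1 aH, bbm_qk 2 aH, bbm_qk 3 aH).
  rewrite -IntD// /mom -IntZ// -IntB//; last exact: bbmZ.
  rewrite -IntD//; last by apply: bbmB => //; exact: bbmZ.
  apply: le_Int; first exact: bbmD.
    by apply: bbmD => //; apply: bbmB => //; exact: bbmZ.
  move=> x; rewrite /pp maxE exprMn i2 -mulrDr.
  have -> : \1_(@qball R n) x * (q x ^+ 1 * H x) - 2 * (\1_(@qball R n) x * (q x ^+ 2 * H x)) +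
      \1_(@qball R n) x * (q x ^+ 3 * H x) = \1_(@qball R n) x * (1 - q x) ^+ 2 * (q x * H x).
    by move: (\1__ x : R) => a; ring.
  have i0 : 0 <= \1_(@qball R n) x * (1 - q x) ^+ 2 :> R.
    by apply: mulr_ge0; [rewrite iE|exact: sqr_ge0].
  apply: (ler_wpM2l i0).
  have [->|x0] := eqVneq x 0; first by rewrite q0 !mxE !(mul0r, mulr0) addr0 expr0n addr0.
  have -> : q x * H x = \sum_k (q x * df k x + f x * (2 * x ord0 k)) ^+ 2.
    have sE Q c : \sum_k (Q * df k x + c * (2 * x ord0 k)) ^+ 2 =
        Q ^+ 2 * (\sum_k df k x ^+ 2) + 4 * Q * c * (\sum_k x ord0 k * df k x) +
        4 * c ^+ 2 * (\sum_k x ord0 k ^+ 2).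
      by rewrite !mulr_sumr -!big_split/=; apply: eq_bigr => k _; ring.
    rewrite sE.
    by rewrite (cls_euler fc x0) -qE /H /gsq /f2; ring.
  rewrite (bigD1 i)//= (bigD1 j) 1?eq_sym//= addrA lerDl sumr_ge0// => k _; exact: sqr_ge0.
have m2f := @moment R n f2 2 af2 f20 f2h; have m3f := @moment R n f2 3 af2 f20 f2h.
have m1H := @moment R n H 1 aH H0 Hh; have m2H := @moment R n H 2 aH H0 Hh.
have m3H := @moment R n H 3 aH H0 Hh.
have MH : M H = 4 * M f2 + M (gsq df) by rewrite /H MD ?MZ//; exact: admZ.
rewrite PE in hi hj.
rewrite !natrD in m2f m3f m1H m2H m3H.
have N0 : 0 < N by rewrite ltr0n.
have sol (k c w : R) : 0 < k -> k * c = w -> c = w / k.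
  by move=> k0 <-; rewrite mulrC mulKf// gt_eqF.
have {}m2f : mom 2 f2 = N * M f2 / (N + (2 * 2)%:R) by apply: sol m2f; rewrite addr_gt0.
have {}m3f : mom 3 f2 = N * M f2 / (N + (2 * 3)%:R) by apply: sol m3f; rewrite addr_gt0.
have {}m1H : mom 1 H = N * M H / (N + (2 * 1)%:R) by apply: sol m1H; rewrite addr_gt0.
have {}m2H : mom 2 H = N * M H / (N + (2 * 2)%:R) by apply: sol m2H; rewrite addr_gt0.
have {}m3H : mom 3 H = N * M H / (N + (2 * 3)%:R) by apply: sol m3H; rewrite addr_gt0.
have key : 8 * (mom 2 f2 - mom 3 f2) <= mom 1 H - 2 * mom 2 H + mom 3 H by lra.
move: key; rewrite m2f m3f m1H m2H m3H MH /Bq -/f2.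
move: (M f2) (M (gsq df)) N N0 => a g k k0 key.
have kk (c : R) : 0 < c -> 0 < k + c by move=> c0; rewrite addr_gt0.
(* The factor comes from [1/(k+2) - 2/(k+4) + 1/(k+6) = 8/((k+2)(k+4)(k+6))]; here [k] is the
   dimension. *)
have -> : g - 2 * k * a = (k + 2) * (k + 4) * (k + 6) / (8 * k) *
   (k * (4 * a + g) / (k + (2 * 1)%:R) - 2 * (k * (4 * a + g) / (k + (2 * 2)%:R)) +
     k * (4 * a + g) / (k + (2 * 3)%:R) - 8 * (k * a / (k + (2 * 2)%:R) - k * a / (k + (2 * 3)%:R))).
  have -> : (2 * 1)%:R = 2 :> R by [].
  have -> : (2 * 2)%:R = 4 :> R by [].
  have -> : (2 * 3)%:R = 6 :> R by [].
  field; rewrite !gt_eqF ?kk//.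
by rewrite mulr_ge0 ?subr_ge0// divr_ge0 ?mulr_ge0// ltW// kk.
Qed.

(** The gradient of [f o refl m]; a reflection is its own transpose. *)
Definition rdf m df (k : I) x := refl m (grad df (refl m x)) ord0 k.

Lemma refl0 m : refl m 0 = 0.
Proof. by rewrite /refl dotp0l mulr0 scale0r subr0. Qed.

Lemma refl_neq0 m x : dotp m m = 1 -> x != 0 -> refl m x != 0.
Proof. by move=> m1; apply: contra_neq => h; rewrite -(reflK x m1) h refl0. Qed.

Lemma q_refl m x : dotp m m = 1 -> q (refl m x) = q x.
Proof. exact: dotp_refl. Qed.

Lemma reflE m x k : refl m x ord0 k = x ord0 k - 2 * dotp x m * m ord0 k.
Proof. by rewrite !mxE. Qed.

Lemma reflZ m t x : refl m (t *: x) = t *: refl m x.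
Proof. by rewrite /refl dotpZl scalerBr scalerA; congr (_ - _ *: _); ring. Qed.

Lemma refl_refl m u x : dotp m m = 1 -> refl m (refl u x) = refl (refl m u) (refl m x).
Proof.
move=> m1; rewrite {3}/refl dotp_refl// {2}/refl; set c := 2 * _.
by rewrite /refl !dotpBl !dotpZl; apply/rowP => k; rewrite !mxE; ring.
Qed.

Lemma gsq_refl m df x : dotp m m = 1 -> gsq (rdf m df) x = gsq df (refl m x).
Proof.
move=> m1; rewrite !gsqE q_refl//; congr (_ * _).
rewrite -[RHS](q_refl _ m1); congr q; by apply/rowP => k; rewrite mxE.
Qed.

Lemma C1on_refl m f df : dotp m m = 1 -> C1on off0 f df -> C1on off0 (fun x => f (refl m x)) (rdf m df).
Proof.
move=> m1 fC.
pose T (i : I) x := x ord0 i - \sum_l 2 * m ord0 l * m ord0 i * x ord0 l.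
pose dT (i k : I) x := (k == i)%:R - \sum_l 2 * m ord0 l * m ord0 i * (k == l)%:R : R.
have TC i : C1on off0 (T i) (dT i).
  apply: C1onB; first exact: C1on_coord.
  by apply: C1on_sum => l; apply: C1onZ; exact: C1on_coord.
have TE x : (\row_i T i x) = refl m x.
  apply/rowP => i; rewrite /refl !mxE /T /dotp; congr (_ - _).
  by rewrite mulr_sumr mulr_suml; apply: eq_bigr => l _; ring.
have T0 x : x != 0 -> (\row_i T i x : V) != 0 by rewrite TE; exact: refl_neq0.
apply: (C1on_ext _ _ (C1on_compV (@open_ne0 R n) (@open_ne0 R n) fC TC T0)) => [x|k x].
  by rewrite TE.
rewrite TE /rdf reflE mxE.
have dTE i : dT i k x = (k == i)%:R - 2 * m ord0 k * m ord0 i.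
  rewrite /dT (bigD1 k)//= big1 ?addr0 ?eqxx ?mulr1// => l lk.
  by rewrite eq_sym (negbTE lk) mulr0.
under eq_bigr do rewrite dTE mulrBr.
rewrite sumrB; congr (_ - _).
  by rewrite (bigD1 k)//= eqxx mulr1 big1 ?addr0// => i ik; rewrite eq_sym (negbTE ik) mulr0.
by rewrite dotp_grad mulr_sumr mulr_suml; apply: eq_bigr => i _; ring.
Qed.

Lemma cls_refl C m f df : dotp m m = 1 -> cls C f df -> cls C (fun x => f (refl m x)) (rdf m df).
Proof.
move=> m1 [h1 h2 h3 h4]; split.
- by move=> t x t0; rewrite reflZ h1.
- exact: C1on_refl.
- by move=> x x0; apply: h3; exact: refl_neq0.
- by move=> x x0; rewrite gsq_refl//; apply: h4; exact: refl_neq0.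
Qed.

Lemma M_refl m F : dotp m m = 1 -> adm F -> M (fun x => F (refl m x)) = M F.
Proof.
move=> m1 aF; rewrite /M -(Int_refl m1 (bbm_M aF)).2; apply: eq_Int => x; congr (_ * _).
by rewrite !indicE; congr ((_ : bool)%:R); apply/idP/idP; rewrite !inE /qball /= q_refl.
Qed.

Lemma Bq_refl C m f df : dotp m m = 1 -> cls C f df -> Bq (fun x => f (refl m x)) (rdf m df) = Bq f df.
Proof.
move=> m1 fc; rewrite /Bq; congr (_ - _ * _); last first.
  by apply: (@M_refl m (fun x => f x ^+ 2)) => //; apply: admX; exact: cls_adm fc.
by rewrite -(M_refl m1 (adm_gsq fc)); apply: eq_M => x; rewrite gsq_refl.
Qed.

(** The even part ([s = 1]) or the odd part ([s = -1]) of [f] in the mirror orthogonal to [m]. *)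
Definition avg s m f x := 2^-1 * (f x + s * f (refl m x)).
Definition davg s m df (k : I) x := 2^-1 * (df k x + s * rdf m df k x).

Lemma cls_lin C a b f df g dg : cls C f df -> cls C g dg -> `|a| + `|b| <= 1 ->
  cls C (fun x => a * f x + b * g x) (fun k x => a * df k x + b * dg k x).
Proof.
move=> fc gc ab; have C0 := cls_ge0 fc.
case: fc gc => [f1 f2 f3 f4] [g1 g2 g3 g4]; split.
- by move=> t x t0; rewrite f1// g1.
- by apply: C1onD; apply: C1onZ.
- move=> x x0; apply: (le_trans (ler_normD _ _)); rewrite !normrM.
  apply: (@le_trans _ _ (`|a| * C + `|b| * C)); first by rewrite lerD// ler_wpM2l// ?f3 ?g3.
  by rewrite -mulrDl ler_piMl.
- move=> x x0; rewrite gsqE.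
  have -> : grad (fun k x => a * df k x + b * dg k x) x = a *: grad df x + b *: grad dg x.
    by apply/rowP => k; rewrite !mxE.
  move: (f4 x x0) (g4 x x0); rewrite !gsqE; set u := grad df x; set v := grad dg x.
  move=> hu hv; have qx := q_gt0 x0.
  have quv : q x * dotp u v <= C ^+ 2 /\ - (q x * dotp u v) <= C ^+ 2.
    have := dotp_ge0 (u - v); have := dotp_ge0 (u + v).
    rewrite !dotpE (dotpC v u) -/(q u) -/(q v) => h1 h2.
    by split; rewrite -(ler_pM2l (ltr0n R 2 : 0 < 2%:R)); nra.
  rewrite /q !dotpE (dotpC v u) -/(q x) -/(q u) -/(q v).
  have e : q x * (a * (a * q u) + a * (b * dotp u v) + (b * (a * dotp u v) + b * (b * q v))) =
     a ^+ 2 * (q x * q u) + b ^+ 2 * (q x * q v) + 2 * (a * b * (q x * dotp u v)) by ring.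
  rewrite e; apply: (@le_trans _ _ ((`|a| + `|b|) ^+ 2 * C ^+ 2)); last first.
    by rewrite ler_piMl ?sqr_ge0// exprn_ile1.
  have h3 : a * b * (q x * dotp u v) <= `|a| * `|b| * C ^+ 2.
    rewrite -normrM; apply: le_trans (ler_norm _) _; rewrite [leLHS]normrM ler_wpM2l//.
    by rewrite ler_norml; apply/andP; split; lra.
  have h4 : a ^+ 2 * (q x * q u) <= `|a| ^+ 2 * C ^+ 2.
    by rewrite real_normK ?num_real// ler_wpM2l ?sqr_ge0.
  have h5 : b ^+ 2 * (q x * q v) <= `|b| ^+ 2 * C ^+ 2.
    by rewrite real_normK ?num_real// ler_wpM2l ?sqr_ge0.
  lra.
Qed.

Lemma cls_avg C s m f df : dotp m m = 1 -> `|s| = 1 -> cls C f df -> cls C (avg s m f) (davg s m df).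
Proof.
move=> m1 s1 fc; have := @cls_lin C 2^-1 (2^-1 * s) _ _ _ _ fc (cls_refl m1 fc).
rewrite normrM s1 mulr1 ger0_norm ?invr_ge0// => /(_ (ltac:(lra))).
by congr (cls _ _ _); [apply/funext => x|apply/funext => k; apply/funext => x]; rewrite ?/avg ?/davg mulrDr mulrA.
Qed.

(** Reflections preserve [M], so the even and odd parts are orthogonal for both quadratic forms in
    [Bq]. *)
Lemma Bq_avg C m f df : dotp m m = 1 -> cls C f df ->
  Bq (avg 1 m f) (davg 1 m df) + Bq (avg (-1) m f) (davg (-1) m df) = Bq f df.
Proof.
move=> m1 fc; have rc := cls_refl m1 fc.
have s1 : `|1 : R| = 1 by rewrite normr1. have s2 : `|-1 : R| = 1 by rewrite normrN1.
have c1 := cls_avg m1 s1 fc; have c2 := cls_avg m1 s2 fc.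
have [a1 a2] := (admX 2 (cls_adm c1), admX 2 (cls_adm c2)).
have e1 : M (gsq (davg 1 m df)) + M (gsq (davg (-1) m df)) = M (gsq df).
  rewrite -MD; [|exact: adm_gsq c1|exact: adm_gsq c2].
  have -> : M (gsq df) = M (fun x => 2^-1 * (gsq df x + gsq (rdf m df) x)).
    rewrite MZ ?MD; [|exact: adm_gsq fc|exact: adm_gsq rc|by apply: admD; [exact: adm_gsq fc|exact: adm_gsq rc]].
    have -> : M (gsq (rdf m df)) = M (gsq df).
      by rewrite -(M_refl m1 (adm_gsq fc)); apply: eq_M => x; rewrite gsq_refl.
    by field.
  apply: eq_M => y; rewrite /gsq -!mulrDr mulrCA; congr (_ * _).
  by rewrite -!big_split mulr_sumr; apply: eq_bigr => k _; rewrite /= /davg; field.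
have e2 : M (fun x => avg 1 m f x ^+ 2) + M (fun x => avg (-1) m f x ^+ 2) = M (fun x => f x ^+ 2).
  have [a3 a4] := (admX 2 (cls_adm fc), admX 2 (cls_adm rc)).
  rewrite -MD//.
  have -> : M (fun x => f x ^+ 2) = M (fun x => 2^-1 * (f x ^+ 2 + f (refl m x) ^+ 2)).
    rewrite MZ ?MD//; last exact: admD.
    rewrite (@M_refl m (fun x => f x ^+ 2))//; by field.
  by apply: eq_M => y; rewrite /avg; field.
by rewrite /Bq -e1 -e2; ring.
Qed.

Lemma avg_odd m f x : dotp m m = 1 -> avg (-1) m f (refl m x) = - avg (-1) m f x.
Proof. by move=> m1; rewrite /avg reflK//; ring. Qed.
Lemma avg_even m f x : dotp m m = 1 -> avg 1 m f (refl m x) = avg 1 m f x.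
Proof. by move=> m1; rewrite /avg reflK//; ring. Qed.

Lemma avg_flip s (i k : I) c f x : i != k -> (forall y, f (flip i y) = c * f y) ->
  avg s (ei k) f (flip i x) = c * avg s (ei k) f x.
Proof.
move=> ik fi; have com : flip k (flip i x) = flip i (flip k x).
  by apply/rowP => l; rewrite !mxE; do 2 case: ifP.
by rewrite /avg -!flip_refl com !fi; ring.
Qed.

Lemma reflN_arg m x : refl m (- x) = - refl m x.
Proof. by have := reflZ m (-1) x; rewrite !scaleN1r. Qed.

Lemma avg_sym s m f x : (forall y, f (- y) = f y) -> avg s m f (- x) = avg s m f x.
Proof. by move=> fe; rewrite /avg reflN_arg !fe. Qed.

Lemma foldr_flip (s : seq I) x l : uniq s ->
  (foldr (@flip R n) x s) ord0 l = if l \in s then - x ord0 l else x ord0 l.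
Proof.
elim: s => [|k s IH]//= /andP[ks us]; rewrite mxE IH// inE.
by case: (eqVneq l k) => [->|_]//; rewrite (negbTE ks).
Qed.

Lemma Bq_ge0_zero C f df : cls C f df -> (forall x, f x = 0) -> 0 <= Bq f df.
Proof.
move=> fc f0; have -> : Bq f df = M (gsq df) - 0.
  rewrite /Bq (@eq_M R n (fun x => f x ^+ 2) (fun=> 0)); last by move=> x; rewrite f0 expr0n.
  by rewrite M_cst mul0r mulr0.
by rewrite subr0; apply: M_ge0; [exact: adm_gsq fc|move=> x _; exact: gsq_ge0].
Qed.

(** Induction on the coordinates in which [f] is not yet known to be even. Splitting in the mirror
    [k], the odd part is odd in two coordinates and falls under [odd_pair], while the even part has
    one coordinate less to treat. When only [i] remains, [f (- x) = f x] together with oddness in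
    [i] forces [f = 0]. *)
Lemma gap_odd_flip C f df i : cls C f df -> (forall x, f (- x) = f x) ->
  (forall x, f (flip i x) = - f x) -> 0 <= Bq f df.
Proof.
have : forall k, k \in enum I \/ k = i \/ forall x, f (flip k x) = f x by move=> k; left; rewrite mem_enum.
elim: (enum I) f df => [|k s IH] f df fs fc fe fi.
  apply: (Bq_ge0_zero fc) => x.
  pose s := rem i (enum I).
  have us : uniq s by exact/rem_uniq/enum_uniq.
  have xE : - x = flip i (foldr (@flip R n) x s).
    apply/rowP => l; rewrite !mxE foldr_flip// mem_rem_uniq ?enum_uniq// inE mem_enum andbT.
    by case: eqP.
  have fE : f (foldr (@flip R n) x s) = f x.
    have : i \notin s by rewrite mem_rem_uniq ?enum_uniq// inE eqxx.
    elim: s {us xE} => [|l s IH]//=; rewrite inE negb_or => /andP[il is_].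
    by have [//|[e|->]] := fs l; [rewrite e eqxx in il|exact: IH].
  have := fe x; rewrite xE fi fE => /eqP; rewrite eq_sym -addr_eq0 -mulr2n mulrn_eq0/= => /eqP; exact.
have [ki|ki] := eqVneq k i.
  apply: IH => // l; have := fs l; rewrite inE ki => -[/orP[/eqP ->|ls]|h]; [by right; left|by left|by right].
have k1 := dotp_ei R k.
have s1 : `|1 : R| = 1 by rewrite normr1. have s2 : `|-1 : R| = 1 by rewrite normrN1.
have c1 := cls_avg k1 s1 fc; have c2 := cls_avg k1 s2 fc.
have fi' x : f (flip i x) = -1 * f x by rewrite mulN1r.
have ik : i != k by rewrite eq_sym.
rewrite -(Bq_avg k1 fc) addr_ge0//.
  apply: IH => //; last 2 first.
  - by move=> x; exact: avg_sym.
  - by move=> x; rewrite (avg_flip _ _ ik fi') mulN1r.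
  move=> l; have [->|lk] := eqVneq l k.
    by right; right => x; rewrite flip_refl avg_even.
  have := fs l; rewrite inE (negbTE lk) => -[h|[h|h]]; [by left|by right; left|right; right => x].
  have fl' y : f (flip l y) = 1 * f y by rewrite mul1r.
  by rewrite (avg_flip _ _ lk fl') mul1r.
apply: (odd_pair c2 ik) => x; first by rewrite (avg_flip _ _ ik fi') mulN1r.
by rewrite flip_refl avg_odd.
Qed.

Lemma exists_refl u v : q u = 1 -> q v = 1 -> u != v -> exists2 m, dotp m m = 1 & refl m u = v.
Proof.
rewrite /q => u1 v1 uv; pose d := u - v; have d0 : d != 0 by rewrite subr_eq0.
pose t := enorm d; have t0 : t != 0 by rewrite gt_eqF// enorm_gt0.
have t2 : t ^+ 2 = 2 - 2 * dotp u v.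
  by rewrite enorm_sqr /q /d !dotpE u1 v1 (dotpC v u); ring.
have qd : dotp d d = t ^+ 2 by rewrite -[dotp d d]/(q d) -enorm_sqr.
exists (t^-1 *: d); first by rewrite dotpZl dotpZr qd; field.
rewrite /refl dotpZr scalerA {1}/d dotpBr u1.
have -> : 2 * (t^-1 * (1 - dotp u v)) * t^-1 = t ^+ 2 / t ^+ 2 by rewrite {1}t2; field.
by rewrite divff ?expf_neq0// scale1r /d opprB addrCA subrr addr0.
Qed.

(** A reflection carries the mirror of [m] to a coordinate mirror, and it leaves [Bq] unchanged. *)
Lemma gap_odd C m f df : dotp m m = 1 -> cls C f df -> (forall x, f (- x) = f x) ->
  (forall x, f (refl m x) = - f x) -> 0 <= Bq f df.
Proof.
move=> m1 fc fe fm; have e1 : dotp (ei ord0) (ei ord0) = 1 := dotp_ei R ord0.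
have [me|me] := eqVneq m (ei ord0).
  by apply: (gap_odd_flip (i := ord0) fc fe) => x; rewrite flip_refl -me.
have [b b1 bm] := exists_refl m1 e1 me.
have em : refl b (ei ord0) = m by rewrite -bm reflK.
rewrite -(Bq_refl b1 fc); apply: (gap_odd_flip (i := ord0) (cls_refl b1 fc)) => x.
  by rewrite reflN_arg fe.
by rewrite flip_refl refl_refl// em fm.
Qed.

Section Mass.
Variables (C : R) (f : V -> R) (df : I -> V -> R).
Hypothesis fc : cls C f df.

(* A value at least [h] at a unit vector persists on a cube around the midpoint of the radius. *)
Lemma value_mass h : 0 < h -> exists2 mu : R, 0 < mu &
  forall g dg, cls C g dg -> M (fun x => g x ^+ 2) < mu -> forall x, x != 0 -> `|g x| <= h.
Proof.
move=> h0; have C0 := cls_ge0 fc.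
have N1 : 1 <= N by rewrite ler1n.
have N0 : 0 < N by lra.
pose L := N * (C * (4 * N)); have L0 : 0 <= L by rewrite !mulr_ge0// ltW.
have [r [r0 r1 r2]] : exists r, [/\ 0 < r, r <= (4 * N)^-1 & L * r <= h / 2].
  exists (Num.min (4 * N)^-1 (h / (2 * (L + 1)))); split.
  - by rewrite lt_min invr_gt0 mulr_gt0//= divr_gt0// mulr_gt0//; lra.
  - by rewrite ge_min lexx.
  apply: (@le_trans _ _ (L * (h / (2 * (L + 1))))); first by rewrite ler_wpM2l// ge_min lexx orbT.
  rewrite mulrA ler_pdivrMr; last by rewrite mulr_gt0//; lra.
  by rewrite mulrC; nra.
have bc : bbm (\1_(cube r : set V) : V -> R).
  apply: bbm_indic; first exact: cube_measurable.
  by exists r.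
pose vc := Int (\1_(cube r : set V) : V -> R).
have vc0 : 0 < vc.
  rewrite /vc Int_indic; last exact: cube_measurable.
  have -> : lebesgue_vol (cube r : set V) = (boxvol (\row_i (- r) : V) (\row_i r))%:E.
    by apply/eqP; rewrite eq_le lebesgue_vol_box_le lebesgue_vol_box// => i; rewrite !mxE; lra.
  by rewrite /boxvol; apply: prodr_gt0 => i _; rewrite !mxE lt_max; apply/orP; right; lra.
exists (h ^+ 2 / 4 * vc); first by rewrite mulr_gt0// divr_gt0// exprn_gt0.
move=> g dg gc hM x x0; case: (lerP `|g x| h) => // gx.
have [gh gC gb _] := gc.
pose u := (enorm x)^-1 *: x; have u1 : q u = 1 by exact: normalize_q.
pose y0 := 2^-1 *: u; have gy : g y0 = g x by rewrite /y0 /u !gh ?invr_gt0 ?enorm_gt0.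
have un : 1 <= N * `|u|.
  have := q_le_norm u; have := norm_le_q u; rewrite u1 => h1 h2.
  have h3 : `|u| <= 1 by rewrite -(@ler_sqr R) ?nnegrE// expr1n.
  by apply: (le_trans h2); rewrite ler_wpM2l ?(ltW N0)// expr2 ler_piMl.
have yn : `|y0| = 2^-1 * `|u| by rewrite normrZ ger0_norm.
have Nr : N * r <= 4^-1.
  have := ler_wpM2l (ltW N0) r1; have -> : N * (4 * N)^-1 = 4^-1 by field; rewrite gt_eqF.
  exact.
have zb (z : V) : `|z - y0| <= r -> 4^-1 <= N * `|z|.
  move=> hz; have h1 : `|y0| <= `|z| + r.
    have := ler_normB z (z - y0); rewrite opprB addrCA subrr addr0; lra.
  have := ler_wpM2l (ltW N0) h1; rewrite yn; lra.
have zn (z : V) : 4^-1 <= N * `|z| -> z != 0.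
  by apply: contraTneq => ->; rewrite normr0 mulr0 -ltNge invr_gt0.
have dgb (z : V) k : `|z - y0| <= r -> `|dg k z| <= C * (4 * N).
  move=> /zb hz; have := cls_dbound gc k (zn _ hz).
  have h1 : `|z| <= enorm z.
    by rewrite -(@ler_sqr R) ?nnegrE ?enorm_ge0// enorm_sqr norm_le_q.
  have h2 : 1 <= 4 * N * enorm z by have := ler_wpM2l (ltW N0) h1; lra.
  move=> h3; have := ler_wpM2l (normr_ge0 (dg k z)) h2; rewrite mulr1 => h4.
  apply: (le_trans h4); have : 0 <= 4 * N by rewrite mulr_ge0// ltW.
  by move=> /ler_wpM2r /(_ _ _ h3); lra.
have lip (w : V) : `|w| <= r -> `|g (y0 + w) - g y0| <= h / 2.
  move=> wr; have [|xi [xi1 ->]] := @multi_mvt R n g dg y0 w.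
    move=> z hz k; have [+ _] := gC z (zn _ (zb _ (le_trans hz wr))); exact.
  apply: (le_trans (ler_norm_sum _ _ _)).
  apply: (@le_trans _ _ (\sum_(k < n.+1) r * (C * (4 * N)))).
    apply: ler_sum => k _; rewrite normrM ler_pM//.
      exact: le_trans (coord_le_norm _ _) wr.
    by apply: dgb; exact: le_trans (xi1 k) wr.
  by rewrite sumr_const card_ord -[leLHS]mulr_natl; move: r2; rewrite /L; lra.
have qb (w : V) : `|w| <= r -> q (y0 + w) <= 1.
  move=> wr; have qw : q w <= 4^-1.
    apply: (le_trans (q_le_norm w)).
    have h1 : `|w| ^+ 2 <= r * r by rewrite expr2 ler_pM.
    have h2 := ler_wpM2l (ltW N0) h1; apply: (le_trans h2); rewrite mulrA.
    have r4 : r <= 1 by have := ler_wpM2r (ltW r0) N1; lra.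
    by apply: (le_trans (ler_wpM2r (ltW r0) Nr)); rewrite ler_piMr.
  have aux (a b : V) : q a = 1 -> q b <= 4^-1 -> q (2^-1 *: a + b) <= 1.
    move=> ha hb; have := q_ge0 (2^-1 *: a - b); move: ha hb.
    by rewrite /q !dotpE (dotpC b a) => ->; lra.
  exact: aux.
suff : h ^+ 2 / 4 * vc <= M (fun x => g x ^+ 2) by rewrite leNgt hM.
have -> : vc = Int (fun x => (\1_(cube r : set V) : V -> R) (x - y0)) by rewrite Int_translate.
have bt := bbm_translate (- y0) bc.
rewrite -IntZ//; apply: le_Int; first exact: bbmZ.
  by apply: bbm_M; apply: admX; exact: cls_adm gc.
move=> z; rewrite !indicE; case: (boolP (z - y0 \in (cube r : set V))) => [|_]; last first.
  by rewrite mulr0 mulr_ge0 ?sqr_ge0.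
rewrite inE => /cubeP hz; have zE : z = y0 + (z - y0) by rewrite addrC subrK.
have qz : q z <= 1 by rewrite zE; exact: qb.
rewrite mem_set ?mulr1 ?mul1r//; have := lip _ hz; rewrite -zE gy => hl.
have hg : h / 2 <= `|g z|.
  have := ler_normB (g z) (g z - g x); rewrite opprB addrCA subrr addr0; lra.
have -> : h ^+ 2 / 4 = (h / 2) ^+ 2 by field.
by rewrite -[leRHS]real_normK ?num_real// ler_sqr ?nnegrE// divr_ge0// ltW.
Qed.
End Mass.

Lemma avg_mean m f C df : dotp m m = 1 -> cls C f df -> M (avg 1 m f) = M f.
Proof.
move=> m1 fc; have af := cls_adm fc; have ar := cls_adm (cls_refl m1 fc).
have -> : M (avg 1 m f) = M (fun x => 2^-1 * (f x + f (refl m x))).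
  by apply: eq_M => x; rewrite /avg mul1r.
by rewrite MZ ?MD ?M_refl//; [field|exact: admD].
Qed.

Lemma Bq_sqr_avg m f C df : dotp m m = 1 -> cls C f df ->
  M (fun x => avg 1 m f x ^+ 2) + M (fun x => avg (-1) m f x ^+ 2) = M (fun x => f x ^+ 2).
Proof.
move=> m1 fc; have rc := cls_refl m1 fc.
have s1 : `|1 : R| = 1 by rewrite normr1. have s2 : `|-1 : R| = 1 by rewrite normrN1.
have c1 := cls_avg m1 s1 fc; have c2 := cls_avg m1 s2 fc.
have [a1 a2] := (admX 2 (cls_adm c1), admX 2 (cls_adm c2)).
have [a3 a4] := (admX 2 (cls_adm fc), admX 2 (cls_adm rc)).
rewrite -MD//.
have -> : M (fun x => f x ^+ 2) = M (fun x => 2^-1 * (f x ^+ 2 + f (refl m x) ^+ 2)).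
  rewrite MZ ?MD//; last exact: admD.
  rewrite (@M_refl m (fun x => f x ^+ 2))//; by field.
by apply: eq_M => y; rewrite /avg; field.
Qed.

(** A variational argument with a near-minimiser. Among competitors with mean 0 and [Bq] at most
    that of [f], take [g] of almost least L^2 mass. Its even part in any mirror is again a
    competitor, since the odd part has [Bq >= 0] by [gap_odd]; so the odd part has tiny mass and by
    [value_mass] is uniformly at most [h]. Thus [g] is nearly constant, hence nearly 0, and its [Bq]
    is at least a small negative number. *)
Lemma gap_mean0 C f df : cls C f df -> (forall x, f (- x) = f x) -> M f = 0 -> 0 <= Bq f df.
Proof.
move=> fc fe f0; have C0 := cls_ge0 fc.
pose S := [set mu : R | exists g dg, [/\ cls C g dg, forall x, g (- x) = g x, M g = 0,
  Bq g dg <= Bq f df & mu = M (fun x => g x ^+ 2)]].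
have S0 : has_inf S.
  split; first by exists (M (fun x => f x ^+ 2)), f, df.
  exists 0 => mu [g [dg [gc _ _ _ ->]]]; apply: M_ge0; first by apply: admX; exact: cls_adm gc.
  by move=> x _; exact: sqr_ge0.
have M10 := @M1_gt0 R n.
have D0 : 0 <= 8 * N * M1 by rewrite mulr_ge0 ?ltW// mulr_gt0// ltr0n.
suff key h : 0 < h -> h < 1 -> 0 <= Bq f df + 8 * N * M1 * h by exact: (le_small_eps D0 key).
move=> h0 h1; have [eta eta0 hm] := value_mass fc h0.
have [_ [g [dg [gc ge g0 gB ->]]] gi] := inf_adherent eta0 S0.
have odd_small m x : dotp m m = 1 -> x != 0 -> `|avg (-1) m g x| <= h.
  move=> m1; have s1 : `|1 : R| = 1 by rewrite normr1. have s2 : `|-1 : R| = 1 by rewrite normrN1.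
  have c1 := cls_avg m1 s1 gc; have c2 := cls_avg m1 s2 gc.
  apply: (hm _ _ c2); have e := Bq_sqr_avg m1 gc.
  have : inf S <= M (fun x => avg 1 m g x ^+ 2).
    apply: ge_inf; first exact: S0.2.
    exists (avg 1 m g), (davg 1 m dg); split=> //; first by move=> z; exact: avg_sym.
      by rewrite (avg_mean m1 gc).
    have : 0 <= Bq (avg (-1) m g) (davg (-1) m dg).
      apply: (gap_odd m1 c2) => z; first exact: avg_sym.
      exact: avg_odd.
    by have := Bq_avg m1 gc; lra.
  lra.
have osc x y : x != 0 -> y != 0 -> `|g x - g y| <= 2 * h.
  move=> x0 y0; have [gh _ _ _] := gc.
  pose u := (enorm x)^-1 *: x; pose v := (enorm y)^-1 *: y.
  have gu : g u = g x by rewrite /u gh// invr_gt0 enorm_gt0.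
  have gv : g v = g y by rewrite /v gh// invr_gt0 enorm_gt0.
  rewrite -gu -gv; have [->|uv] := eqVneq u v; first by rewrite subrr normr0 mulr_ge0// ltW.
  (* The reflection exchanging [u] and [v] makes [g u - g v] twice the odd part of [g] at [u]. *)
  have [m m1 mE] := exists_refl (normalize_q x0) (normalize_q y0) uv.
  have := odd_small m u m1 (q1_neq0 (normalize_q x0)).
  rewrite /avg mE mulN1r normrM ger0_norm ?invr_ge0//; lra.
have gs x : x != 0 -> `|g x| <= 2 * h.
  move=> x0; have ag := cls_adm gc; have ac := @adm_cst R n (g x).
  have := @le_M_norm R n (fun y => g x - g y) (fun=> 2 * h) (admB ac ag) (@adm_cst R n (2 * h)) (fun y (hy : y != 0) => osc x y x0 hy).
  rewrite MB// g0 subr0 (@M_cst R n (g x)) (@M_cst R n (2 * h)) normrM (gtr0_norm M10).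
  by rewrite ler_pM2r.
have g2 : M (fun x => g x ^+ 2) <= (2 * h) ^+ 2 * M1.
  rewrite -M_cst; apply: le_M; [by apply: admX; exact: cls_adm gc|exact: adm_cst|].
  by move=> x x0; rewrite -[leLHS]real_normK ?num_real// ler_sqr ?nnegrE ?gs// mulr_ge0// ltW.
have gg : 0 <= M (gsq dg) by apply: M_ge0 => [|x _]; [exact: adm_gsq gc|exact: gsq_ge0].
have N0 : 0 < N by rewrite ltr0n.
have h3 : N * M (fun x => g x ^+ 2) <= N * (4 * h * M1).
  rewrite ler_wpM2l ?(ltW N0)//; apply: (le_trans g2); rewrite ler_wpM2r ?(ltW M10)//.
  have h2 : h ^+ 2 <= h by rewrite expr2 ler_piMl ?ltW.
  by rewrite exprMn; lra.
by move: gB; rewrite {1}/Bq; lra.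
Qed.

Theorem spectral_gap C f df : cls C f df -> (forall x, f (- x) = f x) ->
  2 * N * (M (fun x => f x ^+ 2) - M f ^+ 2 / M1) <= M (gsq df).
Proof.
move=> fc fe; have M10 := @M1_gt0 R n; pose c := M f / M1.
have af := cls_adm fc; have ac := @adm_cst R n c.
have gc : cls (C + `|c|) (fun x => f x - c) df.
  have C0 := cls_ge0 fc; case: fc => h1 h2 h3 h4; split.
  - by move=> t x t0; rewrite h1.
  - apply: (C1on_ext _ _ (C1onB h2 (@C1on_cst R n off0 c))) => // k x; exact: subr0.
  - by move=> x x0; rewrite (le_trans (ler_normB _ _))// lerD2r h3.
  - move=> x x0; apply: (le_trans (h4 x x0)); rewrite lerXn2r ?nnegrE ?addr_ge0//.
    by rewrite lerDl.
have c0 : M (fun x => f x - c) = 0.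
  by rewrite MB// M_cst /c divfK ?subrr// gt_eqF.
have := gap_mean0 gc (fun x => congr1 (fun z : R => z - c) (fe x)) c0.
rewrite /Bq subr_ge0; have -> : M (fun x => (f x - c) ^+ 2) = M (fun x => f x ^+ 2) - M f ^+ 2 / M1.
  have a2 : adm (fun x => f x ^+ 2) by exact: admX.
  have -> : M (fun x => (f x - c) ^+ 2) = M (fun x => f x ^+ 2 + (c ^+ 2 - 2 * c * f x)).
    by apply: eq_M => x; ring.
  rewrite MD//; last by apply: admB; [exact: adm_cst|exact: admZ].
  rewrite MB//; [|exact: adm_cst|exact: admZ].
  rewrite MZ// M_cst /c; field; rewrite gt_eqF//.
by [].
Qed.

End SpectralGap.

(** * The L_p mean of positive numbers *)

Section LpMean.
Variables (R : realType) (p : R).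
Implicit Types (x y t r s e lam : R).

(** Normalised to have value 0 and slope 1 at 1 for every [p], so that [p = 0] is an ordinary member
    of the family. The L_p mean is the arithmetic mean transported by [Phi], with inverse [Psi]. *)
Definition Phi x := if p == 0 then ln x else (x `^ p - 1) / p.
Definition Psi y := if p == 0 then expR y else (1 + p * y) `^ (1 / p).

Lemma ln_leB1 x : 0 < x -> ln x <= x - 1.
Proof.
move=> x0; have := @le_ln1Dx R (x - 1); have -> : 1 + (x - 1) = x by ring.
by apply; lra.
Qed.

Lemma powR_expR x s : 0 < x -> x `^ s = expR (s * ln x).
Proof. by move=> x0; rewrite /powR gt_eqF. Qed.

Lemma Phi1 : Phi 1 = 0.
Proof. by rewrite /Phi ln1; case: eqP => // _; rewrite powR1 subrr mul0r. Qed.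

Lemma Phi_derive x : 0 < x -> is_derive x (1 : R) Phi (x `^ (p - 1)).
Proof.
move=> x0; have [p0|p0] := eqVneq p 0.
  have -> : Phi = @ln R by apply/funext => y; rewrite /Phi p0 eqxx.
  by rewrite p0 sub0r powR_inv1 ?ltW//; exact: is_derive1_ln.
have -> : Phi = (fun y => p^-1 * (y `^ p - 1)).
  by apply/funext => y; rewrite /Phi (negbTE p0) mulrC.
have d1 := is_deriveB (is_derive1_powR p x0) (is_derive_cst (1 : R) x (1 : R)).
have d2 := is_deriveM (is_derive_cst p^-1 x (1 : R)) d1.
apply: (is_derive_eq d2); rewrite /GRing.scale/= subr0 mulr0 addr0; field; exact: p0.
Qed.

Lemma Phi_scale t x : 0 < t -> 0 < x -> Phi (t * x) = t `^ p * Phi x + Phi t.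
Proof.
move=> t0 x0; rewrite /Phi; case: eqP => [->|/eqP p0].
  by rewrite powRr0 mul1r lnM// addrC.
by rewrite powRM ?ltW//; move: (t `^ p) (x `^ p) => a b; field; exact: p0.
Qed.

Lemma Phi_lt x y : 0 < x -> x < y -> Phi x < Phi y.
Proof.
move=> x0 xy; have y0 := lt_trans x0 xy; rewrite /Phi; case: eqP => [_|/eqP p0]; first by rewrite ltr_ln.
have ll : ln x < ln y by rewrite ltr_ln.
rewrite !powR_expR//; case: (ltrP 0 p) => h.
  by rewrite ltr_pM2r ?invr_gt0// ltrD2r ltr_expR ltr_pM2l.
have pn : p < 0 by rewrite lt_neqAle p0.
by rewrite ltr_nM2r ?invr_lt0// ltrD2r ltr_expR ltr_nM2l.
Qed.

Lemma Phi_inj x y : 0 < x -> 0 < y -> Phi x = Phi y -> x = y.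
Proof.
move=> x0 y0 h; apply/eqP; rewrite eq_le !leNgt; apply/andP; split; apply/negP => /Phi_lt.
  by move=> /(_ y0); rewrite h ltxx.
by move=> /(_ x0); rewrite h ltxx.
Qed.

Lemma Phi_le x y : 0 < x -> x <= y -> Phi x <= Phi y.
Proof. by move=> x0; rewrite le_eqVlt => /orP[/eqP -> //|/Phi_lt h]; apply/ltW/h. Qed.

Lemma Phi_dom x : 0 < x -> 0 < 1 + p * Phi x.
Proof.
move=> x0; rewrite /Phi; case: eqP => [->|/eqP p0]; first by rewrite mul0r addr0.
by rewrite mulrCA divff// mulr1 addrC subrK powR_gt0.
Qed.

Lemma Psi_gt0 y : 0 < 1 + p * y -> 0 < Psi y.
Proof. by move=> h; rewrite /Psi; case: eqP => _; [exact: expR_gt0|exact: powR_gt0]. Qed.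

Lemma PsiK y : 0 < 1 + p * y -> Phi (Psi y) = y.
Proof.
move=> h; rewrite /Phi /Psi; case: eqP => [_|/eqP p0]; first by rewrite expRK.
rewrite -powRrM mul1r mulVf// powRr1 ?ltW//; field; exact: p0.
Qed.

Lemma Psi_derive y : 0 < 1 + p * y -> is_derive y (1 : R) Psi ((Psi y) `^ (1 - p)).
Proof.
move=> h; rewrite /Psi; have [p0|p0] := eqVneq p 0.
  by rewrite p0 subr0 powRr1 ?expR_ge0//; exact: is_derive_expR.
have d1 : is_derive y (1 : R) (fun z => 1 + p * z) p.
  by have := affine_derive p 1 y; congr is_derive; apply/funext => z; rewrite addrC.
have d2 := @is_derive1_comp _ (fun z : R => z `^ (1 / p)) (fun z => 1 + p * z) y _ _ (is_derive1_powR (1 / p) h) d1.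
apply: (is_derive_eq d2); rewrite mulrAC div1r mulVf// mul1r -powRrM; congr (_ `^ _); field; exact: p0.
Qed.

Definition lpmean lam x y := if p == 0 then x `^ (1 - lam) * y `^ lam
  else ((1 - lam) * x `^ p + lam * y `^ p) `^ (1 / p).

Lemma lpmeanE lam x y : 0 < x -> 0 < y -> 0 <= lam <= 1 ->
  [/\ 0 < lpmean lam x y, lpmean lam x y = Psi ((1 - lam) * Phi x + lam * Phi y),
   0 < 1 + p * ((1 - lam) * Phi x + lam * Phi y) &
   Phi (lpmean lam x y) = (1 - lam) * Phi x + lam * Phi y].
Proof.
move=> x0 y0 /andP[l0 l1]; have w0 : 0 < 1 + p * ((1 - lam) * Phi x + lam * Phi y).
  have -> : 1 + p * ((1 - lam) * Phi x + lam * Phi y) =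
    (1 - lam) * (1 + p * Phi x) + lam * (1 + p * Phi y) by ring.
  have [hx hy] := (Phi_dom x0, Phi_dom y0).
  have [e|e] := eqVneq lam 0; first by rewrite e subr0 mul0r addr0 mul1r.
  have lp : 0 < lam by rewrite lt_neqAle eq_sym e.
  have a1 : 0 <= (1 - lam) * (1 + p * Phi x) by apply: mulr_ge0; lra.
  have a2 : 0 < lam * (1 + p * Phi y) by rewrite mulr_gt0.
  lra.
have e : lpmean lam x y = Psi ((1 - lam) * Phi x + lam * Phi y).
  rewrite /lpmean /Psi /Phi; case: eqP => [_|/eqP p0]; first by rewrite !powR_expR// expRD.
  congr (_ `^ _); field; exact: p0.
by split=> //; rewrite e; [exact: Psi_gt0|exact: PsiK].
Qed.

Lemma lpmean_between lam x y l u : 0 < l -> l <= x <= u -> l <= y <= u -> 0 <= lam <= 1 ->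
  l <= lpmean lam x y <= u.
Proof.
move=> l0 /andP[lx xu] /andP[ly yu] hl.
have [x0 y0] := (lt_le_trans l0 lx, lt_le_trans l0 ly).
have u0 := lt_le_trans x0 xu.
have [m0 _ _ Pm] := lpmeanE x0 y0 hl; case/andP: hl => l00 l1.
have [h1 h2 h3 h4] := And4 (Phi_le l0 lx) (Phi_le l0 ly) (Phi_le x0 xu) (Phi_le y0 yu).
apply/andP; split; rewrite leNgt; apply/negP => /Phi_lt.
  by move=> /(_ m0); rewrite Pm; nra.
by move=> /(_ u0); rewrite Pm; nra.
Qed.

Lemma powR_cvgR s x : 0 < x -> y `^ s @[y --> x] --> x `^ s.
Proof.
move=> x0; suff : {for x, continuous (fun y : R => y `^ s)} by [].
by apply: differentiable_continuous; apply/derivable1_diffP; case: (is_derive1_powR s x0).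
Qed.

Lemma powR_near1 s x : 1 / 2 <= x <= 3 / 2 -> 0 <= x `^ s <= expR `|s|.
Proof.
move=> /andP[h1 h2]; have x0 : 0 < x by lra.
rewrite powR_ge0/= powR_expR// ler_expR.
have l1 : ln x <= 1 by have := ln_leB1 x0; lra.
have l2 : - ln x <= 1.
  rewrite -lnV ?posrE//; have xi : x^-1 <= 2 by rewrite invf_ple ?posrE//; lra.
  have xi0 : 0 < x^-1 by rewrite invr_gt0.
  by have := ln_leB1 xi0; lra.
apply: (le_trans (ler_norm _)); rewrite normrM ler_piMr//.
by rewrite ler_norml; apply/andP; split; lra.
Qed.

(* Second-order lower bound; the constant [1 + eta] absorbs the third-order term. *)
Lemma Phi_lower eta : p < 1 -> 0 < eta -> exists2 d, 0 < d & d <= 1 / 2 /\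
  forall t, `|t| <= d -> t - (1 - p) / 2 * (1 + eta) * t ^+ 2 <= Phi (1 + t).
Proof.
move=> p1 eta0; have P0 : 0 < 1 - p by lra.
have D0 : 0 < (1 + eta) * (1 + (1 - p)) by rewrite mulr_gt0//; lra.
pose d := Num.min (1 / 2) (eta / ((1 + eta) * (1 + (1 - p)))).
have d0 : 0 < d by rewrite lt_min divr_gt0//= divr_gt0.
exists d => //; split; first by rewrite ge_min lexx.
move=> t td; pose c := (1 - p) / 2 * (1 + eta).
have d2 : d <= 1 / 2 by rewrite ge_min lexx.
have dD : d * ((1 + eta) * (1 + (1 - p))) <= eta by rewrite -ler_pdivlMr// ge_min lexx orbT.
pose psi s := Phi (1 + s) - s + c * (s * s).
pose dpsi s := (1 + s) `^ (p - 1) - 1 + c * (s + s).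
have pd s : -1 < s -> is_derive s (1 : R) psi (dpsi s).
  move=> s1; have sp : 0 < 1 + s by lra.
  have e1 : is_derive s (1 : R) (fun z => 1 + z) 1.
    by have := affine_derive 1 1 s; congr is_derive; apply/funext => z; rewrite mul1r addrC.
  have e2 := @is_derive1_comp _ Phi (fun z => 1 + z) s _ _ (Phi_derive sp) e1.
  have e3 := is_deriveM (is_derive_id s (1 : R)) (is_derive_id s (1 : R)).
  have e4 := is_deriveM (is_derive_cst c s (1 : R)) e3.
  apply: (is_derive_eq (is_deriveD (is_deriveB e2 (is_derive_id s (1 : R))) e4)).
  by rewrite /GRing.scale/= /dpsi !mulr1 mulr0 addr0.
have psi0 : psi 0 = 0 by rewrite /psi addr0 Phi1; ring.
suff : 0 <= psi t by rewrite /psi -/c expr2; lra.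
have contp (u v : R) : -1 < u -> {within `[u, v], continuous psi}.
  move=> u1; apply: derivable_within_continuous => s; rewrite in_itv/= => /andP[us _].
  by case: (pd s (lt_le_trans u1 us)).
have [t0|t0] := leP 0 t.
  have gd (s : R) : s \in `]0, t[ -> is_derive s (1 : R) psi (dpsi s).
    by rewrite in_itv/= => /andP[s0 _]; apply: pd; lra.
  have [s + e] := MVT_segment t0 gd (contp 0 t (ltac:(lra))).
  rewrite in_itv/= => /andP[s0 st]; rewrite psi0 !subr0 in e; rewrite e mulr_ge0//.
  have l1 : ln (1 + s) <= s by apply: le_ln1Dx; lra.
  have := @expR_ge1Dx R ((p - 1) * ln (1 + s)); rewrite -powR_expR; last by lra.
  have g1 : (1 - p) * ln (1 + s) <= (1 - p) * s by rewrite ler_wpM2l// ltW.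
  have g2 : 0 <= (1 - p) * eta * s by apply: mulr_ge0 => //; apply: mulr_ge0; exact: ltW.
  by rewrite /dpsi /c; lra.
have t1 : -1 < t by move: td; rewrite ltr0_norm//; lra.
have gd (s : R) : s \in `]t, 0[ -> is_derive s (1 : R) psi (dpsi s).
  by rewrite in_itv/= => /andP[s0 _]; apply: pd; lra.
have [s + e] := MVT_segment (ltW t0) gd (contp t 0 t1).
rewrite in_itv/= => /andP[ts s0]; rewrite psi0 !sub0r in e.
suff : dpsi s <= 0 by move=> h; nra.
move: td; rewrite ltr0_norm// => td.
have [r rE] : {r | r = - s} by eexists.
have [r0 rd] : 0 <= r /\ r <= d by split; rewrite rE; lra.
have sE : s = - r by rewrite rE opprK.
(* For negative increments the claim is [(1 - r)^(p - 1) <= 1 + 2 c r]. The reciprocal is bounded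
   below through the exponential and the logarithm; the choice of [d] in terms of [eta] absorbs the
   second-order loss. *)
rewrite /dpsi sE; have q0 : 0 < 1 - r by lra.
have qn0 : 1 - r != 0 by rewrite gt_eqF.
have l1 : - (r / (1 - r)) <= ln (1 - r).
  have qi : 0 < (1 - r)^-1 by rewrite invr_gt0.
  have := ln_leB1 qi; rewrite lnV ?posrE//.
  have -> : (1 - r)^-1 - 1 = r / (1 - r) by field.
  lra.
have h1 := @expR_ge1Dx R ((1 - p) * ln (1 - r)); rewrite -powR_expR// in h1.
have [Y YE] : {Y | Y = (1 - r) `^ (1 - p)} by eexists.
have -> : (1 - r) `^ (p - 1) = Y^-1 by rewrite YE -powRN opprB.
have Y0 : 0 < Y by rewrite YE powR_gt0.
rewrite -YE in h1.
have h2 : 1 - (1 - p) * (r / (1 - r)) <= Y by apply: le_trans h1; nra.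
have h3 : 1 <= Y * (1 + 2 * c * r).
  apply: (@le_trans _ _ ((1 - (1 - p) * (r / (1 - r))) * (1 + 2 * c * r))); last first.
    have c0 : 0 <= c by rewrite /c mulr_ge0 ?divr_ge0//; lra.
    by apply: ler_wpM2r => //; apply: addr_ge0 => //; apply: mulr_ge0 => //; apply: mulr_ge0.
  have h4 : 0 <= (1 - p) * r / (1 - r) * (eta - r * ((1 + eta) * (1 + (1 - p)))).
    rewrite mulr_ge0//; first by rewrite divr_ge0 ?mulr_ge0//; lra.
    by rewrite subr_ge0 (le_trans _ dD)// ler_wpM2r// ltW.
  rewrite -subr_ge0; apply: le_trans h4 _; rewrite le_eqVlt; apply/orP; left; apply/eqP.
  by rewrite /c; field.
have : Y^-1 <= 1 + 2 * c * r by rewrite -[leLHS]mul1r ler_pdivrMr// mulrC.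
lra.
Qed.

End LpMean.

(** For exponents at most 1 the function [Phi] is concave, so its graph lies below the tangent at
    1. *)
Lemma Phi_le1 (R : realType) (r X : R) : r <= 1 -> 0 < X -> Phi r X <= X - 1.
Proof.
move=> r1 X0; rewrite /Phi; case: eqP => [_|/eqP r0].
  exact: ln_leB1.
rewrite powR_expR//; have XE : X = expR (ln X) by rewrite lnK.
rewrite {2}XE; set s := ln X.
case: (ltrP 0 r) => h.
  rewrite ler_pdivrMr//.
  have h1 := @expR_ge1Dx R (s - r * s); have h2 := @expR_ge1Dx R (- (r * s)).
  have h3 : 1 <= r * expR (s - r * s) + (1 - r) * expR (- (r * s)) by nra.
  have e0 := expR_gt0 (r * s).
  have := ler_wpM2l (ltW e0) h3; rewrite mulr1 mulrDr !(mulrCA (expR (r * s))) -!expRD.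
  have -> : r * s + (s - r * s) = s by ring.
  rewrite subrr expR0; lra.
have rn : r < 0 by rewrite lt_neqAle r0.
rewrite ler_ndivrMr//; have h1 := @expR_ge1Dx R (r * s); have h2 := @expR_ge1Dx R s; nra.
Qed.

Lemma Phi_root (R : realType) (p X : R) (j : nat) : (0 < j)%N -> 0 < X ->
  Phi p (X `^ (j%:R^-1)) = Phi (p / j%:R) X / j%:R.
Proof.
move=> j0 X0; have jn : j%:R != 0 :> R by rewrite pnatr_eq0 -lt0n.
rewrite /Phi mulf_eq0 invr_eq0 (negbTE jn) orbF; case: eqP => [_|/eqP p0].
  by rewrite ln_powR mulrC.
have -> : (X `^ j%:R^-1) `^ p = X `^ (p / j%:R) by rewrite -powRrM mulrC.
by move: (X `^ _) => Y; field; rewrite p0 jn.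
Qed.

Section RealBounds.
Variable R : realFieldType.
Implicit Types (e t u w c B l : R).

Lemma sum4_ge (x y z v : R) : 0 <= x -> 0 <= y -> 0 <= z -> 0 <= v ->
  [/\ x <= x + y + z + v, y <= x + y + z + v, z <= x + y + z + v & v <= x + y + z + v].
Proof. by move=> *; split; lra. Qed.

Lemma near1_half e t : e <= 1 / 2 -> 1 - e <= t -> t <= 1 + e -> 1 / 2 <= t <= 3 / 2.
Proof. by move=> *; apply/andP; split; lra. Qed.

Lemma convex_comb_le l u w c : 0 <= 1 - l -> 0 <= l -> u <= c -> w <= c -> (1 - l) * u + l * w <= c.
Proof. by move=> l1 l0 uc wc; have := ler_wpM2l l1 uc; have := ler_wpM2l l0 wc; lra. Qed.

Lemma sqr_le_small e : 0 <= e -> e <= 1 / 2 -> e * e <= e.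
Proof. by move=> *; rewrite ler_piMr//; lra. Qed.

Lemma second_order_bound1 B t e : t * B * (e * e) <= t * B * e ->
  B * e + e * (t * B * e) <= B * (1 + t) * e.
Proof. lra. Qed.

Lemma second_order_bound2 B t u e : 0 <= e -> 0 <= B * B * e ->
  B * (u * B * (B * B)) * (e * e) <= B * (u * B * (B * B)) * e ->
  B * (B * (1 + t) * e) + B * e * (u * B * (B * B * e)) <=
    (B * (B * (1 + t)) + B * (u * B * (B * B)) + B * B + 1) * e.
Proof. lra. Qed.

End RealBounds.

(** * The L_p mean of nearly constant functions *)

Section NiceMean.
Variables (R : realType) (n : nat) (p : R).
Notation V := 'rV[R]_n.+1.
Notation I := 'I_n.+1.
Notation off0 := [set x : V | x != 0].
Implicit Types (x y : V) (e lam : R) (a b : V -> R) (da db : I -> V -> R) (dda ddb : I -> I -> V -> R).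

Lemma nice_le e e' a da dda : e <= e' -> nice e a da dda -> nice e' a da dda.
Proof.
move=> ee [aH h]; split=> // x x1; have [h1 h2 h3] := h x x1.
by split=> [|i|i k]; exact: le_trans ee.
Qed.

Definition dpw a da (i : I) x : R := a x `^ (p - 1) * da i x.
Definition ddpw a da dda (i k : I) x : R :=
  a x `^ (p - 1) * dda i k x + da i x * ((p - 1) * a x `^ (p - 1 - 1) * da k x).

Lemma C1on_dpw e a da dda i : nice e a da dda -> e <= 1 / 2 -> C1on off0 (dpw a da i) (ddpw a da dda i).
Proof.
move=> aN e2; have [[_ h1 h2] _] := aN.
apply: (C1onM (@open_ne0 R n) _ (h2 i)).
have := @C1on_comp1 R n off0 _ _ (fun t : R => t `^ (p - 1)) (fun t => (p - 1) * t `^ (p - 1 - 1)) (@open_ne0 R n) h1.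
apply => x x0.
have /andP[a1 _] := nice_half aN e2 x0; have a0 : 0 < a x by lra.
split; first exact: is_derive1_powR.
by apply: cvgM; [exact: cvg_cst|exact: powR_cvgR].
Qed.

Section Mean.
Variables (lam : R) (a b : V -> R) (da db : I -> V -> R) (dda ddb : I -> I -> V -> R).

Definition lpm x := lpmean p lam (a x) (b x).
Definition dlw (i : I) x : R := (1 - lam) * dpw a da i x + lam * dpw b db i x.
Definition ddlw (i k : I) x : R := (1 - lam) * ddpw a da dda i k x + lam * ddpw b db ddb i k x.
Definition dlpm (i : I) x : R := lpm x `^ (1 - p) * dlw i x.
Definition ddlpm (i k : I) x : R :=
  lpm x `^ (1 - p) * ddlw i k x + dlw i x * ((1 - p) * lpm x `^ (1 - p - 1) * dlpm k x).

Variable e : R.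
Hypotheses (aN : nice e a da dda) (bN : nice e b db ddb) (e2 : e <= 1 / 2) (l01 : 0 <= lam <= 1).

Lemma lpm_bounds x : x != 0 -> 1 - e <= lpm x <= 1 + e.
Proof.
move=> x0; have h1 := nice_val aN x0; have h2 := nice_val bN x0.
move: (e2) => h3; apply: lpmean_between => //; first by lra.
  by move: h1; rewrite ler_norml => /andP[? ?]; apply/andP; split; lra.
by move: h2; rewrite ler_norml => /andP[? ?]; apply/andP; split; lra.
Qed.

Lemma ab_gt0 x : x != 0 -> 0 < a x /\ 0 < b x.
Proof.
move=> x0; have /andP[h1 _] := nice_half aN e2 x0; have /andP[h2 _] := nice_half bN e2 x0.
by split; lra.
Qed.

Lemma hom2_lpm : hom2 lpm dlpm ddlpm.
Proof.
have [[a1 a2 a3] _] := aN; have [[b1 b2 b3] _] := bN.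
have wC i : C1on off0 (dlw i) (ddlw i).
  by apply: C1onD; apply: C1onZ; [exact: C1on_dpw aN e2|exact: C1on_dpw bN e2].
have fC : C1on off0 lpm dlpm.
  pose w x := (1 - lam) * Phi p (a x) + lam * Phi p (b x).
  have wC1 : C1on off0 w dlw.
    apply: C1onD; apply: C1onZ.
      apply: (@C1on_comp1 R n off0 _ _ (Phi p) (fun t => t `^ (p - 1)) (@open_ne0 R n) a2) => x x0.
      have [p1 p2] := ab_gt0 x0; split; [exact: Phi_derive|exact: powR_cvgR].
    apply: (@C1on_comp1 R n off0 _ _ (Phi p) (fun t => t `^ (p - 1)) (@open_ne0 R n) b2) => x x0.
    have [p1 p2] := ab_gt0 x0; split; [exact: Phi_derive|exact: powR_cvgR].
  have wl x : x != 0 -> 0 < 1 + p * w x /\ lpm x = Psi p (w x).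
    by move=> x0; have [p1 p2] := ab_gt0 x0; have [_ h1 h2 _] := lpmeanE p p1 p2 l01.
  have fC' : C1on off0 (fun x => Psi p (w x)) (fun k x => Psi p (w x) `^ (1 - p) * dlw k x).
    apply: (@C1on_comp1 R n off0 _ _ (Psi p) (fun t => Psi p t `^ (1 - p)) (@open_ne0 R n) wC1) => x x0.
    have [w0 _] := wl _ x0; split; first exact: Psi_derive.
    have cP : {for w x, continuous (Psi p)}.
      by apply: differentiable_continuous; apply/derivable1_diffP; case: (Psi_derive w0).
    by apply: (cvg_comp (Psi p) (fun t : R => t `^ (1 - p)) cP); apply: powR_cvgR; exact: Psi_gt0.
  apply: (C1on_local (@open_ne0 R n) _ _ fC') => [x x0|k x x0]; have [_ e1] := wl _ x0; by rewrite ?/dlpm e1.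
split=> [t x t0||i]; [by rewrite /lpm (a1 t x t0) (b1 t x t0)|exact: fC|].
apply: (C1onM (@open_ne0 R n) _ (wC i)).
have := @C1on_comp1 R n off0 _ _ (fun t : R => t `^ (1 - p)) (fun t => (1 - p) * t `^ (1 - p - 1)) (@open_ne0 R n) fC.
apply => x x0.
have /andP[h1 _] := lpm_bounds x0; have f0 : 0 < lpm x by move: (e2) => ?; lra.
split; first exact: is_derive1_powR.
by apply: cvgM; [exact: cvg_cst|exact: powR_cvgR].
Qed.

(** Dominates on [[1 / 2, 3 / 2]] the four powers that occur in two derivatives of the mean. [lpC]
    collects the terms of the chain rule and depends on [p] alone, which keeps the final smallness
    uniform in the weight and the bodies. *)
Definition pwB := expR `|p - 1| + expR `|p - 1 - 1| + expR `|1 - p| + expR `|1 - p - 1|.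
Definition lpC := pwB * (pwB * (1 + `|p - 1|)) + pwB * (`|1 - p| * pwB * (pwB * pwB)) + pwB * pwB + 1.

Lemma pwB_ge1 : 1 <= pwB.
Proof.
have h (s : R) : 1 <= expR `|s| by rewrite -[leLHS]expR0 ler_expR.
by rewrite /pwB; have := h (p - 1); have := h (p - 1 - 1); have := h (1 - p); have := h (1 - p - 1); lra.
Qed.

Lemma nice_lpm : nice (lpC * e) lpm dlpm ddlpm.
Proof.
have e0 := nice_ge0 aN; have B1 := pwB_ge1; have B0 : 0 <= pwB by lra.
split; first exact: hom2_lpm.
move=> x x1; have x0 := q1_neq0 x1.
have [ha1 ha2 ha3] := (aN.2 x x1); have [hb1 hb2 hb3] := (bN.2 x x1).
have /andP[f1 f2] := lpm_bounds x0.
have fe : `|lpm x - 1| <= e by rewrite ler_norml; apply/andP; split; lra.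
have [l0 l1] : 0 <= 1 - lam /\ 0 <= lam by case/andP: l01 => ? ?; split; lra.
have nM (u w c d : R) : `|u| <= c -> `|w| <= d -> `|u * w| <= c * d.
  by move=> h1 h2; rewrite normrM ler_pM.
have pb (y s : R) : 1 / 2 <= y <= 3 / 2 -> expR `|s| <= pwB -> `|y `^ s| <= pwB.
  by move=> /(powR_near1 s) /andP[h1 h2] h3; rewrite ger0_norm// (le_trans h2).
have [E1 E2 E3 E4] : [/\ expR `|p - 1| <= pwB, expR `|p - 1 - 1| <= pwB, expR `|1 - p| <= pwB & expR `|1 - p - 1| <= pwB].
  have h (s : R) := expR_ge0 `|s|.
  by rewrite /pwB; exact: (sum4_ge (h _) (h _) (h _) (h _)).
have ah := nice_half aN e2 x0; have bh := nice_half bN e2 x0.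
have fh : 1 / 2 <= lpm x <= 3 / 2 by exact: (near1_half e2 f1 f2).
have cvx (u w c : R) : `|u| <= c -> `|w| <= c -> `|(1 - lam) * u + lam * w| <= c.
  move=> h1 h2; apply: (le_trans (ler_normD _ _)); rewrite !normrM (ger0_norm l0) (ger0_norm l1).
  exact: (convex_comb_le l0 l1 h1 h2).
have dwb i : `|dlw i x| <= pwB * e by apply: cvx; apply: nM => //; exact: pb.
have p10 : 0 <= `|p - 1| by []. have p20 : 0 <= `|1 - p| by [].
have ee : e * e <= e by exact: (sqr_le_small e0 e2).
have ddb_ y (a' : V -> R) da' dda' : 1 / 2 <= a' y <= 3 / 2 -> (forall i, `|da' i y| <= e) ->
    (forall i k, `|dda' i k y| <= e) -> forall i k, `|ddpw a' da' dda' i k y| <= pwB * (1 + `|p - 1|) * e.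
  move=> h1 h2 h3 i k; apply: (le_trans (ler_normD _ _)).
  have g1 := nM _ _ _ _ (pb _ _ h1 E1) (h3 i k).
  have g2 := nM _ _ _ _ (h2 i) (nM _ _ _ _ (nM _ _ _ _ (lexx `|p - 1|) (pb _ _ h1 E2)) (h2 k)).
  apply: (le_trans (lerD g1 g2)).
  have : `|p - 1| * pwB * (e * e) <= `|p - 1| * pwB * e by rewrite ler_wpM2l// mulr_ge0.
  exact: second_order_bound1.
have ddwb i k : `|ddlw i k x| <= pwB * (1 + `|p - 1|) * e by apply: cvx; exact: ddb_.
have dfb i : `|dlpm i x| <= pwB * pwB * e.
  by rewrite -mulrA; apply: nM => //; exact: pb.
have C1 : 0 <= pwB * (pwB * (1 + `|p - 1|)) * e /\ 0 <= pwB * (`|1 - p| * pwB * (pwB * pwB)) * e /\ 0 <= pwB * pwB * e.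
  by do !split; rewrite !mulr_ge0// addr_ge0.
case: C1 => c1 [c2 c3].
have lE (X Y Z t : R) : (X + Y + Z + 1) * t = X * t + Y * t + Z * t + t by ring.
split=> [|i|i k]; rewrite /lpC.
- apply: (le_trans fe).
  by rewrite lE lerDr; apply: addr_ge0 => //; exact: addr_ge0.
- apply: (le_trans (dfb i)); rewrite lE -addrA [leRHS]addrCA lerDl.
  by apply: addr_ge0 => //; exact: addr_ge0.
- apply: (le_trans (ler_normD _ _)).
  have g1 := nM _ _ _ _ (pb _ _ fh E3) (ddwb i k).
  have g2 := nM _ _ _ _ (dwb i) (nM _ _ _ _ (nM _ _ _ _ (lexx `|1 - p|) (pb _ _ fh E4)) (dfb k)).
  apply: (le_trans (lerD g1 g2)).
  have : pwB * (`|1 - p| * pwB * (pwB * pwB)) * (e * e) <= pwB * (`|1 - p| * pwB * (pwB * pwB)) * e.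
    by rewrite ler_wpM2l// !mulr_ge0.
  exact: (second_order_bound2 _ e0 c3).
Qed.

End Mean.
End NiceMean.

Lemma coef_XD1n (R : comNzRingType) (m k : nat) : ((1 + 'X : {poly R}) ^+ m)`_k = 'C(m, k)%:R.
Proof.
have -> : (1 + 'X : {poly R}) ^+ m = \poly_(i < m.+1) 'C(m, i)%:R.
  rewrite poly_def exprDn; apply: eq_bigr => i _.
  by rewrite expr1n mul1r -mul_polyC polyCMn mulr_natl.
by rewrite coef_poly; case: ltnP => // mk; rewrite bin_small.
Qed.

(** * Second-order expansion of the Steiner coefficients *)

Section CoefExpansion.
Variables (R : realType) (n : nat).
Notation V := 'rV[R]_n.+1.
Notation I := 'I_n.+1.
Notation off0 := [set x : V | x != 0].
Notation N := (n.+1%:R : R).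
Implicit Types (x y : V) (e t s : R) (a b : V -> R) (da db : I -> V -> R) (dda ddb : I -> I -> V -> R).

Lemma nice_scale e s a da dda : 0 <= s -> s <= 1 -> e <= 1 -> nice e a da dda ->
  nice (e + 2 * s) (fun x => (1 + s) * a x) (fun i x => (1 + s) * da i x) (fun i k x => (1 + s) * dda i k x).
Proof.
move=> s0 s1 e1 aN; have e0 := nice_ge0 aN; have [[h1 h2 h3] h] := aN; split.
  by split=> [t x t0||i]; [rewrite h1|exact: C1onZ|exact: C1onZ].
have se : s * e <= s by rewrite ler_piMr.
have nb (u : R) : `|u| <= e -> `|(1 + s) * u| <= e + 2 * s.
  move=> ue; rewrite normrM ger0_norm; last by lra.
  have := ler_wpM2l (ltac:(lra) : 0 <= 1 + s) ue; lra.
move=> x x1; have [g1 g2 g3] := h x x1; split=> [|i|i k]; [|exact: nb|exact: nb].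
have -> : (1 + s) * a x - 1 = (1 + s) * (a x - 1) + s by ring.
apply: (le_trans (ler_normD _ _)); rewrite (ger0_norm s0) normrM ger0_norm; last by lra.
have := ler_wpM2l (ltac:(lra) : 0 <= 1 + s) g1; lra.
Qed.

Section WithConstants.
Variables (K K' : R).
Hypotheses (K0 : 0 < K) (HK : forall (M : 'M[R]_n.+1) d, 0 <= d -> d <= 1 ->
    (forall i j, `|M i j - (i == j)%:R| <= d) -> `|\det M - 1| <= K * d).
Hypotheses (K'0 : 0 <= K') (HK' : forall e, 4 * n.+1%:R ^+ 2 * e <= 1 / 100 -> K * (5 * e) <= 1 / 2 ->
  forall a da dda b db ddb, nice e a da dda -> nice e b db ddb ->
  `|M (Jac b db ddb) - (M (Jac a da dda) + n.+1%:R * M (fun x => (b x - a x) * (Jac a da dda x / a x))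
     + n.+1%:R / 2 * M (fun x => (n.+1%:R - 1) * (b x - a x) ^+ 2 - gdist da db x))|
  <= K' * (e * M (fun x => (b x - a x) ^+ 2 + gdist da db x))).
Variable c : nat -> nat -> R.
Hypothesis cP : forall p : {poly R}, (size p <= n.+2)%N ->
    forall k, (k < n.+2)%N -> p`_k = \sum_(i < n.+2) c k i * p.[i.+1%:R].
Variable k : nat.
Hypothesis kn : (k < n)%N.

Let rho (i : 'I_n.+2) : R := i.+1%:R.
Let rho1 i : 0 < 1 + rho i. Proof. by rewrite addr_gt0// ltr0n. Qed.
Let rho0 i : 0 <= rho i. Proof. by rewrite ler0n. Qed.

(** The interpolation weights are applied to the polynomial [(1 + X) ^ m]. For the ball the rescaled
    densities are all 1, so sums of this shape give the leading constants of the first and second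
    variation. *)
Lemma binom_sum m : (m <= n.+1)%N -> \sum_(i < n.+2) c k i * (1 + rho i) ^+ m = 'C(m, k)%:R.
Proof.
move=> mn; rewrite -(coef_XD1n R m k) (cP (p := (1 + 'X) ^+ m)).
- by apply: eq_bigr => i _; rewrite horner_exp hornerD hornerC hornerX.
- rewrite (leq_trans (size_exp_leq _ _))// addrC size_XaddC mul1n ltnS//.
- by rewrite (ltn_trans kn)// ltnS leqnSn.
Qed.

(** The density of the first variation of [Ucoef k] at [a], assembled from the densities [N * J / a]
    of the shrunk parallel bodies; one of the [n.+1] powers of [1 + rho] is used up by the
    derivative of [sh]. *)
Definition sigma a da dda x : R := N * \sum_(i < n.+2) c k i * (1 + rho i) ^+ n *
  (Jac (sh (rho i) a) (dsh (rho i) da) (ddsh (rho i) dda) x / sh (rho i) a x).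

Definition csum := \sum_(i < n.+2) `|c k i| * (1 + rho i) ^+ n.+1.

Lemma csum_ge0 : 0 <= csum.
Proof. by apply: sumr_ge0 => i _; rewrite mulr_ge0// exprn_ge0// ltW. Qed.

Variable e : R.
Hypotheses (es1 : 4 * n.+1%:R ^+ 2 * e <= 1 / 100) (es2 : K * (5 * e) <= 1 / 2).

Section A.
Variables (a : V -> R) (da : I -> V -> R) (dda : I -> I -> V -> R).
Hypothesis aN : nice e a da dda.

Let e2 : 0 <= e /\ e <= 1 / 100.
Proof. by have [? ? _ _ _] := e_small es1 aN. Qed.

Lemma adm_ratio i : adm (fun x => Jac (sh (rho i) a) (dsh (rho i) da) (ddsh (rho i) dda) x / sh (rho i) a x).
Proof.
move: (e2) => [e0 e1]; have bN := nice_sh (rho0 i) aN.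
apply: admM; [apply: (adm_Jac bN); lra|apply: (adm_inv bN); lra].
Qed.

Lemma adm_sigma : adm (sigma a da dda).
Proof. by apply: admZ; apply: adm_sum => i; apply: admZ; exact: adm_ratio. Qed.

Lemma sigma_near x : x != 0 -> `|sigma a da dda x - N * 'C(n, k)%:R| <= N * (csum * (2 * (K * 5 + 1))) * e.
Proof.
move=> x0; move: (e2) => [e0 e1]; rewrite -(binom_sum (leqnSn n)) /sigma -mulrBr -sumrB.
rewrite normrM (ger0_norm (ler0n _ _)) -!mulrA ler_wpM2l//.
apply: (le_trans (ler_norm_sum _ _ _)); rewrite /csum !mulr_suml; apply: ler_sum => i _.
have bN := nice_sh (rho0 i) aN.
set J := Jac _ _ _ x; set s := sh _ _ _.
have hs := nice_val bN x0; rewrite -/s in hs.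
have hJ : `|J - 1| <= K * (5 * e) by apply: (Jac_near bN HK); lra.
have s2 : 1 / 2 <= s by move: hs; rewrite ler_norml => /andP[? ?]; lra.
have sn : s != 0 by rewrite gt_eqF//; lra.
rewrite -[X in _ - X]mulr1 -mulrBr normrM.
have -> : J / s - 1 = (J - s) / s by field.
have cr : `|c k i * (1 + rho i) ^+ n| <= `|c k i| * (1 + rho i) ^+ n.+1.
  rewrite normrM ler_wpM2l// ger0_norm ?exprn_ge0 ?(ltW (rho1 i))// exprS ler_peMl ?exprn_ge0 ?(ltW (rho1 i))//.
  by have := rho0 i; lra.
apply: ler_pM => //; rewrite normrM normfV (ger0_norm (_ : 0 <= s)); last by lra.
rewrite ler_pdivrMr; last by lra.
have -> : J - s = (J - 1) - (s - 1) by ring.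
apply: (le_trans (ler_normB _ _)); apply: (le_trans (lerD hJ hs)).
have : 0 <= (K * 5 + 1) * e by rewrite mulr_ge0// addr_ge0// mulr_ge0// ltW.
nra.
Qed.

End A.

(** A combination of the volume expansions of the shrunk parallel bodies. A difference of two [sh]
    functions carries the factor [1 / (1 + rho)], so the linear and quadratic terms come with the
    powers [n] and [n.-1] of [1 + rho]; [binom_sum] evaluates the quadratic coefficient. *)
Lemma U_expand a da dda b db ddb : nice e a da dda -> nice e b db ddb ->
  `|Ucoef k b db ddb - (Ucoef k a da dda + M (fun x => (b x - a x) * sigma a da dda x)
     + N / 2 * 'C(n.-1, k)%:R * M (fun x => n%:R * (b x - a x) ^+ 2 - gdist da db x))|
  <= csum * K' * (e * M (fun x => (b x - a x) ^+ 2 + gdist da db x)).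
Proof.
move=> aN bN; have [e0 e1 _ _ _] := e_small es1 aN.
have kn2 : (k < n.+2)%N by rewrite (ltn_trans kn)// ltnS leqnSn.
have n0 : (0 < n)%N by exact: leq_ltn_trans kn.
have af := admB (adm_nice bN) (adm_nice aN); have ag := adm_gdist aN bN.
have ar := adm_ratio aN.
have aQ : adm (fun x => n%:R * (b x - a x) ^+ 2 - gdist da db x).
  by apply: admB => //; apply: admZ; exact: admX.
have aD : adm (fun x => (b x - a x) ^+ 2 + gdist da db x) by apply: admD => //; exact: admX.
rewrite !(Ucoef_interp es1 cP kn2)//.
pose S i x := Jac (sh (rho i) a) (dsh (rho i) da) (ddsh (rho i) dda) x / sh (rho i) a x.
have e_sig : M (fun x => (b x - a x) * sigma a da dda x) =
    \sum_(i < n.+2) c k i * ((1 + rho i) ^+ n * (N * M (fun x => (b x - a x) * S i x))).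
  transitivity (M (fun x => \sum_(i < n.+2) c k i * ((1 + rho i) ^+ n * (N * ((b x - a x) * S i x))))).
    apply: eq_M => x; rewrite /sigma !mulr_sumr; apply: eq_bigr => i _; rewrite -/(S i x).
    by move: (S i x) => s; ring.
  rewrite M_sum => [|i]; last by do 3 apply: admZ; apply: admM => //; exact: ar.
  apply: eq_bigr => i _; rewrite !MZ//; try (do 2 apply: admZ); try apply: admZ; by apply: admM => //; exact: ar.
have nm : (n.-1 <= n.+1)%N by rewrite (leq_trans (leq_pred n)).
rewrite e_sig -(binom_sum nm) -mulrA mulr_suml mulr_sumr -!big_split/= -sumrB.
apply: (le_trans (ler_norm_sum _ _ _)); rewrite /csum -mulrA mulr_suml; apply: ler_sum => i _.
have aN' := nice_sh (rho0 i) aN; have bN' := nice_sh (rho0 i) bN.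
have := HK' es1 es2 aN' bN'.
have r0 := rho1 i; have rn : 1 + rho i != 0 by rewrite gt_eqF.
have dE x : sh (rho i) b x - sh (rho i) a x = (1 + rho i)^-1 * (b x - a x) by rewrite /sh; ring.
have gE x : gdist (dsh (rho i) da) (dsh (rho i) db) x = (1 + rho i) ^- 2 * gdist da db x.
  have sE : \sum_l (dsh (rho i) db l x - dsh (rho i) da l x) ^+ 2 =
      (1 + rho i) ^- 2 * \sum_l (db l x - da l x) ^+ 2.
    by rewrite mulr_sumr; apply: eq_bigr => l _; rewrite /dsh -mulrBr exprMn exprVn.
  by rewrite /gdist /gsq sE mulrCA.
have -> : M (fun x => (sh (rho i) b x - sh (rho i) a x) * (Jac (sh (rho i) a) (dsh (rho i) da) (ddsh (rho i) dda) x / sh (rho i) a x))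
   = (1 + rho i)^-1 * M (fun x => (b x - a x) * S i x).
  rewrite -MZ; last by apply: admM => //; exact: ar.
  by apply: eq_M => x; rewrite dE -mulrA.
have -> : M (fun x => (N - 1) * (sh (rho i) b x - sh (rho i) a x) ^+ 2 - gdist (dsh (rho i) da) (dsh (rho i) db) x)
   = (1 + rho i) ^- 2 * M (fun x => n%:R * (b x - a x) ^+ 2 - gdist da db x).
  rewrite -MZ//; apply: eq_M => x; rewrite dE gE exprMn exprVn -natr1 addrK; ring.
have -> : M (fun x => (sh (rho i) b x - sh (rho i) a x) ^+ 2 + gdist (dsh (rho i) da) (dsh (rho i) db) x)
   = (1 + rho i) ^- 2 * M (fun x => (b x - a x) ^+ 2 + gdist da db x).
  by rewrite -MZ//; apply: eq_M => x; rewrite dE gE exprMn exprVn mulrDr.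
have MD0 : 0 <= M (fun x => (b x - a x) ^+ 2 + gdist da db x).
  by apply: M_ge0 => // x _; rewrite addr_ge0 ?sqr_ge0// gsq_ge0.
have rE1 : (1 + rho i) ^+ n.+1 = (1 + rho i) ^+ n * (1 + rho i) by rewrite exprSr.
have rE2 : (1 + rho i) ^+ n.+1 = (1 + rho i) ^+ n.-1 * (1 + rho i) ^+ 2.
  by rewrite -exprD addnC add2n prednK.
have i1 : (1 + rho i) ^- 2 <= 1.
  by rewrite invf_le1 ?exprn_gt0// exprn_ege1//; have := rho0 i; lra.
move: rE1 rE2 i1 MD0; rewrite -/(rho i).
set vb := M (Jac (sh _ b) _ _); set va := M (Jac (sh _ a) _ _).
set X := M (fun x => _ * S i x); set Y := M (fun x => _ - _); set Z := M (fun x => _ + _).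
move=> rE1 rE2 i1 Z0 h.
have -> : c k i * ((1 + rho i) ^+ n.+1 * vb) - (c k i * ((1 + rho i) ^+ n.+1 * va) +
     c k i * ((1 + rho i) ^+ n * (N * X)) + N / 2 * (c k i * (1 + rho i) ^+ n.-1 * Y)) =
   c k i * (1 + rho i) ^+ n.+1 * (vb - (va + N * ((1 + rho i)^-1 * X) + N / 2 * ((1 + rho i) ^- 2 * Y))).
  have h1 : (1 + rho i) ^+ n = (1 + rho i) ^+ n.+1 / (1 + rho i) by rewrite rE1 mulfK.
  have h2 : (1 + rho i) ^+ n.-1 = (1 + rho i) ^+ n.+1 / (1 + rho i) ^+ 2 by rewrite rE2 mulfK// expf_neq0.
  by rewrite h1 h2; move: ((1 + rho i) ^+ n.+1) => W; field.
rewrite 2!normrM (ger0_norm (exprn_ge0 _ (ltW r0))).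
apply: ler_wpM2l; first by rewrite mulr_ge0// exprn_ge0// ltW.
apply: (le_trans h); apply: ler_wpM2l => //; apply: ler_wpM2l => //; exact: ler_piMl.
Qed.

(* Euler's identity for the [n.+1 - k]-homogeneous functional [Ucoef k], read off the expansion at [(1 + s) a]. *)
Lemma Ucoef_euler a da dda : nice (e / 2) a da dda -> 0 < e ->
  M (fun x => a x * sigma a da dda x) = (n.+1 - k)%:R * Ucoef k a da dda.
Proof.
move=> aN' ep; have aN := nice_le (ltac:(lra) : e / 2 <= e) aN'.
have [e0 e1 _ _ _] := e_small es1 aN.
have kn1 : (k <= n.+1)%N by rewrite ltnW// (ltn_trans kn).
have e21 : e / 2 <= 1 by lra.
have small r : 0 < r -> r <= e / 4 -> [/\ e / 2 + 2 * r <= e, r <= 1, 0 < 1 + r & `|r| <= 1].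
  by move=> r0 re; split; rewrite ?ger0_norm; lra.
set U := Ucoef k a da dda; set m := M (fun x => _ * _); set j := (n.+1 - k)%N.
pose Q := M (fun x => n%:R * a x ^+ 2 - gsq da x); pose D := M (fun x => a x ^+ 2 + gsq da x).
have [C3 C30 hC] := @bernoulli2 R j.
pose Z := `|N / 2 * 'C(n.-1, k)%:R * Q| + csum * K' * (e * D) + `|U| * (`|j%:R * (j%:R - 1) / 2| + C3).
have aa := adm_nice aN; have ag : adm (gsq da).
  have c0 : nice e (fun _ : V => 1 : R) (fun (_ : I) (_ : V) => 0 : R) (fun (_ _ : I) (_ : V) => 0 : R).
    split; last by move=> x _; rewrite subrr normr0.
    split=> // [|i]; exact: C1on_cst.
  by have := adm_gdist c0 aN; congr adm; apply/funext => x; rewrite /gdist /gsq; congr (_ * _); apply: eq_bigr => i _; rewrite subr0.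
have a2 := admX 2 aa.
have D0 : 0 <= D by apply: M_ge0 => [|x _]; [exact: admD|rewrite addr_ge0 ?sqr_ge0// gsq_ge0].
have Z0 : 0 <= Z.
  by rewrite !addr_ge0 ?mulr_ge0 ?csum_ge0// addr_ge0.
have key s : 0 < s -> s < 1 -> `|m - j%:R * U| <= 0 + (Z * (e / 4)) * s.
  move=> s0 s1; pose r := s * (e / 4).
  have r0 : 0 < r by rewrite mulr_gt0// divr_gt0.
  have re : r <= e / 4 by rewrite ler_piMl ?(ltW s1)// divr_ge0// ltW.
  have [r1 r11 rp rn] := small r r0 re.
  have bN := nice_le r1 (nice_scale (ltW r0) r11 e21 aN').
  have := U_expand aN bN; rewrite (Ucoef_hom es1 rp aN kn1) -/U -/j.
  have -> : M (fun x => ((1 + r) * a x - a x) * sigma a da dda x) = r * m.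
    rewrite -MZ; last by apply: admM => //; exact: (adm_sigma aN).
    by apply: eq_M => x; ring.
  have gE x : gdist da (fun i x => (1 + r) * da i x) x = r ^+ 2 * gsq da x.
    have sE : \sum_l ((1 + r) * da l x - da l x) ^+ 2 = r ^+ 2 * \sum_l da l x ^+ 2.
      by rewrite mulr_sumr; apply: eq_bigr => l _; ring.
    by rewrite /gdist /gsq sE mulrCA.
  have -> : M (fun x => n%:R * ((1 + r) * a x - a x) ^+ 2 - gdist da (fun i x => (1 + r) * da i x) x) = r ^+ 2 * Q.
    rewrite -MZ; last by apply: admB => //; exact: admZ.
    by apply: eq_M => x; rewrite gE; ring.
  have -> : M (fun x => ((1 + r) * a x - a x) ^+ 2 + gdist da (fun i x => (1 + r) * da i x) x) = r ^+ 2 * D.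
    rewrite -MZ; last by exact: admD.
    by apply: eq_M => x; rewrite gE; ring.
  have := hC r rn; rewrite (ger0_norm (ltW r0)).
  set P := (1 + r) ^+ j; set jj := j%:R * (j%:R - 1) / 2; set B := N / 2 * _ => h1 h2.
  have r2 : 0 <= r ^+ 2 := sqr_ge0 r.
  have r3 : r ^+ 3 <= r ^+ 2 by rewrite exprS ler_piMl.
  have h3 : `|P - 1 - j%:R * r| <= (`|jj| + C3) * r ^+ 2.
    have -> : P - 1 - j%:R * r = (P - (1 + j%:R * r + jj * r ^+ 2)) + jj * r ^+ 2 by ring.
    apply: (le_trans (ler_normD _ _)); rewrite normrM (ger0_norm r2).
    by have := ler_wpM2l C30 r3; lra.
  have h4 : r * `|m - j%:R * U| <= Z * r ^+ 2.
    rewrite -{1}(gtr0_norm r0) -normrM.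
    have -> : r * (m - j%:R * U) = (P - 1 - j%:R * r) * U - B * Q * r ^+ 2 - (P * U - (U + r * m + B * (r ^+ 2 * Q))) by ring.
    apply: (le_trans (ler_normB _ _)).
    apply: (@le_trans _ _ ((`|jj| + C3) * r ^+ 2 * `|U| + `|B * Q| * r ^+ 2 + csum * K' * (e * (r ^+ 2 * D)))).
      apply: lerD; last by [].
      apply: (le_trans (ler_normB _ _)).
      by rewrite (normrM (B * Q)) (ger0_norm r2) lerD2r normrM ler_wpM2r.
    by rewrite /Z -/jj -/B le_eqVlt; apply/orP; left; apply/eqP; ring.
  rewrite add0r -(ler_pM2l r0); apply: (le_trans h4); rewrite le_eqVlt; apply/orP; left; apply/eqP.
  by rewrite /r; ring.
have Z4 : 0 <= Z * (e / 4) by rewrite mulr_ge0// divr_ge0.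
have := le_small_eps Z4 key; rewrite normr_le0 subr_eq0 => /eqP; exact.
Qed.

End WithConstants.
End CoefExpansion.

(** The later requirements on the size parameter are linear bounds [c * E <= r] with [r > 0], and
    are met all at once in this way. *)
Lemma exists_small (R : realType) (s : seq (R * R)) : all (fun cr => 0 < cr.2) s ->
  exists2 E : R, 0 < E & all (fun cr => cr.1 * E <= cr.2) s.
Proof.
elim: s => [|[c r] s IH] /=; first by exists 1.
move=> /andP[r0 hs]; have [E E0 hE] := IH hs; pose c' := `|c| + 1; have c0 : 0 < c' by rewrite ltr_wpDl.
exists (Num.min E (r / c')); first by rewrite lt_min E0 divr_gt0.
have m0 : 0 < Num.min E (r / c') by rewrite lt_min E0 divr_gt0.
apply/andP; split.
  apply: (@le_trans _ _ (c' * Num.min E (r / c'))).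
    by rewrite ler_pM2r// (le_trans (ler_norm c))// /c' lerDl.
  by rewrite mulrC -ler_pdivlMr// ge_min lexx orbT.
apply/allP => -[c1 r1] cs; have /allP/(_ _ cs)/= h := hE.
case: (lerP 0 c1) => c10; first by rewrite (le_trans _ h)// ler_wpM2l// ge_min lexx.
have r10 : 0 < r1 by have /allP/(_ _ cs) := hs.
by rewrite (le_trans _ (ltW r10))// mulr_le0_ge0// ltW.
Qed.

(* The numerical heart: [b] is half the second-order coefficient, and [b (n + 2)] must beat the curvature term [L]. *)
Lemma mink_arith (R : realType) (n : nat) (A G Y b eps del L kap : R) : 0 <= A -> 0 <= G -> 0 <= eps -> eps <= b ->
  0 <= del -> del <= 1 -> 2 * n.+1%:R * (1 - del) * A <= G ->
  Y <= b * (n%:R * A - G) + eps * (A + G) ->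
  eps * (1 + 2 * n.+1%:R) + 2 * n.+1%:R * b * del + L + kap <= b * (n%:R + 2) ->
  Y + kap * A <= - L * A.
Proof.
rewrite -[n.+1%:R]natr1; move: n%:R (ler0n R n) => m m0 A0 G0 e0 eb d0 d1 hG hY hL.
have h1 : (b - eps) * (2 * (m + 1) * (1 - del) * A) <= (b - eps) * G by rewrite ler_wpM2l// subr_ge0.
have h2 : 0 <= eps * del * (2 * (m + 1)) * A by rewrite !mulr_ge0// addr_ge0.
have h3 := ler_wpM2r A0 hL.
nra.
Qed.

Lemma mink_ratio (R : realFieldType) (s f Q E KE eta : R) : `|s - Q| <= KE -> `|f - 1| <= E ->
  KE <= eta / 4 -> 2 * E <= eta / 4 -> 1 <= Q -> 0 < eta -> eta <= 1 -> 0 < f -> s / f <= Q * (1 + eta).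
Proof.
rewrite !ler_norml => /andP[_ sx] /andP[fx _] k5 k6 kQ k0 k1 fp; rewrite ler_pdivrMr//.
have h1 : s <= Q * (1 + eta / 4).
  have : eta / 4 <= Q * (eta / 4) by rewrite ler_peMl// divr_ge0// ltW.
  lra.
have h3 : 1 + eta / 4 <= (1 + eta) * f.
  have h4 : (1 + eta) * (1 - eta / 8) <= (1 + eta) * f by rewrite ler_wpM2l//; lra.
  by apply: le_trans h4; nra.
by apply: (le_trans h1); rewrite -mulrA ler_wpM2l//; lra.
Qed.

Lemma mink_pointwise (R : realFieldType) (ph f s P Q eta F : R) : 0 < f -> 0 <= s -> 0 <= P -> 0 < eta ->
  s / f <= Q * (1 + eta) -> ph / f - P / 2 * (1 + eta) * (ph / f) ^+ 2 <= F ->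
  ph * s - P / 2 * (1 + eta) * (Q * (1 + eta)) * ph ^+ 2 <= F * (f * s).
Proof.
move=> fp s0 P0 e0 sf hF; have fne : f != 0 by rewrite gt_eqF.
apply: (le_trans _ (ler_wpM2r (mulr_ge0 (ltW fp) s0) hF)).
have P2 : 0 <= P / 2 * (1 + eta) * ph ^+ 2.
  by rewrite mulr_ge0 ?sqr_ge0// mulr_ge0 ?divr_ge0// addr_ge0// ltW.
have := ler_wpM2l P2 sf.
have -> : (ph / f - P / 2 * (1 + eta) * (ph / f) ^+ 2) * (f * s) =
   ph * s - P / 2 * (1 + eta) * ph ^+ 2 * (s / f) by field.
lra.
Qed.

Lemma mink_comb (R : realDomainType) (u v w y kA LA : R) :
  u + w <= y -> y + kA <= LA -> LA <= v + w -> u + kA <= v.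
Proof. by move=> *; lra. Qed.

(** Undoes the normalisation by [t]. The tangent bound [Phi_le1] for the exponent [p / j] bounds
    [Phi] of the rescaled volume ratio by [Ug - U], and [Phi_scale] splits the same term
    [Phi p t * MF] off both sides, where it cancels. *)
Lemma mink_unscale (R : realType) (j : nat) (p t U UH Ug MF Q Qg A kap LA : R) : (0 < j)%N -> p < 1 ->
  0 < t -> 0 < U -> 0 < UH -> Ug = t ^+ j * UH -> MF = j%:R * U -> 0 < kap -> 0 <= A ->
  Ug - U + kap * A <= LA -> LA <= Qg -> Qg = t `^ p * Q + Phi p t * MF ->
  Phi p ((UH / U) `^ (j%:R^-1)) * MF <= Q /\
  (Phi p ((UH / U) `^ (j%:R^-1)) * MF = Q -> A <= 0).
Proof.
move=> j0 p1 t0 Up Uh -> MFE kap0 A0 Y2 R1 QgE.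
have jn : j%:R != 0 :> R by rewrite pnatr_eq0 -lt0n.
have X0 : 0 < UH / U by rewrite divr_gt0.
have Xg : (t ^+ j * UH / U) `^ (j%:R^-1) = t * (UH / U) `^ (j%:R^-1).
  rewrite -mulrA powRM ?exprn_ge0 ?(ltW t0) ?(ltW X0)//; congr (_ * _).
  by rewrite -powR_mulrn ?(ltW t0)// -powRrM mulfV ?powRr1 ?(ltW t0).
have Le : Phi p ((t ^+ j * UH / U) `^ (j%:R^-1)) * MF <= t ^+ j * UH - U.
  have Xg0 : 0 < t ^+ j * UH / U by rewrite divr_gt0// mulr_gt0// exprn_gt0.
  rewrite (Phi_root p j0 Xg0) MFE.
  have -> : Phi (p / j%:R) (t ^+ j * UH / U) / j%:R * (j%:R * U) = Phi (p / j%:R) (t ^+ j * UH / U) * U.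
    by field.
  have pj : p / j%:R <= 1 by rewrite ler_pdivrMr ?ltr0n// mul1r (le_trans (ltW p1))// ler1n.
  by have := ler_wpM2r (ltW Up) (Phi_le1 pj Xg0); rewrite mulrBl mul1r divfK// gt_eqF.
have x0p : 0 < (UH / U) `^ (j%:R^-1) by rewrite powR_gt0.
have tp : 0 < t `^ p by rewrite powR_gt0.
rewrite Xg Phi_scale// mulrDl -mulrA in Le; rewrite QgE in R1.
have main := mink_comb Le Y2 R1.
have kA : 0 <= kap * A by rewrite mulr_ge0// ltW.
split; first by rewrite -(ler_pM2l tp); apply: le_trans main; rewrite lerDl.
by move=> eq; move: main; rewrite eq gerDl pmulr_rle0.
Qed.

(** * The L_p Minkowski inequality for intrinsic volumes *)

Section Minkowski.
Variables (R : realType) (n : nat).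
Notation V := 'rV[R]_n.+1.
Notation I := 'I_n.+1.
Notation N := (n.+1%:R : R).
Notation M1 := (M (fun _ : V => 1 : R)).
Implicit Types (x y : V) (e t s : R) (a b f h : V -> R) (da db df dh : I -> V -> R) (dda ddb ddf ddh : I -> I -> V -> R).

Lemma M_CS_bound (F G : V -> R) d : adm F -> adm G -> 0 < d -> (forall x, x != 0 -> `|G x| <= d) ->
  M (fun x => F x * G x) ^+ 2 <= d ^+ 2 * M1 * M (fun x => F x ^+ 2).
Proof.
move=> aF aG d0 Gd; have M10 := @M1_gt0 R n; set m := M (fun x => _ * _).
have G2 : M (fun x => G x ^+ 2) <= d ^+ 2 * M1.
  rewrite -M_cst; apply: le_M; [exact: admX|exact: adm_cst|move=> x x0].
  by rewrite -[leLHS]real_normK ?num_real// ler_sqr ?nnegrE ?Gd// ltW.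
have D0 : 0 < d ^+ 2 * M1 by rewrite mulr_gt0// exprn_gt0.
pose r := m / (d ^+ 2 * M1).
have : 0 <= M (fun x => (F x - r * G x) ^+ 2).
  apply: M_ge0 => [|x _]; [by apply: admX; apply: admB => //; exact: admZ|exact: sqr_ge0].
have aF2 := admX 2 aF; have aG2 := admX 2 aG; have aFG := admM aF aG.
have -> : M (fun x => (F x - r * G x) ^+ 2) = M (fun x => F x ^+ 2) - 2 * r * m + r ^+ 2 * M (fun x => G x ^+ 2).
  rewrite -!MZ// -MB//; last exact: admZ.
  rewrite -MD//; [|by apply: admB => //; exact: admZ|exact: admZ].
  by apply: eq_M => x; ring.
set A := M (fun x => F x ^+ 2); set B := M (fun x => G x ^+ 2) in G2 * => h.
have rE : r * (d ^+ 2 * M1) = m by rewrite /r divfK// gt_eqF.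
have : r ^+ 2 * B <= r ^+ 2 * (d ^+ 2 * M1) by rewrite ler_wpM2l ?sqr_ge0.
rewrite expr2 -[X in _ <= X]mulrA rE => h2.
have h3 : r * m <= A by rewrite expr2 in h; lra.
have -> : m ^+ 2 = (d ^+ 2 * M1) * (r * m) by rewrite [RHS]mulrA [d ^+ 2 * M1 * r]mulrC rE expr2.
by rewrite ler_pM2l.
Qed.

Lemma cls_of_nice e f df ddf h dh ddh : nice e f df ddf -> nice e h dh ddh ->
  cls (2 * N * e) (fun x => h x - f x) (fun i x => dh i x - df i x).
Proof.
move=> fN hN; have e0 := nice_ge0 fN; have [[f1 f2 _] _] := fN; have [[h1 h2 _] _] := hN.
have N1 : 1 <= N by rewrite ler1n.
have eN : 2 * e <= 2 * N * e by rewrite -[X in X <= _]mul1r -mulrA [N * e]mulrC !mulrA; nra.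
split=> [t x t0||x x0|x x0]; [by rewrite f1// h1|exact: C1onB| |].
  have hf := nice_val fN x0; have hh := nice_val hN x0.
  have -> : h x - f x = (h x - 1) - (f x - 1) by ring.
  by apply: (le_trans (ler_normB _ _)); lra.
rewrite /gsq mulr_sumr.
apply: (@le_trans _ _ (\sum_(i < n.+1) (2 * e) ^+ 2)).
  apply: ler_sum => i _; rewrite -enorm_sqr -exprMn -[leLHS]real_normK ?num_real//.
  rewrite ler_sqr ?nnegrE ?mulr_ge0// normrM (ger0_norm (enorm_ge0 x)) mulrC.
  have := nice_da fN i x0; have := nice_da hN i x0; have := enorm_ge0 x.
  have := ler_normB (dh i x) (df i x); move=> u1 u2 u3 u4.
  by apply: (le_trans (ler_wpM2r u2 u1)); rewrite mulrDl; lra.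
rewrite sumr_const card_ord -[leLHS]mulr_natl.
have -> : (2 * N * e) ^+ 2 = N * (N * (2 * e) ^+ 2) by ring.
by rewrite ler_wpM2l// ler_peMl// sqr_ge0.
Qed.

Lemma M_sq_zero C f df : cls C f df -> M (fun x => f x ^+ 2) <= 0 -> forall x, x != 0 -> f x = 0.
Proof.
move=> fc f0 x x0; apply/eqP; rewrite -normr_le0; apply/ler_addgt0Pr => h h0; rewrite add0r.
have [mu mu0 hm] := value_mass fc h0; exact: (hm _ _ fc (le_lt_trans f0 mu0)).
Qed.

Lemma nice_mul e t h dh ddh : 0 <= e -> e <= 1 / 8 -> `|t - 1| <= 4 * e -> nice e h dh ddh ->
  nice (6 * e) (fun x => t * h x) (fun i x => t * dh i x) (fun i k x => t * ddh i k x).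
Proof.
move=> e0 e1 te [[h1 h2 h3] hh]; split.
  by split=> [s x s0||i]; [rewrite h1|exact: C1onZ|exact: C1onZ].
have [t0 t1] : 0 <= t /\ t <= 3 / 2 by move: te; rewrite ler_norml => /andP[? ?]; split; lra.
have nb (u : R) : `|u| <= e -> `|t * u| <= 3 / 2 * e.
  by move=> ue; rewrite normrM (ger0_norm t0) ler_pM.
move=> x x1; have [g1 g2 g3] := hh x x1; split=> [|i|i k].
- have -> : t * h x - 1 = t * (h x - 1) + (t - 1) by ring.
  by apply: (le_trans (ler_normD _ _)); have := nb _ g1; lra.
- by apply: (le_trans (nb _ (g2 i))); lra.
- by apply: (le_trans (nb _ (g3 i k))); lra.
Qed.

Lemma ratio_bounds e f df ddf h dh ddh x : nice e f df ddf -> nice e h dh ddh -> e <= 1 / 2 -> x != 0 ->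
  0 < f x /\ 3^-1 <= h x / f x <= 3.
Proof.
move=> fN hN e2 x0; have /andP[f1 f2] := nice_half fN e2 x0; have /andP[h1 h2] := nice_half hN e2 x0.
have f0 : 0 < f x by lra.
by split=> //; rewrite ler_pdivlMr// ler_pdivrMr//; apply/andP; split; lra.
Qed.

Lemma adm_Phi_ratio p e f df ddf h dh ddh : nice e f df ddf -> nice e h dh ddh -> e <= 1 / 2 ->
  adm (fun x => Phi p (h x / f x)).
Proof.
move=> fN hN e2; have [[_ f2 _] _] := fN; have [[_ h2 _] _] := hN.
apply: (adm_cont (C := `|Phi p 3^-1| + `|Phi p 3|)) => x x0;
  have [f0 /andP[r1 r2]] := ratio_bounds fN hN e2 x0; have r0 : 0 < h x / f x by apply: lt_le_trans r1; rewrite invr_gt0.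
  have cr : {for x, continuous (fun y => h y / f y)}.
    exact: (cvgM (C1on_forcont h2 x0) (cvgV (lt0r_neq0 f0) (C1on_forcont f2 x0))).
  have cP : {for h x / f x, continuous (Phi p)}.
    by apply: differentiable_continuous; apply/derivable1_diffP; case: (Phi_derive p r0).
  exact: (cvg_comp _ _ cr cP).
have p1 := Phi_le p (ltac:(by rewrite invr_gt0) : 0 < 3^-1 :> R) r1; have p2 := Phi_le p r0 r2.
rewrite ler_norml; apply/andP; split.
  apply: le_trans p1; have := ler_norm (- Phi p 3^-1); rewrite normrN; have := normr_ge0 (Phi p 3); lra.
by apply: (le_trans p2); have := ler_norm (Phi p 3); have := normr_ge0 (Phi p 3^-1); lra.
Qed.

Lemma twelfth (E : R) : 0 < E -> 4 * E <= 1 / 100 ->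
  [/\ 0 < E / 12, E / 12 <= 1 / 8, E / 12 <= E / 2 & E / 12 <= E] /\
  [/\ E / 12 <= 1 / 2, 6 * (E / 12) <= E & E <= 1 / 2].
Proof. by move=> E0 E4; split; split; lra. Qed.

Section Core.
Variables (j k : nat) (p K K' : R) (c : nat -> nat -> R).
Hypotheses (j0 : (0 < j)%N) (kn : (k < n)%N) (jE : (n.+1 - k)%N = j) (p1 : p < 1).
Hypotheses (K0 : 0 < K) (HK : forall (M : 'M[R]_n.+1) d, 0 <= d -> d <= 1 ->
    (forall i j, `|M i j - (i == j)%:R| <= d) -> `|\det M - 1| <= K * d).
Hypotheses (K'0 : 0 <= K') (HK' : forall e, 4 * n.+1%:R ^+ 2 * e <= 1 / 100 -> K * (5 * e) <= 1 / 2 ->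
  forall a da dda b db ddb, nice e a da dda -> nice e b db ddb ->
  `|M (Jac b db ddb) - (M (Jac a da dda) + n.+1%:R * M (fun x => (b x - a x) * (Jac a da dda x / a x))
     + n.+1%:R / 2 * M (fun x => (n.+1%:R - 1) * (b x - a x) ^+ 2 - gdist da db x))|
  <= K' * (e * M (fun x => (b x - a x) ^+ 2 + gdist da db x))).
Hypothesis cP : forall p : {poly R}, (size p <= n.+2)%N ->
    forall k, (k < n.+2)%N -> p`_k = \sum_(i < n.+2) c k i * p.[i.+1%:R].
Variables (C1 Ks KU b L kap eta d E e : R).
Hypotheses (C1E : C1 = 'C(n, k)%:R) (KsE : Ks = N * (csum n c k * (2 * (K * 5 + 1)))) (KUE : KU = csum n c k * K')
  (bE : b = N / 2 * 'C(n.-1, k)%:R) (LE : L = (1 - p) / 2 * (1 + eta) * (N * C1 * (1 + eta))).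
Hypotheses (kap0 : 0 < kap) (eta0 : 0 < eta) (eta1 : eta <= 1)
  (Phid : forall t, `|t| <= d -> t - (1 - p) / 2 * (1 + eta) * t ^+ 2 <= Phi p (1 + t))
  (bL : L + 2 * kap <= b * (n%:R + 2)).
Hypotheses (Ks0 : 0 <= Ks) (KU0 : 0 <= KU) (NC1 : 1 <= N * C1).
Hypotheses (E0 : 0 < E) (es1 : 4 * n.+1%:R ^+ 2 * E <= 1 / 100) (es2 : K * (5 * E) <= 1 / 2)
  (c3 : Ks * E <= 1 / 2) (c4 : (Ks + 1) * E <= 1) (c5 : Ks * E <= eta / 4) (c6 : 2 * E <= eta / 4)
  (c7 : 4 * E <= d) (c8 : KU * E <= b) (c9 : (KU * (1 + 2 * N) + 2 * N * b * (Ks + 1)) * E <= kap).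
Hypotheses (e0 : 0 < e) (e8 : e <= 1 / 8) (eE2 : e <= E / 2) (eE : e <= E)
  (e12 : e <= 1 / 2) (eE6 : 6 * e <= E) (E12 : E <= 1 / 2).

Let M10 := @M1_gt0 R n.
Let sg f df ddf := sigma c k f df ddf.

Let sgb f df ddf x : nice e f df ddf -> x != 0 -> `|sg f df ddf x - N * C1| <= Ks * E.
Proof. by move=> fN; rewrite C1E KsE; exact: (sigma_near K0 HK cP kn es1 (nice_le eE fN)). Qed.
Let sg2 f df ddf x : nice e f df ddf -> x != 0 -> 2^-1 <= sg f df ddf x.
Proof.
move=> fN x0; have := sgb fN x0; have h1 := c3; have h2 := NC1.
by rewrite ler_norml => /andP[? ?]; lra.
Qed.
Let sg0 f df ddf x : nice e f df ddf -> x != 0 -> 0 <= sg f df ddf x.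
Proof. by move=> fN x0; apply: le_trans (sg2 fN x0); rewrite invr_ge0. Qed.
Let asg f df ddf : nice e f df ddf -> adm (sg f df ddf).
Proof. by move=> fN; exact: (adm_sigma c k es1 (nice_le eE fN)). Qed.
Let hf12 f df ddf x : nice e f df ddf -> x != 0 -> 2^-1 <= f x.
Proof. by move=> fN /(nice_half fN e12)/andP[+ _]; rewrite div1r. Qed.
Let MHpos f df ddf h dh ddh : nice e f df ddf -> nice e h dh ddh -> 0 < M (fun x => h x * sg f df ddf x).
Proof.
move=> fN hN; apply: (@lt_le_trans _ _ (4^-1 * M1)); first by rewrite mulr_gt0.
rewrite -M_cst; apply: le_M; [exact: adm_cst|apply: admM; [exact: adm_nice hN|exact: asg]|move=> x x0].
have -> : 4^-1 = 2^-1 * 2^-1 :> R by field.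
by apply: ler_pM; rewrite ?invr_ge0//; [exact: hf12 hN x0|exact: sg2].
Qed.
Let eul f df ddf : nice e f df ddf -> M (fun x => f x * sg f df ddf x) = j%:R * Ucoef k f df ddf.
Proof. by move=> fN; rewrite -jE; exact: (Ucoef_euler K'0 HK' cP kn es1 es2 (nice_le eE2 fN) E0). Qed.
Let Upos f df ddf : nice e f df ddf -> 0 < Ucoef k f df ddf.
Proof. by move=> fN; have := MHpos fN fN; rewrite (eul fN) pmulr_rgt0// ltr0n. Qed.

Let hL : KU * E * (1 + 2 * N) + 2 * N * b * ((Ks + 1) * E) + L + kap <= b * (n%:R + 2).
Proof. have h1 := c9; have h2 := bL; lra. Qed.

(** The analytic half of [lp_minkowski], with every constant a parameter subject to the inequalities
    it must satisfy. *)
Lemma minkowski_core f df ddf : nice e f df ddf -> (forall x, f (- x) = f x) ->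
    0 < Ucoef k f df ddf /\
    exists sig : V -> R, [/\ adm sig, forall x, x != 0 -> 0 < sig x, 0 < M (fun x => f x * sig x) &
    forall h dh ddh, nice e h dh ddh -> (forall x, h (- x) = h x) ->
      [/\ 0 < Ucoef k h dh ddh,
       Phi p ((Ucoef k h dh ddh / Ucoef k f df ddf) `^ (j%:R^-1)) * M (fun x => f x * sig x) <=
         M (fun x => Phi p (h x / f x) * (f x * sig x)) &
       Phi p ((Ucoef k h dh ddh / Ucoef k f df ddf) `^ (j%:R^-1)) * M (fun x => f x * sig x) =
         M (fun x => Phi p (h x / f x) * (f x * sig x)) ->
       exists2 t, 0 < t & forall x, x != 0 -> h x = t * f x]].
Proof.
move=> fN fe.
split; first exact: Upos.
exists (sg f df ddf); set s := sg f df ddf.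
have as_ : adm s by exact: asg.
have af := adm_nice fN; have MF0 : 0 < M (fun x => f x * s x) by exact: (MHpos fN fN).
split=> // [x x0|h dh ddh hN he]; first by apply: lt_le_trans (sg2 fN x0); rewrite invr_gt0.

pose MF := M (fun x => f x * s x); pose MH := M (fun x => h x * s x).
have MFp : 0 < MF by [].
have MHp : 0 < MH by exact: (MHpos fN hN).
have ah := adm_nice hN.
have Ms2 : 2^-1 * M s <= MH.
  rewrite -MZ//; apply: le_M; [exact: admZ|exact: admM|move=> x x0].
  have s0 : 0 <= s x by exact: sg0 fN x0.
  by rewrite ler_wpM2r//; exact: hf12 hN x0.
have MFH : `|MF - MH| <= 2 * e * M s.
  rewrite -MB; [|exact: admM|exact: admM]; rewrite -MZ//.
  apply: le_M_norm; [by apply: admB; exact: admM|exact: admZ|move=> x x0].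
  have s0 : 0 <= s x by exact: sg0 fN x0.
  have -> : f x * s x - h x * s x = ((f x - 1) - (h x - 1)) * s x by ring.
  rewrite normrM (ger0_norm s0) ler_wpM2r// (le_trans (ler_normB _ _))//.
  by have := nice_val fN x0; have := nice_val hN x0; lra.
pose t := MF / MH; have t0 : 0 < t by rewrite divr_gt0.
have t1 : `|t - 1| <= 4 * e.
  have -> : t - 1 = (MF - MH) / MH by rewrite mulrBl divff// gt_eqF.
  rewrite normrM normfV (gtr0_norm MHp) ler_pdivrMr//; apply: (le_trans MFH).
  by have := ler_wpM2l (ltW e0) Ms2; lra.
pose g x := t * h x; pose dg (i : I) x := t * dh i x; pose ddg (i l : I) x := t * ddh i l x.
have gN6 : nice (6 * e) g dg ddg by exact: nice_mul (ltW e0) e8 t1 hN.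
have gN := nice_le eE6 gN6; have fN' := nice_le eE fN.
have ag := adm_nice gN.
pose phi x := g x - f x; have aphi : adm phi by exact: admB.
have aphi2 := admX 2 aphi.
have phis : M (fun x => phi x * s x) = 0.
  have -> : M (fun x => phi x * s x) = M (fun x => t * (h x * s x) - f x * s x).
    by apply: eq_M => x; rewrite /phi /g; ring.
  rewrite MB; [|by apply: admZ; exact: admM|exact: admM]; rewrite MZ; last exact: admM.
  by rewrite -/MH -/MF /t divfK ?subrr// gt_eqF.
pose A := M (fun x => phi x ^+ 2); pose G := M (gdist df dg).
have agd : adm (gdist df dg) by exact: adm_gdist fN' gN.
have A0 : 0 <= A by apply: M_ge0 => // x _; exact: sqr_ge0.
have G0 : 0 <= G by apply: M_ge0 => // x _; exact: gsq_ge0.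
have pc : cls (2 * N * E) phi (fun i x => dg i x - df i x) by exact: cls_of_nice fN' gN.
have pe x : phi (- x) = phi x by rewrite /phi /g he fe.
pose del := (Ks + 1) * E.
have del0 : 0 < del by rewrite mulr_gt0// ltr_wpDl.
(* [phi] has mean 0 against [s], whereas the spectral gap speaks of the uniform density. Since [s]
   is within [Ks * E] of the constant [N * C1], Cauchy-Schwarz makes the plain mean of [phi] small,
   and the gap loses only the factor [1 - del]. *)
have gapG : 2 * N * (1 - del) * A <= G.
  have := spectral_gap pc pe; rewrite -/A -/G; set m := M phi => hg.
  have mE : N * C1 * m = M (fun x => phi x * (N * C1 - s x)).
    have -> : M (fun x => phi x * (N * C1 - s x)) = M (fun x => N * C1 * phi x - phi x * s x).
      by apply: eq_M => x; ring.
    by rewrite MB; [rewrite phis subr0 MZ|exact: admZ|exact: admM].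
  have CS := @M_CS_bound phi (fun x => N * C1 - s x) del aphi (admB (@adm_cst R n (N * C1)) as_) del0.
  have {}CS : (N * C1 * m) ^+ 2 <= del ^+ 2 * M1 * A.
    rewrite mE; apply: CS => x x0; rewrite -normrN opprB; apply: (le_trans (sgb fN x0)).
    by rewrite /del mulrDl mul1r lerDl ltW.
  have m2 : m ^+ 2 <= (N * C1 * m) ^+ 2.
    by rewrite exprMn ler_peMl ?sqr_ge0// exprn_ege1.
  have m3 : m ^+ 2 / M1 <= del ^+ 2 * A.
    by rewrite ler_pdivrMr// (le_trans m2)// (le_trans CS)// mulrAC.
  have m4 : del ^+ 2 * A <= del * A by rewrite ler_wpM2r// expr2 ler_piMl// ltW.
  apply: le_trans hg; rewrite -!mulrA ler_wpM2l// ler_wpM2l//; lra.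
have Y1 : Ucoef k g dg ddg - Ucoef k f df ddf <= b * (n%:R * A - G) + KU * E * (A + G).
  have gen (Ug Uf X Y Z B KK y z : R) : `|Ug - (Uf + X + B * Y)| <= KK * (E * Z) ->
      X = 0 -> B = b -> Y = y -> KK = KU -> Z = z -> Ug - Uf <= b * y + KU * E * z.
    move=> hU eX eB eY eK eZ; move: hU; rewrite eX eB eY eK eZ ler_norml addr0 [KU * (E * z)]mulrA => /andP[_ hU]; lra.
  have EY : M (fun x => n%:R * (g x - f x) ^+ 2 - gdist df dg x) = n%:R * A - G.
    by rewrite MB// ?MZ//; exact: admZ.
  have EZ : M (fun x => (g x - f x) ^+ 2 + gdist df dg x) = A + G by rewrite MD.
  exact: (gen _ _ _ _ _ _ _ _ _ (U_expand K'0 HK' cP kn es1 es2 fN' gN) phis (esym bE) EY (esym KUE) EZ).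
have Y2 : Ucoef k g dg ddg - Ucoef k f df ddf + kap * A <= - L * A.
  have KE0 : 0 <= KU * E by rewrite mulr_ge0// ltW.
  exact: (mink_arith A0 G0 KE0 c8 (ltW del0) c4 gapG Y1 hL).
(* The linear part integrates to 0 against [s], so only the quadratic loss in the lower bound for
   [Phi] remains; [L] combines it with the upper bound [N * C1 * (1 + eta)] for [s / f]. *)
have R1 : - L * A <= M (fun x => Phi p (g x / f x) * (f x * s x)).
  have -> : - L * A = M (fun x => phi x * s x - L * phi x ^+ 2).
    rewrite MB ?MZ// ?phis; [by rewrite sub0r mulNr|exact: admM|exact: admZ].
  apply: le_M; first by apply: admB; [exact: admM|exact: admZ].
    by apply: admM; [exact: (adm_Phi_ratio p fN' gN E12)|exact: admM].
  move=> x x0; have f12 := hf12 fN x0; have fp : 0 < f x by apply: lt_le_trans f12; rewrite invr_gt0.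
  have fne : f x != 0 by rewrite gt_eqF.
  have gx : g x / f x = 1 + phi x / f x by rewrite /phi; field.
  have phE : `|phi x| <= 2 * E.
    have -> : phi x = (g x - 1) - (f x - 1) by rewrite /phi; ring.
    have -> : 2 * E = E + E by ring.
    by apply: (le_trans (ler_normB _ _)); apply: lerD; [exact: (nice_val gN x0)|exact: (nice_val fN' x0)].
  have tb : `|phi x / f x| <= d.
    rewrite normrM normfV (gtr0_norm fp) ler_pdivrMr//; apply: (le_trans phE).
    have -> : 2 * E = 4 * E * 2^-1 by field.
    by apply: ler_pM => //; rewrite ?invr_ge0// mulr_ge0// ltW.
  have s0 : 0 <= s x by exact: sg0 fN x0.
  have sf := mink_ratio (sgb fN x0) (nice_val fN' x0) c5 c6 NC1 eta0 eta1 fp.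
  have P0 : 0 <= 1 - p by rewrite subr_ge0 ltW.
  by rewrite gx LE; exact: (mink_pointwise fp s0 P0 eta0 sf (Phid tb)).
have UgE : Ucoef k g dg ddg = t ^+ j * Ucoef k h dh ddh.
  by rewrite (Ucoef_hom es1 t0 (nice_le eE hN)) ?jE// ltnW// (ltn_trans kn).
have R2 : M (fun x => Phi p (g x / f x) * (f x * s x)) =
    t `^ p * M (fun x => Phi p (h x / f x) * (f x * s x)) + Phi p t * MF.
  have aPh : adm (fun x => Phi p (h x / f x) * (f x * s x)).
    by apply: admM; [exact: (adm_Phi_ratio p fN hN e12)|exact: admM].
  rewrite -MZ// /MF -MZ; last exact: admM.
  rewrite -MD; [|exact: admZ|by apply: admZ; exact: admM].
  apply: eq_M_off0.
    by apply: admM; [exact: (adm_Phi_ratio p fN' gN E12)|exact: admM].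
  move=> x x0; have [f0 /andP[r1 _]] := ratio_bounds fN hN e12 x0.
  have r0 : 0 < h x / f x by apply: lt_le_trans r1; rewrite invr_gt0.
  have -> : g x / f x = t * (h x / f x) by rewrite /g mulrA.
  by rewrite (Phi_scale p t0 r0) mulrDl -mulrA.
have [m1 m2] := mink_unscale j0 p1 t0 (Upos fN) (Upos hN) UgE (eul fN) kap0 A0 Y2 R1 R2.
split=> //; first exact: Upos hN.
(* Equality leaves [phi] no L^2 mass, so [h] is a multiple of [f]. *)
move=> eq; have z := M_sq_zero pc (m2 eq).
exists t^-1 => [|x x0]; first by rewrite invr_gt0.
by have := z x x0; rewrite /phi /g => /eqP; rewrite subr_eq0 => /eqP <-; rewrite mulKf// gt_eqF.
Qed.

End Core.

(* With [h] rescaled so that its first variation along [f] vanishes, the second variation and the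
   spectral gap give the inequality; [Phi_scale] removes the normalisation. *)
Lemma lp_minkowski (j : nat) (p : R) : (2 <= j <= n)%N -> p < 1 ->
  (1 - p) * n%:R < (j%:R - 1) * (n%:R + 2) ->
  exists2 e, 0 < e & [/\ e <= 1 / 8,
    forall (C : set V) a da dda, nice e a da dda -> Body C a da ->
      intrinsic_volume j C = Ucoef (n.+1 - j) a da dda / kappa R (n.+1 - j) &
    forall f df ddf, nice e f df ddf -> (forall x, f (- x) = f x) ->
    0 < Ucoef (n.+1 - j) f df ddf /\
    exists sig : V -> R, [/\ adm sig, forall x, x != 0 -> 0 < sig x, 0 < M (fun x => f x * sig x) &
    forall h dh ddh, nice e h dh ddh -> (forall x, h (- x) = h x) ->
      [/\ 0 < Ucoef (n.+1 - j) h dh ddh,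
       Phi p ((Ucoef (n.+1 - j) h dh ddh / Ucoef (n.+1 - j) f df ddf) `^ (j%:R^-1)) * M (fun x => f x * sig x) <=
         M (fun x => Phi p (h x / f x) * (f x * sig x)) &
       Phi p ((Ucoef (n.+1 - j) h dh ddh / Ucoef (n.+1 - j) f df ddf) `^ (j%:R^-1)) * M (fun x => f x * sig x) =
         M (fun x => Phi p (h x / f x) * (f x * sig x)) ->
       exists2 t, 0 < t & forall x, x != 0 -> h x = t * f x]]].
Proof.
move=> /andP[j2 jn] p1 hp; set k := (n.+1 - j)%N.
have kn : (k < n)%N by rewrite /k ltn_subLR ?(leq_trans jn)// -[n.+2]/(2 + n)%N leq_add2r.
have n0 : (0 < n)%N by exact: leq_ltn_trans kn.
have jE : (n.+1 - k)%N = j by rewrite /k subKn// (leq_trans jn).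
have nR0 : 0 < n%:R :> R by rewrite ltr0n.
have N0 : 0 < N by rewrite ltr0n.
have j0 : 0 < j%:R :> R by rewrite ltr0n (leq_trans _ j2).
have [K K0 HK] := @det_near1 R n.+1.
have [K' K'0 HK'] := vol_expand K0 HK.
have [c cP] := coef_interpolation R n.+2.
pose C1 : R := 'C(n, k)%:R; pose C2 : R := 'C(n.-1, k)%:R.
have C11 : 1 <= C1 by rewrite ler1n bin_gt0 ltnW.
have C21 : 1 <= C2 by rewrite ler1n bin_gt0 -ltnS prednK.
(* Absorption [n C(n-1, k) = (n - k) C(n, k)] with [n - k = j - 1]. It turns the binomials of the
   second variation into the factor [j - 1] of the hypothesis on [p]. *)
have CC : n%:R * C2 = (j%:R - 1) * C1.
  rewrite -natrM mul_bin_down natrM; congr (_ * _).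
  rewrite natrB ?(ltnW kn)//; have := congr1 (fun m => m%:R : R) jE.
  by rewrite /= natrB; [rewrite -natr1; lra|rewrite ltnW// (ltn_trans kn)].
(* The slack in the hypothesis on [p]. Half of it pays for [eta], the losses in the Taylor bound and
   in [s / f]; the other half gives [2 * kap], one [kap] for the error terms and one for rigidity in
   the equality case. *)
pose gam := (j%:R - 1) * (n%:R + 2) / n%:R - (1 - p).
have gam0 : 0 < gam by rewrite subr_gt0 ltr_pdivlMr.
pose eta := Num.min 1 (gam / (6 * (1 - p))).
have P0 : 0 < 1 - p by lra.
have eta0 : 0 < eta by rewrite lt_min ltr01 divr_gt0// mulr_gt0.
have eta1 : eta <= 1 by rewrite ge_min lexx.
have etag : (1 - p) * (3 * eta) <= gam / 2.
  have : eta <= gam / (6 * (1 - p)) by rewrite ge_min lexx orbT.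
  by rewrite ler_pdivlMr ?mulr_gt0//; lra.
have [d d0 [d2 Phid]] := Phi_lower p1 eta0.
pose b := N / 2 * C2; have b0 : 0 < b by rewrite mulr_gt0 ?divr_gt0//; lra.
pose L := (1 - p) / 2 * (1 + eta) * (N * C1 * (1 + eta)).
pose kap := N * C1 * gam / 8.
have kap0 : 0 < kap by rewrite divr_gt0// !mulr_gt0//; lra.
have bL : L + 2 * kap <= b * (n%:R + 2).
  have e1 : b * (n%:R + 2) = N * C1 / 2 * (gam + (1 - p)).
    rewrite /b /gam subrK; have -> : C2 = (j%:R - 1) * C1 / n%:R by rewrite -CC mulrC mulKf// gt_eqF.
    by field; rewrite gt_eqF.
  rewrite e1 /L /kap.
  have e2 : (1 + eta) * (1 + eta) <= 1 + 3 * eta by clear -eta0 eta1; nra.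
  have e3 := ler_wpM2l (ltW P0) e2.
  have e4 : (1 - p) * ((1 + eta) * (1 + eta)) <= (1 - p) + gam / 2 by clear -e3 etag; lra.
  have NC : 0 <= N * C1 by rewrite mulr_ge0//; lra.
  have e5 := ler_wpM2l NC e4; clear -e5; lra.
pose Ks := N * (csum n c k * (2 * (K * 5 + 1))); pose KU := csum n c k * K'.
have cs0 : 0 <= csum n c k by exact: csum_ge0.
have Ks0 : 0 <= Ks by rewrite !mulr_ge0// addr_ge0// mulr_ge0// ltW.
have KU0 : 0 <= KU by rewrite mulr_ge0.
have h100 : 0 < 1 / 100 :> R by rewrite divr_gt0.
have h2 : 0 < 1 / 2 :> R by rewrite divr_gt0.
have he4 : 0 < eta / 4 by rewrite divr_gt0.
pose sq := [:: (4 * N ^+ 2, 1 / 100 : R); (K * 5, 1 / 2); (Ks, 1 / 2); (Ks + 1, 1);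
  (Ks, eta / 4); (2, eta / 4); (4, d); (KU, b); (KU * (1 + 2 * N) + 2 * N * b * (Ks + 1), kap)].
have hsq : all (fun cr => 0 < cr.2) sq.
  apply/allP => cr; rewrite !inE => /orP[/eqP->//|]; do 7 (move=> /orP[/eqP->//|]); by move/eqP->.
have [E E0] := exists_small hsq.
rewrite /= => /andP[c1 /andP[c2 /andP[c3 /andP[c4 /andP[c5 /andP[c6 /andP[c7 /andP[c8 /andP[c9 _]]]]]]]]].
have es1 : 4 * n.+1%:R ^+ 2 * E <= 1 / 100 by exact: c1.
have es2 : K * (5 * E) <= 1 / 2 by rewrite mulrA.
have E4 : 4 * E <= 1 / 100.
  apply: (le_trans _ es1); rewrite ler_wpM2r ?(ltW E0)// -[leLHS]mulr1 ler_wpM2l// exprn_ege1// ler1n//.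
have NC1 : 1 <= N * C1 by rewrite -[leLHS]mulr1 ler_pM// ler1n.
have [[e0 e8 eE2 eE] [e12 eE6 E12]] := twelfth E0 E4.
(* The factor 12 leaves room: a rescaled [h] is only [6 * e]-nice, and Euler's identity asks for
   [e <= E / 2]. *)
exists (E / 12) => //; split=> // [C a da dda aN bC|].
  exact: (intrinsic_volumeE HK es1 es2 j (nice_le eE aN) bC).
exact: (minkowski_core (ltnW j2) kn jE p1 K0 HK K'0 HK' cP (erefl C1) (erefl Ks) (erefl KU) (erefl b) (erefl L)
  kap0 eta0 eta1 Phid bL Ks0 KU0 NC1 E0 es1 es2 c3 c4 c5 c6 c7 c8 c9 e0 e8 eE2 eE e12 eE6 E12).
Qed.
End Minkowski.

(** * Support functions and Wulff shapes of convex bodies *)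

Section SupportFunctions.
Variables (R : realType) (n : nat).
Notation V := 'rV[R]_n.+1.
Notation I := 'I_n.+1.
Notation off0 := [set x : V | x != 0].
Notation ei k := (delta_mx ord0 k : V).
Implicit Types (x y z u v : V) (t e c : R) (f : V -> R) (K L : set V).

Lemma dotp_cont x : continuous (dotp x).
Proof.
have dC := C1on_sum (index_enum I) (fun i => C1onZ (x ord0 i) (@C1on_coord R n setT i)).
by move=> y; exact: (C1on_cont openT dC).
Qed.

Lemma q_contT : continuous (@q R n).
Proof. by move=> y; exact: (C1on_cont openT (@C1on_q R n setT)). Qed.

Lemma compact_sphere : compact (@sphere R n.+1).
Proof.
apply: bounded_closed_compact.
  exists 1; split; first exact: num_real.
  move=> m m1 x /sphereE x1; apply/ltW/(le_lt_trans _ m1).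
  by rewrite -(@ler_sqr R) ?nnegrE// expr1n -x1 norm_le_q.
have -> : @sphere R n.+1 = @q R n @^-1` [set 1].
  by apply/seteqP; split=> x /sphereE.
apply: closed_comp; [by move=> x _; exact: q_contT|exact: closed_eq].
Qed.

Lemma sphere_hom0 f u : sphere u -> hom0 f u = f u.
Proof. by rewrite /sphere /hom0 /= => ->; rewrite invr1 scale1r. Qed.

Lemma hom0_scale f t x : 0 < t -> hom0 f (t *: x) = hom0 f x.
Proof.
move=> t0; congr f; have [->|x0] := eqVneq x 0; first by rewrite !scaler0.
have -> : enorm (t *: x) = t * enorm x.
  by rewrite /enorm dotpZl dotpZr mulrA -expr2 sqrtrM ?sqr_ge0// sqrtr_sqr gtr0_norm.
have e0 : enorm x != 0 by rewrite gt_eqF// enorm_gt0.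
by rewrite scalerA; congr (_ *: _); field; rewrite e0 gt_eqF.
Qed.

Lemma C2_hom2 f : C2_sphere f ->
  hom2 (hom0 f) (fun i => pder i (hom0 f)) (fun i k => pder k (pder i (hom0 f))).
Proof.
move=> fC; split=> [t x t0|x x0|i x x0]; first exact: hom0_scale.
  have [_ h1 h2 _ _] := fC x x0; split=> k; last exact: h2.
  apply: is_derive_line0; have d := h1 k; apply: DeriveDef; first exact: d.
  by rewrite /pder derive1E.
have [_ _ _ h1 h2] := fC x x0; split=> k; last exact: h2.
apply: is_derive_line0; have d := h1 i k; apply: DeriveDef; first exact: d.
by rewrite /pder derive1E.
Qed.

Lemma pderB i (g : V -> R) c : pder i (fun y => g y - c) = pder i g.
Proof.
apply/funext => x; rewrite /pder /derive1.
have -> : (fun h : R => h^-1 *: (g (x + (h + 0) *: evec R i) - c - (g (x + 0 *: evec R i) - c))) =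
    (fun h : R => h^-1 *: (g (x + (h + 0) *: evec R i) - g (x + 0 *: evec R i))).
  by apply/funext => h; congr (_ *: _); ring.
by [].
Qed.

Lemma cvg_normR (F : set_system V) (FF : Filter F) (g : V -> R) (l : R) :
  g y @[y --> F] --> l -> `|g y| @[y --> F] --> `|l|.
Proof. by move=> h; exact: cvg_norm h. Qed.

Lemma le_sum1 (F : I -> R) i : (forall i, 0 <= F i) -> F i <= \sum_i F i.
Proof. by move=> F0; rewrite (bigD1 i)//= lerDl sumr_ge0. Qed.

Lemma sum3_le (A B C e : R) : 0 <= A -> 0 <= B -> 0 <= C -> A + B + C <= e ->
  [/\ A <= e, B <= e & C <= e].
Proof. by move=> *; split; lra. Qed.

(** A [sup] controls the members of its set only if the set is bounded above; boundedness comes from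
    compactness of the sphere and continuity of the derivatives. *)
Lemma C2_norm_nice f e : C2_sphere f -> C2_norm (fun x => f x - 1) < e ->
  nice e (hom0 f) (fun i => pder i (hom0 f)) (fun i k => pder k (pder i (hom0 f))).
Proof.
move=> fC; have fH := C2_hom2 fC; have [_ h1 h2] := fH.
pose G u := `|hom0 f u - 1| + \sum_(i < n.+1) `|pder i (hom0 f) u|
  + \sum_(i < n.+1) \sum_(k < n.+1) `|pder k (pder i (hom0 f)) u|.
have -> : C2_norm (fun x => f x - 1) = sup [set G u | u in @sphere R n.+1].
  have pE : (fun i => pder i (hom0 (fun x => f x - 1))) = (fun i => pder i (hom0 f)).
    by apply/funext => i; exact: (pderB i (hom0 f) 1).
  have GE := congr1 (fun (A : I -> V -> R) u => `|hom0 f u - 1| + \sum_(i < n.+1) `|A i u|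
      + \sum_(i < n.+1) \sum_(k < n.+1) `|pder k (A i) u|) pE.
  exact: (congr1 (fun H : V -> R => sup [set H u | u in @sphere R n.+1]) GE).
have cG : {within @sphere R n.+1, continuous G}.
  apply: continuous_in_subspaceT => u; rewrite inE => /sphereE/q1_neq0 u0.
  have c1 : {for u, continuous (hom0 f)} by exact: C1on_forcont h1 u0.
  have cA : `|hom0 f y - 1| @[y --> u] --> `|hom0 f u - 1|.
    have h : hom0 f y @[y --> u] --> hom0 f u by exact: c1.
    have hb : (hom0 f y - 1) @[y --> u] --> hom0 f u - 1 by exact: (cvgB h (cvg_cst _)).
    exact: (@cvg_normR (nbhs u) _ (fun y => hom0 f y - 1) (hom0 f u - 1) hb).
  have cB : \sum_(i < n.+1) `|pder i (hom0 f) y| @[y --> u] --> \sum_(i < n.+1) `|pder i (hom0 f) u|.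
    apply: (@cvg_sumR _ _ _ (nbhs u)) => i.
    have [_ /(_ i) hi] := h1 u u0; exact: (@cvg_normR (nbhs u) _ (pder i (hom0 f)) _ hi).
  have cC : \sum_(i < n.+1) \sum_(k < n.+1) `|pder k (pder i (hom0 f)) y| @[y --> u] -->
      \sum_(i < n.+1) \sum_(k < n.+1) `|pder k (pder i (hom0 f)) u|.
    apply: (@cvg_sumR _ _ _ (nbhs u)) => i; apply: (@cvg_sumR _ _ _ (nbhs u)) => k.
    have [_ /(_ k) hi] := h2 i u u0; exact: (@cvg_normR (nbhs u) _ (pder k (pder i (hom0 f))) _ hi).
  exact: (cvgD (cvgD cA cB) cC).
have s0 : @sphere R n.+1 !=set0 by exists (ei ord0); apply/sphereE; exact: dotp_ei.
have [c cs cmax] := EVT_max_rV s0 compact_sphere cG.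
have ub : has_ubound [set G u | u in @sphere R n.+1].
  by exists (G c) => _ [u su <-]; apply: cmax; rewrite inE.
move=> he; split=> // x x1; have Gx : G x <= e.
  by apply/ltW/(le_lt_trans _ he)/ub_le_sup => //; exists x => //; apply/sphereE.
have p1 i : `|pder i (hom0 f) x| <= \sum_(i < n.+1) `|pder i (hom0 f) x|.
  by apply: (@le_sum1 (fun l => `|pder l (hom0 f) x|) i) => l; exact: normr_ge0.
have p2 i k : `|pder k (pder i (hom0 f)) x| <= \sum_(i < n.+1) \sum_(k < n.+1) `|pder k (pder i (hom0 f)) x|.
  have le1 : `|pder k (pder i (hom0 f)) x| <= \sum_(l < n.+1) `|pder l (pder i (hom0 f)) x|.
    by apply: (@le_sum1 (fun l => `|pder l (pder i (hom0 f)) x|) k) => l; exact: normr_ge0.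
  apply: (le_trans le1).
  by apply: (@le_sum1 (fun i => \sum_(k < n.+1) `|pder k (pder i (hom0 f)) x|) i) => l; exact: sumr_ge0.
have q1 : 0 <= \sum_(i < n.+1) `|pder i (hom0 f) x| by exact: sumr_ge0.
have q2 : 0 <= \sum_(i < n.+1) \sum_(k < n.+1) `|pder k (pder i (hom0 f)) x|.
  by apply: sumr_ge0 => i _; exact: sumr_ge0.
have q0 : 0 <= `|hom0 f x - 1| by [].
have [g1 g2 g3] := sum3_le q0 q1 q2 Gx.
by split=> [|i|i k]; [exact: g1|exact: (le_trans (p1 i) g2)|exact: (le_trans (p2 i k) g3)].
Qed.

Section Body.
Variable K : set V.
Hypotheses (cK : compact K) (vK : convex_set_n K) (K0 : K !=set0).

Lemma supp_attained x : exists2 y, K y & supp K x = dotp x y /\ forall z, K z -> dotp x z <= supp K x.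
Proof.
have cd : {within K, continuous (dotp x)} by apply: continuous_in_subspaceT => y _; exact: dotp_cont.
have [c] := EVT_max_rV K0 cK cd; rewrite inE => cK' cmax; exists c => //.
have ub : ubound [set dotp x y | y in K] (dotp x c) by move=> _ [y Ky <-]; apply: cmax; rewrite inE.
have e1 : supp K x = dotp x c.
  apply/eqP; rewrite eq_le; apply/andP; split; first by apply: ge_sup => //; exists (dotp x c), c.
  by apply: ub_le_sup; [exists (dotp x c)|exists c].
by split=> // z Kz; rewrite e1; apply: ub; exists z.
Qed.

(** Separation by the nearest point: if [z] is outside [K] and [c] is its nearest point in [K], the
    direction [z - c] separates, since otherwise a short step from [c] towards some [y] in [K] would
    come closer to [z]. *)
Lemma wulff_supp : wulff (supp K) = K.
Proof.
apply/seteqP; split=> z; last first.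
  move=> Kz u su; rewrite dotpC; have [_ _ [_]] := supp_attained u; exact.
move=> zw; have [//|Kz] := pselect (K z); exfalso.
have cd : {within K, continuous (fun y => q (y - z))}.
  apply: continuous_in_subspaceT => y _.
  apply: (@cvg_comp _ _ _ (fun y => y - z) (@q R n) (nbhs y) (nbhs (y - z)) _); last exact: q_contT.
  by apply: cvgB; [exact: cvg_id|exact: cvg_cst].
have [c] := EVT_min_rV K0 cK cd; rewrite inE => Kc cmin.
pose d := z - c; have d0 : d != 0 by rewrite subr_eq0; apply/eqP => e; apply: Kz; rewrite e.
have sep y : K y -> dotp (y - c) d <= 0.
  move=> Ky; rewrite leNgt; apply/negP; set m := dotp _ _ => m0.
  have s0 : 0 <= q (y - c) := q_ge0 _; set s := q (y - c) in s0.
  have ms : 0 < m + s by rewrite ltr_pwDl.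
  (* A step length in [(0, 1]] with [t * s < 2 * m], for which the squared distance decreases. *)
  pose t := m / (m + s); have t0 : 0 < t by rewrite divr_gt0.
  have t1 : t <= 1 by rewrite ler_pdivrMr// mul1r lerDl.
  have t01 : 0 <= t <= 1 by rewrite (ltW t0).
  have := cmin _ (mem_set (vK Kc Ky t01)).
  have -> : (1 - t) *: c + t *: y - z = t *: (y - c) - d.
    by rewrite /d; apply/rowP => l; rewrite !mxE; ring.
  have -> : c - z = - d by rewrite /d opprB.
  have -> : q (- d) = q d by rewrite /q dotpNl dotpNr opprK.
  have -> : q (t *: (y - c) - d) = t ^+ 2 * s - 2 * t * m + q d.
    have gen (a b : V) : q (t *: a - b) = t ^+ 2 * q a - 2 * t * dotp a b + q b.
      by rewrite /q !dotpE (dotpC b a); ring.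
    exact: gen.
  rewrite lerDr => h; have ts : t * (m + s) = m by rewrite /t divfK// gt_eqF.
  have : t * (t * s - 2 * m) < 0.
    rewrite nmulr_llt0//; have : 0 < t * m by rewrite mulr_gt0.
    by move: ts; rewrite mulrDr; lra.
  lra.
pose u := (enorm d)^-1 *: d; have u1 : q u = 1 by exact: normalize_q.
have su : sphere u by apply/sphereE.
have [y Ky [e1 _]] := supp_attained u.
have := zw u su; rewrite e1 /u dotpZl dotpZr ler_pM2l ?invr_gt0 ?enorm_gt0// (dotpC d y) => h.
have := sep y Ky; have := q_gt0 d0; rewrite /q {1}/d.
move: h; rewrite dotpBl dotpBl; lra.
Qed.

Hypothesis sK : origin_symmetric K.

Lemma sym_mem y : K y -> K (- y).
Proof. by move=> Ky; rewrite -sK; exists y. Qed.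

Lemma zero_mem : K 0.
Proof.
have [y Ky] := K0; have := vK Ky (sym_mem Ky) (ltac:(apply/andP; split; lra) : 0 <= (1 / 2 : R) <= 1).
have -> : (1 - 1 / 2) *: y + (1 / 2) *: - y = 0; last by [].
by apply/rowP => l; rewrite !mxE; field.
Qed.

Lemma supp_even x : supp K (- x) = supp K x.
Proof.
rewrite /supp; congr sup; apply/seteqP; split=> _ [y Ky <-]; exists (- y); rewrite ?dotpNl ?dotpNr ?opprK//; exact: sym_mem.
Qed.

Lemma hom0_even x : hom0 (supp K) (- x) = hom0 (supp K) x.
Proof.
have eN : enorm (- x) = enorm x by rewrite /enorm dotpNl dotpNr opprK.
by rewrite /hom0 eN scalerN supp_even.
Qed.

Lemma supp_scaleE x : x != 0 -> supp K x = enorm x * hom0 (supp K) x.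
Proof.
move=> x0; have ep := enorm_gt0 x0; have en : enorm x != 0 by rewrite gt_eqF.
rewrite /hom0; have [y Ky [e1 h1]] := supp_attained x.
have [z Kz [e2 h2]] := supp_attained ((enorm x)^-1 *: x).
apply/eqP; rewrite eq_le; apply/andP; split.
  by rewrite e1 mulrC -ler_pdivrMr// mulrC -dotpZl h2.
by rewrite e2 dotpZl mulrA mulfV// mul1r h1.
Qed.

(** The point [y] where [K] is touched in direction [u] is the gradient image of [u]: the function
    [F = h_K^2 - <y, .>^2] is nonnegative by symmetry and vanishes at [u], so its partial
    derivatives vanish there. Convexity and [0] in [K] extend this from the sphere to the ball. *)
Lemma body_supp e da dda : nice e (hom0 (supp K)) da dda -> e <= 1 / 2 -> Body K (hom0 (supp K)) da.
Proof.
move=> aN e2; set a := hom0 (supp K) in aN *; have [[_ aC _] _] := aN.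
split.
  by move=> z Kz u su; rewrite /a sphere_hom0// dotpC; have [_ _ [_]] := supp_attained u; exact.
have unit u : q u = 1 -> K (\row_i Tmap a da i u).
  move=> u1; have u0 := q1_neq0 u1; have su : sphere u by apply/sphereE.
  have [y Ky [e1 _]] := supp_attained u; rewrite -(sphere_hom0 _ su) -/a in e1.
  have a0 : 0 < a u by have /andP[h _] := nice_half aN e2 u0; lra.
  suff -> : \row_i Tmap a da i u = y by [].
  apply/rowP => i; rewrite mxE /Tmap u1 mul1r.
  pose F (x : V) := a x * a x * q x - dotp y x * dotp y x.
  pose dF (k : I) x := a x * a x * (2 * x ord0 k) + q x * (a x * da k x + a x * da k x)
     - (dotp y x * y ord0 k + dotp y x * y ord0 k).
  have dC : C1on off0 (dotp y) (fun k x => y ord0 k).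
    have := C1on_sum (index_enum I) (fun i => C1onZ (y ord0 i) (@C1on_coord R n off0 i)).
    apply: C1on_ext => // k x; rewrite (bigD1 k)//= eqxx mulr1 big1 ?addr0// => l lk.
    by rewrite eq_sym (negbTE lk) mulr0.
  have FC : C1on off0 F dF.
    apply: C1onB; last exact: (C1onM (@open_ne0 R n) dC dC).
    exact: (C1onM (@open_ne0 R n) (C1onM (@open_ne0 R n) aC aC) (@C1on_q R n off0)).
  have F0 x : x != 0 -> 0 <= F x.
    move=> x0; have [_ _ [_ h]] := supp_attained x.
    have := h _ Ky; have := h _ (sym_mem Ky); rewrite dotpNr (supp_scaleE x0) -/a (dotpC x y) => h1 h2.
    have e3 : F x = (enorm x * a x) ^+ 2 - dotp y x ^+ 2 by rewrite /F exprMn enorm_sqr; ring.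
    have nb : `|dotp y x| <= enorm x * a x by rewrite ler_norml; apply/andP; split; lra.
    by rewrite e3 subr_ge0 -[leLHS]real_normK ?num_real// ler_sqr ?nnegrE// (le_trans _ nb).
  have Fu : F u = 0 by rewrite /F u1 e1 (dotpC y u); ring.
  have nz t : t \in `]-1, 1[ -> u + t *: ei i != 0.
    rewrite in_itv/= => /andP[t1 t2]; apply/eqP => h.
    have ut : u = - (t *: ei i) by apply/eqP; rewrite -subr_eq0 opprK h.
    move: u1; rewrite ut /q dotpNl dotpNr opprK dotpZl dotpZr dotp_ei; nra.
  have gd (t : R) : t \in `]-1, 1[ -> is_derive t (1 : R) (fun s : R => F (u + s *: ei i)) (dF i (u + t *: ei i)).
    by move=> /nz h; apply: is_derive_line; have [+ _] := FC _ h; exact.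
  have z0 : (0 : R) \in `]-1, 1[ by rewrite in_itv/= oppr_lt0 ltr01.
  have m1 : -1 <= 1 :> R by lra.
  have fmin (t : R) : t \in `]-1, 1[ -> F (u + 0 *: ei i) <= F (u + t *: ei i).
    by move=> ht; rewrite scale0r addr0 Fu; exact: (F0 _ (nz t ht)).
  have fd (t : R) : t \in `]-1, 1[ -> derivable (fun s : R => F (u + s *: ei i)) t 1.
    by move=> ht; case: (gd t ht).
  have dmin := @derive1_at_min R (fun s : R => F (u + s *: ei i)) (-1) 1 0 m1 fd z0 fmin.
  have := gd 0 z0; rewrite scale0r addr0 => d1.
  have [_ v1] := d1; have [_ v2] := dmin; have : dF i u = 0 by rewrite -v1 v2.
  rewrite /dF u1 (dotpC y u) -e1 mul1r => h.
  have : 2 * a u * (a u * u ord0 i + da i u - y ord0 i) = 0 by rewrite -[RHS]h; ring.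
  by move/eqP; rewrite !mulf_eq0 pnatr_eq0/= (gt_eqF a0)/= subr_eq0 => /eqP.
move=> x qx; have [x0|x0] := eqVneq x 0.
  suff -> : \row_i Tmap a da i x = 0 by exact: zero_mem.
  by apply/rowP => i; rewrite !mxE /Tmap x0 q0 mul0r addr0 mxE mulr0.
have [u [u1 ep xE]] := unit_decomp x0.
have e1 : enorm x <= 1 by rewrite -(@ler_sqr R) ?nnegrE ?enorm_ge0// expr1n enorm_sqr.
have -> : \row_i Tmap a da i x = (1 - enorm x) *: 0 + enorm x *: (\row_i Tmap a da i u).
  apply/rowP => i; rewrite {1}xE mxE (Tmap_hom (proj1 aN))// !mxE mulr0 add0r.
  by rewrite /q; congr (_ * _).
by apply: vK; [exact: zero_mem|exact: unit|rewrite (ltW ep)].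
Qed.

Lemma support_data e : C2_sphere (supp K) -> C2_norm (fun x => supp K x - 1) < e -> e <= 1 / 2 ->
  exists da dda, nice e (hom0 (supp K)) da dda /\ Body K (hom0 (supp K)) da.
Proof.
move=> fC ne e2; have aN := C2_norm_nice fC ne.
by do 2 eexists; split; [exact: aN|exact: body_supp aN e2].
Qed.

End Body.
End SupportFunctions.

Section MeanAlgebra.
Variable R : realType.
Implicit Types (p lam x y c : R) (j : nat).

Lemma Phi_exprn p c j : (0 < j)%N -> 0 < c -> Phi (p / j%:R) (c ^+ j) = j%:R * Phi p c.
Proof.
move=> j0 c0; have jn : j%:R != 0 :> R by rewrite pnatr_eq0 -lt0n.
have := Phi_root p j0 (exprn_gt0 j c0).
have -> : (c ^+ j) `^ j%:R^-1 = c by rewrite -powR_mulrn ?ltW// -powRrM mulfV// powRr1// ltW.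
by move=> ->; field.
Qed.

Lemma lpmean_scale p lam x c : 0 < x -> 0 < c -> 0 <= lam <= 1 ->
  lpmean p lam x (c * x) = lpmean p lam 1 c * x.
Proof.
move=> x0 c0 l01; have cx : 0 < c * x by rewrite mulr_gt0.
have [m0 _ _ e1] := lpmeanE p x0 cx l01; have [k0 _ _ e2] := lpmeanE p ltr01 c0 l01.
apply: (@Phi_inj _ p) => //; first by rewrite mulr_gt0.
by rewrite e1 [lpmean p lam 1 c * x]mulrC (Phi_scale p x0 k0) e2 Phi1 mulr0 add0r [c * x]mulrC (Phi_scale p x0 c0); ring.
Qed.

Lemma lpmean_exprn p lam c j : (0 < j)%N -> 0 < c -> 0 <= lam <= 1 ->
  lpmean (p / j%:R) lam 1 (c ^+ j) = lpmean p lam 1 c ^+ j.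
Proof.
move=> j0 c0 l01; have [k0 _ _ e2] := lpmeanE p ltr01 c0 l01.
have [m0 _ _ e1] := lpmeanE (p / j%:R) ltr01 (exprn_gt0 j c0) l01.
apply: (@Phi_inj _ (p / j%:R) _ _ m0 (exprn_gt0 j k0)).
by rewrite e1 !Phi_exprn// e2 !Phi1; ring.
Qed.

Lemma lpmean_factor p lam x y v : 0 < x -> 0 < y -> 0 < v -> 0 <= lam <= 1 ->
  Phi p (lpmean p lam x y) = v `^ p * ((1 - lam) * Phi p (x / v) + lam * Phi p (y / v)) + Phi p v.
Proof.
move=> x0 y0 v0 l01; have [m0 _ _ ->] := lpmeanE p x0 y0 l01.
have vn : v != 0 by rewrite gt_eqF.
have xe : Phi p x = v `^ p * Phi p (x / v) + Phi p v by rewrite -Phi_scale ?divr_gt0// mulrC divfK.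
have ye : Phi p y = v `^ p * Phi p (y / v) + Phi p v by rewrite -Phi_scale ?divr_gt0// mulrC divfK.
by rewrite xe ye; ring.
Qed.

Lemma lpmean_ratio0 p lam x y : 0 < x -> 0 < y -> 0 <= lam <= 1 ->
  (1 - lam) * Phi p (x / lpmean p lam x y) + lam * Phi p (y / lpmean p lam x y) = 0.
Proof.
move=> x0 y0 l01; have [m0 _ _ _] := lpmeanE p x0 y0 l01.
have /eqP := lpmean_factor p x0 y0 m0 l01; have vp := powR_gt0 p m0.
by rewrite -subr_eq0 opprD addrCA subrr addr0 oppr_eq0 mulf_eq0 (gt_eqF vp)/= => /eqP.
Qed.

Lemma lpmean_le p lam x y v : 0 < x -> 0 < y -> 0 < v -> 0 <= lam <= 1 ->
  (1 - lam) * Phi p (x / v) + lam * Phi p (y / v) <= 0 -> lpmean p lam x y <= v.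
Proof.
move=> x0 y0 v0 l01 h; rewrite leNgt; apply/negP => /(Phi_lt p v0).
by rewrite (lpmean_factor p x0 y0 v0 l01) ltrDr pmulr_rgt0 ?powR_gt0// ltNge h.
Qed.

Lemma lam_split lam : 0 < lam < 1 -> [/\ 0 < lam, 0 < 1 - lam & 0 <= lam <= 1].
Proof. by move=> /andP[? ?]; split=> //; [lra|apply/andP; split; lra]. Qed.

Lemma convex_comb_eq (l m X Y A B : R) : 0 < l -> 0 < m -> X <= A -> Y <= B ->
  m * A + l * B = 0 -> m * X + l * Y = 0 -> X = A /\ Y = B.
Proof.
move=> l0 m0 XA YB h1 h2; have h3 := ler_wpM2l (ltW m0) XA; have h4 := ler_wpM2l (ltW l0) YB.
by split; apply/eqP; rewrite eq_le ?XA ?YB/=; [rewrite -(ler_pM2l m0)|rewrite -(ler_pM2l l0)]; lra.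
Qed.

Lemma weighted_bound (lam X Y c m A B : R) : 0 < lam -> 0 < 1 - lam -> 0 < c -> 0 < m ->
  X / c * m <= A -> Y / c * m <= B -> (1 - lam) * A + lam * B = 0 ->
  (1 - lam) * X + lam * Y <= 0 /\
  ((1 - lam) * X + lam * Y = 0 -> X / c * m = A /\ Y / c * m = B).
Proof.
move=> l0 l1 c0 m0 XA YB AB.
have e : (1 - lam) * (X / c * m) + lam * (Y / c * m) = ((1 - lam) * X + lam * Y) * (m / c).
  by field; rewrite gt_eqF.
split=> [|z]; last by apply: (convex_comb_eq l0 l1 XA YB AB); rewrite e z mul0r.
have := lerD (ler_wpM2l (ltW l1) XA) (ler_wpM2l (ltW l0) YB).
by rewrite AB e pmulr_lle0// divr_gt0.
Qed.

Lemma comb0_mulr (l A B s : R) : (1 - l) * A + l * B = 0 -> (1 - l) * (A * s) + l * (B * s) = 0.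
Proof. by move=> h; rewrite !mulrA -mulrDl h mul0r. Qed.

Lemma eq_ratio (k x y X Y : R) : 0 < k -> 0 < x -> 0 < y -> X = x / k -> Y = y / k ->
  [/\ 0 < X, 0 < Y, 0 < X / Y & x / y = X / Y].
Proof.
move=> k0 x0 y0 -> ->; have kn : k != 0 by rewrite gt_eqF.
by rewrite !divr_gt0//; split=> //; field; rewrite kn gt_eqF.
Qed.

Lemma scaled_ratio (x y z s t : R) : 0 < t -> x = t * z -> y = s * z -> y = s / t * x.
Proof. by move=> t0 -> ->; rewrite mulrA divfK// gt_eqF. Qed.

Lemma drop_factor6 (N d c : R) : 0 < d -> 4 * N ^+ 2 * (6 * d) <= c -> 4 * N ^+ 2 * d <= c.
Proof. by move=> d0; have := mulr_ge0 (sqr_ge0 N) (ltW d0); rewrite mulrA; nra. Qed.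

Lemma near_ratio (t a d : R) : 1 / 2 <= a -> `|a - 1| <= d -> `|t * a - 1| <= d -> `|t - 1| <= 4 * d.
Proof.
move=> ah a1 ta; have a0 : 0 < a by lra.
have d0 : 0 <= d := le_trans (normr_ge0 _) a1.
have -> : t - 1 = ((t * a - 1) - (a - 1)) / a by field; rewrite gt_eqF.
rewrite normrM normfV (gtr0_norm a0) ler_pdivrMr//.
by apply: (le_trans (ler_normB _ _)); have := ler_wpM2l d0 ah; lra.
Qed.

Lemma norm_bounds (x d : R) : 1 - d <= x <= 1 + d -> `|x - 1| <= d.
Proof. by move=> /andP[? ?]; rewrite ler_norml; apply/andP; split; lra. Qed.

End MeanAlgebra.

(** * The L_p Brunn-Minkowski inequality and its equality case *)

Section BrunnMinkowski.
Variables (R : realType) (n : nat).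
Notation V := 'rV[R]_n.+1.
Implicit Types (K L : set V) (a b f : V -> R).

Lemma eq_wulff f g : (forall u, sphere u -> f u = g u) -> wulff f = wulff g :> set V.
Proof. by move=> fg; apply/seteqP; split=> x xw u su; have := xw u su; rewrite fg. Qed.

Lemma wulffZ (c : R) f : 0 < c -> wulff (fun u => c * f u) = dilate c (wulff f) :> set V.
Proof.
move=> c0; have cn : c != 0 by rewrite gt_eqF.
apply/seteqP; split=> [x xw|_ [x xw <-] u su]; last by rewrite dotpZl ler_pM2l// xw.
exists (c^-1 *: x); last by rewrite scalerA mulfV// scale1r.
by move=> u su; rewrite dotpZl ler_pdivrMl// xw.
Qed.

Lemma supp_dilate (c : R) K x : compact K -> K !=set0 -> 0 < c -> supp (dilate c K) x = c * supp K x.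
Proof.
move=> cK K0 c0; have [y Ky [e1 h1]] := supp_attained cK K0 x.
have ub : ubound [set dotp x z | z in dilate c K] (c * supp K x).
  by move=> _ [_ [w Kw <-] <-]; rewrite dotpZr ler_pM2l// h1.
have mem : [set dotp x z | z in dilate c K] (c * supp K x).
  by exists (c *: y); [exists y|rewrite dotpZr e1].
apply/eqP; rewrite eq_le; apply/andP; split; first by apply: ge_sup => //; exists (c * supp K x).
by apply: ub_le_sup => //; exists (c * supp K x).
Qed.

Lemma Body_dilate (c : R) C a da : 0 < c -> Body C a da ->
  Body (dilate c C) (fun x => c * a x) (fun i x => c * da i x).
Proof.
move=> c0 [h1 h2]; split=> [_ [x /h1 xw <-] u su|x qx]; first by rewrite dotpZl ler_pM2l// xw.
exists (\row_i Tmap a da i x); first exact: h2.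
by apply/rowP => i; rewrite !mxE /Tmap; ring.
Qed.

Lemma M_comb0 (lam : R) (F G : V -> R) : adm F -> adm G ->
  (forall x, x != 0 -> (1 - lam) * F x + lam * G x = 0) -> (1 - lam) * M F + lam * M G = 0.
Proof.
move=> aF aG h; rewrite -!MZ// -MD; [|exact: admZ|exact: admZ].
transitivity (M (fun _ : V => 0 : R)); last by rewrite M_cst mul0r.
by apply: eq_M_off0 h; apply: admD; exact: admZ.
Qed.

(** As [f] is the mean of [a] and [b], the weighted sum of [Phi (a / f)] and [Phi (b / f)] is 0 at
    every point ([lpmean_ratio0]). The weighted sum of the two Minkowski inequalities thus has
    right-hand side 0, which is the claim by [lpmean_le]. Equality makes both of them equalities, so
    [a] and [b] are multiples of [f]. *)
Lemma lp_brunn_minkowski (j : nat) (p : R) : (2 <= j <= n)%N -> p < 1 ->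
  (1 - p) * n%:R < (j%:R - 1) * (n%:R + 2) ->
  exists2 delta : R, 0 < delta &
  forall (lam : R) K L, 0 < lam < 1 ->
    convex_body K -> origin_symmetric K -> convex_body L -> origin_symmetric L ->
    C2_sphere (supp K) -> C2_sphere (supp L) ->
    Num.max (C2_norm (fun x => supp K x - 1)) (C2_norm (fun x => supp L x - 1)) < delta ->
    let VK := intrinsic_volume j K in
    let VL := intrinsic_volume j L in
    lpmean (p / j%:R) lam VK VL <= intrinsic_volume j (lp_comb p lam K L) /\
    (intrinsic_volume j (lp_comb p lam K L) = lpmean (p / j%:R) lam VK VL <->
       exists c : R, 0 < c /\ L = dilate c K).
Proof.
move=> jn p1 hp; have [e e0 [e8 eV eM]] := lp_minkowski jn p1 hp.
have j0 : (0 < j)%N by case/andP: jn => /ltnW.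
(* Besides [d <= e], room is needed for the mean, which is [lpC p * d]-nice, and for the dilates in
   the equality case, which are [6 * d]-nice. *)
pose sq := [:: (1, 1 / 8 : R); (1, e); (lpC p, e); (6, e); (4 * n.+1%:R ^+ 2 * lpC p, 1 / 100); (4 * n.+1%:R ^+ 2 * 6, 1 / 100)].
have hsq : all (fun cr => 0 < cr.2) sq.
  have h8 : 0 < 1 / 8 :> R by rewrite divr_gt0. have h100 : 0 < 1 / 100 :> R by rewrite divr_gt0.
  by apply/allP => cr; rewrite !inE => /orP[/eqP->//|]; do 4 (move=> /orP[/eqP->//|]); move/eqP->.
have [d d0 /and5P[d1 d2 d3 d4 /and3P[d5 d6 _]]] := exists_small hsq.
rewrite /= mul1r in d1; rewrite /= mul1r in d2.
have {d5}d5 : 4 * n.+1%:R ^+ 2 * (lpC p * d) <= 1 / 100 by rewrite mulrA.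
have {d6}d6 : 4 * n.+1%:R ^+ 2 * (6 * d) <= 1 / 100 by rewrite mulrA.
have half8 : 1 / 8 <= 1 / 2 :> R by lra.
have d12 : d <= 1 / 2 := le_trans d1 half8.
have e12 : e <= 1 / 2 := le_trans e8 half8.
exists d => // lam K L lam01 [cK [vK iK]] sK [cL [vL iL]] sL C2K C2L.
rewrite gt_max => /andP[nK nL] VK VL.
have [l0 l1 l01] := lam_split lam01.
have K0 : K !=set0 by case: iK => x /interior_subset; exists x.
have L0 : L !=set0 by case: iL => x /interior_subset; exists x.
have [da [dda [aN aB]]] := support_data cK vK K0 sK C2K nK d12.
have [db [ddb [bN bB]]] := support_data cL vL L0 sL C2L nL d12.
move: (hom0_even sK) (hom0_even sL) aN bN aB bB.
set a := hom0 (supp K); set b := hom0 (supp L) => ae be aN bN aB bB.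
pose f := lpm p lam a b; pose df := dlpm p lam a b da db; pose ddf := ddlpm p lam a b da db dda ddb.
have fN : nice (lpC p * d) f df ddf by exact: nice_lpm.
have fNe := nice_le d3 fN; have aNe := nice_le d2 aN; have bNe := nice_le d2 bN.
have fe x : f (- x) = f x by rewrite /f /lpm ae be.
have lpE : lp_comb p lam K L = wulff f.
  by apply: eq_wulff => u su; rewrite /f /lpm /lpmean /a /b !sphere_hom0.
have fB : Body (lp_comb p lam K L) f df.
  by rewrite lpE; split; [exact: subset_refl|move=> x qx; exact: (Tmap_in_wulff d5 fN qx)].
have [Uf0 [sig [asig sig0 MF0 mk]]] := eM f df ddf fNe fe.
have [Ua0 ma ma_eq] := mk a da dda aNe ae; have [Ub0 mb mb_eq] := mk b db ddb bNe be.
have VLd : VL = intrinsic_volume j L by exact: erefl.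
have VKE : VK = Ucoef (n.+1 - j) a da dda / kappa R (n.+1 - j) by exact: eV aNe aB.
have VLE : VL = Ucoef (n.+1 - j) b db ddb / kappa R (n.+1 - j) by exact: eV bNe bB.
clearbody VK VL; have VfE : intrinsic_volume j (lp_comb p lam K L) = Ucoef (n.+1 - j) f df ddf / kappa R (n.+1 - j).
  exact: eV fNe fB.
(* [j <= n] keeps the index positive; in dimension 0 the box construction gives the ball volume
   [+oo], and [kappa] would be 0. *)
have kap0 : 0 < kappa R (n.+1 - j) by rewrite subSn; [exact: kappa_gt0|case/andP: jn].
move: VfE; set VF := intrinsic_volume j (lp_comb p lam K L) => VfE.
have abp x : x != 0 -> [/\ 0 < a x, 0 < b x & 0 < f x].
  move=> x0; have [pa pb] := ab_gt0 aN bN d12 x0; have [h _ _ _] := lpmeanE p pa pb l01; exact: (And3 pa pb h).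
have af := adm_nice fNe; have afs := admM af asig.
have aPa := admM (adm_Phi_ratio p fNe aNe e12) afs; have aPb := admM (adm_Phi_ratio p fNe bNe e12) afs.
have Msum : (1 - lam) * M (fun x => Phi p (a x / f x) * (f x * sig x)) +
    lam * M (fun x => Phi p (b x / f x) * (f x * sig x)) = 0.
  apply: (M_comb0 aPa aPb) => x x0; have [pa pb pf] := abp x x0.
  exact: (comb0_mulr _ (lpmean_ratio0 p pa pb l01)).
have [VK0 VF0 ra0 ra] := eq_ratio kap0 Ua0 Uf0 VKE VfE.
have [VL0 _ rb0 rb] := eq_ratio kap0 Ub0 Uf0 VLE VfE.
rewrite ra (Phi_root p j0 ra0) in ma ma_eq; rewrite rb (Phi_root p j0 rb0) in mb mb_eq.
set MF := M (fun x => f x * sig x) in MF0 ma ma_eq mb mb_eq.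
set MA := M (fun x => Phi p (a x / f x) * _) in ma ma_eq Msum.
set MB := M (fun x => Phi p (b x / f x) * _) in mb mb_eq Msum.
have jR : 0 < j%:R :> R by rewrite ltr0n.
have le0 : (1 - lam) * Phi (p / j%:R) (VK / VF) + lam * Phi (p / j%:R) (VL / VF) <= 0.
  by have [h _] := weighted_bound l0 l1 jR MF0 ma mb Msum.
split; first exact: (lpmean_le VK0 VL0 VF0 l01 le0).
have wK := wulff_supp cK vK K0; have wL := wulff_supp cL vL L0.
split=> [e1|[c [c0 LE]]].
  have z : (1 - lam) * Phi (p / j%:R) (VK / VF) + lam * Phi (p / j%:R) (VL / VF) = 0.
    by rewrite e1; exact: (lpmean_ratio0 (p / j%:R) VK0 VL0 l01).
  have [_ /(_ z) [ea eb]] := weighted_bound l0 l1 jR MF0 ma mb Msum.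
  have [t t0 ta] := ma_eq ea; have [s sp sb] := mb_eq eb.
  exists (s / t); split; first exact: divr_gt0.
  have st0 : 0 < s / t by exact: divr_gt0.
  rewrite -{1}wL -{1}wK -(wulffZ _ st0).
  apply: eq_wulff => u su; rewrite -(sphere_hom0 (supp L) su) -(sphere_hom0 (supp K) su) -/a -/b.
  have u0 := q1_neq0 ((sphereE u).1 su).
  exact: (scaled_ratio t0 (ta _ u0) (sb _ u0)).
have bE x : b x = c * a x by rewrite /b LE /hom0 supp_dilate.
have [x1 x10] : exists x : V, x != 0 by exists (delta_mx ord0 ord0); apply: q1_neq0; exact: dotp_ei.
have [pa pb _] := abp x1 x10.
have a1 := nice_val aN x10; have /andP[ah _] := nice_half aN d12 x10.
have scaled (t : R) : `|t - 1| <= 4 * d -> 0 < t -> intrinsic_volume j (dilate t K) = t ^+ j * VK.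
  move=> t1 t0; have tN := nice_mul (ltW d0) d1 t1 aN.
  rewrite (eV _ _ _ _ (nice_le d4 tN) (Body_dilate t0 aB)).
  have d6' : 4 * n.+1%:R ^+ 2 * d <= 1 / 100.
    exact: (drop_factor6 d0 d6).
  have jle : (j <= n.+1)%N by case/andP: jn => _ /leqW.
  by rewrite (Ucoef_hom d6' t0 aN (leq_subr _ _)) (subKn jle) VKE mulrA.
pose mu := lpmean p lam 1 c; have [mu0 _ _ _] := lpmeanE p ltr01 c0 l01.
have fE x : x != 0 -> f x = mu * a x.
  by move=> x0; have [pa' _ _] := abp x x0; rewrite /f /lpm bE lpmean_scale.
(* Since [b = c a] and both functions are close to 1, so is [c]; the dilates therefore stay in the
   range where [scaled] applies. *)
have c1 : `|c - 1| <= 4 * d.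
  by apply: (near_ratio ah a1); rewrite -bE; exact: (nice_val bN x10).
have m1 : `|mu - 1| <= 4 * d.
  apply: (near_ratio ah a1); rewrite -(fE x1 x10); apply: norm_bounds.
  exact: (lpm_bounds p aN bN d12 l01 x10).
rewrite /VF; have -> : lp_comb p lam K L = dilate mu K.
  rewrite lpE -{1}wK -(wulffZ _ mu0); apply: eq_wulff => u su.
  have u0 := q1_neq0 ((sphereE u).1 su).
  by rewrite (fE u u0) /a (sphere_hom0 (supp K) su).
rewrite (scaled mu m1 mu0) VLd LE (scaled c c1 c0).
by rewrite (lpmean_scale _ VK0 (exprn_gt0 j c0) l01) (lpmean_exprn p j0 c0 l01).
Qed.

End BrunnMinkowski.

Theorem theorem1p2 (R : realType) (n : nat) : (3 <= n)%N ->
  forall p : R, exists delta : R, 0 < delta /\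
  forall j : nat, (2 <= j <= n.-1)%N ->
    (2 * n%:R - j%:R - n%:R * j%:R) / (n%:R - 1) < p -> p < 1 ->
  forall (lam : R) (K L : set 'rV[R]_n), 0 < lam < 1 ->
    convex_body K -> origin_symmetric K ->
    convex_body L -> origin_symmetric L ->
    C2_sphere (supp K) -> C2_sphere (supp L) ->
    Num.max (C2_norm (fun x => supp K x - 1)) (C2_norm (fun x => supp L x - 1)) < delta ->
    let VK := intrinsic_volume j K in
    let VL := intrinsic_volume j L in
    let rhs := if p == 0 then VK `^ (1 - lam) * VL `^ lam
               else ((1 - lam) * VK `^ (p / j%:R) + lam * VL `^ (p / j%:R)) `^ (j%:R / p) in
    rhs <= intrinsic_volume j (lp_comb p lam K L) /\
    (intrinsic_volume j (lp_comb p lam K L) = rhs <->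
       exists c : R, 0 < c /\ L = dilate c K).
Proof.
case: n => // n n3 p.
pose P (j : nat) (delta : R) := (2 <= j <= n)%N ->
  (2 * n.+1%:R - j%:R - n.+1%:R * j%:R) / (n.+1%:R - 1) < p -> p < 1 ->
  forall (lam : R) (K L : set 'rV[R]_n.+1), 0 < lam < 1 ->
    convex_body K -> origin_symmetric K -> convex_body L -> origin_symmetric L ->
    C2_sphere (supp K) -> C2_sphere (supp L) ->
    Num.max (C2_norm (fun x => supp K x - 1)) (C2_norm (fun x => supp L x - 1)) < delta ->
    let VK := intrinsic_volume j K in
    let VL := intrinsic_volume j L in
    lpmean (p / j%:R) lam VK VL <= intrinsic_volume j (lp_comb p lam K L) /\
    (intrinsic_volume j (lp_comb p lam K L) = lpmean (p / j%:R) lam VK VL <->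
       exists c : R, 0 < c /\ L = dilate c K).
have P1 j : exists2 delta, 0 < delta & P j delta.
  have n0 : 0 < n%:R :> R by rewrite ltr0n; exact: (ltnW n3).
  case: (boolP (2 <= j <= n)%N) => [jn|jn]; last by exists 1 => // h; rewrite h in jn.
  case: (ltrP p 1) => [p1|p1]; last by exists 1 => // _ _; rewrite ltNge p1.
  case: (ltrP ((2 * n.+1%:R - j%:R - n.+1%:R * j%:R) / (n.+1%:R - 1)) p) => [hp|hp]; last first.
    by exists 1 => // _; rewrite ltNge hp.
  (* With dimension [n.+1] the lower bound on [p] takes this form after clearing the denominator
     [n]. *)
  have hp' : (1 - p) * n%:R < (j%:R - 1) * (n%:R + 2).
    by move: hp; rewrite -[n.+1%:R]natr1 addrK ltr_pdivrMr//; lra.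
  have [delta d0 h] := lp_brunn_minkowski jn p1 hp'.
  by exists delta => // _ _ _; exact: h.
(* The constant must serve all [j] at once; the minimum over the finitely many indices is built by
   induction. *)
have key m : exists delta, 0 < delta /\ forall j, (j <= m)%N -> P j delta.
  elim: m => [|m [delta [d0 hd]]].
    by have [delta d0 h] := P1 0%N; exists delta; split=> // j; rewrite leqn0 => /eqP ->.
  have [delta' d0' h'] := P1 m.+1.
  exists (Num.min delta delta'); split; first by rewrite lt_min d0.
  move=> j; rewrite leq_eqVlt => /orP[/eqP ->|jm] jn hp p1 lam K L h1 h2 h3 h4 h5 h6 h7; rewrite lt_min => /andP[m1 m2].
    exact: h'.
  exact: (hd j jm).
have [delta [d0 hd]] := key n.
exists delta; split=> // j jn hp p1 lam K L h1 h2 h3 h4 h5 h6 h7 h8.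
have jn' : (j <= n)%N by case/andP: jn.
have := hd j jn' jn hp p1 lam K L h1 h2 h3 h4 h5 h6 h7 h8.
have jR : j%:R != 0 :> R by rewrite pnatr_eq0; case/andP: jn; case: (j).
by rewrite /lpmean mulf_eq0 invr_eq0 (negbTE jR) orbF div1r invf_div.
Qed.
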